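(* Let $\Gamma$ be a smoothly embedded circle in a complete Riemannian manifold, and let $\mathcal{D}$ be the distance function on pairs of points of $\Gamma$. Then there are two possibilities: (1) $0<\mathcal{S}(\Gamma)<\mathrm{diam}(\Gamma)$, in which case $\mathcal{D}$ has at least two non-trivial critical points in $\mathcal{P}_*$. (2) $\mathcal{S}(\Gamma)=\mathrm{diam}(\Gamma)$, in which case $\mathcal{D}$ has infinitely many non-trivial critical points in $\mathcal{P}_*$. Assume, moreover, that $\Gamma$ is the boundary of a smoothly embedded totally convex disc. Then, in case (2), the set of all non-trivial critical points of $\mathcal{D}$ is a continuously embedded, homotopically non-trivial circle in $\mathcal{P}_*$.
   Context: Let $d$ be the Riemannian distance of the ambient manifold $M$ and $\mathrm{diam}(\Gamma)=\max_{x,y\in\Gamma}d(x,y)$. $\mathcal{P}$ is the set of subsets $\{p,q\}\subset\Gamma$ with at most two elements, topologised as the quotient of $\Gamma\times\Gamma$ by $(p,q)\sim(q,p)$ (a Möbius band whose boundary consists of the singletons). $\mathcal{P}_*$ is the quotient of $\mathcal{P}$ collapsing all singletons to a single point (a real projective plane). $\mathcal{D}(\{p,q\})=d(p,q)$, which descends to $\mathcal{P}_*$. Non-trivial geodesics are parametrised by arc length; a geodesic is minimising if its length equals the distance between its endpoints. $\{p,q\}$ is a regular point of $\mathcal{D}$ if there exists $(v_1,v_2)\in T_p\Gamma\times T_q\Gamma$ such that $\langle v_2,\gamma'(a)\rangle-\langle v_1,\gamma'(0)\rangle<0$ for every minimising geodesic $\gamma:[0,a]\to M$ with $\gamma(0)=p$,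 $\gamma(a)=q$; otherwise it is a critical point. A critical point $\{p,q\}$ is non-trivial if $p\neq q$. Width: a family $\{p_t,q_t\}\subset\Gamma$, $t\in[0,1]$, is a sweepout of $\Gamma$ if (i) $p_0=q_0$, $p_1=q_1$; (ii) $t\mapsto p_t$, $t\mapsto q_t$ are continuous; (iii) $p_t,q_t$ bound a closed arc $C_t\subset\Gamma$ with $t\mapsto C_t$ continuous (distance between arcs = length of symmetric difference), $C_0=\{p_0\}$, $C_1=\Gamma$. $\mathcal{S}(\Gamma)=\inf\max_{t\in[0,1]}d(p_t,q_t)$ over all sweepouts of $\Gamma$. A subset of a Riemannian manifold is totally convex if every geodesic with extremities in the subset lies entirely in the subset. Discs are two-dimensional. *)

(* Defs.v *)
From HB Require Import structures.
From mathcomp Require Import all_boot all_order all_algebra.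
From mathcomp Require Import generic_quotient.
From mathcomp Require Import all_classical all_reals all_analysis.

Set Implicit Arguments.
Unset Strict Implicit.
Unset Printing Implicit Defensive.

Import Order.TTheory GRing.Theory Num.Theory.
Import numFieldNormedType.Exports.

Local Open Scope classical_set_scope.
Local Open Scope ring_scope.
Local Open Scope quotient_scope.

(* Meaningful for open [A]: the derivatives then only depend on [f] on [A]. *)
Fixpoint Ck_on (R : realType) (V W : normedModType R) (k : nat) (A : set V)
    (f : V -> W) : Prop :=
  if k is k'.+1 then
    (forall x, A x -> differentiable f x) /\
    (forall v : V, Ck_on k' A (fun x => 'D_v f x))
  else forall x, A x -> {for x, continuous f}.

Definition smooth_on (R : realType) (V W : normedModType R) (A : set V)
    (f : V -> W) : Prop := forall k, Ck_on k A f.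

(* A Riemannian manifold without boundary, given by an atlas together with the
   coordinate expressions of the metric tensor.  [chart_at x] is a chosen chart
   around [x]; it is only used to represent a tangent vector at [x] by its
   coordinates, a row vector.  Connectedness is not required: the Riemannian
   distance below is extended-real valued. *)
Record riemannianManifold (R : realType) (n : nat) := RiemannianManifold {
  carrier :> topologicalType;
  carrier_hausdorff : hausdorff_space carrier;
  carrier_second_countable : @second_countable carrier;
  chart_index : Type;
  chart_dom : chart_index -> set carrier;
  chart : chart_index -> carrier -> 'rV[R]_n;
  chart_inv : chart_index -> 'rV[R]_n -> carrier;
  chart_at : carrier -> chart_index;
  mem_chart_at : forall x, chart_dom (chart_at x) x;
  chart_dom_open : forall i, open (chart_dom i);
  chart_im_open : forall i, open (chart i @` chart_dom i);
  chart_continuous : forall i x, chart_dom i x -> {for x, continuous (chart i)};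
  chart_inv_continuous : forall i y, (chart i @` chart_dom i) y ->
    {for y, continuous (chart_inv i)};
  chartK : forall i x, chart_dom i x -> chart_inv i (chart i x) = x;
  transition_smooth : forall i j,
    smooth_on (chart i @` (chart_dom i `&` chart_dom j))
              (chart j \o chart_inv i);
  metric : chart_index -> 'rV[R]_n -> 'M[R]_n;
  metric_smooth : forall i, smooth_on (chart i @` chart_dom i) (metric i);
  metric_sym : forall i x, chart_dom i x ->
    (metric i (chart i x))^T = metric i (chart i x);
  metric_posdef : forall i x, chart_dom i x -> forall u : 'rV[R]_n, u != 0 ->
    0 < (u *m metric i (chart i x) *m u^T) 0 0;
  metric_compat : forall i j x, chart_dom i x -> chart_dom j x ->
    forall u v : 'rV[R]_n,
    u *m metric i (chart i x) *m v^T =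
    ('d (chart j \o chart_inv i) (chart i x) u : 'rV[R]_n)
      *m metric j (chart j x)
      *m ('d (chart j \o chart_inv i) (chart i x) v : 'rV[R]_n)^T }.

Section RiemannianGeometry.
Context {R : realType} {n : nat} {M : riemannianManifold R n}.

Definition Ck_map (V : normedModType R) (k : nat) (U : set V) (F : V -> M) :
    Prop :=
  (forall x, U x -> {for x, continuous F}) /\
  (forall i, Ck_on k (U `&` F @^-1` chart_dom i) (chart i \o F)).

Definition smooth_map (V : normedModType R) (U : set V) (F : V -> M) : Prop :=
  forall k, Ck_map k U F.

(* Scalar product of two vectors of T_xM, in the coordinates of [chart_at x]. *)
Definition inner (x : M) (u v : 'rV[R]_n) : R :=
  (u *m metric (chart_at x) (chart (chart_at x) x) *m v^T) 0 0.

Definition velocity (g : R -> M) (t : R) : 'rV[R]_n :=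
  derive1 (chart (chart_at (g t)) \o g) t.

Definition speed (g : R -> M) (t : R) : R :=
  Num.sqrt (inner (g t) (velocity g t) (velocity g t)).

(* Length of the part of [g] parametrised by [A]. *)
Definition length_over (g : R -> M) (A : set R) : \bar R :=
  (\int[lebesgue_measure]_(t in A) (speed g t)%:E)%E.

(* Each piece is C^1 up to its end points, i.e. it is the restriction to a
   closed interval of a C^1 curve defined on the whole line. *)
Definition piecewise_C1 (g : R -> M) : Prop :=
  exists s : seq R, let nodes := 0 :: rcons s 1 in
    sorted <%R nodes /\
    forall k, (k.+1 < size nodes)%N ->
      exists2 h : R -> M, Ck_map (V := R^o) 1 setT h &
        {in `[nth 0 nodes k, nth 0 nodes k.+1], g =1 h}.

(* Riemannian distance; it is +oo between different connected components. *)
Definition dist (x y : M) : \bar R :=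
  ereal_inf [set length_over g `[0, 1] |
             g in [set g | [/\ piecewise_C1 g, g 0 = x & g 1 = y]]].

Definition diam (A : set M) : \bar R :=
  ereal_sup [set dist z.1 z.2 | z in A `*` A].

Definition christoffel (i : chart_index M) (x : 'rV[R]_n) (k a b : 'I_n) : R :=
  2^-1 * \sum_(l < n) invmx (metric i x) k l *
    ('D_(delta_mx 0 a) (fun y : 'rV[R]_n => metric i y b l) x
     + 'D_(delta_mx 0 b) (fun y : 'rV[R]_n => metric i y a l) x
     - 'D_(delta_mx 0 l) (fun y : 'rV[R]_n => metric i y a b) x).

Definition geodesic_at (g : R -> M) (t : R) : Prop :=
  {for t, continuous g} /\
  forall i, chart_dom i (g t) ->
    let x := chart i \o g in
    [/\ derivable x t 1, derivable (derive1 x) t 1 &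
        forall k, derive1 (derive1 x) t 0 k
          + \sum_(a < n) \sum_(b < n)
              christoffel i (x t) k a b * derive1 x t 0 a * derive1 x t 0 b
          = 0].

(* [g] solves the geodesic equation on a neighbourhood of [A]; a geodesic on a
   closed interval is the same thing as the restriction of such a [g]. *)
Definition geodesic_on (A : set R) (g : R -> M) : Prop :=
  forall t, A t -> \forall s \near t, geodesic_at g s.

(* Minimising geodesics [0, a] -> M, parametrised by arc length unless they are
   trivial. *)
Definition minimising_geodesic (g : R -> M) (a : R) : Prop :=
  [/\ 0 <= a, geodesic_on `[0, a] g,
      (0 < a /\ forall t : R, t \in `[0, a] -> speed g t = 1)
        \/ (forall t, g t = g 0) &
      length_over g `[0, a] = dist (g 0) (g a)].

Definition totally_convex (A : set M) : Prop :=
  forall (g : R -> M) (a b : R), a <= b -> geodesic_on `[a, b] g ->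
    A (g a) -> A (g b) -> forall t : R, t \in `[a, b] -> A (g t).

(* The circle is R / Z: [c] is a 1-periodic injective immersion (which by
   compactness of the circle is an embedding), the submanifold is [range c]. *)
Definition smooth_circle (c : R -> M) : Prop :=
  [/\ smooth_map (V := R^o) setT c,
      forall t, c (t + 1) = c t,
      forall s t, c s = c t -> exists k : int, s = t + k%:~R &
      forall t, velocity c t != 0].

Definition unit_disc : set 'rV[R]_2 := [set z | z 0 0 ^+ 2 + z 0 1 ^+ 2 <= 1].

Definition unit_circle : set 'rV[R]_2 := [set z | z 0 0 ^+ 2 + z 0 1 ^+ 2 = 1].

(* Smoothness up to the boundary is smoothness of an extension to an open
   neighbourhood of the closed disc. *)
Definition smooth_disc (F : 'rV[R]_2 -> M) : Prop :=
  [/\ exists U : set 'rV[R]_2,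
        [/\ open U, unit_disc `<=` U & smooth_map U F],
      {in unit_disc &, injective F} &
      forall z, unit_disc z -> forall v : 'rV[R]_2,
        'd (chart (chart_at (F z)) \o F) z v = 0 -> v = 0].

Definition bounds_totally_convex_disc (A : set M) : Prop :=
  exists F : 'rV[R]_2 -> M,
    [/\ smooth_disc F, totally_convex (F @` unit_disc) & F @` unit_circle = A].

Section Circle.
Variable c : R -> M.

Definition tangent (p : M) : set 'rV[R]_n :=
  [set v | exists t l : R, c t = p /\ v = l *: velocity c t].

Definition regular_pair (p q : M) : Prop :=
  exists v1 v2 : 'rV[R]_n, [/\ tangent p v1, tangent q v2 &
    forall (g : R -> M) (a : R),
      minimising_geodesic g a -> g 0 = p -> g a = q ->
      inner q v2 (velocity g a) - inner p v1 (velocity g 0) < 0].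

(* Closed arcs of the circle with end points [p] and [q], in no particular
   order; when [p = q] these are [{p}] and the whole circle. *)
Definition closed_arc (p q : M) (C : set M) : Prop :=
  exists s s' : R, [/\ s <= s' <= s + 1, C = c @` `[s, s'] &
    (c s = p /\ c s' = q) \/ (c s = q /\ c s' = p)].

Definition arc_dist (C C' : set M) : \bar R :=
  length_over c (`[0, 1[ `&` c @^-1` (C `+` C')).

Definition sweepout (p q : R -> M) : Prop :=
  [/\ p 0 = q 0 /\ p 1 = q 1,
      {within `[0, 1], continuous p} /\ {within `[0, 1], continuous q} &
      exists C : R -> set M,
        [/\ forall t : R, t \in `[0, 1] -> closed_arc (p t) (q t) (C t),
            forall t : R, t \in `[0, 1] -> forall e : R, 0 < e ->
              exists2 d : R, 0 < d & forall s : R, s \in `[0, 1] ->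
                `|s - t| < d -> (arc_dist (C t) (C s) < e%:E)%E,
            C 0 = [set p 0] & C 1 = range c]].

Definition width : \bar R :=
  ereal_inf [set x | exists p q : R -> M, sweepout p q /\
    x = ereal_sup [set dist (p t) (q t) | t in `[0, 1]]].

End Circle.

End RiemannianGeometry.

Definition complete_manifold (R : realType) (n : nat) (M : riemannianManifold R n)
    : Prop :=
  forall u : nat -> M,
    (forall e : R, 0 < e -> exists N, forall m k,
       (N <= m)%N -> (N <= k)%N -> (dist (u m) (u k) < e%:E)%E) ->
    exists x : M, forall e : R, 0 < e -> exists N, forall m,
       (N <= m)%N -> (dist (u m) x < e%:E)%E.

Section UnorderedPairs.
Variable T : topologicalType.

Definition swap_rel (x y : T * T) : bool := (y == x) || (y == (x.2, x.1)).

Fact swap_rel_refl : reflexive swap_rel.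
Proof. by move=> x; rewrite /swap_rel eqxx. Qed.

Fact swap_rel_sym : symmetric swap_rel.
Proof.
have sub x y : swap_rel x y -> swap_rel y x.
  case: x => p q; rewrite /swap_rel => /orP[/eqP->|/eqP->] /=;
  by rewrite eqxx ?orbT.
by move=> x y; apply/idP/idP; exact: sub.
Qed.

Fact swap_rel_trans : transitive swap_rel.
Proof.
move=> [p q] [p1 q1] [p2 q2]; rewrite /swap_rel /=.
by move=> /orP[/eqP[-> ->]|/eqP[-> ->]] /orP[/eqP[-> ->]|/eqP[-> ->]];
  rewrite eqxx ?orbT.
Qed.

Canonical swap_equiv :=
  EquivRel swap_rel swap_rel_refl swap_rel_sym swap_rel_trans.

Definition unordered_pairs := quotient_topology {eq_quot swap_equiv}.
HB.instance Definition _ := Topological.on unordered_pairs.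
HB.instance Definition _ := Quotient.on unordered_pairs.

Definition unordered_pair (p q : T) : unordered_pairs :=
  (\pi_unordered_pairs (p, q))%qT.

Definition singleton (x : unordered_pairs) : bool := (repr x).1 == (repr x).2.

Definition collapse_rel (x y : unordered_pairs) : bool :=
  (x == y) || (singleton x && singleton y).

Fact collapse_rel_refl : reflexive collapse_rel.
Proof. by move=> x; rewrite /collapse_rel eqxx. Qed.

Fact collapse_rel_sym : symmetric collapse_rel.
Proof. by move=> x y; rewrite /collapse_rel eq_sym andbC. Qed.

Fact collapse_rel_trans : transitive collapse_rel.
Proof.
move=> y x z; rewrite /collapse_rel.
move=> /orP[/eqP->//|/andP[sx sy]] /orP[/eqP<-|/andP[_ sz]];
by rewrite sx ?sy ?sz orbT.
Qed.

Canonical collapse_equiv :=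
  EquivRel collapse_rel collapse_rel_refl collapse_rel_sym collapse_rel_trans.

Definition collapsed_pairs := quotient_topology {eq_quot collapse_equiv}.
HB.instance Definition _ := Topological.on collapsed_pairs.
HB.instance Definition _ := Quotient.on collapsed_pairs.

Definition collapsed_pair (p q : T) : collapsed_pairs :=
  (\pi_collapsed_pairs (unordered_pair p q))%qT.

Lemma singletonE (p q : T) : singleton (unordered_pair p q) = (p == q).
Proof.
rewrite /singleton /unordered_pair.
have : swap_rel (p, q) (repr (\pi_unordered_pairs (p, q))%qT).
  have := reprK (\pi_unordered_pairs (p, q)) => /esym.
  by move=> /(@eqquotP _ swap_equiv {eq_quot swap_equiv}).
by rewrite /swap_rel => /orP[/eqP->|/eqP->] //=; rewrite eq_sym.
Qed.

Lemma collapsed_pair_eq (p q p' q' : T) :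
  (collapsed_pair p q == collapsed_pair p' q')
    = swap_rel (p, q) (p', q') || ((p == q) && (p' == q')).
Proof.
have eq_up x y : (unordered_pair x.1 x.2 == unordered_pair y.1 y.2)
    = swap_rel x y.
  rewrite /unordered_pair -!surjective_pairing.
  by apply/eqP/idP => [/(@eqquotP _ swap_equiv {eq_quot swap_equiv})//|xy];
    exact/(@eqquotP _ swap_equiv {eq_quot swap_equiv}).
rewrite -(eq_up (p, q) (p', q')) -!singletonE.
by apply/eqP/idP =>
    [/(@eqquotP _ collapse_equiv {eq_quot collapse_equiv})//|xy];
  exact/(@eqquotP _ collapse_equiv {eq_quot collapse_equiv}).
Qed.

End UnorderedPairs.

(* Non-trivial critical points of the distance function, as points of the
   quotient of the unordered pairs in which all singletons are identified. *)
Definition nontrivial_critical (R : realType) (n : nat)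
    (M : riemannianManifold R n) (c : R -> M) :
    set (collapsed_pairs (set_type (range c))) :=
  [set x | exists p q : set_type (range c),
     [/\ x = collapsed_pair p q, p <> q & ~ regular_pair c (val p) (val q)]].
Arguments nontrivial_critical {R n M} c.

Section Loops.
Variables (R : realType) (X : topologicalType).

(* Circles in [X] are maps from R / Z.  A continuous injective one is an
   embedding as soon as [X] is Hausdorff. *)
Definition loop (f : R -> X) : Prop :=
  continuous f /\ forall t, f (t + 1) = f t.

Definition embedded_loop (f : R -> X) : Prop :=
  loop f /\ forall s t, f s = f t -> exists k : int, s = t + k%:~R.

Definition null_homotopic (f : R -> X) : Prop :=
  exists (H : R * R -> X) (x : X),
    [/\ {within `[0, 1] `*` setT, continuous H},
        forall s t : R, s \in `[0, 1] -> H (s, t + 1) = H (s, t),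
        forall t, H (0, t) = f t & forall t, H (1, t) = x].

End Loops.

(* Main.v *)
(* Short geodesics solve a two-point boundary value problem; comparing energies
   shows that they minimise, and Hopf-Rinow with a compactness argument bounds
   the variation of D at a regular pair by a definite descent.  A regular level
   could be pushed down along a sweepout, so S(Gamma) is a critical value; when
   it equals the diameter, every sweepout fixing p meets the maximum, so every p
   lies in a critical pair.
   In a convex disc, segments joining linked pairs cross (Poincare-Miranda), and
   cutting at the crossing gives a Monge inequality.  Hence maximal pairs
   (x, y), x < y < x + 1, of lifts to R are not nested and form a family
   continuous in t = x + y, with (x, y) replaced by (y, x + 1) at t + 1.  A pair
   strictly inside a maximal one is regular: by the Monge inequality D is
   monotone there, and two pairs with segments normal to the boundary at a
   common end lie on one geodesic.  The critical loop is essential because the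
   line spanned by (|sin pi(y - x)| exp(i pi(x + y)), cos pi(y - x)) is well
   defined on collapsed pairs, while that vector changes sign along the loop. *)
Require Import Defs.
From HB Require Import structures.
From mathcomp Require Import all_boot all_order all_algebra.
From mathcomp Require Import ring lra zify.
From mathcomp Require Import all_classical all_reals all_analysis.
From mathcomp Require Import measurable_realfun.
Import Order.TTheory GRing.Theory Num.Theory.
Import numFieldNormedType.Exports.
Set Implicit Arguments.
Unset Strict Implicit.
Unset Printing Implicit Defensive.
Local Open Scope classical_set_scope.
Local Open Scope ring_scope.

Ltac split_lra := apply/andP; split; lra.

Section matrix_norm.
Context {R : realType}.

Lemma le_coord_norm m n (A : 'M[R]_(m, n)) i j : `|A i j| <= `|A|.
Proof.
rewrite [leRHS]/Num.Def.normr/= mx_normrE.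
exact: (le_bigmax _ (fun ij : 'I_m * 'I_n => `|A ij.1 ij.2|) (i, j)).
Qed.

Lemma norm_mx_le m n (A : 'M[R]_(m, n)) (C : R) : 0 <= C ->
  (forall i j, `|A i j| <= C) -> `|A| <= C.
Proof.
move=> C0 AC; rewrite [leLHS]/Num.Def.normr/= mx_normrE.
by apply: bigmax_le => // -[i j] _; exact: AC.
Qed.

Lemma norm_mulmx_le m n p (A : 'M[R]_(m, n)) (B : 'M[R]_(n, p)) :
  `|A *m B| <= n%:R * `|A| * `|B|.
Proof.
apply: norm_mx_le => [|i j]; first by rewrite !mulr_ge0.
rewrite mxE (le_trans (ler_norm_sum _ _ _))//.
apply: (@le_trans _ _ (\sum_(k < n) `|A| * `|B|)).
  by apply: ler_sum => k _; rewrite normrM ler_pM// le_coord_norm.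
by rewrite sumr_const card_ord -mulrA mulr_natl.
Qed.

Lemma norm_trmx m n (A : 'M[R]_(m, n)) : `|A^T| = `|A|.
Proof.
apply/eqP; rewrite eq_le; apply/andP; split; apply: norm_mx_le => // i j.
  by rewrite mxE le_coord_norm.
by rewrite -[A]trmxK mxE trmxK le_coord_norm.
Qed.

Lemma row_sum_pd n (v : 'rV[R]_n) : v = \sum_i v 0 i *: delta_mx 0 i.
Proof. exact: row_sum_delta. Qed.

End matrix_norm.

Section curves.
Context {R : realType}.

Lemma is_derive_rV n (f : R -> 'rV[R]_n) (t : R) (v : 'rV[R]_n) :
  is_derive t (1 : R) f v <-> forall i, is_derive t (1 : R) (fun s => f s 0 i) (v 0 i).
Proof.
split=> [fv i|fv].
  have df : derivable f t 1 by [].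
  apply: DeriveDef; first by move/derivable_mxP : df; exact.
  by have := derive_mx df; rewrite derive_val => ->; rewrite mxE.
have df : derivable f t 1 by apply/derivable_mxP => i j; rewrite ord1; have [] := fv j.
apply: DeriveDef => //; rewrite derive_mx//; apply/rowP => j; rewrite mxE.
by rewrite (_ : 'D_1 _ t = v 0 j)//; apply: (@derive_val _ _ _ _ _ _ _ (fv j)).
Qed.

Lemma is_derive_continuous (V : normedModType R) (f : R -> V) (t : R) (v : V) :
  is_derive t (1 : R) f v -> {for t, continuous f}.
Proof.
by move=> fv; apply/differentiable_continuous/derivable1_diffP.
Qed.

Lemma is_derive1_intro (V : normedModType R) (f : R -> V) (t : R) (v : V) :
  derivable f t 1 -> f^`()%classic t = v -> is_derive t (1 : R) f v.
Proof. by move=> df; rewrite derive1E; exact: DeriveDef. Qed.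

Lemma is_derive1_derive1 (V : normedModType R) (f : R -> V) (t : R) (v : V) :
  is_derive t (1 : R) f v -> f^`()%classic t = v.
Proof. by move=> fv; rewrite derive1E derive_val. Qed.

Lemma MVT_is_derive (f df : R -> R) (a b : R) : a < b ->
  (forall t : R, t \in `[a, b] -> is_derive t (1 : R) f (df t)) ->
  exists2 t : R, t \in `]a, b[ & f b - f a = df t * (b - a).
Proof.
move=> ab fdf.
have fdf' (t : R) : t \in `]a, b[ -> is_derive t (1 : R) f (df t) by rewrite in_itv/= => /andP[t0 t1]; apply: fdf; rewrite in_itv/= !ltW.
have cf : {within `[a, b], continuous f} by apply: derivable_within_continuous => t /fdf; case.
exact: (MVT ab fdf' cf).
Qed.

Lemma MVT01 (h dh : R -> R) :
  (forall t : R, t \in `[0, 1] -> is_derive t (1 : R) h (dh t)) ->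
  exists2 t : R, t \in `]0, 1[ & h 1 - h 0 = dh t * (1 - 0).
Proof.
by move=> hdh; exact: (@MVT_is_derive h dh 0 1 ltr01 hdh).
Qed.

Lemma mean_value_le (f df : R -> R) (a b C : R) : a <= b ->
  (forall t, t \in `]a, b[ -> is_derive t (1 : R) f (df t)) ->
  (forall t, t \in `]a, b[ -> df t <= C) ->
  {within `[a, b], continuous f} -> f b - f a <= C * (b - a).
Proof.
rewrite le_eqVlt => /predU1P[-> _ _ _|ab fdf fC cf]; first by rewrite !subrr mulr0.
have [c cab ->] := MVT ab fdf cf.
by rewrite ler_wpM2r ?subr_ge0 ?(ltW ab)// fC.
Qed.

Lemma mean_value_norm n (f df : R -> 'rV[R]_n) (a b C : R) : a <= b -> 0 <= C ->
  (forall t, t \in `]a, b[ -> is_derive t (1 : R) f (df t)) ->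
  (forall t, t \in `]a, b[ -> `|df t| <= C) ->
  {within `[a, b], continuous f} -> `|f b - f a| <= C * (b - a).
Proof.
move=> ab C0 fdf fC cf; apply: norm_mx_le => [|i j].
  by rewrite mulr_ge0// subr_ge0.
rewrite ord1 !mxE ler_norml.
have ci : {within `[a, b], continuous (fun t => f t 0 j)}.
  move=> t; apply: (@continuous_comp (subspace `[a, b]) _ _ f (fun A : 'rV_n => A 0 j)).
    exact: cf.
  exact: coord_continuous.
have di t : t \in `]a, b[ -> is_derive t (1 : R) (fun t => f t 0 j) (df t 0 j) by move=> /fdf /is_derive_rV.
have cdi t : t \in `]a, b[ -> `|df t 0 j| <= C by move=> /fC; apply/le_trans/le_coord_norm.
apply/andP; split; last first.
  by apply: mean_value_le di _ ci => // t /cdi; apply/le_trans/ler_norm.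
rewrite lerNl opprB.
have -> : f a 0 j - f b 0 j = (- f b 0 j) - (- f a 0 j) by rewrite opprK addrC.
apply: (@mean_value_le (fun t => - f t 0 j) (fun t => - df t 0 j)) => //.
- by move=> t /di ?; exact: is_deriveN.
- by move=> t /cdi; apply/le_trans; rewrite -normrN ler_norm.
- by move=> t; apply: continuousN; exact: ci.
Qed.

Lemma ex_primitive (f : R -> R) (a b : R) : continuous f ->
  exists P : R -> R, forall t, t \in `]a, b[ -> is_derive t (1 : R) P (f t).
Proof.
move=> cf; exists (fun x => \int[lebesgue_measure]_(t in [set` Interval (BLeft a) (BRight x)]) f t).
move=> t; rewrite in_itv/= => /andP[at' tb].
have [|//||d1 d2] := @continuous_FTC1_closed R f a t b tb.
- apply: continuous_compact_integrable; first exact: segment_compact.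
  exact: continuous_subspaceT.
- exact: cf.
- exact: (is_derive1_intro d1 d2).
Qed.

Lemma ex_primitive_rV n (f : R -> 'rV[R]_n) (a b c : R) : continuous f ->
  exists P : R -> 'rV[R]_n, P c = 0 /\
    forall t, t \in `]a, b[ -> is_derive t (1 : R) P (f t).
Proof.
move=> cf.
have /choice[P HP] i : exists P : R -> R, forall t, t \in `]a, b[ ->
    is_derive t (1 : R) P (f t 0 i).
  apply: ex_primitive => t; apply: (@continuous_comp _ _ _ f (fun A : 'rV_n => A 0 i)).
    exact: cf.
  exact: coord_continuous.
exists (fun t => \row_i (P i t - P i c)); split.
  by apply/rowP => i; rewrite !mxE subrr.
move=> t tab; apply/is_derive_rV => i.
rewrite (_ : (fun _ => _) = P i - cst (P i c)); last first.
  by apply/funext => s; rewrite !mxE.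
rewrite -[f t 0 i]subr0; have := HP i t tab => ?; exact: is_deriveB.
Qed.

End curves.

Section lipschitz_on_balls.
Context {R : realType} {n : nat}.
Implicit Types (f : 'rV[R]_n -> R) (m x v : 'rV[R]_n) (r : R).

Definition cball m r : set 'rV[R]_n := [set x | `|x - m| <= r].

Lemma closed_cball m r : closed (cball m r).
Proof.
have -> : cball m r = (fun x : 'rV[R]_n => `|x - m|) @^-1` [set y | y <= r] by [].
apply: closed_comp; last exact: closed_le.
move=> x _; apply: (@continuous_comp _ _ _ (fun x => x - m) (@Num.Def.normr _ _)).
  by apply: (@continuousB _ _ _ id (cst m)) => //; exact: cst_continuous.
exact: norm_continuous.
Qed.

Lemma compact_cball m r : compact (cball m r).
Proof.
apply: bounded_closed_compact; last exact: closed_cball.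
exists (`|m| + r); split; first exact: num_real.
move=> M mM x /= xm; apply: le_trans (ltW mM).
by rewrite -[x](subrK m) (le_trans (ler_normD _ _))// addrC lerD2l.
Qed.

Lemma cball_segment m r x v (t : R) : t \in `[0, 1] ->
  cball m r x -> cball m r (x + v) -> cball m r (x + t *: v).
Proof.
rewrite in_itv/= /cball/= => /andP[t0 t1] xm xvm.
have -> : x + t *: v - m = (1 - t) *: (x - m) + t *: (x + v - m).
  by apply/rowP => i; rewrite !mxE; ring.
rewrite (le_trans (ler_normD _ _))// !normrZ (ger0_norm t0) ger0_norm ?subr_ge0//.
apply: (@le_trans _ _ ((1 - t) * r + t * r)); last by rewrite -mulrDl subrK mul1r.
by rewrite lerD// ler_wpM2l ?subr_ge0.
Qed.

Lemma is_derive_line f x v (t : R) : derivable f (x + t *: v) v ->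
  is_derive t (1 : R) (fun s : R => f (x + s *: v)) ('D_v f (x + t *: v)).
Proof.
have E : (fun h : R => h^-1 *: ((fun s : R => f (x + s *: v)) (h *: 1 + t) - f (x + t *: v)))
   = (fun h : R => h^-1 *: (f (h *: v + (x + t *: v)) - f (x + t *: v))).
  apply/funext => h; congr (_ *: (f _ - _)).
  by rewrite scalerDl [h *: 1]mulr1 addrCA.
by move=> df; split; rewrite /derivable /derive /= E.
Qed.

Lemma derive_sum_pd f x v : differentiable f x ->
  'D_v f x = \sum_i v 0 i * 'D_(delta_mx 0 i) f x.
Proof.
move=> df; rewrite deriveE// {1}[v]row_sum_pd linear_sum/=.
by apply: eq_bigr => i _; rewrite linearZ/= deriveE.
Qed.

Lemma mean_value_ball f m r x v : cball m r x -> cball m r (x + v) ->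
  (forall y, cball m r y -> differentiable f y) ->
  exists2 t : R, t \in `]0, 1[ & f (x + v) - f x = 'D_v f (x + t *: v).
Proof.
move=> xm xvm df.
have dl t : t \in `[(0:R), 1] ->
    is_derive t (1 : R) (fun s : R => f (x + s *: v)) ('D_v f (x + t *: v)).
  by move=> t01; apply/is_derive_line/diff_derivable/df/cball_segment.
pose h (s : R) : R := f (x + s *: v).
pose dh (s : R) : R := 'D_v f (x + s *: v).
suff [t t01 E] : exists2 t : R, t \in `]0, 1[ & h 1 - h 0 = dh t * (1 - 0).
  exists t => //; move: E; rewrite /h /dh.
  by rewrite scale1r scale0r addr0 subr0 mulr1.
exact: MVT01.
Qed.

Lemma ex_lipschitz_cball f m r :
  (forall y, cball m r y -> differentiable f y) ->
  (forall y i, cball m r y -> {for y, continuous (fun x => 'D_(delta_mx 0 i) f x)}) ->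
  exists2 L : R, 0 <= L & forall x y, cball m r x -> cball m r y ->
    `|f x - f y| <= L * `|x - y|.
Proof.
move=> df cdf.
have bd i : exists2 L : R, 0 <= L & forall y, cball m r y ->
    `|'D_(delta_mx 0 i) f y| <= L.
  have [cb0|/set0P cb0] := eqVneq (cball m r) set0.
    by exists 0 => // y; rewrite cb0.
  have [||c _ cP] := @compact_EVT_max _ _ (fun y => `|'D_(delta_mx 0 i) f y|) _ cb0.
  - exact: compact_cball.
  - apply: continuous_in_subspaceT => y /set_mem ymr.
    by apply: (@continuous_comp _ _ _ (fun x => 'D_(delta_mx 0 i) f x)); [exact: cdf|exact: norm_continuous].
  - exists `|'D_(delta_mx 0 i) f c| => // y ymr; apply: cP; exact: mem_set.
have {bd}[L L0 bd] : exists2 L : 'I_n -> R, (forall i, 0 <= L i) &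
    forall i y, cball m r y -> `|'D_(delta_mx 0 i) f y| <= L i.
  have /choice[L HL] : forall i, exists L : R, 0 <= L /\ forall y, cball m r y ->
    `|'D_(delta_mx 0 i) f y| <= L by move=> i; have [L ? ?] := bd i; exists L.
  by exists L => i; have [] := HL i.
exists (\sum_i L i); first by rewrite sumr_ge0.
move=> x y xm ym; have -> : x = y + (x - y) by rewrite addrC subrK.
have [|t t01 ->] := @mean_value_ball f m r y (x - y) ym _ df.
  by rewrite addrC subrK.
have yt : cball m r (y + t *: (x - y)).
  apply: cball_segment => //; last by rewrite addrC subrK.
  by move: t01; rewrite !in_itv/= => /andP[? ?]; rewrite !ltW.
rewrite derive_sum_pd; last exact: df.
rewrite (_ : y + (x - y) - y = x - y); last by rewrite addrAC subrr add0r.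
rewrite (le_trans (ler_norm_sum _ _ _))//.
rewrite mulr_suml ler_sum// => i _; rewrite normrM mulrC.
by rewrite ler_pM//; [exact: bd|exact: le_coord_norm].
Qed.

End lipschitz_on_balls.

Section clamp.
Context {R : realType}.

Definition clip (a b t : R) : R := Num.max a (Num.min b t).

Lemma clip_id a b t : a <= t <= b -> clip a b t = t.
Proof. by move=> /andP[at_ tb]; rewrite /clip min_r// max_r. Qed.

Lemma clip_itv a b t : a <= b -> a <= clip a b t <= b.
Proof. by move=> ab; rewrite le_max lexx/= ge_max ab/= ge_min lexx. Qed.

Lemma continuous_clip_id a b : continuous (clip a b).
Proof.
move=> t; have c2 : {for t, continuous (cst b \min (id : R -> R^o))} by apply: continuous_min; [exact: cst_continuous|exact: cvg_id].
have c1 : {for t, continuous (cst a : R -> R^o)} by exact: cst_continuous.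
exact: (continuous_max c1 c2).
Qed.

Definition clamp : R -> R := clip (-1) 2.

Lemma clamp_itv t : -1 <= clamp t <= 2.
Proof. by apply: clip_itv; lra. Qed.

Lemma clamp_id t : -1 <= t <= 2 -> clamp t = t.
Proof. exact: clip_id. Qed.

Lemma clampK t : clamp (clamp t) = clamp t.
Proof. exact/clamp_id/clamp_itv. Qed.

Lemma continuous_clamp : continuous clamp.
Proof. exact: continuous_clip_id. Qed.

Definition clamped (T : Type) (f : R -> T) := forall t, f (clamp t) = f t.

Lemma near_clamp (t : R) : t \in `]-1, 2[ -> \forall s \near t, clamp s = s.
Proof.
move=> tI; have : nbhs t `](-1 : R), 2[%classic.
  by apply: open_nbhs_nbhs; split => //; exact: itv_open.
by apply: filterS => s; rewrite /= in_itv/= => /andP[? ?]; apply: clamp_id; lra.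
Qed.

Lemma is_derive_near (V : normedModType R) (f g : R -> V) t v :
  (\forall s \near t, f s = g s) -> is_derive t (1 : R) f v -> is_derive t (1 : R) g v.
Proof. by move=> fg; apply: near_eq_is_derive => //; rewrite oner_eq0. Qed.

Definition primitive n (f P : R -> 'rV[R]_n) :=
  [/\ continuous P, clamped P & forall t : R, t \in `]-1, 2[ -> is_derive t (1 : R) P (f t)].

Lemma ex_clamped_primitive n (f : R -> 'rV[R]_n) (c : 'rV[R]_n) : continuous f ->
  exists P : R -> 'rV[R]_n, primitive f P /\ P 0 = c.
Proof.
move=> cf; have [P [P0 HP]] := @ex_primitive_rV R n f (-2) 3 0 cf.
exists (fun t => c + P (clamp t)); split; last first.
  by rewrite clamp_id ?P0 ?addr0//; lra.
split=> [t|t|t].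
- apply: cvgD; first exact: cvg_cst.
  apply: (@continuous_comp _ _ _ clamp P); first exact: continuous_clamp.
  have ct := clamp_itv t.
  by apply/is_derive_continuous/HP; rewrite in_itv/=; lra.
- by rewrite clampK.
- move=> tI; apply: (@is_derive_near _ (fun s => c + P s)).
    by apply: filterS (near_clamp tI) => s ->.
  have tI' : t \in `](-2), 3[ by move: tI; rewrite !in_itv/=; lra.
  have ? := HP t tI'; rewrite -[f t]add0r; apply: is_deriveD.
Qed.

Lemma primitive_mean_value n (f P : R -> 'rV[R]_n) (C a b : R) : primitive f P ->
  -1 <= a -> a <= b -> b <= 2 ->
  (forall t, `|f t| <= C) -> `|P b - P a| <= C * (b - a).
Proof.
move=> [cP kP dP] a1 ab b2 fC.
have C0 : 0 <= C by rewrite (le_trans _ (fC 0)).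
have h1 (t : R) : t \in `]a, b[ -> is_derive t (1 : R) P (f t) by rewrite in_itv/= => tab; apply: dP; rewrite in_itv/=; lra.
have h2 : {within `[a, b], continuous P} by exact: continuous_subspaceT.
exact: (mean_value_norm ab C0 h1 (fun t _ => fC t) h2).
Qed.

Lemma primitive_bound n (f P : R -> 'rV[R]_n) (C : R) : primitive f P ->
  (forall t, `|f t| <= C) -> forall t, `|P t - P 0| <= 2 * C.
Proof.
move=> fP fC t; have [_ kP _] := fP; rewrite -(kP t).
have C0 : 0 <= C by rewrite (le_trans _ (fC 0)).
have /andP[s1 s2] := clamp_itv t; set s := clamp t in s1 s2 *.
have [s0|s0] := leP 0 s.
  have := primitive_mean_value fP (lerN10 _) s0 s2 fC.
  by move/le_trans; apply; rewrite subr0 mulrC ler_wpM2r.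
have := primitive_mean_value fP s1 (ltW s0) (ler0n _ 2) fC.
rewrite distrC => /le_trans; apply; rewrite mulrC ler_wpM2r//; lra.
Qed.

Lemma primitiveB n (f g P Q : R -> 'rV[R]_n) : primitive f P -> primitive g Q ->
  primitive (fun t => f t - g t) (fun t => P t - Q t).
Proof.
move=> [cP kP dP] [cQ kQ dQ]; split=> [t|t|t tI].
- by apply: cvgB; [exact: cP|exact: cQ].
- by rewrite kP kQ.
- have ? := dP t tI; have ? := dQ t tI; exact: is_deriveB.
Qed.

End clamp.

Section boundary_value_problem.
Context {R : realType} {n : nat}.
Variables (F : 'rV[R]_n -> 'rV[R]_n -> 'rV[R]_n) (m : 'rV[R]_n) (r K : R).
Hypothesis r0 : 0 < r.
Hypothesis K0 : 0 < K.
Hypothesis F_bound : forall x u, cball m r x -> `|F x u| <= K * `|u| ^+ 2.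
Hypothesis F_lip : forall x x' u u', cball m r x -> cball m r x' ->
  `|F x u - F x' u'| <= K * (`|u| ^+ 2 * `|x - x'| + (`|u| + `|u'|) * `|u - u'|).

Definition bvp_radius : R := Num.min 1 (Num.min (96 * K)^-1 (r / 8)).

Lemma bvp_radius_gt0 : 0 < bvp_radius.
Proof. by rewrite !lt_min ltr01 invr_gt0 divr_gt0// mulr_gt0. Qed.

Lemma bvp_radiusP (W : R) : 0 <= W -> W <= bvp_radius ->
  [/\ W <= 1, 96 * K * W <= 1 & 8 * W <= r].
Proof.
move=> W0; rewrite !le_min => /and3P[-> h1 h2]; split => //.
  by rewrite -(@ler_pdivlMl _ (96 * K)) ?mulr1// mulr_gt0.
by move: h2; rewrite ler_pdivlMr// mulrC.
Qed.

Definition geodesic_bvp (p q : 'rV[R]_n) (x u : R -> 'rV[R]_n) :=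
  [/\ x 0 = p /\ x 1 = q, primitive u x, primitive (fun t => F (x t) (u t)) u &
      forall t, `|u t| <= 2 * `|q - p|].

Definition picard (p q : 'rV[R]_n) (u u2 : R -> 'rV[R]_n) :=
  exists X P Q : R -> 'rV[R]_n,
   [/\ primitive u X /\ X 0 = p,
       primitive (fun t => F (X t) (u t)) P /\ P 0 = 0,
       primitive P Q /\ Q 0 = 0 &
       forall t, u2 t = (q - p) + P t - Q 1].

Definition picard_dom (p q : 'rV[R]_n) (u : R -> 'rV[R]_n) :=
  [/\ continuous u, clamped u & forall t, `|u t| <= 2 * `|q - p|].

Lemma picard_cball p q u X : cball m (r / 2) p -> `|q - p| <= bvp_radius ->
  picard_dom p q u -> primitive u X -> X 0 = p -> forall t, cball m r (X t).
Proof.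
move=> pm pq [cu ku bu] uX X0 t; rewrite /cball/=.
have [_ _ h] := bvp_radiusP (normr_ge0 _) pq.
have := primitive_bound uX bu t; rewrite X0 => H.
rewrite -[X t](subrK p) -addrA (le_trans (ler_normD _ _))//.
by move: pm; rewrite /cball/=; lra.
Qed.

Lemma picard_continuous p q u X : cball m (r / 2) p -> `|q - p| <= bvp_radius ->
  picard_dom p q u -> primitive u X -> X 0 = p ->
  continuous (fun t => F (X t) (u t)).
Proof.
move=> pm pq du uX X0 t; have Xm := picard_cball pm pq du uX X0.
have [cu ku bu] := du; have [cX _ _] := uX.
apply/cvgrPdist_le => e e0.
pose C := K * ((2 * `|q - p|) ^+ 2 + 4 * `|q - p|) + 1.
have C0 : 0 < C by rewrite ltr_wpDl// mulr_ge0 ?(ltW K0)// addr_ge0// ?exprn_ge0 ?mulr_ge0.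
have eC : 0 < e / C by rewrite divr_gt0.
near=> s.
have h1 : `|X t - X s| <= e / C by near: s; move/cvgrPdist_le : (cX t) => /(_ _ eC).
have h2 : `|u t - u s| <= e / C by near: s; move/cvgrPdist_le : (cu t) => /(_ _ eC).
apply: (le_trans (F_lip _ _ (Xm t) (Xm s))).
apply: (@le_trans _ _ (C * (e / C))); last by rewrite mulrCA divff ?mulr1// gt_eqF.
apply: (@le_trans _ _ (K * ((2 * `|q - p|) ^+ 2 * (e / C) + (4 * `|q - p|) * (e / C)))).
  rewrite ler_wpM2l ?(ltW K0)// lerD//.
    by rewrite ler_pM ?exprn_ge0// lerXn2r ?nnegrE ?mulr_ge0.
  rewrite ler_pM ?addr_ge0//.
  by clear -pq bu; move: (bu t) (bu s); lra.
by rewrite -mulrDl mulrA ler_wpM2r ?(ltW eC)// /C lerDl.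
Unshelve. all: by end_near. Qed.

Lemma ex_picard p q u : cball m (r / 2) p -> `|q - p| <= bvp_radius ->
  picard_dom p q u -> exists u2, picard p q u u2 /\ picard_dom p q u2.
Proof.
move=> pm pq du; have [cu ku bu] := du.
have [X [uX X0]] := ex_clamped_primitive p cu.
have cF := picard_continuous pm pq du uX X0.
have Xm := picard_cball pm pq du uX X0.
have [P [FP P0]] := ex_clamped_primitive 0 cF.
have [cP kP _] := FP.
have [Q [PQ Q0]] := ex_clamped_primitive 0 cP.
exists (fun t => (q - p) + P t - Q 1); split; first by exists X, P, Q; split.
split=> [t|t|t].
- apply: cvgB; last exact: cvg_cst.
  by apply: cvgD; [exact: cvg_cst|exact: cP].
- by rewrite kP.
- have [W1 W2 W3] := bvp_radiusP (normr_ge0 _) pq.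
  set W := `|q - p| in W1 W2 W3 *.
  have W0 : 0 <= W by exact: normr_ge0.
  have bF s : `|F (X s) (u s)| <= K * (4 * W ^+ 2).
    apply: (le_trans (F_bound _ (Xm s))); rewrite ler_wpM2l ?(ltW K0)//.
    have -> : 4 * W ^+ 2 = (2 * W) ^+ 2 by ring.
    by rewrite lerXn2r ?nnegrE ?mulr_ge0//; exact: bu.
  have bP s : `|P s| <= 2 * (K * (4 * W ^+ 2)) by have := primitive_bound FP bF s; rewrite P0 subr0.
  have bQ : `|Q 1 - Q 0| <= 1 * (2 * (K * (4 * W ^+ 2))).
    have := primitive_mean_value PQ (lerN10 _) ler01 (ler1n _ 2) bP.
    by rewrite subr0 mulrC.
  move: bQ; rewrite Q0 subr0 => bQ.
  rewrite (le_trans (ler_normB _ _))// (le_trans (lerD (ler_normD _ _) (lexx _)))// -/W.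
  have H : 16 * K * W ^+ 2 <= W.
    have -> : 16 * K * W ^+ 2 = (16 * K * W) * W by ring.
    apply: ler_piMl => //.
    have := mulr_ge0 (ltW K0) W0; nra.
  by have := bP t; nra.
Qed.

Lemma picard_lip p q p' q' u u' u2 u2' (d : R) :
  cball m (r / 2) p -> `|q - p| <= bvp_radius ->
  cball m (r / 2) p' -> `|q' - p'| <= bvp_radius ->
  picard_dom p q u -> picard_dom p' q' u' ->
  picard p q u u2 -> picard p' q' u' u2' ->
  (forall t, `|u t - u' t| <= d) ->
  forall t, `|u2 t - u2' t| <= `|(q - p) - (q' - p')| + `|p - p'| + d / 2.
Proof.
move=> pm pq pm' pq' du du' [X [P [Q [[uX X0] [FP P0] [PQ Q0] Eu2]]]].
move=> [X' [P' [Q' [[uX' X0'] [FP' P0'] [PQ' Q0'] Eu2']]]] ud t.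
have d0 : 0 <= d by rewrite (le_trans _ (ud 0)).
have Xm := picard_cball pm pq du uX X0.
have Xm' := picard_cball pm' pq' du' uX' X0'.
have [_ _ bu] := du; have [_ _ bu'] := du'.
have W0 := ltW bvp_radius_gt0.
have [W1 W2 W3] := bvp_radiusP W0 (lexx _).
set W := bvp_radius in pq pq' W0 W1 W2 W3.
have bX s : `|X s - X' s| <= `|p - p'| + 2 * d.
  have := primitive_bound (primitiveB uX uX') ud s; rewrite X0 X0' => H.
  rewrite -[X s - X' s](subrK (p - p')) (le_trans (ler_normD _ _))//.
  by rewrite addrC lerD2l.
set D := `|p - p'| in bX *.
have D0 : 0 <= D by exact: normr_ge0.
have bF s : `|F (X s) (u s) - F (X' s) (u' s)| <= K * W * (4 * D + 12 * d).
  apply: (le_trans (F_lip _ _ (Xm s) (Xm' s))).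
  rewrite -mulrA ler_wpM2l ?(ltW K0)//.
  have a1 : `|u s| ^+ 2 * `|X s - X' s| <= (4 * W) * (D + 2 * d).
    rewrite ler_pM ?exprn_ge0//.
    have h : `|u s| <= 2 * W by apply: (le_trans (bu s)); rewrite ler_pM2l.
    rewrite expr2; apply: (@le_trans _ _ ((2 * W) * 2)); last by lra.
    by rewrite ler_pM//; lra.
  have a2 : (`|u s| + `|u' s|) * `|u s - u' s| <= (4 * W) * d.
    rewrite ler_pM ?addr_ge0//.
    by have := bu s; have := bu' s; lra.
  lra.
have bP s : `|P s - P' s| <= 2 * (K * W * (4 * D + 12 * d)) by have := primitive_bound (primitiveB FP FP') bF s; rewrite P0 P0' subrr subr0.
have bQ : `|Q 1 - Q' 1| <= 2 * (K * W * (4 * D + 12 * d)).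
  have := primitive_mean_value (primitiveB PQ PQ') (lerN10 _) ler01 (ler1n _ 2) bP.
  by rewrite Q0 Q0' !subr0 mulr1.
rewrite Eu2 Eu2'.
have -> : q - p + P t - Q 1 - (q' - p' + P' t - Q' 1) =
  (q - p - (q' - p')) + (P t - P' t) - (Q 1 - Q' 1).
  by apply/rowP => i; rewrite !mxE; ring.
rewrite (le_trans (ler_normB _ _))// (le_trans (lerD (ler_normD _ _) (lexx _)))//.
have := bP t.
have H1 : K * W * D <= D / 96 by rewrite -[leRHS]mulrC ler_wpM2r//; lra.
have H2 : K * W * d <= d / 96 by clear -d0 bu W2; rewrite -[leRHS]mulrC ler_wpM2r//; lra.
clear -D0 bQ H1 H2; lra.
Qed.

Lemma geodesic_bvp_picard p q x u : geodesic_bvp p q x u ->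
  picard_dom p q u /\ picard p q u u.
Proof.
move=> [[x0 x1] ux Fu bu]; have [cx kx dx] := ux; have [cu ku du] := Fu.
split; first by split.
exists x, (fun t => u t - u 0), (fun t => x t - p - clamp t *: u 0); split => //.
- split; last by rewrite subrr.
  split=> [t|t|t tI].
  + by apply: cvgB; [exact: cu|exact: cvg_cst].
  + by rewrite ku.
  + have ? := du t tI; rewrite -[F _ _]subr0; exact: is_deriveB.
- split; last by rewrite clamp_id ?scale0r ?x0 ?subrr ?subr0//; lra.
  split=> [t|t|t tI].
  + apply: cvgB; first by apply: cvgB; [exact: cx|exact: cvg_cst].
    apply: (@continuous_comp _ _ _ clamp (fun t => t *: u 0)); first exact: continuous_clamp.
    exact: scalel_continuous.
  + by rewrite kx clampK.
  + apply: (@is_derive_near _ _ (fun s => x s - p - s *: u 0)).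
      by apply: filterS (near_clamp tI) => s ->.
    have ? := dx t tI.
    have ? : is_derive t (1 : R) (fun s : R => s *: u 0) (u 0).
      apply/is_derive_rV => i.
      rewrite (_ : (fun _ => _) = (fun s : R => s * u 0 0 i)); last first.
        by apply/funext => s; rewrite mxE.
      by apply: is_derive_eq; rewrite scaler0 add0r; exact: mulr1.
    rewrite -[u t]subr0; apply: is_deriveB.
- move=> t; rewrite x1 clamp_id ?scale1r; last lra.
  by apply/rowP => i; rewrite !mxE; ring.
Qed.

Lemma geodesic_bvp_lip p q x u p' q' x' u' :
  cball m (r / 2) p -> `|q - p| <= bvp_radius ->
  cball m (r / 2) p' -> `|q' - p'| <= bvp_radius ->
  geodesic_bvp p q x u -> geodesic_bvp p' q' x' u' ->
  forall t, `|u t - u' t| <= 2 * (`|(q - p) - (q' - p')| + `|p - p'|).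
Proof.
move=> pm pq pm' pq' g g'.
have [du uu] := geodesic_bvp_picard g; have [du' uu'] := geodesic_bvp_picard g'.
set M := 2 * _; pose S := 2 * `|q - p| + 2 * `|q' - p'|.
have H k t : `|u t - u' t| <= M + S / 2 ^+ k.
  elim: k t => [t|k IH t].
    rewrite expr0 divr1 (le_trans (ler_normB _ _))//.
    have [_ _ bu] := du; have [_ _ bu'] := du'.
    rewrite ler_wpDl// ?lerD// /M mulr_ge0// addr_ge0//.
  have := picard_lip pm pq pm' pq' du du' uu uu' IH t.
  move=> /le_trans; apply; rewrite exprS invfM /M; lra.
move=> t; apply/ler_addgt0Pr => e e0.
have [k Sk] : exists k, S / 2 ^+ k < e.
  have [N SN] : exists N : nat, S / e < N%:R by exists (Num.truncn (S / e)).+1; exact: truncnS_gt.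
  exists N; rewrite ltr_pdivrMr ?exprn_gt0//.
  move: SN; rewrite ltr_pdivrMr// => /lt_le_trans; apply.
  rewrite mulrC ler_wpM2l ?(ltW e0)// -natrX ler_nat ltnW// ltn_expl//.
by rewrite (le_trans (H k t))// lerD2l ltW.
Qed.

Lemma geometric_limit (v : nat -> R -> 'rV[R]_n) (S : R) : 0 <= S ->
  (forall k t, `|v k.+1 t - v k t| <= S / 2 ^+ k) ->
  exists l : R -> 'rV[R]_n, forall k t, `|l t - v k t| <= 2 * S / 2 ^+ k.
Proof.
move=> S0 vS.
have step k l t : (k <= l)%N -> `|v l t - v k t| <= 2 * S / 2 ^+ k - 2 * S / 2 ^+ l.
  elim: l => [|l IH]; first by rewrite leqn0 => /eqP->; rewrite !subrr normr0.
  rewrite leq_eqVlt => /predU1P[->|]; first by rewrite !subrr normr0.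
  rewrite ltnS => /IH {}IH.
  rewrite -[v l.+1 t](subrK (v l t)) -addrA (le_trans (ler_normD _ _))//.
  have E : S / 2 ^+ l = 2 * S / 2 ^+ l.+1 by rewrite exprS; field; rewrite expf_neq0.
  by have := vS l t; lra.
have step' k l t : (k <= l)%N -> `|v l t - v k t| <= 2 * S / 2 ^+ k.
  move=> kl; apply: (le_trans (step k l t kl)).
  by rewrite gerBl divr_ge0 ?mulr_ge0// exprn_ge0.
have small e : 0 < e -> exists N : nat, forall k, (N <= k)%N -> 2 * S / 2 ^+ k < e.
  move=> e0; exists (Num.truncn (2 * S / e)).+1 => k Nk.
  have := truncnS_gt (2 * S / e); set N := (Num.truncn _).+1 in Nk *.
  rewrite ltr_pdivrMr// ltr_pdivrMr ?exprn_gt0// => /lt_le_trans; apply.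
  rewrite mulrC ler_wpM2l ?(ltW e0)// -natrX ler_nat.
  by rewrite (leq_trans Nk)// ltnW// ltn_expl.
have cv t : cvgn (fun k => v k t).
  apply/cauchy_cvgP/cauchy_exP => _/posnumP[e].
  have [N HN] := small e%:num (gt0 e).
  exists (v N t); exists N => // k Nk.
  by rewrite -ball_normE/= distrC (le_lt_trans (step' N k t Nk))// HN.
exists (fun t => limn (fun k => v k t)) => k t.
apply: (closed_cvg (fun y : 'rV[R]_n => `|y - v k t| <= 2 * S / 2 ^+ k) _ _ _ (cv t)).
  exact: (@closed_cball R n).
by near=> l; apply: step'; near: l; exact: nbhs_infty_ge.
Unshelve. all: by end_near. Qed.

Lemma le0_geometric (y S : R) : 0 <= S -> (forall k, y <= S / 2 ^+ k) -> y <= 0.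
Proof.
move=> S0 yS; rewrite leNgt; apply/negP => y0.
pose N := (Num.truncn (S / y)).+1.
have := truncnS_gt (S / y); rewrite -/N ltr_pdivrMr// => SN.
have := yS N; rewrite ler_pdivlMr ?exprn_gt0// leNgt => /negP; apply.
apply: (lt_le_trans SN); rewrite mulrC ler_wpM2l ?(ltW y0)// -natrX ler_nat.
by rewrite ltnW// ltn_expl.
Qed.

Lemma ex_geodesic_bvp p q : cball m (r / 2) p -> `|q - p| <= bvp_radius ->
  exists x u, geodesic_bvp p q x u /\ forall t, cball m r (x t).
Proof.
move=> pm pq.
pose dom := {u : R -> 'rV[R]_n | picard_dom p q u}.
have u0 : picard_dom p q (cst (q - p)).
  split=> [t|t|t]; [exact: cst_continuous|by []|].
  by rewrite /= ler_peMl// ler1n.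
have /choice[f Hf] : forall u : dom, exists u2 : dom, picard p q (sval u) (sval u2).
  move=> [u du]; have [u2 [? du2]] := ex_picard pm pq du.
  by exists (exist _ u2 du2).
pose v k := iter k f (exist _ _ u0 : dom).
have vP k : picard p q (sval (v k)) (sval (v k.+1)) by exact: Hf.
have vD k : picard_dom p q (sval (v k)) by exact: svalP.
pose S := 4 * `|q - p|; have S0 : 0 <= S by rewrite mulr_ge0.
have vS k t : `|sval (v k.+1) t - sval (v k) t| <= S / 2 ^+ k.
  elim: k t => [|k IH] t.
    have [_ _ b1] := vD 1%N; have [_ _ b0] := vD 0%N.
    rewrite expr0 divr1 (le_trans (ler_normB _ _))//.
    by have := b1 t; have := b0 t; rewrite /S; lra.
  have := picard_lip pm pq pm pq (vD k.+1) (vD k) (vP k.+1) (vP k) IH t.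
  by rewrite !subrr normr0 !add0r exprSr invfM mulrA.
have [l Hl] := geometric_limit S0 vS.
have S20 : 0 <= 2 * S by rewrite mulr_ge0.
have lD : picard_dom p q l.
  split.
  - move=> t; apply/cvgrPdist_le => e e0.
    pose k := (Num.truncn (6 * S / e)).+1.
    have kS : 2 * S / 2 ^+ k <= e / 3.
      rewrite ler_pdivrMr ?exprn_gt0//.
      have := truncnS_gt (6 * S / e); rewrite -/k ltr_pdivrMr// => kS.
      have : k%:R * e <= 2 ^+ k * e.
        by rewrite ler_wpM2r ?(ltW e0)// -natrX ler_nat ltnW// ltn_expl.
      by move: (2 ^+ k) (k%:R) kS => X Y; lra.
    have [cv _ _] := vD k.
    near=> s.
    have h : `|sval (v k) t - sval (v k) s| <= e / 3.
      near: s; move/cvgrPdist_le : (cv t); apply.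
      by rewrite divr_gt0.
    have ht := le_trans (Hl k t) kS; have hs := le_trans (Hl k s) kS.
    have -> : l t - l s = (l t - sval (v k) t) + (sval (v k) t - sval (v k) s)
        - (l s - sval (v k) s) by apply/rowP => i; rewrite !mxE; ring.
    rewrite (le_trans (ler_normB _ _))// (le_trans (lerD (ler_normD _ _) (lexx _)))//.
    by move: h ht hs; clear; lra.
  - move=> t; apply/eqP; rewrite -subr_eq0 -normr_le0; apply: (@le0_geometric _ (2 * (2 * S))).
      by rewrite mulr_ge0.
    move=> k; have [_ kv _] := vD k.
    have -> : l (clamp t) - l t = (l (clamp t) - sval (v k) (clamp t)) - (l t - sval (v k) t).
      by rewrite kv opprB addrA subrK.
    rewrite (le_trans (ler_normB _ _))//.
    by have := Hl k t; have := Hl k (clamp t); lra.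
  - move=> t; rewrite -subr_le0; apply: (@le0_geometric _ (2 * S)) => // k.
    have [_ _ bv] := vD k.
    have := ler_normD (l t - sval (v k) t) (sval (v k) t); rewrite subrK.
    by have := Hl k t; have := bv t; lra.
have [l2 [ll2 l2D]] := ex_picard pm pq lD.
have El t : l2 t = l t.
  apply/eqP; rewrite -subr_eq0 -normr_le0; apply: (@le0_geometric _ (2 * S)) => // k.
  have d k' := picard_lip pm pq pm pq lD (vD k') ll2 (vP k') (Hl k') t.
  move: (d k) (Hl k.+1 t); rewrite !subrr normr0 !add0r.
  have -> : l2 t - l t = (l2 t - sval (v k.+1) t) - (l t - sval (v k.+1) t).
    by rewrite opprB addrA subrK.
  rewrite exprSr invfM mulrA => h1 h2.
  by rewrite (le_trans (ler_normB _ _))//; lra.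
have [X [P [Q [[uX X0] [FP P0] [PQ Q0] El2]]]] := ll2.
have Xm := picard_cball pm pq lD uX X0.
exists X, l; split => //.
have lE t : l t = (q - p) + P t - Q 1 by rewrite -El.
have [cP kP dP] := FP.
split=> //.
- split => //.
  have [cX kX dX] := uX; have [cQ kQ dQ] := PQ.
  have hd (t : R) : t \in `]0, 1[ ->
     is_derive t (1 : R) (fun t => X t - Q t - t *: (q - p - Q 1)) 0.
    rewrite in_itv/= => t01; have tI : t \in `](-1), 2[ by rewrite in_itv/=; lra.
    have ? := dX t tI; have ? := dQ t tI.
    have ? : is_derive t (1 : R) (fun s : R => s *: (q - p - Q 1)) (q - p - Q 1).
      apply/is_derive_rV => i.
      rewrite (_ : (fun _ => _) = (fun s : R => s * (q - p - Q 1) 0 i)); last first.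
        by apply/funext => s; rewrite !mxE.
      by apply: is_derive_eq; rewrite scaler0 add0r; exact: mulr1.
    have -> : 0 = l t - P t - (q - p - Q 1).
      by rewrite lE; apply/rowP => i; rewrite !mxE; ring.
    exact: is_deriveB.
  have cd : continuous (fun t => X t - Q t - t *: (q - p - Q 1)).
    move=> t; apply: cvgB; first by apply: cvgB; [exact: cX|exact: cQ].
    exact: scalel_continuous.
  have hb (t : R) : t \in `]0, 1[ -> `|0 : 'rV[R]_n| <= 0 by rewrite normr0.
  have := mean_value_norm ler01 (lexx 0) hd hb (continuous_subspaceT cd).
  rewrite mul0r normr_le0 Q0 X0 scale0r scale1r !subr0 => /eqP E.
  apply/rowP => i; move/rowP : E => /(_ i); rewrite !mxE; lra.
- split=> [|t|t tI]; [by have [] := lD|by have [] := lD|].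
  apply: (@is_derive_near _ _ (fun s => (q - p) + P s - Q 1)).
    by near=> s; rewrite lE.
  have ? := dP t tI.
  rewrite -[F (X t) (l t)]subr0 -[F (X t) (l t)]add0r.
  apply: is_deriveB.
- by have [] := lD.
Unshelve. all: by end_near. Qed.

Lemma geodesic_ivp_unique (x u x' u' : R -> 'rV[R]_n) (a b U : R) :
  a <= b -> 0 <= U -> K * (b - a) * (U ^+ 2 * (b - a) + 2 * U) <= 2^-1 ->
  (forall t : R, t \in `[a, b] -> [/\ cball m r (x t), cball m r (x' t),
     `|u t| <= U & `|u' t| <= U]) ->
  (forall t : R, t \in `[a, b] -> is_derive t (1 : R) x (u t) /\ is_derive t (1 : R) u (F (x t) (u t))) ->
  (forall t : R, t \in `[a, b] -> is_derive t (1 : R) x' (u' t) /\ is_derive t (1 : R) u' (F (x' t) (u' t))) ->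
  x a = x' a -> u a = u' a ->
  forall t : R, t \in `[a, b] -> x t = x' t /\ u t = u' t.
Proof.
move=> ab U0 small bd dx dx' xa ua.
have ba0 : 0 <= b - a by rewrite subr_ge0.
have cu : {within `[a, b], continuous (fun t => u t - u' t)}.
  apply: continuous_in_subspaceT => t /set_mem /= tab.
  have [? ?] := dx t tab; have [? ?] := dx' t tab.
  by apply: continuousB; exact: is_derive_continuous.
have cx : {within `[a, b], continuous (fun t => x t - x' t)}.
  apply: continuous_in_subspaceT => t /set_mem /= tab.
  have [? ?] := dx t tab; have [? ?] := dx' t tab.
  by apply: continuousB; exact: is_derive_continuous.
have sub (t s : R) : t \in `[a, b] -> s \in `]a, t[ -> s \in `[a, b] by rewrite !in_itv/=; lra.
have bx S : 0 <= S -> (forall t : R, t \in `[a, b] -> `|u t - u' t| <= S) ->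
    forall t : R, t \in `[a, b] -> `|x t - x' t| <= S * (b - a).
  move=> S0 uS t tab.
  have /andP[at_ tb] : a <= t <= b by move: tab; rewrite in_itv.
  have cxt : {within `[a, t], continuous (fun t => x t - x' t)}.
    apply: continuous_subspaceW cx => s /=; rewrite !in_itv/=; lra.
  have dxt (s : R) : s \in `]a, t[ -> is_derive s (1 : R) (fun t => x t - x' t) (u s - u' s).
    move=> /(sub t s tab) sab; have [? _] := dx s sab; have [? _] := dx' s sab.
    exact: is_deriveB.
  have := mean_value_norm at_ S0 dxt (fun s sat => uS s (sub t s tab sat)) cxt.
  rewrite xa subrr subr0 => /le_trans; apply; rewrite ler_wpM2l//; lra.
have H k t : t \in `[a, b] -> `|u t - u' t| <= (2 * U) / 2 ^+ k.
  elim: k t => [|k IH] t tab.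
    have [_ _ h1 h2] := bd t tab.
    by rewrite expr0 divr1 (le_trans (ler_normB _ _))//; lra.
  set S := 2 * U / 2 ^+ k in IH.
  have S0 : 0 <= S by rewrite divr_ge0 ?exprn_ge0// mulr_ge0.
  have {}bx := bx S S0 IH.
  have /andP[at_ tb] : a <= t <= b by move: tab; rewrite in_itv.
  pose C := K * (U ^+ 2 * (b - a) + 2 * U) * S.
  have C0 : 0 <= C by rewrite !mulr_ge0 ?(ltW K0)// addr_ge0// ?mulr_ge0// exprn_ge0.
  have cut : {within `[a, t], continuous (fun t => u t - u' t)}.
    apply: continuous_subspaceW cu => s /=; rewrite !in_itv/=; lra.
  have dut (s : R) : s \in `]a, t[ ->
      is_derive s (1 : R) (fun t => u t - u' t) (F (x s) (u s) - F (x' s) (u' s)).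
    move=> /(sub t s tab) sab; have [_ ?] := dx s sab; have [_ ?] := dx' s sab.
    exact: is_deriveB.
  have bF s : s \in `]a, t[ -> `|F (x s) (u s) - F (x' s) (u' s)| <= C.
    move=> /(sub t s tab) sab; have [xm xm' h1 h2] := bd s sab.
    apply: (le_trans (F_lip _ _ xm xm')).
    rewrite /C -mulrA ler_wpM2l ?(ltW K0)// [leRHS]mulrDl lerD//.
      rewrite -mulrA [_ * S]mulrC ler_pM ?exprn_ge0//; last exact: bx.
      by rewrite lerXn2r ?nnegrE.
    by rewrite ler_pM ?addr_ge0//; [lra|exact: IH].
  have := mean_value_norm at_ C0 dut bF cut.
  rewrite ua subrr subr0 => /le_trans; apply.
  apply: (@le_trans _ _ (C * (b - a))); first by rewrite ler_wpM2l//; lra.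
  have -> : C * (b - a) = (K * (b - a) * (U ^+ 2 * (b - a) + 2 * U)) * S.
    by rewrite /C; ring.
  have -> : 2 * U / 2 ^+ k.+1 = 2^-1 * S by rewrite [in LHS]exprSr invfM mulrA mulrC.
  exact: ler_wpM2r S0 _ _ small.
have uE t : t \in `[a, b] -> u t = u' t.
  move=> tab; apply/eqP; rewrite -subr_eq0 -normr_le0.
  by apply: (@le0_geometric _ (2 * U)) => [|k]; [rewrite mulr_ge0|exact: H].
move=> t tab; split; last exact: uE.
apply/eqP; rewrite -subr_eq0 -normr_le0.
have := bx 0 (lexx 0) _ t tab; rewrite mul0r; apply.
by move=> s sab; rewrite uE// subrr normr0.
Qed.

End boundary_value_problem.

Section differentiability.
Context {R : realType} {V W : normedModType R}.

Lemma differentiable_eps (f : V -> W) (x : V) : differentiable f x ->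
  forall e : R, 0 < e -> \forall y \near x, `|f y - f x - 'd f x (y - x)| <= e * `|y - x|.
Proof.
move=> df e e0; have := diff_locally df => /eqaddoP/(_ e e0) H.
rewrite (near_shift 0 x)/= subr0; apply: filterS H => h /=.
by rewrite addrK -[(_ - _) h]/(f (h + x) - (f x + 'd f x h)) opprD addrA.
Qed.

Lemma differentiable_of_eps (f : V -> W) (x : V) (L : {linear V -> W}) :
  continuous L ->
  (forall e : R, 0 < e -> \forall y \near x, `|f y - f x - L (y - x)| <= e * `|y - x|) ->
  differentiable f x /\ 'd f x = L :> (V -> W).
Proof.
move=> cL H.
have E : f \o shift x = cst (f x) + L +o_ 0 id.
  apply/eqaddoP => e e0; have := H e e0.
  rewrite (near_shift 0 x)/= subr0; apply: filterS => h /=.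
  by rewrite addrK -[(_ - _) h]/(f (h + x) - (f x + L h)) opprD addrA.
have D := diff_unique cL E; split => //.
by apply/diff_locallyP; rewrite D.
Qed.

Lemma near_eq_differentiable (f g : V -> W) (x : V) :
  (\forall y \near x, f y = g y) -> differentiable f x ->
  differentiable g x /\ 'd g x = 'd f x :> (V -> W).
Proof.
move=> fg df; apply: differentiable_of_eps; first exact: diff_continuous.
move=> e e0; near=> y; have <- : f y = g y by near: y.
have <- : f x = g x by exact: nbhs_singleton fg.
by near: y; exact: differentiable_eps.
Unshelve. all: by end_near. Qed.

End differentiability.

Section smooth_entries.
Context {R : realType} {n : nat}.

Lemma differentiable_entry m p (V : normedModType R) (f : V -> 'M[R]_(m, p)) (x : V) i j :
  differentiable f x -> differentiable (fun y => f y i j) x.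
Proof.
move=> df; apply: (@differentiable_comp _ _ _ _ f (fun A : 'M[R]_(m, p) => A i j)) => //.
exact: differentiable_coord.
Qed.

Lemma derive_entry m p (V : normedModType R) (f : V -> 'M[R]_(m, p)) (x v : V) i j :
  derivable f x v -> 'D_v (fun y => f y i j) x = ('D_v f x) i j.
Proof. by move=> df; rewrite derive_mx// mxE. Qed.

Lemma is_derive_comp_diff (f : 'rV[R]_n -> R) (c : R -> 'rV[R]_n) (t : R) (u : 'rV[R]_n) :
  differentiable f (c t) -> is_derive t (1 : R) c u ->
  is_derive t (1 : R) (fun s => f (c s)) ('D_u f (c t)).
Proof.
move=> df dc.
have dct : differentiable c t by apply/derivable1_diffP.
have dfc : differentiable (f \o c) t by exact: differentiable_comp.
have d1 : derivable (f \o c) t 1 by exact/derivable1_diffP.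
apply: (DeriveDef d1).
rewrite deriveE// diff_comp//= deriveE//; congr ('d f (c t) _).
by rewrite -deriveE// derive_val.
Qed.

End smooth_entries.

Section metric_forms.
Context {R : realType} {n : nat}.
Variable gm : 'rV[R]_n -> 'M[R]_n.
Implicit Types (x y u v w k : 'rV[R]_n).

Definition gform x u v : R := (u *m gm x *m v^T) 0 0.

Definition gdform x w u v : R :=
  \sum_a \sum_b u 0 a * v 0 b * 'D_w (fun y => gm y a b) x.

Definition gchristoffel x (k a b : 'I_n) : R :=
  2^-1 * \sum_(l < n) invmx (gm x) k l *
    ('D_(delta_mx 0 a) (fun y : 'rV[R]_n => gm y b l) x
     + 'D_(delta_mx 0 b) (fun y : 'rV[R]_n => gm y a l) x
     - 'D_(delta_mx 0 l) (fun y : 'rV[R]_n => gm y a b) x).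

Definition gaccel x u : 'rV[R]_n :=
  \row_k - \sum_(a < n) \sum_(b < n) gchristoffel x k a b * u 0 a * u 0 b.

Definition glow x u : 'rV[R]_n := \row_l (2^-1 *
  \sum_(a < n) \sum_(b < n)
    ('D_(delta_mx 0 a) (fun y : 'rV[R]_n => gm y b l) x
     + 'D_(delta_mx 0 b) (fun y : 'rV[R]_n => gm y a l) x
     - 'D_(delta_mx 0 l) (fun y : 'rV[R]_n => gm y a b) x) * (u 0 a * u 0 b)).

Lemma gformE x u v : gform x u v = \sum_a \sum_b u 0 a * v 0 b * gm x a b.
Proof.
rewrite /gform mxE exchange_big/=; apply: eq_bigr => b _.
rewrite mxE mxE mulr_suml; apply: eq_bigr => a _; ring.
Qed.

Lemma gaccel_glow x u : gaccel x u = - (glow x u *m (invmx (gm x))^T).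
Proof.
apply/rowP => k; rewrite !mxE; congr (- _).
under [RHS]eq_bigr do rewrite !mxE mulr_sumr mulr_suml.
rewrite [RHS]exchange_big/=; apply: eq_bigr => a _.
under [RHS]eq_bigr do rewrite mulr_sumr mulr_suml.
rewrite [RHS]exchange_big/=; apply: eq_bigr => b _.
rewrite /gchristoffel mulr_sumr !mulr_suml; apply: eq_bigr => l _; ring.
Qed.

Lemma gform0l x v : gform x 0 v = 0.
Proof. by rewrite /gform !mul0mx mxE. Qed.

Lemma gformDl x u u' v : gform x (u + u') v = gform x u v + gform x u' v.
Proof. by rewrite /gform !mulmxDl mxE. Qed.

Lemma gformDr x u v v' : gform x u (v + v') = gform x u v + gform x u v'.
Proof. by rewrite /gform linearD/= mulmxDr mxE. Qed.

Lemma gformZl x (s : R) u v : gform x (s *: u) v = s * gform x u v.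
Proof. by rewrite /gform -!scalemxAl mxE. Qed.

Lemma gformZr x (s : R) u v : gform x u (s *: v) = s * gform x u v.
Proof. by rewrite /gform linearZ/= -scalemxAr mxE. Qed.

Lemma gformC x u v : (gm x)^T = gm x -> gform x u v = gform x v u.
Proof.
move=> gs; rewrite /gform -[in LHS]gs.
by rewrite -[in LHS](trmxK u) -!trmx_mul mxE mulmxA.
Qed.

Lemma glow_form x u v : (forall a b, differentiable (fun y => gm y a b) x) ->
  (glow x u *m v^T) 0 0 = gdform x u u v - 2^-1 * gdform x v u u.
Proof.
move=> dg; rewrite mxE.
pose d c a b := 'D_(delta_mx 0 c) (fun y => gm y a b) x.
have gE w s t : gdform x w s t = \sum_a \sum_b \sum_c s 0 a * t 0 b * (w 0 c * d c a b).
  rewrite /gdform; apply: eq_bigr => a _; apply: eq_bigr => b _.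
  by rewrite derive_sum_pd// mulr_sumr.
have -> : \sum_j glow x u 0 j * v^T j 0 = 2^-1 * (
    \sum_l \sum_a \sum_b d a b l * (u 0 a * u 0 b) * v 0 l
    + \sum_l \sum_a \sum_b d b a l * (u 0 a * u 0 b) * v 0 l
    - \sum_l \sum_a \sum_b d l a b * (u 0 a * u 0 b) * v 0 l).
  rewrite -big_split/= -sumrB mulr_sumr; apply: eq_bigr => l _.
  rewrite !mxE -mulrA; congr (_ * _).
  rewrite mulr_suml -big_split/= -sumrB; apply: eq_bigr => a _.
  rewrite mulr_suml -big_split/= -sumrB; apply: eq_bigr => b _.
  rewrite /d; ring.
have E1 : \sum_l \sum_a \sum_b d b a l * (u 0 a * u 0 b) * v 0 l = gdform x u u v.
  rewrite gE exchange_big/=; apply: eq_bigr => a _; apply: eq_bigr => b _.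
  by apply: eq_bigr => c _; ring.
have E2 : \sum_l \sum_a \sum_b d a b l * (u 0 a * u 0 b) * v 0 l = gdform x u u v.
  rewrite -E1; apply: eq_bigr => l _; rewrite exchange_big/=.
  by apply: eq_bigr => a _; apply: eq_bigr => b _; ring.
have E3 : \sum_l \sum_a \sum_b d l a b * (u 0 a * u 0 b) * v 0 l = gdform x v u u.
  rewrite gE exchange_big/=; apply: eq_bigr => a _.
  rewrite exchange_big/=; apply: eq_bigr => b _.
  by apply: eq_bigr => c _; ring.
by rewrite E1 E2 E3; move: (gdform x u u v) (gdform x v u u) => A B; field.
Qed.

Lemma mulmx_gaccel x u : (gm x)^T = gm x -> gm x \in unitmx ->
  gaccel x u *m gm x = - glow x u.
Proof.
move=> gs gu; rewrite gaccel_glow mulNmx -mulmxA.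
by rewrite -{2}gs -trmx_mul mulmxV// trmx1 mulmx1.
Qed.

Lemma gform_gaccel x u v : (gm x)^T = gm x -> gm x \in unitmx ->
  (forall a b, differentiable (fun y => gm y a b) x) ->
  gform x (gaccel x u) v = - gdform x u u v + 2^-1 * gdform x v u u.
Proof.
move=> gs gu dg; rewrite /gform mulmx_gaccel// mulNmx mxE glow_form//; ring.
Qed.

Lemma is_derive_gform (x a b : R -> 'rV[R]_n) (t : R) (x' a' b' : 'rV[R]_n) :
  (forall i j, differentiable (fun y => gm y i j) (x t)) ->
  is_derive t (1 : R) x x' -> is_derive t (1 : R) a a' -> is_derive t (1 : R) b b' ->
  is_derive t (1 : R) (fun s => gform (x s) (a s) (b s))
    (gdform (x t) x' (a t) (b t) + gform (x t) a' (b t) + gform (x t) (a t) b').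
Proof.
move=> dg dx da db.
have -> : (fun s => gform (x s) (a s) (b s)) =
   \sum_i \sum_j (fun s => (a s 0 i * b s 0 j) * gm (x s) i j).
  apply/funext => s; rewrite gformE fct_sumE; apply: eq_bigr => i _.
  by rewrite fct_sumE.
rewrite !gformE /gdform -!big_split/=.
apply: (@is_derive_eq _ _ _ _ _ _ _ (\sum_i \sum_j
  ((a t 0 i * b t 0 j) *: 'D_x' (fun y => gm y i j) (x t)
   + gm (x t) i j *: (a t 0 i *: b' 0 j + b t 0 j *: a' 0 i)))); last first.
  apply: eq_bigr => i _; rewrite -!big_split/=; apply: eq_bigr => j _.
  by rewrite /GRing.scale/=; ring.
apply: is_derive_sum => i; apply: is_derive_sum => j.
have ? := is_derive_comp_diff (dg i j) dx.
have ? := (is_derive_rV _ _ _).1 da i.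
have ? := (is_derive_rV _ _ _).1 db j.
have ? : is_derive t (1 : R) (fun s => a s 0 i * b s 0 j) (a t 0 i *: b' 0 j + b t 0 j *: a' 0 i).
  exact: is_deriveM.
exact: is_deriveM.
Qed.

End metric_forms.

Section metric_estimates.
Context {R : realType} {n : nat}.
Variables (gm : 'rV[R]_n -> 'M[R]_n) (m : 'rV[R]_n) (r C c1 : R).
Implicit Types (x y u v w k : 'rV[R]_n).
Hypothesis C0 : 0 <= C.
Hypothesis c10 : 0 <= c1.
Hypothesis sym : forall x, cball m r x -> (gm x)^T = gm x.
Hypothesis dg : forall x, cball m r x -> forall a b, differentiable (fun y => gm y a b) x.
Hypothesis g_bound : forall x, cball m r x -> forall a b, `|gm x a b| <= C.
Hypothesis g_lip : forall x y, cball m r x -> cball m r y -> forall a b,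
  `|gm x a b - gm y a b| <= C * `|x - y|.
Hypothesis dg_bound : forall x, cball m r x -> forall a b l,
  `|'D_(delta_mx 0 l) (fun y => gm y a b) x| <= C.
Hypothesis dg_lip : forall x y, cball m r x -> cball m r y -> forall a b l,
  `|'D_(delta_mx 0 l) (fun y => gm y a b) x - 'D_(delta_mx 0 l) (fun y => gm y a b) y|
   <= C * `|x - y|.
Hypothesis coercive : forall x, cball m r x -> forall u,
  `|u| ^+ 2 <= c1 * gform gm x u u.

Local Notation N := (n%:R : R).

Lemma ler_sum_const (f : 'I_n -> R) (c : R) : (forall i, `|f i| <= c) ->
  `|\sum_i f i| <= N * c.
Proof.
move=> fc; rewrite (le_trans (ler_norm_sum _ _ _))//.
apply: (@le_trans _ _ (\sum_(i < n) c)); first exact: ler_sum.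
by rewrite sumr_const card_ord mulr_natl.
Qed.

Lemma gform_bound x u v : cball m r x -> `|gform gm x u v| <= (N * (N * C)) * `|u| * `|v|.
Proof.
move=> xm; rewrite gformE.
have -> : N * (N * C) * `|u| * `|v| = N * (N * (`|u| * `|v| * C)) by ring.
apply: ler_sum_const => a; apply: ler_sum_const => b.
by rewrite !normrM ler_pM ?mulr_ge0// ?g_bound// ler_pM// le_coord_norm.
Qed.

Lemma gform_lip x y u v : cball m r x -> cball m r y ->
  `|gform gm x u v - gform gm y u v| <= (N * (N * C)) * `|x - y| * `|u| * `|v|.
Proof.
move=> xm ym; rewrite !gformE -sumrB.
have -> : N * (N * C) * `|x - y| * `|u| * `|v| = N * (N * (`|u| * `|v| * (C * `|x - y|))) by ring.
apply: ler_sum_const => a; rewrite -sumrB; apply: ler_sum_const => b.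
by rewrite -mulrBr !normrM ler_pM ?mulr_ge0// ?g_lip// ler_pM// le_coord_norm.
Qed.

Lemma gform_taylor x k u : cball m r x -> cball m r (x + k) ->
  `|gform gm (x + k) u u - gform gm x u u - gdform gm x k u u|
    <= (N * (N * (N * C))) * `|k| ^+ 2 * `|u| ^+ 2.
Proof.
move=> xm xkm; rewrite !gformE /gdform -!sumrB.
have -> : (N * (N * (N * C))) * `|k| ^+ 2 * `|u| ^+ 2 =
   N * (N * (`|u| * `|u| * (N * (`|k| * (C * `|k|))))) by ring.
apply: ler_sum_const => a; rewrite -!sumrB; apply: ler_sum_const => b.
have dgb y : cball m r y -> differentiable (fun y => gm y a b) y by move=> /dg.
rewrite -!mulrBr !normrM ler_pM ?mulr_ge0//; first by rewrite ler_pM// le_coord_norm.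
have [t t01 ->] := mean_value_ball xm xkm dgb.
have /andP[t0 t1] : 0 <= t <= 1 by move: t01; rewrite in_itv/= => /andP[? ?]; rewrite !ltW.
have xtm : cball m r (x + t *: k) by apply: cball_segment => //; rewrite in_itv/= t0.
rewrite derive_sum_pd; last exact: dgb.
rewrite derive_sum_pd; last exact: dgb.
rewrite -sumrB; apply: ler_sum_const => l.
rewrite -mulrBr normrM ler_pM// ?le_coord_norm//.
apply: (le_trans (dg_lip xtm xm a b l)); rewrite ler_wpM2l//.
by rewrite addrC addKr normrZ ger0_norm// ler_piMl.
Qed.

Lemma glow_bound x u : cball m r x -> `|glow gm x u| <= (N * (N * (3 * C))) * `|u| ^+ 2.
Proof.
move=> xm; apply: norm_mx_le => [|i l]; first by rewrite !mulr_ge0// exprn_ge0.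
rewrite mxE normrM.
set S := `|\sum_(a < n) _|.
suff SP : S <= N * (N * (3 * C)) * `|u| ^+ 2.
  apply: le_trans SP; rewrite ler_piMl ?normr_ge0// ger0_norm ?invr_ge0//.
  by rewrite invf_le1// ler1n.
have -> : N * (N * (3 * C)) * `|u| ^+ 2 = N * (N * (3 * C * (`|u| * `|u|))) by ring.
apply: ler_sum_const => a; apply: ler_sum_const => b.
rewrite normrM ler_pM//; last by rewrite normrM ler_pM// le_coord_norm.
rewrite (le_trans (ler_normB _ _))// (le_trans (lerD (ler_normD _ _) (lexx _)))//.
have := dg_bound xm b l a; have := dg_bound xm a l b; have := dg_bound xm a b l; lra.
Qed.

Lemma glow_lip x y u v : cball m r x -> cball m r y ->
  `|glow gm x u - glow gm y v| <= (N * (N * (3 * C))) *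
     (`|u| ^+ 2 * `|x - y| + (`|u| + `|v|) * `|u - v|).
Proof.
move=> xm ym; apply: norm_mx_le => [|i l].
  by rewrite !mulr_ge0// addr_ge0// mulr_ge0// ?exprn_ge0// addr_ge0.
rewrite !mxE -mulrBr normrM -sumrB.
set S := `|\sum_(a < n) _|.
suff SP : S <= N * (N * (3 * C * (`|u| ^+ 2 * `|x - y| + (`|u| + `|v|) * `|u - v|))).
  rewrite -!mulrA in SP *; apply: le_trans SP.
  rewrite ler_piMl ?normr_ge0// ger0_norm ?invr_ge0//.
  by rewrite invf_le1// ler1n.
apply: ler_sum_const => a; rewrite -sumrB; apply: ler_sum_const => b.
set cx := (X in X * (u 0 a * u 0 b)); set cy := (X in _ - X * (v 0 a * v 0 b)).
have cxy : `|cx - cy| <= 3 * C * `|x - y|.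
  have := dg_lip xm ym b l a; have := dg_lip xm ym a l b; have := dg_lip xm ym a b l.
  rewrite /cx /cy.
  set A1 := 'D_ _ _ x; set B1 := 'D_ _ _ y; set A2 := 'D_ _ _ x; set B2 := 'D_ _ _ y.
  set A3 := 'D_ _ _ x; set B3 := 'D_ _ _ y => h1 h2 h3.
  have -> : A3 + A2 - A1 - (B3 + B2 - B1) = (A3 - B3) + (A2 - B2) - (A1 - B1) by ring.
  rewrite (le_trans (ler_normB _ _))// (le_trans (lerD (ler_normD _ _) (lexx _)))//.
  lra.
have cyb : `|cy| <= 3 * C.
  rewrite /cy (le_trans (ler_normB _ _))// (le_trans (lerD (ler_normD _ _) (lexx _)))//.
  have := dg_bound ym b l a; have := dg_bound ym a l b; have := dg_bound ym a b l; lra.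
have -> : cx * (u 0 a * u 0 b) - cy * (v 0 a * v 0 b) =
   (cx - cy) * (u 0 a * u 0 b) + cy * (u 0 a * (u 0 b - v 0 b) + (u 0 a - v 0 a) * v 0 b) by ring.
have uv (j : 'I_n) : `|u 0 j - v 0 j| <= `|u - v| by have := le_coord_norm (u - v) 0 j; rewrite !mxE.
have e1 : `|(cx - cy) * (u 0 a * u 0 b)| <= (3 * C * `|x - y|) * (`|u| * `|u|) by rewrite 2!normrM ler_pM// ler_pM// le_coord_norm.
have e2 : `|u 0 a * (u 0 b - v 0 b) + (u 0 a - v 0 a) * v 0 b| <=
    (`|u| + `|v|) * `|u - v|.
  rewrite (le_trans (ler_normD _ _))// [leRHS]mulrDl lerD// normrM.
    by rewrite ler_pM// le_coord_norm.
  by rewrite mulrC ler_pM// le_coord_norm.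
have e3 : `|cy * (u 0 a * (u 0 b - v 0 b) + (u 0 a - v 0 a) * v 0 b)| <=
    (3 * C) * ((`|u| + `|v|) * `|u - v|) by rewrite normrM ler_pM.
rewrite (le_trans (ler_normD _ _))// [leRHS]mulrDr lerD//.
by move: e1; rewrite mulrAC -mulrA -expr2.
Qed.

Lemma le_mulmx_metric x v : cball m r x -> `|v| <= c1 * N * `|v *m gm x|.
Proof.
move=> xm; have [->|v0] := eqVneq v 0; first by rewrite mul0mx !normr0 mulr0.
have v0' : 0 < `|v| by rewrite normr_gt0.
rewrite -(ler_pM2r v0') -expr2 (le_trans (coercive xm v))// -!mulrA ler_wpM2l//.
rewrite (le_trans (ler_norm _))// (le_trans (le_coord_norm _ _ _))//.
by rewrite (le_trans (norm_mulmx_le _ _))// norm_trmx mulrA.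
Qed.

Lemma metric_unitmx x : cball m r x -> gm x \in unitmx.
Proof.
move=> xm; rewrite -row_free_unit; apply/row_freeP; apply: contrapT => nex.
have : ~~ row_free (gm x) by apply/negP => /row_freeP.
rewrite -kermx_eq0 => /rowV0Pn[v /sub_kermxP vg v0].
have := le_mulmx_metric v xm; rewrite vg normr0 mulr0 normr_le0 => /eqP v00.
by rewrite v00 eqxx in v0.
Qed.

Lemma gaccel_bound x u : cball m r x ->
  `|gaccel gm x u| <= (c1 * N * (N * (N * (3 * C)))) * `|u| ^+ 2.
Proof.
move=> xm; apply: (le_trans (le_mulmx_metric _ xm)).
rewrite mulmx_gaccel ?sym ?metric_unitmx// normrN -[leRHS]mulrA ler_wpM2l ?mulr_ge0//.
exact: glow_bound.
Qed.

Lemma gaccel_lip x y u v : cball m r x -> cball m r y ->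
  `|gaccel gm x u - gaccel gm y v| <=
  (c1 * N * (N * (N * (3 * C)) + N * (c1 * N * (N * (N * (3 * C)))) * C)) *
     (`|u| ^+ 2 * `|x - y| + (`|u| + `|v|) * `|u - v|).
Proof.
move=> xm ym; apply: (le_trans (le_mulmx_metric _ ym)).
have -> : (gaccel gm x u - gaccel gm y v) *m gm y =
    - (glow gm x u - glow gm y v) - gaccel gm x u *m (gm x - gm y).
  rewrite mulmxBl mulmxBr !mulmx_gaccel ?sym ?metric_unitmx//.
  move: (gaccel gm x u *m gm y) (glow gm x u) (glow gm y v) => A B D.
  by apply/rowP => i; rewrite !mxE; ring.
rewrite -[leRHS]mulrA ler_wpM2l ?mulr_ge0// (le_trans (ler_normB _ _))// normrN.
rewrite [leRHS]mulrDl lerD//; first exact: glow_lip.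
rewrite (le_trans (norm_mulmx_le _ _))//.
have gxy : `|gm x - gm y| <= C * `|x - y| by apply: norm_mx_le => [|i j]; rewrite ?mulr_ge0// !mxE g_lip.
rewrite -2!mulrA -[X in _ <= X]mulrA ler_wpM2l//.
apply: (@le_trans _ _ (c1 * (N * (N * (N * (3 * C)))) * `|u| ^+ 2 * (C * `|x - y|))).
  by rewrite ler_pM//; have := gaccel_bound u xm; rewrite -!mulrA.
have -> : c1 * (N * (N * (N * (3 * C)))) * `|u| ^+ 2 * (C * `|x - y|) =
   (c1 * N * (N * (N * (3 * C))) * C) * (`|u| ^+ 2 * `|x - y|) by ring.
rewrite [leRHS]mulrA ler_wpM2l ?mulr_ge0// lerDl mulr_ge0// addr_ge0.
Qed.

End metric_estimates.

Lemma near_eq_continuous (T U : topologicalType) (f g : T -> U) (x : T) :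
  (\forall y \near x, f y = g y) -> {for x, continuous f} -> {for x, continuous g}.
Proof.
move=> fg cf; have E := nbhs_singleton fg.
rewrite /prop_for /continuous_at -E.
by apply: cvg_trans cf; apply: near_eq_cvg; apply: filterS fg => y ->.
Qed.

Section metric_ball.
Context {R : realType} {n : nat}.
Implicit Types (x y u v w k : 'rV[R]_n).

Record metric_ball (gm : 'rV[R]_n -> 'M[R]_n) (m : 'rV[R]_n) (r K : R) : Prop :=
 MetricBall {
  mb_r : 0 < r;
  mb_K : 1 <= K;
  mb_sym : forall x, cball m r x -> (gm x)^T = gm x;
  mb_diff : forall x, cball m r x -> forall a b, differentiable (fun y => gm y a b) x;
  mb_bound : forall x u v, cball m r x -> `|gform gm x u v| <= K * `|u| * `|v|;
  mb_coer : forall x u, cball m r x -> `|u| ^+ 2 <= K * gform gm x u u;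
  mb_lip : forall x y u v, cball m r x -> cball m r y ->
    `|gform gm x u v - gform gm y u v| <= K * `|x - y| * `|u| * `|v|;
  mb_taylor : forall x k u, cball m r x -> cball m r (x + k) ->
    `|gform gm (x + k) u u - gform gm x u u - gdform gm x k u u|
      <= K * `|k| ^+ 2 * `|u| ^+ 2;
  mb_Fb : forall x u, cball m r x -> `|gaccel gm x u| <= K * `|u| ^+ 2;
  mb_Fl : forall x y u v, cball m r x -> cball m r y ->
    `|gaccel gm x u - gaccel gm y v| <=
    K * (`|u| ^+ 2 * `|x - y| + (`|u| + `|v|) * `|u - v|);
  mb_E : forall x u v, cball m r x ->
    gform gm x (gaccel gm x u) v = - gdform gm x u u v + 2^-1 * gdform gm x v u u }.

Lemma cvg_entry (T : Type) (F : set_system T) (FF : Filter F) a b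
    (f : T -> 'M[R]_(a, b)) (l : 'M[R]_(a, b)) i j :
  f @ F --> l -> f t i j @[t --> F] --> l i j.
Proof.
move=> fl; apply/cvgrPdist_le => e e0; move/cvgrPdist_le : fl => /(_ e e0).
apply: filterS => t; apply: le_trans.
by have := le_coord_norm (l - f t) i j; rewrite !mxE.
Qed.

Lemma continuous_entry (V : normedModType R) a b (f : V -> 'M[R]_(a, b)) (x0 : V) i j :
  {for x0, continuous f} -> {for x0, continuous (fun z : V => f z i j)}.
Proof. by move=> fx; apply: cvg_entry; exact: fx. Qed.

Lemma cvg_gform (T : Type) (F : set_system T) (FF : Filter F) gm
    (X A B : T -> 'rV[R]_n) (x a b : 'rV[R]_n) :
  {for x, continuous gm} -> X @ F --> x -> A @ F --> a -> B @ F --> b ->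
  gform gm (X t) (A t) (B t) @[t --> F] --> gform gm x a b.
Proof.
move=> cg Xx Aa Bb.
have -> : (fun t => gform gm (X t) (A t) (B t)) =
   (fun t => \sum_i \sum_j A t 0 i * B t 0 j * gm (X t) i j).
  by apply/funext => t; rewrite gformE.
rewrite gformE; apply: cvg_big => [|i _]; first exact: add_continuous.
apply: cvg_big => [|j _]; first exact: add_continuous.
have co (C : T -> 'rV[R]_n) (c : 'rV[R]_n) (i' : 'I_n) : C @ F --> c -> C t 0 i' @[t --> F] --> c 0 i'.
  exact: cvg_entry.
apply: cvgM; first by apply: cvgM; exact: co.
apply: (@cvg_entry _ _ _ _ _ (fun t => gm (X t))).
exact: (cvg_comp _ _ Xx cg).
Qed.

Lemma le_sum_nneg (I : finType) (f : I -> R) : (forall i, 0 <= f i) ->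
  forall i, f i <= \sum_j f j.
Proof. by move=> f0 i; rewrite (bigD1 i)//= lerDl sumr_ge0. Qed.

Lemma posdef_coercive (A : 'M[R]_n) :
  (forall u, u != 0 -> 0 < (u *m A *m u^T) 0 0) ->
  exists2 c : R, 0 < c & forall u, c * `|u| ^+ 2 <= (u *m A *m u^T) 0 0.
Proof.
move=> pA; pose S : set 'rV[R]_n := [set u | `|u| = 1].
have nS u : u != 0 -> S (`|u|^-1 *: u) by move=> u0; rewrite /S/= normrZ normfV normr_id mulVf// normr_eq0.
have cS : compact S.
  apply: (@subclosed_compact _ _ (cball 0 1)); last 2 first.
  - exact: compact_cball.
  - by move=> u /=; rewrite /cball/= subr0 => ->.
  have -> : S = (@Num.Def.normr R 'rV[R]_n) @^-1` [set 1] by [].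
  apply: closed_comp; last exact: closed_eq.
  by move=> u _; exact: norm_continuous.
have [S0|/set0P S0] := eqVneq S set0.
  exists 1 => // u; have [->|u0] := eqVneq u 0.
    by rewrite normr0 expr0n mulr0 !mul0mx mxE.
  by have := nS _ u0; rewrite S0.
have [|u0 u0S u0P] := @compact_EVT_min _ _ (fun u => (u *m A *m u^T) 0 0) S S0 cS.
- apply: continuous_subspaceT => u.
  by apply: (@cvg_gform _ (nbhs u) _ (cst A) id id id u u u) => //; exact: cst_continuous.
- exists ((u0 *m A *m u0^T) 0 0).
    apply: pA; apply/eqP => u00; move/set_mem : u0S; rewrite /S/= u00 normr0.
    by move/esym/eqP; rewrite oner_eq0.
  move=> u; have [->|un0] := eqVneq u 0.
    by rewrite normr0 expr0n mulr0 !mul0mx mxE.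
  have := u0P _ (mem_set (nS _ un0)).
  have u1 : 0 < `|u| by rewrite normr_gt0.
  set q := _ 0 0 => /=.
  have -> : (`|u|^-1 *: u *m A *m (`|u|^-1 *: u)^T) 0 0 = `|u| ^- 2 * (u *m A *m u^T) 0 0.
    rewrite linearZ/= -!scalemxAl -scalemxAr scalerA mxE.
    by rewrite -invfM -expr2.
  by rewrite ler_pdivlMl ?exprn_gt0// mulrC.
Qed.

Lemma ex_lipschitz_family (I : finType) (f : I -> 'rV[R]_n -> R) m (r : R) : 0 < r ->
  (forall i x, cball m r x -> differentiable (f i) x) ->
  (forall i x l, cball m r x -> {for x, continuous (fun x => 'D_(delta_mx 0 l) (f i) x)}) ->
  exists2 C : R, 0 <= C & forall i, (forall x, cball m r x -> `|f i x| <= C) /\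
    (forall x y, cball m r x -> cball m r y -> `|f i x - f i y| <= C * `|x - y|).
Proof.
move=> r0 df cf; have mm : cball m r m by rewrite /cball/= subrr normr0 ltW.
have /choice[L HL] i : exists L : R, 0 <= L /\ forall x y,
    cball m r x -> cball m r y -> `|f i x - f i y| <= L * `|x - y|.
  have [||L ? ?] := @ex_lipschitz_cball R n (f i) m r; [exact: df|by move=> y l; exact: cf|by exists L].
have L0 i : 0 <= L i by have [] := HL i.
have Lr i : 0 <= L i * r by rewrite mulr_ge0// ltW.
have t0 i : 0 <= L i + L i * r + `|f i m| by rewrite !addr_ge0.
exists (\sum_i (L i + L i * r + `|f i m|)) => [|i]; first by rewrite sumr_ge0.
have le := le_sum_nneg t0 i; have [_ H] := HL i; split=> [x xm|x y xm ym].
  apply: le_trans le; rewrite -[f i x](subrK (f i m)) (le_trans (ler_normD _ _))// lerD2r.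
  rewrite (le_trans (H x m xm mm))// -[leLHS]add0r lerD// ler_wpM2l//; exact: xm.
apply: (le_trans (H x y xm ym)); rewrite ler_wpM2r// (le_trans _ le)//.
by rewrite -addrA lerDl addr_ge0.
Qed.

Lemma ex_metric_ball gm (O : set 'rV[R]_n) m : open O -> O m -> smooth_on O gm ->
  (forall x, O x -> (gm x)^T = gm x) ->
  (forall x, O x -> forall u, u != 0 -> 0 < (u *m gm x *m u^T) 0 0) ->
  exists r K, metric_ball gm m r K /\ cball m r `<=` O.
Proof.
move=> oO Om sg symO posO.
have [r1 r10 r1O] : exists2 r1 : R, 0 < r1 & cball m r1 `<=` O.
  have : nbhs m O by exact: open_nbhs_nbhs.
  move=> /nbhs_ballP[e /= e0 eO]; exists (e / 2); first by rewrite divr_gt0.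
  move=> x; rewrite /cball/= => xm; apply: eO; rewrite -ball_normE/= distrC.
  by rewrite (le_lt_trans xm)// ltr_pdivrMr// ltr_pMr// ltr1n.
have [d1 s1] := sg 2%N.
have nO x : O x -> nbhs x O by move=> ?; exact: open_nbhs_nbhs.
have dent x : O x -> forall a b, differentiable (fun y => gm y a b) x by move=> Ox a b; apply: differentiable_entry; exact: d1.
have pdE x a b l : O x -> 'D_(delta_mx 0 l) (fun y => gm y a b) x = ('D_(delta_mx 0 l) gm x) a b.
  by move=> Ox; apply: derive_entry; exact/diff_derivable/d1.
have near_pdE x a b l : O x -> \forall y \near x,
    ('D_(delta_mx 0 l) gm y) a b = 'D_(delta_mx 0 l) (fun y => gm y a b) y.
  by move=> Ox; apply: filterS (nO x Ox) => y Oy; rewrite pdE.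
have dpd x a b l : O x -> differentiable (fun y => 'D_(delta_mx 0 l) (fun y => gm y a b) y) x.
  move=> Ox; have [d2 _] := s1 (delta_mx 0 l).
  have := differentiable_entry a b (d2 x Ox).
  by move=> /(near_eq_differentiable (near_pdE x a b l Ox))[].
have cpd x a b l j : O x -> {for x, continuous (fun x =>
    'D_(delta_mx 0 j) (fun y => 'D_(delta_mx 0 l) (fun y => gm y a b) y) x)}.
  move=> Ox; have [d2 s2] := s1 (delta_mx 0 l).
  have cj := s2 (delta_mx 0 j) x Ox.
  have cja : {for x, continuous (fun y => ('D_(delta_mx 0 j) ('D_(delta_mx 0 l) gm) y) a b)}.
    exact: continuous_entry cj.
  have E : \forall y \near x, ('D_(delta_mx 0 j) ('D_(delta_mx 0 l) gm) y) a b =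
     'D_(delta_mx 0 j) (fun y => 'D_(delta_mx 0 l) (fun y => gm y a b) y) y.
    apply: filterS (nO x Ox) => y Oy.
    rewrite -derive_entry; last exact/diff_derivable/d2.
    by apply: near_eq_derive; exact: near_pdE.
  exact: near_eq_continuous E cja.
have cpd1 x a b l : O x -> {for x, continuous (fun x => 'D_(delta_mx 0 l) (fun y => gm y a b) x)}.
  by move=> Ox; apply: differentiable_continuous; exact: dpd.
have [Cg Cg0 Hg] := @ex_lipschitz_family ('I_n * 'I_n)%type (fun i y => gm y i.1 i.2) m r1 r10
  (fun i x xm => dent x (r1O x xm) _ _) (fun i x l xm => cpd1 x _ _ l (r1O x xm)).
have [Cd Cd0 Hd] := @ex_lipschitz_family ('I_n * 'I_n * 'I_n)%type
  (fun i x => 'D_(delta_mx 0 i.2) (fun y => gm y i.1.1 i.1.2) x) m r1 r10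
  (fun i x xm => dpd x _ _ _ (r1O x xm)) (fun i x l xm => cpd x _ _ _ l (r1O x xm)).
pose C := Cg + Cd; have C0 : 0 <= C by rewrite addr_ge0.
have gC : Cg <= C by rewrite lerDl.
have dC : Cd <= C by rewrite lerDr.
have mm s : 0 <= s -> cball m s m by rewrite /cball/= subrr normr0.
have Clip x y a b : cball m r1 x -> cball m r1 y -> `|gm x a b - gm y a b| <= C * `|x - y|.
  by move=> xm ym; have [_ H] := Hg (a, b); apply: (le_trans (H x y xm ym)); rewrite ler_wpM2r.
have [c c0 cP] := posdef_coercive (posO m Om).
pose M := (n%:R * (n%:R * C)).
have M0 : 0 <= M by rewrite !mulr_ge0.
pose r := Num.min r1 (c / (2 * (M + 1))).
have r0 : 0 < r by rewrite lt_min r10 divr_gt0// mulr_gt0// ltr_wpDl.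
have rr1 : cball m r `<=` cball m r1 by move=> x; rewrite /cball/= => /le_trans; apply; rewrite ge_min lexx.
pose c1 := 2 / c.
have c10 : 0 <= c1 by rewrite divr_ge0// ltW.
have coer x : cball m r x -> forall u, `|u| ^+ 2 <= c1 * gform gm x u u.
  move=> xm u; have := cP u.
  have := gform_lip (fun x y xm ym a b => Clip x y a b xm ym) u u (rr1 _ xm) (mm _ (ltW r10)).
  rewrite -/M -[(u *m _ *m _) 0 0]/(gform gm m u u) => h1 h2.
  have h3 : M * `|x - m| * `|u| * `|u| <= c / 2 * `|u| ^+ 2.
    rewrite -mulrA -expr2 ler_wpM2r ?exprn_ge0//.
    move: xm; rewrite /cball/= le_min => /andP[_].
    rewrite ler_pdivlMr ?mulr_gt0 ?ltr_wpDl// => h.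
    have := normr_ge0 (x - m); nra.
  have : c / 2 * `|u| ^+ 2 <= gform gm x u u.
    move: h1; rewrite ler_norml => /andP[h1 _]; lra.
  by rewrite -ler_pdivrMl ?divr_gt0// invf_div.
have symB x : cball m r x -> (gm x)^T = gm x by move=> /rr1/r1O; exact: symO.
have dB x : cball m r x -> forall a b, differentiable (fun y => gm y a b) x by move=> /rr1/r1O; exact: dent.
have b1 x : cball m r x -> forall a b, `|gm x a b| <= C by move=> /rr1 xm a b; have [H _] := Hg (a, b); exact: le_trans (H x xm) gC.
have b2 x y : cball m r x -> cball m r y -> forall a b, `|gm x a b - gm y a b| <= C * `|x - y| by move=> /rr1 xm /rr1 ym a b; exact: Clip.
have b3 x : cball m r x -> forall a b l, `|'D_(delta_mx 0 l) (fun y => gm y a b) x| <= C.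
  by move=> /rr1 xm a b l; have [H _] := Hd (a, b, l); exact: le_trans (H x xm) dC.
have b4 x y : cball m r x -> cball m r y -> forall a b l,
   `|'D_(delta_mx 0 l) (fun y => gm y a b) x - 'D_(delta_mx 0 l) (fun y => gm y a b) y| <= C * `|x - y|.
  move=> /rr1 xm /rr1 ym a b l; have [_ H] := Hd (a, b, l); apply: (le_trans (H x y xm ym)).
  by rewrite ler_wpM2r.
pose K1 := n%:R * (n%:R * C); pose K2 := n%:R * (n%:R * (n%:R * C)).
pose K3 := c1 * n%:R * (n%:R * (n%:R * (3 * C))).
pose K4 := c1 * n%:R * (n%:R * (n%:R * (3 * C)) + n%:R * (c1 * n%:R * (n%:R * (n%:R * (3 * C)))) * C).
have K10 : 0 <= K1 by rewrite !mulr_ge0.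
have K20 : 0 <= K2 by rewrite !mulr_ge0.
have n0 : 0 <= n%:R :> R by exact: ler0n.
have M3 : 0 <= n%:R * (n%:R * (3 * C)) by rewrite !mulr_ge0.
have cn := mulr_ge0 c10 n0.
have K30 : 0 <= K3 := mulr_ge0 cn M3.
have K40 : 0 <= K4 := mulr_ge0 cn (addr_ge0 M3 (mulr_ge0 (mulr_ge0 n0 K30) C0)).
pose K := 1 + c1 + K1 + K2 + K3 + K4.
have aux (a1 a2 a3 a4 a5 : R) (S := 1 + a1 + a2 + a3 + a4 + a5) :
    0 <= a1 -> 0 <= a2 -> 0 <= a3 -> 0 <= a4 -> 0 <= a5 ->
    [/\ 1 <= S, a1 <= S & a2 <= S] /\ [/\ a3 <= S, a4 <= S & a5 <= S].
  by clear; rewrite /S; split; split; lra.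
have [[k0 k1 k2] [k3 k4 k5]] := aux _ _ _ _ _ c10 K10 K20 K30 K40.
rewrite -/K in k0 k1 k2 k3 k4 k5.
clearbody K.
exists r, K; split; last by move=> x /rr1/r1O.
split => //.
- move=> x u v xm; have := gform_bound b1 u v xm.
  move=> /le_trans; apply; rewrite -mulrA -[leRHS]mulrA.
  by apply: ler_wpM2r; first exact: mulr_ge0.
- move=> x u xm; have := coer x xm u; move=> /le_trans; apply; apply: ler_wpM2r => //.
  have : 0 <= c1 * gform gm x u u by apply: le_trans (coer x xm u); rewrite exprn_ge0.
  by rewrite pmulr_rge0// divr_gt0.
- move=> x y u v xm ym; have := gform_lip b2 u v xm ym; move=> /le_trans; apply.
  by rewrite -2!mulrA -[leRHS]mulrA -[leRHS]mulrA; apply: ler_wpM2r => //; rewrite !mulr_ge0.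
- move=> x k u xm xkm; have := gform_taylor C0 dB b4 u xm xkm; move=> /le_trans; apply.
  rewrite -mulrA -[leRHS]mulrA; apply: ler_wpM2r; last exact: k3.
  by rewrite mulr_ge0 ?exprn_ge0.
- move=> x u xm; have := gaccel_bound C0 c10 symB b3 coer u xm; move=> /le_trans; apply.
  by apply: ler_wpM2r; [rewrite exprn_ge0|exact: k4].
- move=> x y u v xm ym; have := gaccel_lip C0 c10 symB b2 b3 b4 coer u v xm ym.
  move=> /le_trans; apply; apply: ler_wpM2r; last exact: k5.
  by rewrite addr_ge0 ?mulr_ge0 ?exprn_ge0 ?addr_ge0.
- move=> x u v xm; apply: gform_gaccel; [exact: symB| |exact: dB].
  exact: (metric_unitmx c10 coer xm).
Qed.

End metric_ball.

Lemma is_derive_affine {R : realType} n (f : R -> 'rV[R]_n) (c d t : R) (v : 'rV[R]_n) :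
  is_derive (c * t + d) (1 : R) f v ->
  is_derive t (1 : R) (fun s => f (c * s + d)) (c *: v).
Proof.
move=> fv; apply/is_derive_rV => i.
have fi := (is_derive_rV _ _ _).1 fv i.
have dl : is_derive t (1 : R) (fun s : R => c * s + d) c.
  have := is_deriveD (is_deriveZ c (is_derive_id t (1 : R))) (is_derive_cst (d : R) t (1 : R)).
  by rewrite addr0 [_ *: 1]mulr1.
have := @is_derive1_comp R (fun s => f s 0 i) (fun s : R => c * s + d) t (v 0 i) c fi dl.
by rewrite mxE mulrC.
Qed.

Section energy_comparison.
Context {R : realType} {n : nat}.
Variables (gm : 'rV[R]_n -> 'M[R]_n) (m : 'rV[R]_n) (r K : R).
Hypothesis mb : metric_ball gm m r K.

Let K1 : 1 <= K. Proof. by case: mb. Qed.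
Let K0 : 0 < K. Proof. exact: lt_le_trans K1. Qed.
Let r0 : 0 < r. Proof. by case: mb. Qed.
Let mm : cball m r m. Proof. by rewrite /cball/= subrr normr0 ltW. Qed.

Local Notation G := (gform gm).
Local Notation dG := (gdform gm).
Local Notation F := (gaccel gm).

Lemma comparison_quadratic (W k p : R) : 0 <= W -> 8 * K ^+ 4 * W <= 1 -> 0 <= k -> 0 <= p ->
  p ^+ 2 / (8 * K) <= p ^+ 2 / K + K ^- 4 * (k ^+ 2 / K) - K * k ^+ 2 * W ^+ 2
     - 2 * (K * k * W * p) - K ^- 4 * (K * k * p).
Proof.
move=> W0 KW k0 p0; pose q := k / K ^+ 2.
have q0 : 0 <= q by rewrite divr_ge0// exprn_ge0// ltW.
have kq : k = K ^+ 2 * q by rewrite /q; field; rewrite gt_eqF.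
pose w := K ^+ 4 * W.
have w0 : 0 <= w by rewrite mulr_ge0// exprn_ge0// ltW.
have w8 : 8 * w <= 1 by move: KW; rewrite /w mulrA.
have Ww : W = w / K ^+ 4 by rewrite /w; field; rewrite gt_eqF.
have -> : p ^+ 2 / K + K ^- 4 * (k ^+ 2 / K) - K * k ^+ 2 * W ^+ 2
     - 2 * (K * k * W * p) - K ^- 4 * (K * k * p) =
   (p ^+ 2 + q ^+ 2 - w ^+ 2 * q ^+ 2 / K ^+ 2 - 2 * (w * q * p) - q * p) / K.
  by rewrite kq Ww; field; rewrite gt_eqF.
have -> : p ^+ 2 / (8 * K) = (p ^+ 2 / 8) / K by field; rewrite gt_eqF.
rewrite ler_wpM2r ?invr_ge0 ?(ltW K0)//.
have h1 : w ^+ 2 * q ^+ 2 / K ^+ 2 <= q ^+ 2 / 64.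
  rewrite ler_pdivrMr ?exprn_gt0//.
  apply: (@le_trans _ _ (q ^+ 2 / 64 * 1)); last first.
    by rewrite ler_wpM2l ?divr_ge0 ?exprn_ge0// exprn_ege1.
  rewrite mulr1 mulrC ler_wpM2l ?exprn_ge0//; nra.
have h2 : w * q * p <= q * p / 8 by have := mulr_ge0 q0 p0; nra.
nra.
Qed.

Definition potential (ex ey : R) (x u y : R -> 'rV[R]_n) (t : R) : R :=
  ey * t - ex * t - 2 * G (x t) (u t) (y t - x t)
  + K ^- 4 * ((t - 2^-1) * G m (y t - x t) (y t - x t)).

Lemma gdform0 x u v : dG x 0 u v = 0.
Proof.
rewrite /gdform big1// => a _; rewrite big1// => b _.
by rewrite derive0 mulr0.
Qed.

Lemma is_derive_potential (ex ey W : R) (x u y v : R -> 'rV[R]_n) (t : R) :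
  0 <= t <= 1 -> 0 <= W -> 8 * K ^+ 4 * W <= 1 ->
  cball m r (x t) -> cball m r (y t) ->
  is_derive t (1 : R) x (u t) -> is_derive t (1 : R) u (F (x t) (u t)) ->
  is_derive t (1 : R) y (v t) ->
  `|u t| <= W ->
  G (x t) (u t) (u t) = ex -> G (y t) (v t) (v t) = ey ->
  exists2 d : R, is_derive t (1 : R) (potential ex ey x u y) d &
    `|v t - u t| ^+ 2 / (8 * K) <= d.
Proof.
move=> /andP[t0 t1] W0 KW xm ym dx du dy uW exE eyE.
set k' := v t - u t; set k := y t - x t.
have dk : is_derive t (1 : R) (fun s => y s - x s) k' by exact: is_deriveB.
have dgx := mb_diff mb xm.
have d1 := is_derive_gform dgx dx du dk.
have d2 := is_derive_gform (x := cst m) (x' := 0) (mb_diff mb mm) (is_derive_cst m t 1) dk dk.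
rewrite /= gdform0 add0r in d2.
pose d : R := ey - ex - 2 * (dG (x t) (u t) (u t) k + G (x t) (F (x t) (u t)) k + G (x t) (u t) k')
  + K ^- 4 * (G m k k + (t - 2^-1) * (G m k' k + G m k k')).
exists d.
  have e1 : is_derive t (1 : R) (fun s : R => ey * s - ex * s) (ey - ex) by apply: is_derive_eq; rewrite /GRing.scale/= !mulr1.
  have e3 : is_derive t (1 : R) (fun s : R => (s - 2^-1) * G m (y s - x s) (y s - x s))
     (G m k k + (t - 2^-1) * (G m k' k + G m k k')).
    have e4 : is_derive t (1 : R) (fun s : R => s - 2^-1) 1.
      have := is_deriveB (is_derive_id t (1 : R)) (is_derive_cst (2^-1 : R) t (1 : R)).
      by rewrite subr0.
    apply: (@is_derive_eq _ _ _ _ _ _ _ ((t - 2^-1) *: (G m k' k + G m k k') + G m k k *: 1)).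
      exact: (is_deriveM e4 d2).
    by rewrite /GRing.scale/= mulr1 addrC.
  rewrite /potential /d.
  have e5 : is_derive t (1 : R) (fun s => 2 * G (x s) (u s) (y s - x s))
     (2 * (dG (x t) (u t) (u t) k + G (x t) (F (x t) (u t)) k + G (x t) (u t) k')).
    exact: (is_deriveZ 2 d1).
  have e6 : is_derive t (1 : R) (fun s => K ^- 4 * ((s - 2^-1) * G m (y s - x s) (y s - x s)))
     (K ^- 4 * (G m k k + (t - 2^-1) * (G m k' k + G m k k'))).
    exact: (is_deriveZ (K ^- 4) e3).
  exact: (is_deriveD (is_deriveB e1 e5) e6).
have -> : d = (G (y t) (u t) (u t) - G (x t) (u t) (u t) - dG (x t) k (u t) (u t))
   + 2 * (G (y t) (u t) k' - G (x t) (u t) k') + G (y t) k' k'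
   + K ^- 4 * G m k k + K ^- 4 * ((t - 2^-1) * (2 * G m k k')).
  have Ev : v t = u t + k' by rewrite /k' addrC subrK.
  have Gv : G (y t) (v t) (v t) = G (y t) (u t) (u t) + 2 * G (y t) (u t) k' + G (y t) k' k'.
    clearbody k'; rewrite Ev !gformDr !gformDl (gformC k' (u t) (mb_sym mb ym)); ring.
  rewrite /d -eyE -exE (mb_E mb _ _ xm) Gv (gformC k' k (mb_sym mb mm)).
  by field; rewrite gt_eqF.
have T := mb_taylor mb (k := k) (u t) xm.
have yE : x t + k = y t by rewrite /k addrC subrK.
rewrite yE in T; have {}T := T ym.
have L := mb_lip mb (u t) k' ym xm.
have C1 := mb_coer mb k' ym; have C2 := mb_coer mb k mm.
have B := mb_bound mb k k' mm.
have kE : y t - x t = k by [].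
rewrite kE in L.
apply: (le_trans (comparison_quadratic W0 KW (normr_ge0 k) (normr_ge0 k'))).
have c1 : `|k'| ^+ 2 / K <= G (y t) k' k' by rewrite ler_pdivrMr// mulrC.
have c2 : K ^- 4 * (`|k| ^+ 2 / K) <= K ^- 4 * G m k k by rewrite ler_wpM2l ?invr_ge0 ?exprn_ge0 ?(ltW K0)// ler_pdivrMr// mulrC.
have c3 : - (K * `|k| ^+ 2 * W ^+ 2) <= G (y t) (u t) (u t) - G (x t) (u t) (u t) - dG (x t) k (u t) (u t).
  rewrite lerNl (le_trans (ler_norm _))// normrN (le_trans T)//.
  by rewrite ler_wpM2l ?mulr_ge0 ?exprn_ge0 ?(ltW K0)// lerXn2r ?nnegrE.
have c4 : - (2 * (K * `|k| * W * `|k'|)) <= 2 * (G (y t) (u t) k' - G (x t) (u t) k').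
  rewrite lerNl -mulrN ler_wpM2l// (le_trans (ler_norm _))// normrN (le_trans L)//.
  by rewrite ler_wpM2r// ler_wpM2l// mulr_ge0// ltW.
have c5 : - (K ^- 4 * (K * `|k| * `|k'|)) <= K ^- 4 * ((t - 2^-1) * (2 * G m k k')).
  rewrite -mulrN ler_wpM2l ?invr_ge0 ?exprn_ge0 ?(ltW K0)// lerNl (le_trans (ler_norm _))// normrN.
  rewrite mulrA normrM (le_trans _ B)// ler_piMl//.
  by clear -mb t0 t1; rewrite ler_norml; split_lra.
move: c1 c2 c3 c4 c5; clear.
move: (G (y t) k' k') (K ^- 4 * G m k k) (G (y t) (u t) (u t) - _ - _) (2 * (G (y t) _ _ - _)) (K ^- 4 * ((t - 2^-1) * _)).
move=> a1 a2 a3 a4 a5.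
move: (_ / K) (K ^- 4 * (_ / K)) (K * _ * W ^+ 2) (2 * (K * _ * W * _)) (K ^- 4 * (K * _ * _)).
move=> b1 b2 b3 b4 b5; lra.
Qed.

Lemma is_derive_energy (x u : R -> 'rV[R]_n) (t : R) : cball m r (x t) ->
  is_derive t (1 : R) x (u t) -> is_derive t (1 : R) u (F (x t) (u t)) ->
  is_derive t (1 : R) (fun s => G (x s) (u s) (u s)) 0.
Proof.
move=> xm dx du; have d1 := is_derive_gform (mb_diff mb xm) dx du du.
apply: is_derive_eq.
rewrite (gformC (u t) _ (mb_sym mb xm)) (mb_E mb _ _ xm); lra.
Qed.

Definition geodesic01 (x u : R -> 'rV[R]_n) := forall t : R, t \in `[0, 1] ->
  [/\ cball m r (x t), is_derive t (1 : R) x (u t) &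
      is_derive t (1 : R) u (F (x t) (u t))].

Definition energy (x u : R -> 'rV[R]_n) : R := G (x 0) (u 0) (u 0).

Definition small_energy : R := (8 * K ^+ 4) ^- 2 / K.

Lemma small_energy_gt0 : 0 < small_energy.
Proof. by rewrite divr_gt0// invr_gt0 exprn_gt0// mulr_gt0// exprn_gt0. Qed.

Lemma energy_const x u : geodesic01 x u -> forall t : R, t \in `[0, 1] ->
  G (x t) (u t) (u t) = energy x u.
Proof.
move=> xu t t01; have /andP[t0 t1] : 0 <= t <= 1 by move: t01; rewrite in_itv.
have [->//|tn0] := eqVneq t 0.
have dt (s : R) : s \in `[0, t] -> is_derive s (1 : R) (fun s => G (x s) (u s) (u s)) 0.
  rewrite in_itv/= => /andP[s0 st].
  have [] := xu s; first by rewrite in_itv/= s0 (le_trans st).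
  exact: is_derive_energy.
have tp : 0 < t by rewrite lt_neqAle eq_sym tn0.
have [s _] := MVT_is_derive (df := fun=> 0) tp dt.
by rewrite mul0r => /eqP; rewrite subr_eq0 => /eqP.
Qed.

Lemma geodesic01_speed x u : geodesic01 x u -> forall t : R, t \in `[0, 1] ->
  `|u t| ^+ 2 <= K * energy x u.
Proof.
move=> xu t t01; rewrite -(energy_const xu t01).
by have [xm _ _] := xu t t01; exact: (mb_coer mb _ xm).
Qed.

Lemma energy_ge0 x u : geodesic01 x u -> 0 <= energy x u.
Proof.
move=> xu; have t01 : (0 : R) \in `[0, 1] by rewrite in_itv/= lexx ler01.
have := geodesic01_speed xu t01.
by move=> /(le_trans (exprn_ge0 2 (normr_ge0 _))); rewrite pmulr_rge0.
Qed.

Lemma small_speed x u : geodesic01 x u -> energy x u <= small_energy ->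
  exists W : R, [/\ 0 <= W, 8 * K ^+ 4 * W <= 1 & forall t : R, t \in `[0, 1] -> `|u t| <= W].
Proof.
move=> xu e0; have K40 : 0 < 8 * K ^+ 4 by rewrite mulr_gt0// exprn_gt0.
exists (8 * K ^+ 4)^-1; split; first by rewrite invr_ge0 ltW.
  by rewrite mulfV// gt_eqF.
move=> t t01; rewrite -(@ler_pXn2r _ 2)// ?nnegrE ?invr_ge0 ?(ltW K40)//.
apply: (le_trans (geodesic01_speed xu t01)).
rewrite exprVn mulrC -ler_pdivlMr//.
Qed.

(* [y] is run through at constant speed during [a, b]. *)
Definition reparam (a b : R) (y : R -> 'rV[R]_n) (t : R) := y ((t - a) / (b - a)).

Lemma potential_mono (a b : R) x u y v : 0 <= a -> a < b -> b <= 1 ->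
  geodesic01 x u -> energy x u <= small_energy -> geodesic01 y v ->
  let Psi := potential (energy x u) (energy y v / (b - a) ^+ 2) x u (reparam a b y) in
  Psi a <= Psi b /\ (Psi a = Psi b -> forall t : R, t \in `[a, b] ->
    reparam a b y t - x t = reparam a b y a - x a).
Proof.
move=> a0 ab b1 xu xs yv Psi.
have ba0 : 0 < b - a by rewrite subr_gt0.
have [W [W0 KW uW]] := small_speed xu xs.
have t01 (t : R) : t \in `[a, b] -> t \in `[0, 1] by rewrite !in_itv/= => /andP[? ?]; split_lra.
have s01 (t : R) : t \in `[a, b] -> (t - a) / (b - a) \in `[0, 1].
  rewrite !in_itv/= => /andP[at_ tb]; apply/andP; split.
    by rewrite divr_ge0// ?subr_ge0// ltW.
  by rewrite ler_pdivrMr// mul1r lerD2r.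
have dz (t : R) : t \in `[a, b] ->
    is_derive t (1 : R) (reparam a b y) ((b - a)^-1 *: v ((t - a) / (b - a))).
  move=> tab; have [_ dy _] := yv _ (s01 t tab).
  have E s : (s - a) / (b - a) = (b - a)^-1 * s + (- a / (b - a)) by rewrite mulrDl mulrC mulNr.
  have -> : reparam a b y = (fun s => y ((b - a)^-1 * s + (- a / (b - a)))).
    by apply/funext => s; rewrite /reparam E.
  by apply: is_derive_affine; rewrite -E.
have dP (t : R) : t \in `[a, b] -> exists2 d : R, is_derive t (1 : R) Psi d &
    `|(b - a)^-1 *: v ((t - a) / (b - a)) - u t| ^+ 2 / (8 * K) <= d.
  move=> tab; have [xm dx du] := xu _ (t01 t tab).
  have [ym _ _] := yv _ (s01 t tab).
  have h1 : 0 <= t <= 1 by have := t01 t tab; rewrite in_itv.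
  have h2 := energy_const yv (s01 t tab).
  have h3 : G (reparam a b y t) ((b - a)^-1 *: v ((t - a) / (b - a)))
     ((b - a)^-1 *: v ((t - a) / (b - a))) = energy y v / (b - a) ^+ 2.
    by rewrite gformZl gformZr h2 mulrA -invfM -expr2 mulrC.
  exact: (@is_derive_potential _ _ W x u (reparam a b y)
    (fun t => (b - a)^-1 *: v ((t - a) / (b - a))) t h1 W0 KW xm ym dx du
    (dz t tab) (uW t (t01 t tab)) (energy_const xu (t01 t tab)) h3).
have K80 : 0 < 8 * K by rewrite mulr_gt0.
have mono (s t : R) : a <= s -> s <= t -> t <= b -> Psi s <= Psi t.
  move=> as_ st tb; have [->//|nst] := eqVneq s t.
  have {}st : s < t by rewrite lt_neqAle nst.
  have /choice[d dE] (z : R) : exists d : R, z \in `[s, t] ->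
      is_derive z (1 : R) Psi d /\ 0 <= d.
    have [zst|] := boolP (z \in `[s, t]); last by exists 0.
    have [|d ? dge] := dP z.
      by clear -as_ tb zst; move: zst; rewrite !in_itv/= => /andP[? ?]; split_lra.
    exists d => _; split => //; apply: le_trans dge.
    by rewrite divr_ge0 ?exprn_ge0// ltW.
  have dPsi (z : R) : z \in `[s, t] -> is_derive z (1 : R) Psi (d z) by move=> /dE[].
  have [z zst E] := MVT_is_derive st dPsi.
  rewrite -subr_ge0 E mulr_ge0 ?subr_ge0 ?(ltW st)//.
  by have [|] := dE z => //; move: zst; rewrite !in_itv/= => /andP[? ?]; rewrite !ltW.
split; first by apply: mono => //; exact: ltW.
move=> Pab.
have Pc (t : R) : t \in `[a, b] -> Psi t = Psi a.
  rewrite in_itv/= => /andP[at_ tb]; apply/eqP; rewrite eq_le; apply/andP; split.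
    by rewrite Pab; exact: mono.
  exact: mono.
pose k (t : R) := reparam a b y t - x t.
have dk (t : R) : t \in `]a, b[ -> is_derive t (1 : R) k 0.
  move=> tab; have tab' : t \in `[a, b] by move: tab; rewrite !in_itv/= => /andP[? ?]; rewrite !ltW.
  have [d dPt dge] := dP t tab'.
  have d0 : d = 0.
    have c0 : is_derive t (1 : R) Psi 0.
      apply: (@is_derive_near _ _ (cst (Psi a))).
      have : nbhs t `]a, b[%classic.
        by apply: open_nbhs_nbhs; split => //; exact: itv_open.
      apply: filterS => s; rewrite /= => sab; rewrite Pc//.
      by move: sab; rewrite !in_itv/= => /andP[? ?]; rewrite !ltW.
    by rewrite -(@derive_val _ _ _ _ _ _ _ dPt) (@derive_val _ _ _ _ _ _ _ c0).
  have [_ dx _] := xu _ (t01 t tab').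
  have := is_deriveB (dz t tab') dx.
  suff -> : (b - a)^-1 *: v ((t - a) / (b - a)) - u t = 0 by [].
  move: dge; rewrite d0 ler_pdivrMr// mul0r => h.
  apply/eqP; rewrite -normr_eq0 -sqrf_eq0 eq_le h exprn_ge0//.
move=> t tab; have /andP[at_ tb] : a <= t <= b by move: tab; rewrite in_itv.
have ck : {within `[a, t], continuous k}.
  apply: continuous_in_subspaceT => s /set_mem /=; rewrite in_itv/= => /andP[as_ st].
  have sab : s \in `[a, b] by rewrite in_itv/= as_ (le_trans st).
  have [_ dx _] := xu _ (t01 s sab).
  exact: (is_derive_continuous (is_deriveB (dz s sab) dx)).
have dk' (s : R) : s \in `]a, t[ -> is_derive s (1 : R) k 0.
  by clear -dk tb; rewrite in_itv/= => /andP[? ?]; apply: dk; rewrite in_itv/=; split_lra.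
have nb (s : R) : s \in `]a, t[ -> `|0 : 'rV[R]_n| <= 0 by rewrite normr0.
have := mean_value_norm at_ (lexx 0) dk' nb ck.
by rewrite mul0r normr_le0 subr_eq0 => /eqP.
Qed.

Lemma gform0r (x v : 'rV[R]_n) : G x v 0 = 0.
Proof. by rewrite /gform trmx0 mulmx0 mxE. Qed.

Lemma reparam_l a b (y : R -> 'rV[R]_n) : reparam a b y a = y 0.
Proof. by rewrite /reparam subrr mul0r. Qed.

Lemma reparam_r a b (y : R -> 'rV[R]_n) : a < b -> reparam a b y b = y 1.
Proof. by move=> ab; rewrite /reparam divff// subr_eq0 gt_eqF. Qed.

Lemma reparam01 (y : R -> 'rV[R]_n) t : reparam 0 1 y t = y t.
Proof. by rewrite /reparam !subr0 divr1. Qed.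

Lemma geodesic_triangle (x u y1 v1 y2 v2 : R -> 'rV[R]_n) (l : R) : 0 < l < 1 ->
  geodesic01 x u -> energy x u <= small_energy ->
  geodesic01 y1 v1 -> geodesic01 y2 v2 ->
  x 0 = y1 0 -> y1 1 = y2 0 -> y2 1 = x 1 ->
  energy x u <= energy y1 v1 / l + energy y2 v2 / (1 - l) /\
  (energy x u = energy y1 v1 / l + energy y2 v2 / (1 - l) ->
    (forall t : R, t \in `[0, l] -> reparam 0 l y1 t = x t) /\
    (forall t : R, t \in `[l, 1] -> reparam l 1 y2 t = x t)).
Proof.
move=> /andP[l0 l1] xu xs yv1 yv2 x0 y12 y21.
have [m1 e1] := potential_mono (lexx 0) l0 (ltW l1) xu xs yv1.
have [m2 e2] := potential_mono (ltW l0) l1 (lexx 1) xu xs yv2.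
move: m1 e1 m2 e2; rewrite /potential !reparam_l (reparam_r _ l0) (reparam_r _ l1).
rewrite y12 y21 -x0 !subrr !gform0r !mulr0 !subr0 !addr0 !mulr1.
set A := 2 * _; set B := K ^- 4 * _.
have E1 : energy y1 v1 / l ^+ 2 * l = energy y1 v1 / l by field; rewrite gt_eqF.
have E2 : energy y2 v2 / (1 - l) = energy y2 v2 / (1 - l) ^+ 2 * (1 - l) by field; rewrite gt_eqF// subr_gt0.
rewrite E1 E2; move: (_ / l) (_ / (1 - l) ^+ 2) (energy x u) => X Y e.
move=> m1 e1 m2 e2; split; first by lra.
move=> eE; have h1 : 0 = X - e * l - A + B by lra.
have h2 : Y * l - e * l - A + B = Y - e by lra.
have {}e1 := e1 h1; have {}e2 := e2 h2; split=> t tl.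
  by have := e1 t tl => /eqP; rewrite subr_eq0 => /eqP.
have l0l : l \in `[0, l] by rewrite in_itv/= ltW// lexx.
have := e1 l l0l => /eqP; rewrite subr_eq0 (reparam_r _ l0) y12 => /eqP xl.
by have := e2 t tl; rewrite xl subrr => /eqP; rewrite subr_eq0 => /eqP.
Qed.

Lemma geodesic_unique (x u y v : R -> 'rV[R]_n) :
  geodesic01 x u -> energy x u <= small_energy ->
  geodesic01 y v -> energy y v <= small_energy -> x 0 = y 0 -> x 1 = y 1 ->
  energy x u = energy y v /\ forall t : R, t \in `[0, 1] -> x t = y t.
Proof.
move=> xu xs yv ys xy0 xy1.
have [m1 e1] := potential_mono (lexx 0) ltr01 (lexx 1) xu xs yv.
have [m2 _] := potential_mono (lexx 0) ltr01 (lexx 1) yv ys xu.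
move: m1 e1 m2; rewrite /potential !reparam01 xy0 xy1 !subrr !gform0r !subr0 !expr1n !divr1 !mulr1.
rewrite !mulr0 !subr0 !addr0 => m1 e1 m2.
have E : energy x u = energy y v by lra.
split => // t t01; have := e1 _ t t01; rewrite reparam01 E subrr => /(_ erefl)/eqP.
by rewrite subr_eq0 => /eqP.
Qed.

Lemma geodesic_first_variation (x u y v : R -> 'rV[R]_n) :
  geodesic01 x u -> energy x u <= small_energy -> geodesic01 y v -> x 1 = y 1 ->
  energy x u <= energy y v + 2 * G (x 0) (u 0) (y 0 - x 0) + K * `|y 0 - x 0| ^+ 2.
Proof.
move=> xu xs yv xy1.
have [m1 _] := potential_mono (lexx 0) ltr01 (lexx 1) xu xs yv.
move: m1; rewrite /potential !reparam01 xy1 !subrr !gform0r !subr0 !expr1n !divr1 !mulr1.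
rewrite !mulr0 !subr0 !addr0 add0r sub0r => m1.
have B := mb_bound mb (y 0 - x 0) (y 0 - x 0) mm.
have k40 : 0 <= K ^- 4 by rewrite invr_ge0 exprn_ge0// ltW.
have k41 : K ^- 4 <= 1 by rewrite invf_le1 ?exprn_gt0// exprn_ege1.
have g0 : 0 <= G m (y 0 - x 0) (y 0 - x 0).
  have := mb_coer mb (y 0 - x 0) mm => /(le_trans (exprn_ge0 2 (normr_ge0 _))).
  by rewrite pmulr_rge0.
have : K ^- 4 * (2^-1 * G m (y 0 - x 0) (y 0 - x 0)) <= K * `|y 0 - x 0| ^+ 2.
  apply: (@le_trans _ _ (1 * G m (y 0 - x 0) (y 0 - x 0))).
    by rewrite ler_pM// ?mulr_ge0//; lra.
  by rewrite mul1r (le_trans (ler_norm _))// expr2 mulrA.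
move: m1; move: (K ^- 4) (G m _ _) (G (x 0) _ _) => a b d; lra.
Qed.

Lemma geodesic_dist_le x u : geodesic01 x u -> `|x 1 - x 0| ^+ 2 <= K * energy x u.
Proof.
move=> xu; have KE : 0 <= K * energy x u by rewrite mulr_ge0 ?(ltW K0)// (energy_ge0 xu).
pose s := Num.sqrt (K * energy x u); have s2 : s ^+ 2 = K * energy x u by rewrite sqr_sqrtr.
have s0 : 0 <= s by exact: sqrtr_ge0.
have dx (t : R) : t \in `]0, 1[ -> is_derive t (1 : R) x (u t).
  rewrite in_itv/= => /andP[t0 t1]; have [] := xu t => //.
  by rewrite in_itv/= !ltW.
have bu (t : R) : t \in `]0, 1[ -> `|u t| <= s.
  rewrite in_itv/= => /andP[t0 t1]; rewrite -(@ler_pXn2r _ 2)// ?nnegrE// s2.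
  by apply: geodesic01_speed => //; rewrite in_itv/= !ltW.
have cx : {within `[0, 1], continuous x}.
  apply: continuous_in_subspaceT => t /set_mem /= t01; have [_ d _] := xu t t01.
  exact: is_derive_continuous d.
have := mean_value_norm ler01 s0 dx bu cx; rewrite subr0 mulr1 => h.
by rewrite -s2 lerXn2r ?nnegrE.
Qed.

Definition geodesic_radius : R :=
  Num.min (r / 4) (Num.min (bvp_radius r K / 2) ((8 * K ^+ 4)^-1 / (4 * K))).

Lemma geodesic_radius_gt0 : 0 < geodesic_radius.
Proof.
rewrite !lt_min !divr_gt0 ?bvp_radius_gt0 ?invr_gt0 ?mulr_gt0 ?exprn_gt0//.
Qed.

Definition geodesic_segment (p q : 'rV[R]_n) (x u : R -> 'rV[R]_n) :=
  [/\ geodesic_bvp F p q x u, forall t, cball m r (x t), geodesic01 x u &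
      energy x u <= small_energy].

Lemma geodesic_radiusP p q : cball m geodesic_radius p -> cball m geodesic_radius q ->
  [/\ cball m (r / 2) p, `|q - p| <= bvp_radius r K & `|q - p| <= (8 * K ^+ 4)^-1 / (2 * K)].
Proof.
move=> pm qm.
rewrite /cball/= !le_min in pm.
have /and3P[p1 p2 p3] := pm; rewrite /cball/= !le_min in qm.
have /and3P[q1 q2 q3] := qm; rewrite /cball/=.
have pq : `|q - p| <= `|q - m| + `|p - m|.
  have -> : q - p = (q - m) - (p - m) by rewrite opprB addrA subrK.
  exact: ler_normB.
split; first by move: p1 r0; lra.
  by lra.
have -> : (8 * K ^+ 4)^-1 / (2 * K) = (8 * K ^+ 4)^-1 / (4 * K) + (8 * K ^+ 4)^-1 / (4 * K).
  by field; rewrite gt_eqF.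
by lra.
Qed.

Lemma ex_geodesic_segment p q : cball m geodesic_radius p -> cball m geodesic_radius q ->
  exists x u, geodesic_segment p q x u.
Proof.
move=> pm qm; have [p2 pq1 pq2] := geodesic_radiusP pm qm.
have [x [u [xu xm]]] := ex_geodesic_bvp r0 K0 (mb_Fb mb) (mb_Fl mb) p2 pq1.
exists x, u; have [[x0 x1] [_ _ dx] [_ _ du] ub] := xu.
have xu1 : geodesic01 x u.
  move=> t; rewrite in_itv/= => /andP[t0 t1]; have tI : t \in `](-1), 2[ by rewrite in_itv/=; split_lra.
  by split; [exact: xm|exact: dx|exact: du].
split => //.
have B := mb_bound mb (u 0) (u 0) (xm 0).
apply: (le_trans (ler_norm _)); apply: (le_trans B).
have := ub 0; set w := `|q - p| in pq2 * => h.
have h2 : `|u 0| <= (8 * K ^+ 4)^-1 / K.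
  apply: (le_trans h); have -> : (8 * K ^+ 4)^-1 / K = 2 * ((8 * K ^+ 4)^-1 / (2 * K)).
    by field; rewrite gt_eqF.
  by rewrite ler_pM2l.
have -> : small_energy = K * ((8 * K ^+ 4)^-1 / K) * ((8 * K ^+ 4)^-1 / K).
  by rewrite /small_energy; field; rewrite gt_eqF.
rewrite ler_pM ?mulr_ge0 ?(ltW K0)// ler_wpM2l ?(ltW K0)//.
Qed.

Lemma geodesic_first_order p q x u : cball m geodesic_radius p -> cball m geodesic_radius q ->
  geodesic_segment p q x u ->
  `|u 0 - (q - p)| <= 8 * K * `|q - p| ^+ 2.
Proof.
move=> pm qm [[[x0 x1] ux Fu ub] xm _ _].
set w := `|q - p|.
have bF t : `|F (x t) (u t)| <= K * (4 * w ^+ 2).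
  apply: (le_trans (mb_Fb mb _ (xm t))); rewrite ler_wpM2l ?(ltW K0)//.
  have -> : 4 * w ^+ 2 = (2 * w) ^+ 2 by ring.
  by rewrite !expr2 ler_pM.
have bu := primitive_bound Fu bF.
have [cx _ dx] := ux.
have dl (t : R) : t \in `]0, 1[ -> is_derive t (1 : R) (fun t => x t - t *: u 0) (u t - u 0).
  rewrite in_itv/= => /andP[t0 t1].
  have tI : t \in `](-1), 2[ by rewrite in_itv/=; split_lra.
  have d1 := dx t tI.
  have d2 : is_derive t (1 : R) (fun s : R => s *: u 0) (u 0).
    apply/is_derive_rV => i.
    rewrite (_ : (fun _ => _) = (fun s : R => s * u 0 0 i)); last first.
      by apply/funext => s; rewrite mxE.
    by apply: is_derive_eq; rewrite scaler0 add0r; exact: mulr1.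
  exact: is_deriveB.
have cl : {within `[0, 1], continuous (fun t => x t - t *: u 0)}.
  by apply: continuous_subspaceT => t; apply: cvgB; [exact: cx|exact: scalel_continuous].
have C0 := le_trans (normr_ge0 _) (bu 0).
have := mean_value_norm ler01 C0 dl (fun t _ => bu t) cl.
rewrite x0 x1 scale1r scale0r !subr0 mulr1.
have -> : q - u 0 - p = - (u 0 - (q - p)) by apply/rowP => i; rewrite !mxE; ring.
by rewrite normrN => /le_trans; apply; rewrite -/w; lra.
Qed.

Lemma geodesic_segment_lip p q x u p' q' x' u' :
  cball m geodesic_radius p -> cball m geodesic_radius q ->
  cball m geodesic_radius p' -> cball m geodesic_radius q' ->
  geodesic_segment p q x u -> geodesic_segment p' q' x' u' ->
  forall t, `|u t - u' t| <= 4 * (`|p - p'| + `|q - q'|).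
Proof.
move=> pm qm pm' qm' [xu _ _ _] [xu' _ _ _] t.
have [p2 pq1 _] := geodesic_radiusP pm qm.
have [p2' pq1' _] := geodesic_radiusP pm' qm'.
have := geodesic_bvp_lip r0 K0 (mb_Fl mb) p2 pq1 p2' pq1' xu xu' t.
have -> : q - p - (q' - p') = (q - q') - (p - p') by apply/rowP => i; rewrite !mxE; ring.
move=> /le_trans; apply.
have := ler_normB (q - q') (p - p'); have := normr_ge0 (q - q'); lra.
Qed.

End energy_comparison.

Section charts.
Context {R : realType} {n : nat} {M : riemannianManifold R n}.
Implicit Types (g h : R -> M) (p q : M) (i j : chart_index M).

Definition chart_image i : set 'rV[R]_n := @chart R n M i @` chart_dom i.

Lemma chart_image_open i : open (chart_image i).
Proof. exact: chart_im_open. Qed.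

Lemma chart_image_mem i p : chart_dom i p -> chart_image i (chart i p).
Proof. by exists p. Qed.

Lemma metric_differentiable i p : chart_dom i p ->
  differentiable (@metric R n M i) (chart i p).
Proof. by move=> ip; have [d _] := @metric_smooth R n M i 1%N; apply: d; exists p. Qed.

Lemma ex_chart_metric_ball i p : chart_dom i p ->
  exists r K, metric_ball (@metric R n M i) (chart i p) r K /\
    cball (chart i p) r `<=` chart_image i.
Proof.
move=> ip.
have s0 x : chart_image i x -> (metric i x)^T = metric i x by move=> [y iy <-]; exact: Defs.metric_sym.
have p0 x : chart_image i x -> forall u : 'rV[R]_n, u != 0 -> 0 < (u *m metric i x *m u^T) 0 0 by move=> [y iy <-]; exact: metric_posdef.
exact: (@ex_metric_ball R n (metric i) _ _ (@chart_image_open i) (chart_image_mem ip)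
  (@metric_smooth R n M i) s0 p0).
Qed.

Lemma near_chart_dom g t i : {for t, continuous g} -> chart_dom i (g t) ->
  \forall s \near t, chart_dom i (g s).
Proof.
by move=> cg it; apply: cg; apply: open_nbhs_nbhs; split => //; exact: chart_dom_open.
Qed.

Lemma is_derive_diff (f : 'rV[R]_n -> 'rV[R]_n) (c : R -> 'rV[R]_n) (t : R) (w : 'rV[R]_n) :
  differentiable f (c t) -> is_derive t (1 : R) c w ->
  is_derive t (1 : R) (f \o c) ('d f (c t) w).
Proof.
move=> df dc; have dct : differentiable c t by apply/derivable1_diffP.
have dfc : differentiable (f \o c) t by exact: differentiable_comp.
have d1 : derivable (f \o c) t 1 by exact/derivable1_diffP.
apply: (DeriveDef d1); rewrite deriveE// diff_comp//=.
by rewrite -(deriveE (1 : R) dct) (@derive_val _ _ _ _ _ _ _ dc).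
Qed.

Lemma is_derive_transition g t i j w : {for t, continuous g} ->
  chart_dom i (g t) -> chart_dom j (g t) ->
  is_derive t (1 : R) (chart i \o g) w ->
  is_derive t (1 : R) (chart j \o g) ('d (chart j \o chart_inv i) (chart i (g t)) w).
Proof.
move=> cg it jt dg.
have dT : differentiable (chart j \o chart_inv i) (chart i (g t)) by have [d _] := @transition_smooth R n M i j 1%N; apply: d; exists (g t).
apply: (@is_derive_near _ _ ((chart j \o chart_inv i) \o (chart i \o g))).
  by apply: filterS (near_chart_dom cg it) => s is_ /=; rewrite chartK.
exact: is_derive_diff.
Qed.

Lemma inner_chart g h (s t : R) i p u v : g s = p -> h t = p -> chart_dom i p ->
  {for s, continuous g} -> {for t, continuous h} ->
  is_derive s (1 : R) (chart i \o g) u -> is_derive t (1 : R) (chart i \o h) v ->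
  inner p (velocity g s) (velocity h t) = gform (@metric R n M i) (chart i p) u v.
Proof.
move=> gs ht ip cg ch dg dh.
have jp := @mem_chart_at R n M p.
have ig : chart_dom i (g s) by rewrite gs.
have ih : chart_dom i (h t) by rewrite ht.
have jg : chart_dom (chart_at p) (g s) by rewrite gs.
have jh : chart_dom (chart_at p) (h t) by rewrite ht.
have Dg := is_derive1_derive1 (is_derive_transition cg ig jg dg).
have Dh := is_derive1_derive1 (is_derive_transition ch ih jh dh).
rewrite /velocity gs ht Dg Dh gs ht /gform /inner.
by rewrite (metric_compat ip jp).
Qed.

Lemma speed_chart g t i u : chart_dom i (g t) -> {for t, continuous g} ->
  is_derive t (1 : R) (chart i \o g) u ->
  speed g t = Num.sqrt (gform (@metric R n M i) (chart i (g t)) u u).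
Proof. by move=> it cg dg; rewrite /speed (inner_chart erefl erefl it cg cg dg dg). Qed.

Lemma near_eq_speed g h t : (\forall s \near t, g s = h s) -> speed g t = speed h t.
Proof.
move=> gh; have E := nbhs_singleton gh.
rewrite /speed /velocity E !derive1E.
rewrite (near_eq_derive (g := chart (chart_at (h t)) \o h))//.
by apply: filterS gh => s /= ->.
Qed.

Definition C1_curve h := Ck_map (V := R^o) 1 setT h.

Lemma C1_continuous h : C1_curve h -> continuous h.
Proof. by move=> [ch _] t; exact: ch. Qed.

Lemma C1_is_derive h t i : C1_curve h -> chart_dom i (h t) ->
  is_derive t (1 : R) (chart i \o h) (derive1 (chart i \o h) t).
Proof.
move=> [_ /(_ i)[d _]] it; apply: is_derive1_intro => //.
by apply/derivable1_diffP; apply: d.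
Qed.

Lemma C1_derive1_continuous h t i : C1_curve h -> chart_dom i (h t) ->
  {for t, continuous (derive1 (chart i \o h))}.
Proof.
move=> [_ /(_ i)[_ d]] it; have := d 1 t (conj I it).
suff <- : (fun x : R^o => 'D_1 (chart i \o h) x) = derive1 (chart i \o h) by [].
by apply/funext => s; rewrite derive1E.
Qed.

Lemma speed_continuous h : C1_curve h -> continuous (speed h).
Proof.
move=> Ch t; pose i := chart_at (h t).
have it : chart_dom i (h t) := mem_chart_at (h t).
pose D := derive1 (chart i \o h).
apply: (@near_eq_continuous _ _ (fun s => Num.sqrt (gform (@metric R n M i) (chart i (h s)) (D s) (D s)))).
  have := near_chart_dom (C1_continuous Ch (x := t)) it.
  apply: filterS => s is_; rewrite (speed_chart is_ (C1_continuous Ch (x := s)) (C1_is_derive Ch is_))//.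
apply: (@continuous_comp _ _ _ (fun s => gform (@metric R n M i) (chart i (h s)) (D s) (D s)) Num.sqrt);
  last exact: sqrt_continuous.
apply: cvg_gform.
- exact/differentiable_continuous/metric_differentiable.
- by apply: (is_derive_continuous (C1_is_derive Ch it)).
- exact: C1_derive1_continuous.
- exact: C1_derive1_continuous.
Qed.

Lemma speed_ge0 g t : 0 <= speed g t.
Proof. exact: sqrtr_ge0. Qed.

End charts.

Section curve_length.
Context {R : realType} {n : nat} {M : riemannianManifold R n}.
Implicit Types (g h : R -> M) (p q : M).

Lemma C1_curve_intro h : continuous h ->
  (forall t i, chart_dom i (h t) -> derivable (chart i \o h) t 1 /\
     {for t, continuous (derive1 (chart i \o h))}) -> C1_curve h.
Proof.
move=> ch dh; split=> [t _|i]; first exact: ch.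
have d (t : R) : chart_dom i (h t) -> differentiable (chart i \o h) t by move=> /(dh t)[dt _]; apply/derivable1_diffP.
split=> [t [_ it]|v t [_ it]]; first exact: d.
have [_ ct] := dh t i it.
apply: (@near_eq_continuous _ _ (fun s : R => v *: derive1 (chart i \o h) s)).
  apply: filterS (near_chart_dom (ch t) it) => s is_.
  have ds := d s is_; rewrite derive1E !deriveE//.
  by rewrite -linearZ/= [v *: _]mulr1.
exact: (cvgZ (cvg_cst v) ct).
Qed.

Lemma C1_curve_affine h (c d : R) : C1_curve h -> C1_curve (fun t => h (c * t + d)).
Proof.
move=> Ch; have ca : continuous (fun t : R => c * t + d).
  move=> t; apply: cvgD; last exact: cvg_cst.
  by apply: cvgM; [exact: cvg_cst|exact: cvg_id].
have ch : continuous (fun t => h (c * t + d)).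
  by move=> t; apply: (@continuous_comp _ _ _ (fun t : R => c * t + d) h); [exact: ca|exact: C1_continuous].
have D (t : R) i : chart_dom i (h (c * t + d)) ->
    is_derive t (1 : R) (chart i \o (fun t => h (c * t + d))) (c *: derive1 (chart i \o h) (c * t + d)).
  by move=> it; exact: (is_derive_affine (C1_is_derive Ch it)).
apply: C1_curve_intro => // t i it; split; first by have := D t i it; case.
apply: (@near_eq_continuous _ _ (fun s : R => c *: derive1 (chart i \o h) (c * s + d))).
  by apply: filterS (near_chart_dom (ch t) it) => s /D/is_derive1_derive1.
have cD : {for t, continuous (fun s : R => derive1 (chart i \o h) (c * s + d))}.
  apply: (@continuous_comp _ _ _ (fun s : R => c * s + d) (derive1 (chart i \o h))); first exact: ca.
  exact: C1_derive1_continuous.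
exact: (cvgZ (cvg_cst c) cD).
Qed.

Lemma speed_affine h (c d t : R) : C1_curve h ->
  speed (fun t => h (c * t + d)) t = `|c| * speed h (c * t + d).
Proof.
move=> Ch; have Ch' := C1_curve_affine c d Ch.
pose i := chart_at (h (c * t + d)).
have it : chart_dom i (h (c * t + d)) := mem_chart_at _.
have D1 := C1_is_derive Ch it.
have D2 : is_derive t (1 : R) (chart i \o (fun t => h (c * t + d))) (c *: derive1 (chart i \o h) (c * t + d)).
  exact: (is_derive_affine D1).
rewrite (speed_chart it (C1_continuous Ch (x := c * t + d)) D1).
rewrite (speed_chart (g := fun t => h (c * t + d)) it (C1_continuous Ch' (x := t)) D2).
rewrite gformZl gformZr mulrA -expr2 sqrtrM ?sqr_ge0//.
by rewrite sqrtr_sqr.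
Qed.

Inductive pwC1 g : R -> R -> R -> Prop :=
| PwPiece a b h (P : R -> R) l : a < b -> C1_curve h -> {in `[a, b], g =1 h} ->
    (forall t : R, t \in `[a, b] -> is_derive t (1 : R) P (speed h t)) ->
    l = P b - P a -> pwC1 g a b l
| PwCat a b c l1 l2 : pwC1 g a b l1 -> pwC1 g b c l2 -> pwC1 g a c (l1 + l2).

Lemma pwC1_lt g a b l : pwC1 g a b l -> a < b.
Proof. by elim=> // {}a {}b c l1 l2 _ ab _ bc; exact: lt_trans bc. Qed.

Lemma pwC1_piece g a b h : a < b -> C1_curve h -> {in `[a, b], g =1 h} ->
  exists l, pwC1 g a b l.
Proof.
move=> ab Ch gh; have [P HP] := ex_primitive (a - 1) (b + 1) (speed_continuous Ch).
have dP (t : R) : t \in `[a, b] -> is_derive t (1 : R) P (speed h t).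
  by rewrite in_itv/= => /andP[at_ tb]; apply: HP; rewrite in_itv/=; split_lra.
by exists (P b - P a); exact: (PwPiece ab Ch gh dP erefl).
Qed.

Lemma pwC1_eq g g' a b l : {in `[a, b], g =1 g'} -> pwC1 g a b l -> pwC1 g' a b l.
Proof.
move=> + H; elim: H => {a b l}.
- move=> a b h P l ab Ch gh dP E gg'.
  have gh' : {in `[a, b], g' =1 h} by move=> t tab; rewrite -gg'// gh.
  exact: (PwPiece ab Ch gh' dP E).
- move=> a b c l1 l2 H1 IH1 H2 IH2 gg'.
  have ab := pwC1_lt H1; have bc := pwC1_lt H2.
  apply: PwCat; [apply: IH1|apply: IH2] => t; rewrite in_itv/= => /andP[t1 t2];
    by apply: gg'; rewrite in_itv/=; split_lra.
Qed.

Lemma pwC1_affine g a b l (c d : R) : 0 < c -> pwC1 g a b l ->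
  pwC1 (fun t => g (c * t + d)) ((a - d) / c) ((b - d) / c) l.
Proof.
move=> c0; elim=> {a b l}; last by move=> a b e l1 l2 _ H1 _ H2; exact: PwCat H1 H2.
move=> a b h P l ab Ch gh dP E.
have ad e : c * ((e - d) / c) + d = e by field; rewrite gt_eqF.
have tab (t : R) : t \in `[(a - d) / c, (b - d) / c] -> c * t + d \in `[a, b].
  rewrite !in_itv/= ler_pdivrMr// ler_pdivlMr// => /andP[? ?]; split_lra.
have E' : l = P (c * ((b - d) / c) + d) - P (c * ((a - d) / c) + d) by rewrite !ad.
have ab' : (a - d) / c < (b - d) / c by rewrite ltr_pM2r ?invr_gt0// ltrD2r.
have gh' : {in `[(a - d) / c, (b - d) / c], (fun t => g (c * t + d)) =1 (fun t => h (c * t + d))} by move=> t /tab; exact: gh.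
have dP' (t : R) : t \in `[(a - d) / c, (b - d) / c] ->
    is_derive t (1 : R) (fun t => P (c * t + d)) (speed (fun t => h (c * t + d)) t).
  move=> /tab tI; rewrite speed_affine// gtr0_norm//.
  have dl : is_derive t (1 : R) (fun s : R => c * s + d) c.
    have := is_deriveD (is_deriveZ c (is_derive_id t (1 : R))) (is_derive_cst (d : R) t (1 : R)).
    by rewrite addr0 [_ *: 1]mulr1.
  have := @is_derive1_comp R P (fun s : R => c * s + d) t _ c (dP _ tI) dl.
  by rewrite mulrC.
exact: (PwPiece ab' (C1_curve_affine c d Ch) gh' dP' E').
Qed.

Lemma pwC1_reverse g a b l : pwC1 g a b l -> pwC1 (fun t => g (- t)) (- b) (- a) l.
Proof.
elim=> {a b l}; last first.
  by move=> a b c l1 l2 _ H1 _ H2; rewrite addrC; exact: PwCat H2 H1.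
move=> a b h P l ab Ch gh dP E.
have tab (t : R) : t \in `[- b, - a] -> - t \in `[a, b] by rewrite !in_itv/= => /andP[? ?]; split_lra.
have E' : l = (- P (- (- a))) - (- P (- (- b))) by rewrite !opprK addrC.
have EN : (fun t => h (- t)) = (fun t => h ((- 1) * t + 0)) by apply/funext => t; rewrite mulN1r addr0.
have ab' : - b < - a by rewrite ltrN2.
have Ch' : C1_curve (fun t => h (- t)) by rewrite EN; exact: C1_curve_affine.
have gh' : {in `[- b, - a], (fun t => g (- t)) =1 (fun t => h (- t))} by move=> t /tab; exact: gh.
have dP' (t : R) : t \in `[- b, - a] ->
    is_derive t (1 : R) (fun t => - P (- t)) (speed (fun t => h (- t)) t).
  move=> /tab tI.
  rewrite EN speed_affine// normrN1 mul1r mulN1r addr0.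
  have dl := is_deriveN (is_derive_id t (1 : R)).
  have := @is_derive1_comp R P (fun s : R => - s) t _ (-1) (dP _ tI) dl.
  by move=> /is_deriveN; rewrite mulrN1 opprK.
exact: (PwPiece ab' Ch' gh' dP' E').
Qed.

Lemma pwC1_split g a b l t : pwC1 g a b l -> a < t < b ->
  exists l1 l2, [/\ pwC1 g a t l1, pwC1 g t b l2 & l = l1 + l2].
Proof.
elim=> {a b l} [a b h P l ab Ch gh dP E|a b c l1 l2 H1 IH1 H2 IH2] /andP[at_ tb].
  have s1 (s : R) : s \in `[a, t] -> s \in `[a, b] by rewrite !in_itv/= => /andP[? ?]; split_lra.
  have s2 (s : R) : s \in `[t, b] -> s \in `[a, b] by rewrite !in_itv/= => /andP[? ?]; split_lra.
  have gh1 : {in `[a, t], g =1 h} by move=> s /s1; exact: gh.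
  have gh2 : {in `[t, b], g =1 h} by move=> s /s2; exact: gh.
  exists (P t - P a), (P b - P t); split; last by rewrite E; ring.
    exact: (PwPiece at_ Ch gh1 (fun s si => dP s (s1 s si)) erefl).
  exact: (PwPiece tb Ch gh2 (fun s si => dP s (s2 s si)) erefl).
have [tltb|blt|tE] := ltgtP t b.
- have [|k1 [k2 [? ? ->]]] := IH1; first by rewrite at_.
  by exists k1, (k2 + l2); split; [|exact: PwCat H2|rewrite addrA].
- have [|k1 [k2 [? ? ->]]] := IH2; first by rewrite blt.
  by exists (l1 + k1), k2; split; [exact: PwCat H1 _| |rewrite addrA].
- by exists l1, l2; rewrite tE.
Qed.

Lemma pwC1_length g a b l : pwC1 g a b l ->
  measurable_fun `[a, b] (speed g) /\ length_over g `[a, b] = l%:E.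
Proof.
elim=> {a b l} [a b h P l ab Ch gh dP E|a b c l1 l2 H1 [m1 e1] H2 [m2 e2]].
  have mh (D : set R) : measurable D -> measurable_fun D (speed h).
    by move=> mD; apply: (measurable_funS measurableT) => //; exact: (continuous_measurable_fun (speed_continuous Ch)).
  have gE : {in `]a, b[, speed h =1 speed g}.
    move=> t tab; apply/esym/near_eq_speed.
    have : nbhs t `]a, b[%classic by apply: open_nbhs_nbhs; split => //; exact: itv_open.
    by apply: filterS => s /= sab; apply: gh; exact: subset_itv_oo_cc.
  have mo : measurable_fun `]a, b[ (speed h) by apply: mh.
  have mg : measurable_fun `]a, b[ (speed g) by apply: eq_measurable_fun mo => t /set_mem /= tab; exact: gE.
  split.
    apply/measurable_fun_itv_bndo_bndcP; exact/measurable_fun_itv_obnd_cbndP.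
  rewrite /length_over -(eq_integral_itv_bounded _ _ mo mg gE).
  have cP : {within `[a, b], continuous P} by apply: derivable_within_continuous => t /dP[].
  have cS : {within `[a, b], continuous (speed h)}.
    exact/continuous_subspaceT/speed_continuous.
  have [c1 c2 c3] := (continuous_within_itvP _ ab).1 cP.
  have dP' : derivable_oo_LRcontinuous P a b by split => // t /subset_itv_oo_cc/dP[].
  have PE : {in `]a, b[, derive1 P =1 speed h} by move=> t /subset_itv_oo_cc/dP/is_derive1_derive1.
  by rewrite E (continuous_FTC2 ab cS dP' PE) EFinB.
have ab := pwC1_lt H1; have bc := pwC1_lt H2.
have E : [set` `[a, c]] = `[a, b] `|` `]b, c] by rewrite -itv_bndbnd_setU// bnd_simp ltW.
have m2' : measurable_fun `]b, c] (speed g) by apply: measurable_funS m2 => //; exact: subset_itv_oc_cc.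
have mU : measurable_fun (`[a, b] `|` `]b, c]) (speed g) by apply/measurable_funU.
split; first by rewrite E.
rewrite /length_over E ge0_integral_setU//=.
- rewrite -/(length_over g `[a, b]) e1.
  rewrite (integral_itv_obnd_cbnd (f := fun t => (speed g t)%:E)); last exact/measurable_EFinP.
  by rewrite -/(length_over g `[b, c]) e2.
- exact/measurable_EFinP.
- by move=> t _; rewrite lee_fin speed_ge0.
- apply/disj_setPS => t [] /=; rewrite !in_itv/= => /andP[_ tb] /andP[bt _].
  by move: bt; rewrite ltNge tb.
Qed.

Definition C1_piece g (a b : R) := a < b /\
  exists2 h, C1_curve h & {in `[a, b], g =1 h}.

Lemma piecewise_C1P g : piecewise_C1 g <->
  exists s : seq R, path (fun a b => `[< C1_piece g a b >]) 0 (rcons s 1).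
Proof.
split=> [[s [so Hs]]|[s ps]]; exists s.
  apply/(pathP 0) => k ks; apply/asboolP; split.
    by move/(pathP 0) : so => /(_ k ks).
  by have [|h Ch gh] := Hs k; [rewrite /= ltnS|exists h].
split; first by apply/(pathP 0) => k ks; have /(pathP 0)/(_ k ks)/asboolP[] := ps.
move=> k ks; have /(pathP 0)/(_ k)/(_ _)/asboolP[|_ [h Ch gh]] := ps.
  by rewrite /= ltnS in ks.
by exists h.
Qed.

Lemma piecewise_C1_pwC1 g : piecewise_C1 g -> exists l, pwC1 g 0 1 l.
Proof.
move=> /piecewise_C1P[s]; elim: s (0 : R) => [|b s IH] a /=.
  by rewrite andbT => /asboolP[ab [h Ch gh]]; exact: pwC1_piece ab Ch gh.
move=> /andP[/asboolP[ab [h Ch gh]] /IH[l2 H2]].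
have [l1 H1] := pwC1_piece ab Ch gh.
by exists (l1 + l2); exact: PwCat H1 H2.
Qed.

Lemma pwC1_piecewise_C1 g l : pwC1 g 0 1 l -> piecewise_C1 g.
Proof.
move=> H; apply/piecewise_C1P; elim: H => {l}.
  move=> a b h P l ab Ch gh _ _; exists [::]; rewrite /= andbT; apply/asboolP.
  by split => //; exists h.
move=> a b c l1 l2 _ [s1 p1] _ [s2 p2]; exists (rcons s1 b ++ s2).
by rewrite rcons_cat cat_path p1 last_rcons.
Qed.

Lemma pwC1_cst p a b : a < b -> pwC1 (fun=> p) a b 0.
Proof.
move=> ab; pose h : R -> M := fun=> p.
have ch : continuous h by move=> t; exact: cvg_cst.
have D (t : R) i : is_derive t (1 : R) (chart i \o h) 0 by exact: (is_derive_cst (chart i p) t (1 : R)).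
have Ch : C1_curve h.
  apply: C1_curve_intro => // t i _; split; first by have := D t i; case.
  rewrite (_ : derive1 _ = fun=> 0); first exact: cst_continuous.
  by apply/funext => s; exact: is_derive1_derive1.
have s0 t : speed h t = 0.
  rewrite (speed_chart (mem_chart_at _) (ch t) (D t (chart_at p))).
  by rewrite gform0l sqrtr0.
have dP (t : R) : t \in `[a, b] -> is_derive t (1 : R) (fun=> 0) (speed h t).
  by move=> _; rewrite s0; exact: (is_derive_cst (0 : R) t (1 : R)).
have gh : {in `[a, b], (fun=> p) =1 h} by [].
exact: (PwPiece ab Ch gh dP (esym (subrr 0))).
Qed.

End curve_length.

Section distance.
Context {R : realType} {n : nat} {M : riemannianManifold R n}.
Implicit Types (g h : R -> M) (p q : M).
Local Open Scope ereal_scope.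

Lemma dist_le_length g (a b l : R) : pwC1 g a b l -> dist (g a) (g b) <= l%:E.
Proof.
move=> H; have ab := pwC1_lt H; have ba : (0 < b - a)%R by rewrite subr_gt0.
have := pwC1_affine a ba H; rewrite subrr mul0r divff ?gt_eqF// => H'.
apply: ereal_inf_lbound; exists (fun t => g ((b - a) * t + a)%R).
  split; first exact: pwC1_piecewise_C1 H'.
  - by rewrite mulr0 add0r.
  - by rewrite mulr1 subrK.
by have [_ ->] := pwC1_length H'.
Qed.

Lemma dist_lt_ex p q (e : \bar R) : dist p q < e ->
  exists g l, [/\ pwC1 g 0 1 l, g 0%R = p, g 1%R = q & l%:E < e].
Proof.
move=> /ereal_inf_lt[_ [g [pg g0 g1] <-]] ge.
have [l H] := piecewise_C1_pwC1 pg; exists g, l; split => //.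
by have [_ <-] := pwC1_length H.
Qed.

Lemma dist_ge0 p q : 0 <= dist p q.
Proof.
apply: le_ereal_inf_tmp => _ [g _ <-].
by apply: integral_ge0 => t _; rewrite lee_fin speed_ge0.
Qed.

Lemma distxx p : dist p p = 0.
Proof.
apply/eqP; rewrite eq_le dist_ge0 andbT.
by have := dist_le_length (@pwC1_cst _ _ _ p 0%R 1%R ltr01).
Qed.

Lemma dist_sym p q : dist p q = dist q p.
Proof.
wlog : p q / dist q p < dist p q => [H|].
  have [/H->//|/H->//|//] := ltgtP (dist p q) (dist q p).
move=> /dist_lt_ex[g [l [H g0 g1 lt]]].
have := dist_le_length (pwC1_reverse H); rewrite !opprK g0 g1.
by rewrite leNgt lt.
Qed.

Lemma dist_triangle p q s : dist p s <= dist p q + dist q s.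
Proof.
have [->|fpq] := eqVneq (dist p q) +oo.
  by rewrite addye ?leey// gt_eqF// (lt_le_trans _ (dist_ge0 _ _))// ltNye.
have [->|fqs] := eqVneq (dist q s) +oo.
  by rewrite addey ?leey// gt_eqF// (lt_le_trans _ (dist_ge0 _ _))// ltNye.
have f1 : dist p q \is a fin_num by rewrite ge0_fin_numE ?dist_ge0// ltey.
have f2 : dist q s \is a fin_num by rewrite ge0_fin_numE ?dist_ge0// ltey.
apply/lee_addgt0Pr => e e0.
have e20 : (0 < e / 2)%R by rewrite divr_gt0.
have [g1 [l1 [H1 g10 g11 lt1]]] : exists g l, [/\ pwC1 g 0 1 l, g 0%R = p, g 1%R = q & l%:E < dist p q + (e / 2)%:E].
  by apply: dist_lt_ex; rewrite -{1}[dist p q]adde0 lteD2lE// lte_fin.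
have [g2 [l2 [H2 g20 g21 lt2]]] : exists g l, [/\ pwC1 g 0 1 l, g 0%R = q, g 1%R = s & l%:E < dist q s + (e / 2)%:E].
  by apply: dist_lt_ex; rewrite -{1}[dist q s]adde0 lteD2lE// lte_fin.
pose g t := if (t <= 1)%R then g1 t else g2 (t - 1)%R.
have G1 : pwC1 g 0 1 l1 by apply: pwC1_eq H1 => t; rewrite in_itv/= => /andP[_ t1]; rewrite /g t1.
have G2 : pwC1 g 1 2 l2.
  have := pwC1_affine (-1) ltr01 H2; rewrite !divr1 !opprK add0r (_ : (1 + 1 = 2)%R)//.
  apply: pwC1_eq => t; rewrite in_itv/= => /andP[t1 t2]; rewrite /g mul1r.
  case: ifPn => // t1'; have tE : t = 1%R by apply/eqP; rewrite eq_le t1' t1.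
  by rewrite tE (_ : (1 - 1 = 0)%R) ?g20 ?g11//; ring.
have := dist_le_length (PwCat G1 G2).
rewrite /g ler01 g10 (_ : (2 <= 1 :> R)%R = false); last by apply/negbTE; rewrite -ltNge ltr1n.
rewrite (_ : (2 - 1 = 1 :> R)%R) ?g21; last by ring.
move=> /le_trans; apply; rewrite EFinD.
rewrite (_ : dist p q + dist q s + e%:E = (dist p q + (e / 2)%:E) + (dist q s + (e / 2)%:E)).
  by rewrite leeD// ltW.
by rewrite -(fineK f1) -(fineK f2) -!EFinD; congr (_%:E); field.
Qed.

End distance.

Section gluing.
Context {R : realType}.

Lemma interval_gluing (Q : R -> R -> Prop) (a b : R) : a <= b ->
  (forall s t u, s <= t -> t <= u -> Q s t -> Q t u -> Q s u) ->
  (forall t, a <= t <= b -> exists2 d : R, 0 < d & forall s s', a <= s -> s' <= b ->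
     t - d < s -> s <= t -> t <= s' -> s' < t + d -> Q s s') -> Q a b.
Proof.
move=> ab Qt Ql; pose S := [set t | a <= t <= b /\ Q a t].
have Sa : S a.
  split; first by rewrite lexx.
  have [|d d0 Hd] := Ql a; first by rewrite lexx.
  by apply: Hd => //; lra.
have ubS : ubound S b by move=> t [/andP[]].
have sS : has_sup S by split; [exists a|exists b].
have ac : a <= sup S by apply: ub_le_sup => //; exists b.
have cb : sup S <= b by apply: ge_sup => //; exists a.
have [|d d0 Hd] := Ql (sup S); first by rewrite ac.
have [t St lt_t] := sup_adherent d0 sS.
have tc : t <= sup S by apply: ub_le_sup => //; exists b.
have [/andP[at_ tb] Qat] := St.
pose s' := Num.min b (sup S + d / 2).
have s'b : s' <= b by rewrite ge_min lexx.
have cs' : sup S <= s' by rewrite le_min cb/=; lra.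
have s'd : s' < sup S + d by rewrite gt_min; apply/orP; right; lra.
have Qs' : Q a s' by apply: (Qt a t s') => //; [lra|exact: Hd].
have : s' <= sup S.
  by apply: ub_le_sup; [exists b|split => //; split_lra].
rewrite /s' ge_min => /orP[bc|]; last lra.
by move: Qs'; rewrite /s' (@min_l _ _ b) //; lra.
Qed.

End gluing.

Section local_distance.
Context {R : realType} {n : nat}.
Variables (gm : 'rV[R]_n -> 'M[R]_n) (m : 'rV[R]_n) (r K : R).
Hypothesis mb : metric_ball gm m r K.
Implicit Types (p q z : 'rV[R]_n) (x u y v : R -> 'rV[R]_n).
Local Notation G := (gform gm).
Local Notation F := (gaccel gm).
Local Notation R1 := (geodesic_radius r K).

Let K0 : 0 < K. Proof. by have := mb_K mb; lra. Qed.
Let R10 : 0 < R1. Proof. exact: geodesic_radius_gt0 mb. Qed.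

Let mem0I : (0 : R) \in `[0, 1]. Proof. by rewrite in_itv/= lexx ler01. Qed.
Let mem1I : (1 : R) \in `[0, 1]. Proof. by rewrite in_itv/= lexx ler01. Qed.

Lemma gaccelZ (c : R) p q : F p (c *: q) = c ^+ 2 *: F p q.
Proof.
apply/rowP => k; rewrite !mxE mulrN mulr_sumr; congr (- _); apply: eq_bigr => a _.
rewrite mulr_sumr; apply: eq_bigr => b _; rewrite !mxE; ring.
Qed.

Lemma geodesic01_affine x u (s c : R) :
  (forall t : R, t \in `[0, 1] -> [/\ cball m r (x (c * t + s)),
     is_derive (c * t + s) (1 : R) x (u (c * t + s)) &
     is_derive (c * t + s) (1 : R) u (F (x (c * t + s)) (u (c * t + s)))]) ->
  geodesic01 gm m r (fun t => x (c * t + s)) (fun t => c *: u (c * t + s)).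
Proof.
move=> H t /H[H1 H2 H3]; split=> //; first exact: is_derive_affine.
have H4 := is_derive_affine H3.
rewrite gaccelZ expr2 -scalerA; exact: (is_deriveZ c H4).
Qed.

Definition local_dist p q : R := xget 0 [set d | 0 <= d /\
  exists x u, [/\ geodesic01 gm m r x u, energy gm x u <= small_energy K,
                  x 0 = p, x 1 = q & energy gm x u = d ^+ 2]].
Local Notation phi := local_dist.

Lemma local_distE x u : geodesic01 gm m r x u -> energy gm x u <= small_energy K ->
  phi (x 0) (x 1) = Num.sqrt (energy gm x u).
Proof.
move=> g e; rewrite /phi; case: xgetP => [d _ [d0 [y [v [gy ey y0 y1 E]]]]|].
  have [<- _] := geodesic_unique mb gy ey g e y0 y1.
  by rewrite E sqrtr_sqr ger0_norm.
move=> /(_ (Num.sqrt (energy gm x u))) []; split; first exact: sqrtr_ge0.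
by exists x, u; split => //; rewrite sqr_sqrtr// (energy_ge0 mb g).
Qed.

Lemma local_dist_ge0 p q : 0 <= phi p q.
Proof. by rewrite /phi; case: xgetP => [d _ []//|_]. Qed.

Lemma local_dist_segment p q x u : geodesic_segment gm m r K p q x u ->
  energy gm x u = phi p q ^+ 2.
Proof.
move=> [[[<- <-] _ _ _] _ g e]; rewrite (local_distE g e) sqr_sqrtr//.
exact: (energy_ge0 mb g).
Qed.

Section two_points.
Variables p q : 'rV[R]_n.
Hypotheses (pm : cball m R1 p) (qm : cball m R1 q).

Lemma local_dist_norm : `|q - p| <= K * phi p q.
Proof.
have [x [u s]] := ex_geodesic_segment mb pm qm.
have E := local_dist_segment s; have [[[x0 x1] _ _ _] _ g e] := s.
have := geodesic_dist_le mb g; rewrite x0 x1 E => H.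
have P0 := local_dist_ge0 p q; have K1 := mb_K mb.
rewrite -(@ler_pXn2r _ 2)// ?nnegrE ?mulr_ge0//; last lra.
rewrite exprMn (le_trans H)// ler_wpM2r ?sqr_ge0//.
by rewrite expr2; nra.
Qed.

Lemma norm_local_dist : phi p q <= 2 * K * `|q - p|.
Proof.
have [x [u s]] := ex_geodesic_segment mb pm qm.
have E := local_dist_segment s; have [[[x0 x1] _ _ bu] _ g e] := s.
have P0 := local_dist_ge0 p q; have K1 := mb_K mb.
rewrite -(@ler_pXn2r _ 2)// ?nnegrE ?mulr_ge0//; last lra.
have [xm _ _] := g 0 mem0I.
have := mb_bound mb (u 0) (u 0) xm; rewrite -/(energy gm x u) E => H.
have := ler_norm (phi p q ^+ 2) => /le_trans /(_ H) /le_trans; apply.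
rewrite -mulrA.
have UU : `|u 0| * `|u 0| <= 4 * `|q - p| ^+ 2.
  rewrite (_ : 4 * _ = (2 * `|q - p|) * (2 * `|q - p|)); last by rewrite expr2; ring.
  exact: ler_pM.
rewrite (@le_trans _ _ (K * (4 * `|q - p| ^+ 2)))// ?ler_wpM2l//; first lra.
rewrite !exprMn [leLHS](_ : _ = 4 * `|q - p| ^+ 2 * K); last by ring.
rewrite [leRHS](_ : _ = 4 * `|q - p| ^+ 2 * K ^+ 2); last by ring.
by rewrite ler_wpM2l ?mulr_ge0//; nra.
Qed.

Lemma local_dist_sym : phi p q = phi q p.
Proof.
have [x [u s]] := ex_geodesic_segment mb pm qm.
have [[[x0 x1] _ _ bu] _ g e] := s.
have E1 := local_distE g e; rewrite x0 x1 in E1.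
have g' : geodesic01 gm m r (fun t => x (-1 * t + 1)) (fun t => -1 *: u (-1 * t + 1)).
  apply: geodesic01_affine => t; rewrite in_itv/= => /andP[t0 t1].
  by apply: g; rewrite in_itv/=; split_lra.
have e' : energy gm (fun t => x (-1 * t + 1)) (fun t => -1 *: u (-1 * t + 1)) = energy gm x u.
  rewrite /energy gformZl gformZr mulrA mulrNN !mul1r mulr0 add0r.
  exact: (energy_const mb g mem1I).
have := local_distE g'; rewrite e' => /(_ e) E2.
by rewrite E1 -E2 mulr0 mulr1 add0r addNr x0 x1.
Qed.

End two_points.

Lemma local_distxx p : cball m R1 p -> phi p p = 0.
Proof.
move=> pm; apply/eqP; rewrite eq_le local_dist_ge0 andbT.
by have := norm_local_dist pm pm; rewrite subrr normr0 mulr0.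
Qed.

Lemma local_dist_eq0 p q : cball m R1 p -> cball m R1 q -> phi p q = 0 -> q = p.
Proof.
move=> pm qm E; have := local_dist_norm pm qm; rewrite E mulr0.
by rewrite normr_le0 subr_eq0 => /eqP.
Qed.

Lemma local_dist_triangle p z q : cball m R1 p -> cball m R1 z -> cball m R1 q ->
  phi p q <= phi p z + phi z q.
Proof.
move=> pm zm qm.
have [E|n1] := eqVneq (phi p z) 0; first by rewrite E (local_dist_eq0 pm zm E) add0r.
have [E|n2] := eqVneq (phi z q) 0; first by rewrite E (local_dist_eq0 zm qm E) addr0.
have p1 : 0 < phi p z by rewrite lt_def n1 local_dist_ge0.
have p2 : 0 < phi z q by rewrite lt_def n2 local_dist_ge0.
have [x [u s]] := ex_geodesic_segment mb pm qm.
have [y1 [v1 s1]] := ex_geodesic_segment mb pm zm.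
have [y2 [v2 s2]] := ex_geodesic_segment mb zm qm.
have E := local_dist_segment s; have E1 := local_dist_segment s1; have E2 := local_dist_segment s2.
have [[[x0 x1] _ _ _] _ g e] := s.
have [[[y10 y11] _ _ _] _ g1 _] := s1.
have [[[y20 y21] _ _ _] _ g2 _] := s2.
pose l := phi p z / (phi p z + phi z q).
have l01 : 0 < l < 1 by rewrite divr_gt0 ?addr_gt0//= ltr_pdivrMr ?addr_gt0// mul1r ltrDl.
have [H _] := geodesic_triangle mb l01 g e g1 g2 (etrans x0 (esym y10)) (etrans y11 (esym y20)) (etrans y21 (esym x1)).
move: H; rewrite E E1 E2 => H.
rewrite -(@ler_pXn2r _ 2)// ?nnegrE ?addr_ge0 ?local_dist_ge0//.
apply: (le_trans H); rewrite le_eqVlt; apply/orP; left; apply/eqP.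
have -> : 1 - l = phi z q / (phi p z + phi z q) by rewrite /l; field; rewrite gt_eqF// addr_gt0.
by rewrite /l; field; rewrite !gt_eqF// addr_gt0.
Qed.

Lemma local_dist_equality p z q x u (s : R) : cball m R1 p -> cball m R1 z -> cball m R1 q ->
  geodesic_segment gm m r K p q x u -> 0 <= s <= 1 ->
  phi p z = s * phi p q -> phi z q = (1 - s) * phi p q -> z = x s.
Proof.
move=> pm zm qm S s01 A1 A2; have [[[x0 x1] _ _ _] _ g e] := S.
have [s0|n0] := eqVneq s 0.
  by rewrite s0 mul0r in A1 *; rewrite (local_dist_eq0 pm zm A1).
have [s1|n1] := eqVneq s 1.
  by rewrite s1 subrr mul0r in A2 *; rewrite x1 (local_dist_eq0 zm qm A2).
have s01' : 0 < s < 1 by move: s01 => /andP[? ?]; rewrite !lt_neqAle eq_sym n0 n1; apply/andP; split.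
have [y1 [v1 S1]] := ex_geodesic_segment mb pm zm.
have [y2 [v2 S2]] := ex_geodesic_segment mb zm qm.
have E := local_dist_segment S; have E1 := local_dist_segment S1; have E2 := local_dist_segment S2.
have [[[y10 y11] _ _ _] _ g1 _] := S1.
have [[[y20 y21] _ _ _] _ g2 _] := S2.
have [_ H] := geodesic_triangle mb s01' g e g1 g2 (etrans x0 (esym y10)) (etrans y11 (esym y20)) (etrans y21 (esym x1)).
have [|H1 _] := H.
  rewrite E E1 E2 A1 A2; field; move: s01' => /andP[? ?].
  by rewrite !gt_eqF// subr_gt0.
have sI : s \in `[0, s] by rewrite in_itv/= lexx andbT; case/andP: s01.
rewrite -(H1 s sI) reparam_r ?y11//; by case/andP: s01'.
Qed.

Definition dist_radius : R := R1 / (20 * K ^+ 2).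

Lemma dist_radiusP : [/\ 0 < dist_radius, dist_radius <= R1 / 20,
  dist_radius * K <= R1 / 20 & dist_radius * K ^+ 2 = R1 / 20].
Proof.
have K1 := mb_K mb; have E : dist_radius * K ^+ 2 = R1 / 20 by rewrite /dist_radius; field; rewrite gt_eqF.
have D0 : 0 < dist_radius by rewrite divr_gt0// mulr_gt0// exprn_gt0.
split => //; rewrite -E; last by rewrite ler_pM2l// expr2; nra.
by rewrite ler_peMr ?(ltW D0)// expr2; nra.
Qed.

Section segment.
Variables (p q : 'rV[R]_n) (x u : R -> 'rV[R]_n).
Hypotheses (pm : cball m dist_radius p) (qm : cball m dist_radius q).
Hypothesis S : geodesic_segment gm m r K p q x u.

Lemma dist_radius_cball z : cball m dist_radius z -> cball m R1 z.
Proof. by have [d0 d1 _ _] := dist_radiusP; rewrite /cball/= => h; have := R10; lra. Qed.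

Lemma dist_radius_norm : `|q - p| <= 2 * dist_radius.
Proof.
move: pm qm; rewrite /cball/= => h1 h2.
rewrite (_ : q - p = (q - m) - (p - m)); last by rewrite opprB addrA subrK.
by rewrite (le_trans (ler_normB _ _))//; lra.
Qed.

Lemma segment_near_start (s : R) : - 1 <= s <= 2 -> `|x s - p| <= 2 * `|q - p| * `|s|.
Proof.
have [[[x0 x1] Ux _ bu] _ _ _] := S; move=> /andP[s0 s1].
have H := primitive_mean_value Ux.
have [s_0|s_0] := leP 0 s.
  have := H (2 * `|q - p|) 0 s; rewrite subr0 x0 (ger0_norm s_0).
  by apply => //; lra.
have := H (2 * `|q - p|) s 0; rewrite add0r x0 (ltr0_norm s_0) (distrC p).
by apply => //; lra.
Qed.

Lemma segment_energy (s : R) : - 2^-1 <= s <= 3 / 2 -> G (x s) (u s) (u s) = phi p q ^+ 2.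
Proof.
have [[_ [_ _ Ux] [_ _ Uu] _] xm _ _] := S; rewrite -(local_dist_segment S) /energy.
move=> /andP[s0 s1].
have D (t : R) : - 2^-1 <= t <= 3 / 2 -> is_derive t (1 : R) (fun t => G (x t) (u t) (u t)) 0.
  move=> /andP[t0 t1]; have tI : t \in `](-1), 2[ by rewrite in_itv/=; split_lra.
  exact: (is_derive_energy mb (xm t) (Ux t tI) (Uu t tI)).
have E a b : a < b -> - 2^-1 <= a -> b <= 3 / 2 -> G (x a) (u a) (u a) = G (x b) (u b) (u b).
  move=> ab a0 b1.
  have H (t : R) : t \in `[a, b] -> is_derive t (1 : R) (fun t => G (x t) (u t) (u t)) 0.
    by rewrite in_itv/= => /andP[t0 t1]; apply: D; split_lra.
  have [t _ /eqP] := MVT_is_derive ab H.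
  by rewrite mul0r subr_eq0 => /eqP.
have [s_0|s_0|->//] := ltgtP s 0; [apply: E|apply/esym; apply: E] => //; lra.
Qed.

Lemma local_dist_small : phi p q <= R1 / (5 * K).
Proof.
have [d0 d1 d2 d3] := dist_radiusP.
apply: (le_trans (norm_local_dist (dist_radius_cball pm) (dist_radius_cball qm))).
rewrite ler_pdivlMr ?mulr_gt0//.
have H := dist_radius_norm.
apply: (@le_trans _ _ (2 * K * (2 * dist_radius) * (5 * K))).
  rewrite (_ : 2 * K * `|q - p| * (5 * K) = (10 * K * K) * `|q - p|); last by ring.
  rewrite (_ : 2 * K * (2 * dist_radius) * _ = (10 * K * K) * (2 * dist_radius)); last by ring.
  by rewrite ler_wpM2l//; nra.
have -> : 2 * K * (2 * dist_radius) * (5 * K) = 20 * (dist_radius * K ^+ 2) by ring.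
by rewrite d3; lra.
Qed.

Lemma segment_local_dist (s t : R) : - 2^-1 <= s <= 3 / 2 -> - 2^-1 <= t <= 3 / 2 ->
  phi (x s) (x t) = `|t - s| * phi p q.
Proof.
move=> sI tI; have [[_ [_ _ Ux] [_ _ Uu] _] xm _ _] := S.
have g : geodesic01 gm m r (fun w => x ((t - s) * w + s)) (fun w => (t - s) *: u ((t - s) * w + s)).
  apply: geodesic01_affine => w; rewrite in_itv/= => /andP[w0 w1].
  have wI : (t - s) * w + s \in `](-1), 2[.
    move: sI tI => /andP[? ?] /andP[? ?]; rewrite in_itv/=; apply/andP; split; nra.
  by split; [exact: xm|exact: Ux|exact: Uu].
have e : energy gm (fun w => x ((t - s) * w + s)) (fun w => (t - s) *: u ((t - s) * w + s)) =
    ((t - s) * phi p q) ^+ 2.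
  by rewrite /energy gformZl gformZr mulr0 add0r segment_energy// exprMn mulrA expr2.
have P0 := local_dist_ge0 p q.
have e' : ((t - s) * phi p q) ^+ 2 <= small_energy K.
  have P1 := local_dist_small.
  have R14 : R1 <= (8 * K ^+ 4)^-1 / (4 * K) by rewrite !ge_min lexx !orbT.
  have T : `|(t - s) * phi p q| <= (8 * K ^+ 4)^-1 / K.
    rewrite normrM (ger0_norm P0).
    have ts : `|t - s| <= 2 by move: sI tI => /andP[? ?] /andP[? ?]; rewrite ler_norml; split_lra.
    apply: (@le_trans _ _ (2 * (R1 / (5 * K)))); first exact: ler_pM.
    have K1 := mb_K mb.
    rewrite mulrA ler_pdivrMr ?mulr_gt0//.
    rewrite (_ : _ / K * (5 * K) = 5 * (8 * K ^+ 4)^-1); last by field; rewrite gt_eqF.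
    have E0 : 0 < (8 * K ^+ 4)^-1 by rewrite invr_gt0 mulr_gt0// exprn_gt0.
    move: R14 E0; set E := (_^-1); clearbody E; rewrite ler_pdivlMr ?mulr_gt0// => h1 h2.
    have := R10; move: h1 h2 K1; move: R1 => r1 h1 h2 K1 h3; nra.
  rewrite -real_normK ?num_real//.
  have -> : small_energy K = ((8 * K ^+ 4)^-1 / K) ^+ 2 * K.
    by rewrite /small_energy; field; rewrite gt_eqF.
  apply: (@le_trans _ _ (((8 * K ^+ 4)^-1 / K) ^+ 2)).
    by rewrite ler_pXn2r// nnegrE// divr_ge0 ?invr_ge0 ?mulr_ge0 ?exprn_ge0// ltW.
  by rewrite ler_peMr ?sqr_ge0//; exact: mb_K mb.
have := local_distE g; rewrite e => /(_ e').
by rewrite mulr0 add0r mulr1 subrK => ->; rewrite sqrtr_sqr normrM (ger0_norm P0).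
Qed.

End segment.

Lemma local_dist_first_variation p q p' x u : cball m R1 p -> cball m R1 q -> cball m R1 p' ->
  geodesic_segment gm m r K p q x u ->
  phi p' q ^+ 2 <= phi p q ^+ 2 - 2 * G p (u 0) (p' - p) + K * (17 + 16 * R1) * `|p' - p| ^+ 2.
Proof.
move=> pm qm pm' S; have [x' [u' S']] := ex_geodesic_segment mb pm' qm.
have E := local_dist_segment S; have E' := local_dist_segment S'.
have L := geodesic_segment_lip mb pm qm pm' qm S S' 0.
have [[[x0 x1] _ _ bu] xm g e] := S; have [[[x0' x1'] _ _ bu'] xm' g' e'] := S'.
have := geodesic_first_variation mb g' e' g (etrans x1' (esym x1)).
rewrite x0 x0' E E' => /le_trans; apply.
rewrite (distrC p' p) (_ : G p (u 0) (p' - p) = - G p (u 0) (p - p')); last first.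
  by rewrite -[p' - p]opprB -scaleN1r gformZr mulN1r.
rewrite subrr normr0 addr0 in L.
have B : `|u' 0| <= 4 * R1.
  apply: (le_trans (bu' 0)); rewrite (_ : 4 * R1 = 2 * (R1 + R1)); last by ring.
  rewrite ler_pM2l// (_ : q - p' = (q - m) - (p' - m)); last by rewrite opprB addrA subrK.
  by rewrite (le_trans (ler_normB _ _))// lerD.
have c0 : cball m r p by rewrite -x0; exact: xm.
have c0' : cball m r p' by rewrite -x0'; exact: xm'.
have D1 := mb_lip mb (u' 0) (p - p') c0' c0.
have D2 := mb_bound mb (u' 0 - u 0) (p - p') c0.
have E1 : G p (u' 0 - u 0) (p - p') = G p (u' 0) (p - p') - G p (u 0) (p - p') by rewrite -scaleN1r gformDl gformZl mulN1r.
have L2 : `|u' 0 - u 0| <= 4 * `|p - p'| by rewrite distrC.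
have D1' := le_trans (ler_norm _) D1; have D2' := le_trans (ler_norm _) D2.
rewrite (distrC p' p) in D1'.
have Q1 : K * `|p - p'| * `|u' 0| * `|p - p'| <= K * (4 * R1) * `|p - p'| ^+ 2.
  rewrite [leLHS](_ : _ = K * `|u' 0| * `|p - p'| ^+ 2); last by rewrite expr2; ring.
  by rewrite ler_wpM2r ?sqr_ge0// ler_wpM2l// ltW.
have Q2 : K * `|u' 0 - u 0| * `|p - p'| <= K * 4 * `|p - p'| ^+ 2.
  rewrite [leRHS](_ : _ = K * (4 * `|p - p'|) * `|p - p'|); last by rewrite expr2; ring.
  by rewrite ler_wpM2r// ler_wpM2l// ltW.
have S0 : 0 <= K * `|p - p'| ^+ 2 by rewrite mulr_ge0 ?sqr_ge0// ltW.
have S1 : 0 <= K * R1 * `|p - p'| ^+ 2 by rewrite mulr_ge0 ?sqr_ge0// mulr_ge0// ltW.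
rewrite E1 in D2'.
rewrite (_ : K * (17 + 16 * R1) * `|p - p'| ^+ 2 = 17 * (K * `|p - p'| ^+ 2) + 16 * (K * R1 * `|p - p'| ^+ 2)); last by ring.
move: Q1 Q2 D1' D2' S0 S1.
rewrite (_ : K * (4 * R1) * `|p - p'| ^+ 2 = 4 * (K * R1 * `|p - p'| ^+ 2)); last by ring.
rewrite (_ : K * 4 * `|p - p'| ^+ 2 = 4 * (K * `|p - p'| ^+ 2)); last by ring.
move: (K * R1 * `|p - p'| ^+ 2) (K * `|p - p'| ^+ 2) => a b.
move: (K * `|p - p'| * `|u' 0| * `|p - p'|) (K * `|u' 0 - u 0| * `|p - p'|) => c d.
move: (G p' (u' 0) (p - p')) (G p (u' 0) (p - p')) (G p (u 0) (p - p')) => f1 f2 f3.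
by clear; move=> *; lra.
Qed.

Lemma is_derive_eps (y : R -> 'rV[R]_n) (w : 'rV[R]_n) (t e : R) : 0 < e ->
  is_derive t (1 : R) y w ->
  \forall s \near t, `|y s - y t - (s - t) *: w| <= e * `|s - t|.
Proof.
move=> e0 dy; have [dd E] := dy.
have df : differentiable y t by apply/derivable1_diffP.
have := differentiable_eps df e0; apply: filterS => s.
by rewrite diff1E// derive1E E.
Qed.

Lemma local_dist_speed (y : R -> 'rV[R]_n) (w : 'rV[R]_n) (t e : R) : 0 < e ->
  `|y t - m| < R1 -> is_derive t (1 : R) y w ->
  \forall s \near t, cball m R1 (y s) /\
    phi (y t) (y s) <= `|s - t| * (Num.sqrt (G (y t) w w) + e).
Proof.
move=> e0 ytm dy; have cy := is_derive_continuous dy.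
have ym : cball m R1 (y t) by exact: ltW.
have near1 : \forall s \near t, cball m R1 (y s).
  have : (fun s => `|y s - m|) @ t --> `|y t - m|.
    by apply: cvg_norm; apply: cvgB; [exact: cy|exact: cvg_cst].
  by move=> /(cvgr_lt _) /(_ _ ytm); apply: filterS => s /ltW.
have ytr : cball m r (y t).
  have := geodesic_radiusP mb ym ym; rewrite /cball/= => -[h _ _].
  by have := mb_r mb; lra.
pose W := Num.sqrt (G (y t) w w).
have W2 : G (y t) w w <= W ^+ 2 by have [h|h] := leP 0 (G (y t) w w); [rewrite sqr_sqrtr|rewrite (le_trans (ltW h)) ?sqr_ge0].
have K1 := mb_K mb; have w0 : 0 <= `|w| := normr_ge0 _.
have W0 : 0 <= W := sqrtr_ge0 _.
pose eta := Num.min 1 (e ^+ 2 / (4 * K * (`|w| + 1))).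
have eta0 : 0 < eta by rewrite lt_min ltr01 divr_gt0 ?exprn_gt0// !mulr_gt0//; lra.
have eta1 : eta <= 1 by rewrite ge_min lexx.
have etae : eta * (4 * K * (`|w| + 1)) <= e ^+ 2.
  rewrite -ler_pdivlMr; last by rewrite !mulr_gt0//; lra.
  by rewrite ge_min lexx orbT.
have D := is_derive_eps eta0 dy.
have near2 : \forall s \near t, `|s - t| * (8 * K * (`|w| + 1) ^+ 2) <= eta.
  have k0 : 0 < 8 * K * (`|w| + 1) ^+ 2 by rewrite !mulr_gt0// exprn_gt0//; lra.
  have d0 : 0 < eta / (8 * K * (`|w| + 1) ^+ 2) by rewrite divr_gt0.
  have := nbhsx_ballx t _ d0; apply: filterS => s; rewrite /ball/= distrC => h.
  by rewrite -ler_pdivlMr// ltW.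
near=> s; have ys : cball m R1 (y s) by near: s.
split => //.
have [x [u S]] := ex_geodesic_segment mb ym ys.
have E := local_dist_segment S; have [[[x0 x1] _ _ bu] _ g _] := S.
have FO := geodesic_first_order mb ym ys S.
have N1 : `|y s - y t - (s - t) *: w| <= eta * `|s - t| by near: s.
have N2 : `|s - t| * (8 * K * (`|w| + 1) ^+ 2) <= eta by near: s.
have s0 : 0 <= `|s - t| := normr_ge0 _.
have N3 : `|y s - y t| <= `|s - t| * (`|w| + 1).
  clear -eta1 N1 s0; rewrite -[y s - y t](subrK ((s - t) *: w)) (le_trans (ler_normD _ _))// normrZ; nra.
have N4 : `|u 0 - (s - t) *: w| <= 2 * eta * `|s - t|.
  rewrite (_ : u 0 - _ = (u 0 - (y s - y t)) + (y s - y t - (s - t) *: w)); last by rewrite addrA subrK.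
  apply: (le_trans (ler_normD _ _)).
  have : 8 * K * `|y s - y t| ^+ 2 <= eta * `|s - t|.
    apply: (@le_trans _ _ (8 * K * (`|s - t| * (`|w| + 1)) ^+ 2)).
      by clear -K1 w0 N3; rewrite ler_wpM2l ?ler_pXn2r ?nnegrE ?mulr_ge0//; lra.
    rewrite exprMn [leLHS](_ : _ = (`|s - t| * (8 * K * (`|w| + 1) ^+ 2)) * `|s - t|); last by rewrite !expr2; ring.
    by rewrite ler_wpM2r.
  by clear -FO N1; move: FO N1; lra.
rewrite -(@ler_pXn2r _ 2)// ?nnegrE ?local_dist_ge0 ?mulr_ge0 ?addr_ge0 ?(ltW e0)//.
rewrite -E /energy x0.
have [d -> d1] : exists2 d, u 0 = (s - t) *: w + d & `|d| <= 2 * eta * `|s - t| by exists (u 0 - (s - t) *: w) => //; rewrite addrC subrK.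
have EG : G (y t) ((s - t) *: w) ((s - t) *: w) = (s - t) * ((s - t) * G (y t) w w) by rewrite gformZl gformZr.
rewrite !(gformDl, gformDr) EG.
have B1 := le_trans (ler_norm _) (mb_bound mb ((s - t) *: w) d ytr).
have B2 := le_trans (ler_norm _) (mb_bound mb d ((s - t) *: w) ytr).
have B3 := le_trans (ler_norm _) (mb_bound mb d d ytr).
have C1 : K * `|(s - t) *: w| * `|d| <= (2 * K * eta * `|w|) * `|s - t| ^+ 2.
  rewrite normrZ (_ : _ * _ * _ = (2 * K * eta * `|w|) * `|s - t| ^+ 2
     - (K * `|w| * `|s - t|) * (2 * eta * `|s - t| - `|d|)); last by rewrite expr2; ring.
  by rewrite lerBlDr lerDl mulr_ge0 ?subr_ge0// !mulr_ge0// ltW.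
have C3 : K * `|d| * `|d| <= (4 * K * eta) * `|s - t| ^+ 2.
  apply: (@le_trans _ _ (K * (2 * eta * `|s - t|) * (2 * eta * `|s - t|))).
    by rewrite ler_pM ?mulr_ge0 ?ler_wpM2l ?(ltW K0).
  rewrite (_ : _ * _ = (4 * K * `|s - t| ^+ 2) * (eta * eta)); last by rewrite expr2; ring.
  rewrite [leRHS](_ : _ = (4 * K * `|s - t| ^+ 2) * eta); last by ring.
  by clear -K0 eta0 eta1; rewrite ler_wpM2l ?mulr_ge0 ?sqr_ge0 ?(ltW K0)//; nra.
rewrite (_ : K * `|d| * `|(s - t) *: w| = K * `|(s - t) *: w| * `|d|) in B2; last by ring.
have C0 : (s - t) * ((s - t) * G (y t) w w) <= `|s - t| ^+ 2 * W ^+ 2 by rewrite real_normK ?num_real// mulrA -expr2 ler_wpM2l ?sqr_ge0.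
rewrite -/W exprMn; clearbody W eta.
have C4 : `|s - t| ^+ 2 * (W ^+ 2 + e ^+ 2) <= `|s - t| ^+ 2 * (W + e) ^+ 2 by clear -R10 e0 W0; rewrite ler_wpM2l ?sqr_ge0// sqrrD; nra.
have C5 : `|s - t| ^+ 2 * (eta * (4 * K * (`|w| + 1))) <= `|s - t| ^+ 2 * e ^+ 2 by rewrite ler_wpM2l ?sqr_ge0.
move: C0 C1 C3 C4 C5 B1 B2 B3.
move: (G (y t) ((s - t) *: w) d) (G (y t) d ((s - t) *: w)) (G (y t) d d) => g1 g2 g3.
move: (K * `|(s - t) *: w| * `|d|) (K * `|d| * `|d|) ((s - t) * ((s - t) * G (y t) w w)) => a1 a2 a3.
move: (`|s - t| ^+ 2) => S2 *.
lra.
Unshelve. all: by end_near.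
Qed.

End local_distance.

Section chart_curves.
Context {R : realType} {n : nat} {M : riemannianManifold R n}.
Implicit Types (p q z : M) (i j : chart_index M).
Local Notation X := (@chart R n M).
Local Notation Y := (@chart_inv R n M).

Lemma chart_invK i x : chart_image i x -> chart_dom i (Y i x) /\ X i (Y i x) = x.
Proof. by move=> [p ip <-]; rewrite chartK. Qed.

Lemma C1_curve_chart_inv i (y w : R -> 'rV[R]_n) : (forall t, chart_image i (y t)) ->
  (forall t : R, is_derive t (1 : R) y (w t)) -> continuous w -> C1_curve (Y i \o y).
Proof.
move=> yi dy cw; have cy (t : R) : {for t, continuous y} := is_derive_continuous (dy t).
have c : continuous (Y i \o y) by move=> t; apply: continuous_comp; [exact: cy|exact/chart_inv_continuous/yi].
apply: C1_curve_intro => // t j jt.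
have inter (s : R) : chart_dom j (Y i (y s)) -> (X i @` (chart_dom i `&` chart_dom j)) (y s).
  by move=> js; have [di e] := chart_invK (yi s); exists (Y i (y s)).
have [D1 _] := transition_smooth i j 1%N; have [_ D2] := transition_smooth i j 2%N.
have D (s : R) : chart_dom j (Y i (y s)) ->
    is_derive s (1 : R) (X j \o (Y i \o y)) ('d (X j \o Y i) (y s) (w s)).
  by move=> js; exact: (is_derive_diff (D1 _ (inter s js)) (dy s)).
split; first by have := D t jt; case.
apply: (@near_eq_continuous _ _ (fun s : R => \sum_k w s 0 k *: 'D_(delta_mx 0 k) (X j \o Y i) (y s))).
  apply: filterS (near_chart_dom (c t) jt) => s js.
  rewrite (is_derive1_derive1 (D s js)) {2}[w s]row_sum_pd linear_sum.
  apply: eq_bigr => k _; rewrite linearZ -deriveE//; exact: D1 _ (inter s js).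
apply: cvg_big => [|k _]; first exact: add_continuous.
apply: cvgZ.
  exact: cvg_entry (cw t).
have [D3 _] := D2 (delta_mx 0 k).
have cD := differentiable_continuous (D3 _ (inter t jt)).
exact: (@continuous_comp _ _ _ y _ t (cy t) cD).
Qed.

End chart_curves.

Section normal_neighbourhood.
Context {R : realType} {n : nat} {M : riemannianManifold R n}.
Variables (i : chart_index M) (m : M) (r K : R).
Implicit Types (p q z : M).
Local Notation X := (@chart R n M i).
Local Notation Y := (@chart_inv R n M i).
Local Notation R1 := (geodesic_radius r K).
Local Notation rho := (dist_radius r K).
Local Notation gm := (@metric R n M i).
Local Notation phi := (local_dist gm (X m) r K).

Definition normal_chart : Prop := [/\ chart_dom i m, metric_ball gm (X m) r K &
  cball (X m) r `<=` chart_image i].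

Definition nball (d : R) : set M := [set p | chart_dom i p /\ cball (X m) d (X p)].

Hypothesis nc : normal_chart.
Let im : chart_dom i m. Proof. by case: nc. Qed.
Let mb : metric_ball gm (X m) r K. Proof. by case: nc. Qed.
Let sub x : cball (X m) r x -> chart_image i x. Proof. by case: nc => _ _; apply. Qed.
Let K0 : 0 < K. Proof. by have := mb_K mb; lra. Qed.
Let R10 : 0 < R1. Proof. exact: geodesic_radius_gt0 mb. Qed.

Lemma normal_chart_radius : [/\ 0 < r, 1 <= K, 0 < R1, R1 <= r / 4 & 0 < rho <= R1 / 20].
Proof.
have [d0 d1 _ _] := dist_radiusP mb; split; [exact: mb_r mb|exact: mb_K mb|exact: R10| |].
  by rewrite ge_min lexx.
by apply/andP; split.
Qed.

Lemma nball_le d e p : d <= e -> nball d p -> nball e p.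
Proof. by move=> de [ip h]; split => //; rewrite /cball/= in h *; exact: le_trans de. Qed.

Lemma nbhs_nball d p : chart_dom i p -> `|X p - X m| < d -> nbhs p (nball d).
Proof.
move=> ip h; have c : {for p, continuous X} := chart_continuous ip.
have n1 : nbhs p (chart_dom i) by apply: open_nbhs_nbhs; split; [exact: chart_dom_open|].
have n2 : \forall q \near p, `|X q - X m| < d.
  have : (fun q => `|X q - X m|) @ p --> `|X p - X m|.
    by apply: cvg_norm; apply: cvgB; [exact: c|exact: cvg_cst].
  by move=> /(cvgr_lt _) /(_ _ h).
by apply: filterS2 n1 n2 => q iq /ltW hq.
Qed.

Lemma cball_chart_inv d x : d <= r -> cball (X m) d x -> nball d (Y x) /\ X (Y x) = x.
Proof.
move=> dr xm; have : cball (X m) r x by rewrite /cball/= in xm *; exact: le_trans dr.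
by move=> /sub/chart_invK[h1 h2]; rewrite /nball/= h2.
Qed.

Lemma nball_image d : d <= r -> nball d = Y @` cball (X m) d.
Proof.
move=> dr; apply/seteqP; split=> [p [ip pm]|_ [x xm <-]].
  by exists (X p) => //; rewrite chartK.
by have [] := cball_chart_inv dr xm.
Qed.

Lemma compact_nball d : d <= r -> compact (nball d).
Proof.
move=> dr; rewrite nball_image//; apply: continuous_compact; last exact: compact_cball.
apply: continuous_in_subspaceT => x /set_mem xm.
apply: chart_inv_continuous; apply: sub; exact: le_trans dr.
Qed.

Lemma closed_nball d : d <= r -> closed (nball d).
Proof. by move=> dr; apply: compact_closed; [exact: carrier_hausdorff|exact: compact_nball]. Qed.

Let rr : [/\ R1 <= r, R1 / 2 <= r & rho <= r].
Proof. by have [? ? ? ? /andP[? ?]] := normal_chart_radius; split; lra. Qed.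

Definition capped_dist p z : R :=
  if `[< nball R1 z >] then Num.min (phi (X p) (X z)) (R1 / (4 * K)) else R1 / (4 * K).
Local Notation psi := capped_dist.

Lemma capped_dist_out p z : nball rho p -> ~ nball (R1 / 2) z -> psi p z = R1 / (4 * K).
Proof.
move=> [ip pm] nz; rewrite /psi; case: asboolP => // -[iz zm].
have [_ K1 _ _ /andP[r0 r1]] := normal_chart_radius.
have pm1 : cball (X m) R1 (X p) by rewrite /cball/= in pm *; lra.
have zm2 : R1 / 2 < `|X z - X m| by rewrite ltNge; apply/negP => h; apply: nz.
apply/min_idPr.
have := local_dist_norm mb pm1 zm; rewrite ler_pdivrMr ?mulr_gt0// => h.
have h2 : `|X z - X m| <= `|X z - X p| + `|X p - X m| by rewrite (le_trans _ (ler_normD _ _))// addrA subrK.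
rewrite /cball/= in pm; rewrite (_ : _ * (4 * K) = 4 * (K * phi (X p) (X z))); last by ring.
lra.
Qed.

Lemma capped_dist_speed p h (t e : R) : nball rho p -> C1_curve h -> 0 < e ->
  \forall s \near t, `|psi p (h s) - psi p (h t)| <= `|s - t| * (speed h t + e).
Proof.
move=> pm Ch e0; have [_ K1 _ R14 /andP[r0 r1]] := normal_chart_radius.
have ch := C1_continuous Ch.
have S0 s : 0 <= `|s - t| * (speed h t + e) by rewrite mulr_ge0// addr_ge0 ?speed_ge0// ltW.
have [[it tm]|nt] := pselect (chart_dom i (h t) /\ `|X (h t) - X m| < R1).
  have D := C1_is_derive Ch it.
  have H := local_dist_speed mb e0 tm D.
  rewrite (speed_chart it (ch t) D).
  apply: filterS2 (near_chart_dom (ch t) it) H => s is_ [sm hs].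
  have nt : nball R1 (h t) by split => //; exact: ltW.
  have ns : nball R1 (h s) by split.
  have pm1 : cball (X m) R1 (X p) by case: pm => _; rewrite /cball/=; lra.
  have tm1 : cball (X m) R1 (X (h t)) by case: nt.
  rewrite /psi !asboolT//; apply: le_trans hs => /=.
  have T1 := local_dist_triangle mb pm1 tm1 sm.
  have T2 := local_dist_triangle mb pm1 sm tm1.
  rewrite (local_dist_sym mb sm tm1) in T2.
  have A : `|phi (X p) (X (h s)) - phi (X p) (X (h t))| <= phi (X (h t)) (X (h s)) by rewrite ler_norml; split_lra.
  apply: le_trans A.
  move: (phi (X p) (X (h s))) (phi (X p) (X (h t))) (R1 / (4 * K)) => a b c.
  rewrite /Num.min; case: ltP => ac; case: ltP => bc //; rewrite ?subrr ?normr0//.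
    by clear -T1 ac bc; rewrite !ler0_norm; lra.
  by clear -T1 ac bc; rewrite !ger0_norm; lra.
have nA : ~ nball (R1 / 2) (h t) by move=> [it tm]; apply: nt; split => //; rewrite /cball/= in tm; lra.
have [_ r2 _] := rr.
have oA : open (~` nball (R1 / 2)) by apply: closed_openC; exact: closed_nball.
have near1 : \forall s \near t, ~ nball (R1 / 2) (h s).
  have : nbhs (h t) (~` nball (R1 / 2)) by apply: open_nbhs_nbhs; split.
  by move=> /(ch t).
apply: filterS near1 => s ns; rewrite !capped_dist_out// subrr normr0; exact: S0.
Qed.

Lemma capped_dist_length p g (a b l : R) : nball rho p -> pwC1 g a b l ->
  psi p (g b) - psi p (g a) <= l.
Proof.
move=> pm; elim=> {a b l} [a b h P l ab Ch gh dP ->|a b c l1 l2 _ H1 _ H2]; last by lra.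
have ga : g a = h a by apply: gh; rewrite in_itv/= lexx ltW.
have gb : g b = h b by apply: gh; rewrite in_itv/= lexx ltW.
rewrite ga gb; apply/ler_addgt0Pr => e e0.
pose e' := e / (b - a); have e'0 : 0 < e' by rewrite divr_gt0// subr_gt0.
pose Q s t := psi p (h t) - psi p (h s) <= P t - P s + e' * (t - s).
suff : Q a b by rewrite /Q /e' divfK// subr_eq0 gt_eqF.
apply: (@interval_gluing _ Q) => [|s t u _ _|t tab]; [exact: ltW|by rewrite /Q; lra|].
have e20 : 0 < e' / 2 by rewrite divr_gt0.
have N1 := capped_dist_speed t pm Ch e20.
have tI : t \in `[a, b] by rewrite in_itv.
have [dd E] := dP t tI; have df : differentiable P t by apply/derivable1_diffP.
have N2 := differentiable_eps df e20.
have N3 : \forall s \near t, `|P s - P t - (s - t) * speed h t| <= e' / 2 * `|s - t| by apply: filterS N2 => s; rewrite diff1E// derive1E E.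
have [d d0 Hd] : exists2 d : R, 0 < d & forall s, `|t - s| < d ->
   `|psi p (h s) - psi p (h t)| <= `|s - t| * (speed h t + e' / 2) /\
   `|P s - P t - (s - t) * speed h t| <= e' / 2 * `|s - t|.
  have := filterI N1 N3; rewrite nbhs_ballP => -[d d0 H].
  by exists d => // s st; exact: H.
exists d => // s s' _ _ ds st ts' s'd; rewrite /Q.
have [A1 A2] : `|psi p (h s) - psi p (h t)| <= `|s - t| * (speed h t + e' / 2) /\
   `|P s - P t - (s - t) * speed h t| <= e' / 2 * `|s - t|.
  by clear -Hd ds st; apply: Hd; rewrite ger0_norm; lra.
have [B1 B2] : `|psi p (h s') - psi p (h t)| <= `|s' - t| * (speed h t + e' / 2) /\
   `|P s' - P t - (s' - t) * speed h t| <= e' / 2 * `|s' - t|.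
  by clear -Hd ts' s'd; apply: Hd; rewrite ler0_norm; lra.
rewrite (distrC s) (ger0_norm (x := t - s)) in A1 A2; last lra.
rewrite (ger0_norm (x := s' - t)) in B1 B2; last lra.
move: A1 A2 B1 B2; rewrite !ler_norml => /andP[A1 _] /andP[A2 A3] /andP[_ B1] /andP[B2 B3].
clear -A1 A3 B1 B2; nra.
Qed.

Lemma dist_ge_capped p q : nball rho p -> ((psi p q)%:E <= dist p q)%E.
Proof.
move=> pm; apply: le_ereal_inf_tmp => _ [g [pg g0 g1] <-].
have [l H] := piecewise_C1_pwC1 pg; have [_ ->] := pwC1_length H.
have := capped_dist_length pm H; rewrite lee_fin g0 g1.
suff -> : psi p p = 0 by rewrite subr0.
have [_ _ _ _ /andP[r0 r1]] := normal_chart_radius.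
have pm1 : nball R1 p by apply: nball_le pm; lra.
rewrite /psi asboolT// (local_distxx mb); last by case: pm1.
by apply/min_idPl; rewrite divr_ge0 ?mulr_ge0 ?ltW.
Qed.

Lemma dist_le_local p q : nball rho p -> nball rho q ->
  (dist p q <= (phi (X p) (X q))%:E)%E.
Proof.
move=> [ip pm] [iq qm]; have pm1 := dist_radius_cball mb pm; have qm1 := dist_radius_cball mb qm.
have [x [u S]] := ex_geodesic_segment mb pm1 qm1.
have [[[x0 x1] [cx _ Ux] [cu _ _] _] xm _ _] := S.
pose sg (t : R) := (1 - cos (pi * t)) / 2.
pose dsg (t : R) := pi * sin (pi * t) / 2.
have dsgP (t : R) : is_derive t (1 : R) sg (dsg t).
  have d1 : is_derive t (1 : R) (fun t : R => pi * t) pi by have := is_deriveZ (pi : R) (is_derive_id t (1 : R)); rewrite [_ *: 1]mulr1.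
  have d2 := is_derive1_comp (is_derive_cos (pi * t)) d1.
  have d3 := is_deriveZ (2^-1 : R) (is_deriveB (is_derive_cst (1 : R) t (1 : R)) d2).
  have e1 : 2^-1 *: (0 - - sin (pi * t) * pi) = dsg t by rewrite /dsg [LHS]mulrC; ring.
  rewrite -e1 (_ : sg = 2^-1 \*: (cst 1 - (cos \o (fun t => pi * t)))); first exact: d3.
  by apply/funext => s; rewrite /sg mulrC.
have sgI (t : R) : 0 <= sg t <= 1 by have := cos_geN1 (pi * t); have := cos_le1 (pi * t); rewrite /sg => *; split_lra.
have sgI' (t : R) : sg t \in `](-1), 2[ by have /andP[? ?] := sgI t; rewrite in_itv/=; split_lra.
pose y t := x (sg t); pose w t := dsg t *: u (sg t).
have csg : continuous sg by move=> t; exact: (is_derive_continuous (dsgP t)).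
have dy (t : R) : is_derive t (1 : R) y (w t).
  apply/is_derive_rV => k; have dk := (is_derive_rV _ _ _).1 (Ux _ (sgI' t)) k.
  have := is_derive1_comp dk (dsgP t); by rewrite mxE mulrC.
have cdsg : continuous dsg.
  move=> t; apply: cvgM; last exact: cvg_cst.
  apply: cvgM; first exact: cvg_cst.
  apply: (@continuous_comp _ _ _ (fun t => pi * t) sin); last exact: continuous_sin.
  by apply: cvgM; [exact: cvg_cst|exact: cvg_id].
have cw : continuous w.
  move=> t; apply: cvgZ; first exact: cdsg.
  by apply: (@continuous_comp _ _ _ sg u); [exact: csg|exact: cu].
have yi t : chart_image i (y t) by exact/sub/xm.
have Ch := C1_curve_chart_inv yi dy cw.
have sp (t : R) : t \in `[0, 1] -> is_derive t (1 : R) (fun t => sg t * phi (X p) (X q)) (speed (Y \o y) t).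
  rewrite in_itv/= => /andP[t0 t1].
  have [idom XY] := chart_invK (yi t).
  have D : is_derive t (1 : R) (X \o (Y \o y)) (w t).
    rewrite (_ : X \o (Y \o y) = y); first exact: dy.
    by apply/funext => s /=; have [] := chart_invK (yi s).
  rewrite (speed_chart (g := Y \o y) idom (C1_continuous Ch (x := t)) D).
  have -> : X ((Y \o y) t) = y t by exact: XY.
  have sgt : - 2^-1 <= sg t <= 3 / 2 by have /andP[? ?] := sgI t; split_lra.
  rewrite gformZl gformZr (segment_energy mb S sgt) mulrA -expr2 -exprMn sqrtr_sqr.
  have d0 : 0 <= dsg t.
    have p0 := pi_ge0 R; rewrite /dsg divr_ge0// mulr_ge0//.
    by apply: sin_ge0_pi; rewrite mulr_ge0//= ler_piMr.
  have d1 : 0 <= dsg t * phi (X p) (X q) by apply: mulr_ge0 => //; exact: local_dist_ge0.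
  rewrite (ger0_norm d1) mulrC.
  have -> : (fun t => sg t * phi (X p) (X q)) = phi (X p) (X q) \*: sg by apply/funext => s; exact: mulrC.
  exact: (is_deriveZ (phi (X p) (X q)) (dsgP t)).
have g0 : (Y \o y) 0 = p by rewrite /= /y /sg mulr0 cos0 subrr mul0r x0 chartK.
have g1 : (Y \o y) 1 = q by rewrite /= /y /sg mulr1 cospi (_ : (1 - -1) / 2 = 1) ?x1 ?chartK//; field.
have E : {in `[0, 1], Y \o y =1 Y \o y} by [].
have := dist_le_length (PwPiece ltr01 Ch E sp erefl).
rewrite g0 g1 /sg mulr0 mulr1 cos0 cospi.
by rewrite (_ : _ - _ = phi (X p) (X q))//; field.
Qed.

Lemma dist_local p q : nball rho p -> nball rho q -> dist p q = (phi (X p) (X q))%:E.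
Proof.
move=> pm qm; apply/eqP; rewrite eq_le dist_le_local//=.
have [_ K1 _ _ /andP[r0 r1]] := normal_chart_radius.
have qm1 : nball R1 q by apply: nball_le qm; lra.
have := dist_ge_capped q pm; rewrite /psi asboolT//; rewrite (min_idPl _)//.
apply: (le_trans (local_dist_small mb _ _)); [by case: pm|by case: qm|].
by rewrite ler_pM2l// lef_pV2 ?posrE ?mulr_gt0//; lra.
Qed.

Lemma dist_lt_nball p q (e : R) : nball rho p -> (dist p q < e%:E)%E -> e <= R1 / (4 * K) ->
  nball (R1 / 2) q /\ `|X q - X p| <= K * e.
Proof.
move=> pm pq e1; have := le_lt_trans (dist_ge_capped q pm) pq; rewrite lte_fin => H.
have nq : nball (R1 / 2) q by apply: contrapT => nq; move: H; rewrite capped_dist_out//; lra.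
split => //; have [_ K1 _ _ /andP[r0 r1]] := normal_chart_radius.
have qm1 : nball R1 q by apply: nball_le nq; lra.
have pm1 : nball R1 p by apply: nball_le pm; lra.
move: H; rewrite /psi asboolT// gt_min => /orP[H|]; last lra.
apply: (le_trans (local_dist_norm mb _ _)); [by case: pm1|by case: qm1|].
by rewrite ler_wpM2l ?ltW.
Qed.

End normal_neighbourhood.

Section local_isometry.
Context {R : realType} {n : nat} {M : riemannianManifold R n}.
Implicit Types (p q z m : M) (i : chart_index M) (g h : R -> M).
Local Notation X := (@chart R n M).
Local Notation Y := (@chart_inv R n M).

Lemma ex_normal_chart i m : chart_dom i m -> exists r K, normal_chart i m r K.
Proof. by move=> im; have [r [K [mb sub]]] := ex_chart_metric_ball im; exists r, K. Qed.

Lemma nbhs_dist_lt m (e : R) : 0 < e -> \forall z \near m, (dist m z < e%:E)%E.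
Proof.
move=> e0; pose i := chart_at m; have im : chart_dom i m := mem_chart_at m.
have [r [K nc]] := ex_normal_chart im; have [_ mb sub] := nc.
have [r0 K1 R10 _ /andP[h0 h1]] := normal_chart_radius nc.
pose d := Num.min (dist_radius r K) (e / (3 * K)).
have d0 : 0 < d by rewrite lt_min h0 divr_gt0// mulr_gt0//; lra.
have := @nbhs_nball _ _ _ i m d m im; rewrite subrr normr0 => /(_ d0).
apply: filterS => z zd.
have z1 : nball i m (dist_radius r K) z by apply: nball_le zd; rewrite ge_min lexx.
have m1 : nball i m (dist_radius r K) m by split => //; rewrite /cball/= subrr normr0 ltW.
rewrite (dist_local nc m1 z1) lte_fin.
have [_ mR] := m1; have [_ zR] := z1; have [_ zd'] := zd.
apply: (le_lt_trans (norm_local_dist mb (dist_radius_cball mb mR) (dist_radius_cball mb zR))).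
have : `|X i z - X i m| <= e / (3 * K) by apply: (le_trans zd'); rewrite ge_min lexx orbT.
rewrite ler_pdivlMr ?mulr_gt0//; last lra.
move: (`|_ - _|) (normr_ge0 (X i z - X i m)) => x x0; nra.
Qed.

Lemma nbhs_ex_dist m (U : set M) : nbhs m U ->
  exists2 e : R, 0 < e & forall z, (dist m z < e%:E)%E -> U z.
Proof.
move=> mU; pose i := chart_at m; have im : chart_dom i m := mem_chart_at m.
have [r [K nc]] := ex_normal_chart im; have [_ mb sub] := nc.
have [r0 K1 R10 _ /andP[h0 h1]] := normal_chart_radius nc.
have : \forall x \near X i m, U (Y i x).
  by apply: (chart_inv_continuous (chart_image_mem im)); rewrite chartK.
move=> /nbhs_ballP[d d0 Hd].
pose e := Num.min (geodesic_radius r K / (4 * K)) (d / (2 * K)).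
have K0 : 0 < K by lra.
have e0 : 0 < e by rewrite lt_min !divr_gt0// mulr_gt0.
exists e => // z mz.
have m1 : nball i m (dist_radius r K) m by split => //; rewrite /cball/= subrr normr0 ltW.
have [|[iz _] zm] := dist_lt_nball nc m1 mz; first by rewrite ge_min lexx.
rewrite -(chartK iz); apply: Hd; rewrite -ball_normE/= distrC (le_lt_trans zm)//.
have : e <= d / (2 * K) by rewrite ge_min lexx orbT.
by rewrite ler_pdivlMr ?mulr_gt0//; move: d0; rewrite /= => *; nra.
Qed.

Lemma dist_eq0 p q : dist p q = 0%E -> p = q.
Proof.
move=> pq; apply: carrier_hausdorff => A B /nbhs_ex_dist[e e0 He] /nbhs_singleton qB.
by exists q; split => //; apply: He; rewrite pq lte_fin.
Qed.

Definition isometric_on (A : set R) g := forall s t, A s -> A t ->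
  dist (g s) (g t) = (`|s - t|)%:E.

Definition locally_isometric g (t : R) := exists2 d : R, 0 < d &
  isometric_on [set s | `|s - t| < d] g.

Lemma isometric_chart g (t : R) i : locally_isometric g t -> chart_dom i (g t) ->
  exists r K d x u, [/\ normal_chart i (g t) r K, 0 < d,
    geodesic_segment (@metric R n M i) (X i (g t)) r K (x 0) (x 1) x u,
    forall s : R, `|s - t| <= d -> [/\ nball i (g t) (dist_radius r K) (g s),
       X i (g s) = x ((2 * d)^-1 * s + (2^-1 - (2 * d)^-1 * t)) &
       gform (@metric R n M i) (X i (g s)) (u ((2 * d)^-1 * s + (2^-1 - (2 * d)^-1 * t)))
         (u ((2 * d)^-1 * s + (2^-1 - (2 * d)^-1 * t))) = (2 * d) ^+ 2] &
    [/\ cball (X i (g t)) (dist_radius r K / 10) (x 0) & cball (X i (g t)) (dist_radius r K / 10) (x 1)]].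
Proof.
move=> [e e0 He] im; have [r [K nc]] := ex_normal_chart im; have [_ mb sub] := nc.
have [r0 K1 R10 _ /andP[h0 h1]] := normal_chart_radius nc.
have K0 : 0 < K by lra.
pose rho := dist_radius r K.
pose d := Num.min (e / 2) (Num.min (geodesic_radius r K / (8 * K)) (rho / (20 * K))).
have d0 : 0 < d by rewrite !lt_min; apply/and3P; split; apply: divr_gt0 => //; exact: mulr_gt0.
have de : d < e by rewrite gt_min; apply/orP; left; lra.
have d1 : 2 * d <= geodesic_radius r K / (4 * K).
  rewrite (_ : _ / (4 * K) = 2 * (geodesic_radius r K / (8 * K))); last by field; rewrite gt_eqF.
  by rewrite ler_pM2l// !ge_min lexx !orbT.
have d2 : K * (2 * d) <= rho / 10.
  rewrite (_ : rho / 10 = K * (2 * (rho / (20 * K)))); last by field; rewrite gt_eqF.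
  by rewrite !ler_pM2l// !ge_min lexx !orbT.
clearbody d; have rho0 : 0 < rho := h0.
have m1 : nball i (g t) rho (g t) by split => //; rewrite /cball/= subrr normr0 ltW.
have near s : `|s - t| <= d -> nball i (g t) (rho / 10) (g s).
  move=> sd; have ds : (dist (g t) (g s) < (2 * d)%:E)%E.
    rewrite He/= ?subrr ?normr0// ?lte_fin ?(le_lt_trans sd)//; last by rewrite distrC; lra.
  have [[is_ _] sm] := dist_lt_nball nc m1 ds d1.
  by split => //; rewrite /cball/= (le_trans sm).
have rho10 : rho / 10 <= rho by lra.
have near' s sd : nball i (g t) rho (g s) := nball_le rho10 (near s sd).
have tm : `|(t - d) - t| <= d by rewrite addrAC subrr add0r normrN (ger0_norm (ltW d0)).
have tp : `|(t + d) - t| <= d by rewrite addrAC subrr add0r (ger0_norm (ltW d0)).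
pose p := g (t - d); pose q := g (t + d).
have [_ pm] := near' _ tm; have [_ qm] := near' _ tp.
have pm1 := dist_radius_cball mb pm; have qm1 := dist_radius_cball mb qm.
have [x [u S]] := ex_geodesic_segment mb pm1 qm1.
have [[[x0 x1] _ _ _] _ _ _] := S.
have loc s s' : `|s - t| <= d -> `|s' - t| <= d ->
    local_dist (@metric R n M i) (X i (g t)) r K (X i (g s)) (X i (g s')) = `|s - s'|.
  move=> sd sd'; have := dist_local nc (near' _ sd) (near' _ sd').
  by rewrite He/= ?(le_lt_trans sd) ?(le_lt_trans sd')// => -[].
have pq := loc _ _ tm tp; rewrite (_ : t - d - (t + d) = - (2 * d)) in pq; last by ring.
rewrite normrN ger0_norm in pq; last by rewrite mulr_ge0// (ltW d0).
exists r, K, d, x, u; split => //; first by rewrite x0 x1.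
- move=> s sd; have [_ sm] := near' _ sd; move: (sd); rewrite ler_norml => /andP[s1 s2].
  have aE : (2 * d)^-1 * s + (2^-1 - (2 * d)^-1 * t) = (s - t + d) / (2 * d) by field; rewrite gt_eqF.
  have a0 : 0 <= (s - t + d) / (2 * d) by clear -s1 s2; apply: divr_ge0; lra.
  have a1 : (s - t + d) / (2 * d) <= 1 by clear -d0 s2; rewrite ler_pdivrMr ?mulr_gt0//; lra.
  have a2 : (s - t + d) / (2 * d) * (2 * d) = s - t + d by rewrite divfK// gt_eqF// mulr_gt0.
  have L1 : local_dist (@metric R n M i) (X i (g t)) r K (X i p) (X i (g s)) = s - t + d.
    by clear -tm loc sd s1; rewrite loc// ler0_norm; [ring|lra].
  have L2 : local_dist (@metric R n M i) (X i (g t)) r K (X i (g s)) (X i q) = t + d - s.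
    by clear -tp loc sd s2; rewrite loc// ler0_norm; [ring|lra].
  have XE : X i (g s) = x ((s - t + d) / (2 * d)).
    apply: (local_dist_equality mb pm1 (dist_radius_cball mb sm) qm1 S); first by apply/andP.
      by rewrite pq a2.
    by rewrite pq mulrBl a2 mul1r L2; ring.
  have sI : - 2^-1 <= (s - t + d) / (2 * d) <= 3 / 2 by clear -a0 a1; move: a0 a1; move: (_ / (2 * d)) => a *; split_lra.
  have E := segment_energy mb S sI; rewrite pq in E.
  by split; [exact: near'|rewrite aE|rewrite aE XE].
- by rewrite x0 x1; have [_ a] := near _ tm; have [_ b] := near _ tp.
Qed.

Lemma locally_isometric_derive g (t : R) i : locally_isometric g t -> chart_dom i (g t) ->
  exists c v, [/\ {for t, continuous g}, 0 < c,
   \forall s \near t, is_derive s (1 : R) (X i \o g) (c *: v s) /\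
      is_derive s (1 : R) (fun s => c *: v s) (gaccel (@metric R n M i) (X i (g s)) (c *: v s)) &
   gform (@metric R n M i) (X i (g t)) (c *: v t) (c *: v t) = 1].
Proof.
move=> lg im; have [r [K [d [x [u [nc d0 S H _]]]]]] := isometric_chart lg im.
have [[_ [cx _ Ux] [cu _ Uu] _] xm _ _] := S.
pose c := (2 * d)^-1; pose b := 2^-1 - c * t; have c0 : 0 < c by rewrite invr_gt0 mulr_gt0.
have nr : \forall s \near t, `|s - t| < d by have := nbhsx_ballx t _ d0; apply: filterS => s; rewrite /ball/= distrC.
have nr2 : \forall s \near t, \forall w \near s, `|w - t| < d.
  apply: filterS nr => s sd; have o : 0 < d - `|s - t| by rewrite subr_gt0.
  have := nbhsx_ballx s _ o; apply: filterS => w; rewrite /ball/= distrC => h.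
  by rewrite (_ : w - t = (w - s) + (s - t)) ?(le_lt_trans (ler_normD _ _))//; [lra|ring].
have G : \forall s \near t, g s = Y i (x (c * s + b)) by apply: filterS nr => s sd; have [[is_ _] <- _] := H s (ltW sd); rewrite chartK.
have ca : {for t, continuous (fun s => c * s + b)} by apply: cvgD; [apply: cvgM; [exact: cvg_cst|exact: cvg_id]|exact: cvg_cst].
have tt : `|t - t| <= d by rewrite subrr normr0 ltW.
have [_ Et Gt] := H t tt.
exists c, (fun s => u (c * s + b)); split => //.
- apply: (@near_eq_continuous _ _ (fun s => Y i (x (c * s + b)))).
    by apply: filterS G => s ->.
  have cY : {for x (c * t + b), continuous (Y i)} by apply: chart_inv_continuous; rewrite -Et; exact: chart_image_mem.
  have cxa : {for t, continuous (fun s => x (c * s + b))} by apply: (@continuous_comp _ _ _ (fun s => c * s + b) x); [exact: ca|exact: cx].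
  exact: (@continuous_comp _ _ _ (fun s => x (c * s + b)) (Y i) t cxa cY).
- near=> s.
  have sd : `|s - t| < d by near: s.
  have sI : c * s + b \in `](-1), 2[.
    move: sd; rewrite ltr_norml => /andP[s1 s2].
    rewrite in_itv/= /b (_ : c * s + _ = c * (s - t) + 2^-1); last by ring.
    have : c * (s - t) <= 2^-1 by rewrite /c invfM -mulrA ler_piMr// ler_pdivrMl// mulr1 ltW.
    have : - 2^-1 <= c * (s - t).
      rewrite lerNl -mulrN /c invfM -mulrA ler_piMr// ler_pdivrMl// mulr1 ltW//; lra.
    by clear; move=> *; split_lra.
  split.
    have D := is_derive_affine (Ux _ sI).
    have Es : \forall w \near s, x (c * w + b) = (X i \o g) w.
      have : \forall w \near s, `|w - t| < d by near: s.
      by apply: filterS => w wd; have [_ /esym] := H w (ltW wd).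
    exact: (is_derive_near Es D).
  have D := is_derive_affine (Uu _ sI).
  have D' := is_deriveZ c D.
  have Es : X i (g s) = x (c * s + b) by have [] := H s (ltW sd).
  by rewrite gaccelZ expr2 -scalerA Es; exact: D'.
- rewrite gformZl gformZr Gt /c; field; rewrite gt_eqF//.
Unshelve. all: by end_near.
Qed.

End local_isometry.

Section dist_arith.
Context {R : realType} {n : nat} {M : riemannianManifold R n}.
Implicit Types (p q z x y : M).

Lemma dist_le_add x y z (a b : R) : (dist x y <= a%:E)%E -> (dist y z <= b%:E)%E ->
  (dist x z <= (a + b)%:E)%E.
Proof. by move=> h1 h2; apply: (le_trans (dist_triangle x y z)); rewrite EFinD leeD. Qed.

Lemma dist_ge_sub x y z (a b : R) : (a%:E <= dist x z)%E -> (dist y z <= b%:E)%E ->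
  ((a - b)%:E <= dist x y)%E.
Proof.
move=> h1 h2; rewrite EFinB leeBlDr//; apply: (le_trans h1).
by apply: (le_trans (dist_triangle x y z)); rewrite leeD2l.
Qed.

Lemma dist_le_fin x y (a : R) : (dist x y <= a%:E)%E -> exists2 d : R, 0 <= d <= a & dist x y = d%:E.
Proof.
move=> h; have f : dist x y \is a fin_num by rewrite ge0_fin_numE ?dist_ge0// (le_lt_trans h) ?ltry.
exists (fine (dist x y)); last by rewrite fineK.
by rewrite -!lee_fin fineK// h dist_ge0.
Qed.

Lemma dist_additive x y z (a b : R) : (dist x y <= a%:E)%E -> (dist y z <= b%:E)%E ->
  ((a + b)%:E <= dist x z)%E -> dist x y = a%:E /\ dist y z = b%:E.
Proof.
move=> h1 h2 h3; split; apply/eqP; rewrite eq_le ?h1 ?h2/=.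
  by have := dist_ge_sub h3 h2; rewrite addrK.
rewrite dist_sym; apply: (@le_trans _ _ ((a + b) - a)%:E); first by rewrite addrC addrA addNr add0r.
by apply: (dist_ge_sub (z := x)); rewrite 1?dist_sym.
Qed.

Lemma compact_cluster_seq (K : set M) (u : nat -> M) : compact K -> (forall k, K (u k)) ->
  exists2 z, K z & forall (e : R) N, 0 < e -> exists2 k, (N <= k)%N & (dist z (u k) < e%:E)%E.
Proof.
move=> cK Ku; have FK : (u @ \oo) K by exists 0%N => // k _; exact: Ku.
have [z [Kz cz]] := cK _ _ FK.
exists z => // e N e0; have U := nbhs_dist_lt z e0.
have [|_ [[k Nk <-] zk]] := cz (u @` [set k | (N <= k)%N]) _ _ U.
  by exists N => // k Nk; exists k.
by exists k.
Qed.

End dist_arith.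

Section local_segments.
Context {R : realType} {n : nat} {M : riemannianManifold R n}.
Implicit Types (p q z m : M) (i : chart_index M) (g h : R -> M).
Local Notation X := (@chart R n M).
Local Notation Y := (@chart_inv R n M).

Lemma near_locally_isometric g (t : R) : locally_isometric g t ->
  \forall s \near t, locally_isometric g s.
Proof.
move=> [d d0 H]; have := nbhsx_ballx t _ d0; apply: filterS => s; rewrite /ball/= distrC => sd.
exists (d - `|s - t|); first by rewrite subr_gt0.
have S w : `|w - s| < d - `|s - t| -> `|w - t| < d.
  move=> h; rewrite (_ : w - t = (w - s) + (s - t)) ?(le_lt_trans (ler_normD _ _))//; [lra|ring].
by move=> a b /S ha /S hb; exact: H.
Qed.

Lemma locally_isometric_geodesic_at g (t : R) : locally_isometric g t -> geodesic_at g t.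
Proof.
move=> lg; split.
  by have [c [v [? _ _ _]]] := locally_isometric_derive lg (mem_chart_at _).
move=> i it; have [c [v [_ c0 D _]]] := locally_isometric_derive lg it.
have [D1 D2] := nbhs_singleton D; split; first by case: D1.
  have E : \forall s \near t, c *: v s = derive1 (X i \o g) s by apply: filterS D => s [/is_derive1_derive1].
  by have [] := is_derive_near E D2.
move=> k; have E : \forall s \near t, c *: v s = derive1 (X i \o g) s by apply: filterS D => s [/is_derive1_derive1].
rewrite (is_derive1_derive1 (is_derive_near E D2)) (is_derive1_derive1 D1).
by rewrite mxE addNr.
Qed.

Lemma locally_isometric_speed g (t : R) : locally_isometric g t -> speed g t = 1.
Proof.
move=> lg; have it : chart_dom (chart_at (g t)) (g t) := mem_chart_at _.
have [c [v [cg c0 D E]]] := locally_isometric_derive lg it.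
have [D1 _] := nbhs_singleton D.
by rewrite (speed_chart it cg D1) E sqrtr1.
Qed.

Definition unit_segment g (a : R) := [/\ 0 < a, isometric_on `[0, a] g &
  forall t : R, t \in `[0, a] -> locally_isometric g t].

Lemma unit_segment_minimising g (a : R) : unit_segment g a -> minimising_geodesic g a.
Proof.
move=> [a0 iso loc]; split; first exact: ltW.
- move=> t ta; have := near_locally_isometric (loc t ta).
  by apply: filterS => s; exact: locally_isometric_geodesic_at.
- by left; split => // t /loc/locally_isometric_speed.
- rewrite /length_over.
  rewrite (eq_integral (fun=> 1%E)); last first.
    by move=> t /set_mem ta; rewrite locally_isometric_speed//; exact: loc.
  rewrite integral_cst//= mul1e lebesgue_measure_itv/= lte_fin a0 iso/=.
  - by rewrite sub0r normrN (gtr0_norm a0) -EFinB subr0.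
  - by rewrite in_itv/= lexx ltW.
  - by rewrite in_itv/= lexx ltW.
Qed.

Lemma ex_local_segment m : exists2 rho : R, 0 < rho & forall p q, (dist m p < rho%:E)%E ->
  (dist m q < rho%:E)%E -> p <> q -> exists g (a : R), [/\ 0 < a, g 0 = p, g a = q,
   isometric_on [set s | - (a / 2) <= s <= a + a / 2] g &
   forall z (s : R), 0 <= s <= a -> dist p z = s%:E -> dist z q = (a - s)%:E -> z = g s].
Proof.
pose i := chart_at m; have im : chart_dom i m := mem_chart_at m.
have [r [K nc]] := ex_normal_chart im; have [_ mb sub] := nc.
have [r0 K1 R10 r4 /andP[h0 h1]] := normal_chart_radius nc.
have K0 : 0 < K by lra.
have [h0' h2 h3 h4] := dist_radiusP mb.
pose rho := Num.min (geodesic_radius r K / (16 * K)) (dist_radius r K / (40 * K)).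
have rho0 : 0 < rho by rewrite lt_min; apply/andP; split; apply: divr_gt0 => //; exact: mulr_gt0.
have rho1 : rho * (16 * K) <= geodesic_radius r K by rewrite -ler_pdivlMr ?mulr_gt0// ge_min lexx.
have rho2 : rho * (40 * K) <= dist_radius r K by rewrite -ler_pdivlMr ?mulr_gt0// ge_min lexx orbT.
clearbody rho.
have m1 : nball i m (dist_radius r K) m by split => //; rewrite /cball/= subrr normr0 ltW.
have near z : (dist m z < (4 * rho)%:E)%E -> nball i m (dist_radius r K / 10) z.
  move=> mz; have [|[iz _] zm] := dist_lt_nball nc m1 mz.
    by rewrite ler_pdivlMr ?mulr_gt0//; move: rho1; rewrite (_ : 4 * rho * _ = rho * (16 * K)) //; ring.
  split => //; apply: (le_trans zm); rewrite (_ : K * _ = rho * (40 * K) / 10); first lra.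
  by field.
have le10 : dist_radius r K / 10 <= dist_radius r K by lra.
exists rho => // p q mp mq pq.
have mp' : (dist m p < (4 * rho)%:E)%E by apply: (lt_trans mp); rewrite lte_fin; lra.
have mq' : (dist m q < (4 * rho)%:E)%E by apply: (lt_trans mq); rewrite lte_fin; lra.
have p10 := near p mp'; have q10 := near q mq'.
have p1 := nball_le le10 p10; have q1 := nball_le le10 q10.
have [ip pm] := p1; have [iq qm] := q1.
have pm1 := dist_radius_cball mb pm; have qm1 := dist_radius_cball mb qm.
have [x [u S]] := ex_geodesic_segment mb pm1 qm1.
have [[[x0 x1] _ _ _] xm _ _] := S.
pose a := local_dist (@metric R n M i) (X i m) r K (X i p) (X i q).
have dpq : dist p q = a%:E := dist_local nc p1 q1.
have a0 : 0 < a.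
  rewrite lt_def local_dist_ge0 andbT; apply/eqP => E; apply: pq; apply: dist_eq0.
  by rewrite dpq E.
have xb (s : R) : - 2^-1 <= s <= 3 / 2 -> nball i m (dist_radius r K) (Y i (x s)) /\ X i (Y i (x s)) = x s.
  move=> sI; have xs : cball (X i m) (dist_radius r K) (x s).
    have sI' : - 1 <= s <= 2 by clear -sI; move: sI => /andP[? ?]; split_lra.
    have H := segment_near_start S sI'.
    have N : `|X i q - X i p| <= 2 * (dist_radius r K / 10).
      have [_ a1] := p10; have [_ a2] := q10; rewrite /cball/= in a1 a2.
      rewrite (_ : X i q - X i p = (X i q - X i m) - (X i p - X i m)); last by rewrite opprB addrA subrK.
      by clear -a1 a2; rewrite (le_trans (ler_normB _ _))//; lra.
    have sN : `|s| <= 3 / 2 by clear -sI; move: sI => /andP[? ?]; rewrite ler_norml; split_lra.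
    have H' : `|x s - X i p| <= 2 * (2 * (dist_radius r K / 10)) * (3 / 2) by apply: (le_trans H); rewrite ler_pM ?mulr_ge0 ?ler_wpM2l.
    have [_ a1] := p10; rewrite /cball/= in a1 *.
    rewrite (_ : x s - X i m = (x s - X i p) + (X i p - X i m)); last by rewrite addrA subrK.
    by clear -le10 H' a1; rewrite (le_trans (ler_normD _ _))//; lra.
  have rr : dist_radius r K <= r by clear -R10 r4 h1; lra.
  exact: (cball_chart_inv nc rr xs).
pose g s := Y i (x (s / a)).
have sI (s : R) : - (a / 2) <= s <= a + a / 2 -> - 2^-1 <= s / a <= 3 / 2.
  by clear -a0; move=> /andP[s1 s2]; rewrite ler_pdivlMr// ler_pdivrMr//; split_lra.
exists g, a; split => //.
- by rewrite /g mul0r x0 chartK.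
- by rewrite /g divff ?gt_eqF// x1 chartK.
- move=> s t /sI s1 /sI t1; have [ns es] := xb _ s1; have [nt et] := xb _ t1.
  rewrite (dist_local nc ns nt) es et (segment_local_dist mb pm qm S s1 t1) -/a.
  congr (_%:E); rewrite distrC -mulrBl normrM (ger0_norm (x := a^-1)) ?invr_ge0 ?(ltW a0)//.
  by rewrite divfK// gt_eqF.
- move=> z s /andP[s0 sa] pz zq.
  have a2 : a < 2 * rho.
    rewrite -lte_fin -dpq (_ : 2 * rho = rho + rho); last by ring.
    by apply: (le_lt_trans (dist_triangle p m q)); rewrite EFinD lteD// dist_sym.
  have mz : nball i m (dist_radius r K) z.
    apply: (nball_le le10); apply: near; apply: (le_lt_trans (dist_triangle m p z)).
    rewrite pz (_ : 4 * rho = rho + 3 * rho); last by ring.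
    by clear -mp a0 sa a2; rewrite EFinD lte_leD ?fin_numE// lee_fin; lra.
  have [iz zm] := mz.
  have E1 := dist_local nc p1 mz; rewrite pz in E1; have E2 := dist_local nc mz q1; rewrite zq in E2.
  have {}E1 : local_dist (@metric R n M i) (X i m) r K (X i p) (X i z) = s / a * a by rewrite divfK ?gt_eqF//; case: E1.
  have {}E2 : local_dist (@metric R n M i) (X i m) r K (X i z) (X i q) = (1 - s / a) * a by rewrite mulrBl mul1r divfK ?gt_eqF//; case: E2.
  rewrite -(chartK iz) /g; congr (Y i _).
  apply: (local_dist_equality mb pm1 (dist_radius_cball mb zm) qm1 S) => //.
  by rewrite divr_ge0 ?(ltW a0)//= ler_pdivrMr// mul1r.
Qed.


Lemma isometric_on_sub (A B : set R) g : A `<=` B -> isometric_on B g -> isometric_on A g.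
Proof. by move=> AB H s t /AB sB /AB tB; exact: H. Qed.

Lemma extend_left g (a : R) : 0 < a -> isometric_on `[0, a] g ->
  exists h (d : R), [/\ 0 < d, h 0 = g 0, isometric_on [set s | - d < s < d] h &
    forall s, 0 <= s <= d -> s <= a -> h s = g s].
Proof.
move=> a0 iso; have [rho rho0 H] := ex_local_segment (g 0).
pose e := Num.min a (rho / 2).
have e0 : 0 < e by rewrite lt_min a0 divr_gt0.
have ea : e <= a by rewrite ge_min lexx.
have er : e < rho by rewrite gt_min; apply/orP; right; lra.
clearbody e.
have I s : 0 <= s <= e -> `[0, a]%classic s by move=> /andP[s0 se]; rewrite /= in_itv/= s0 (le_trans se).
have D s t : 0 <= s <= e -> 0 <= t <= e -> dist (g s) (g t) = (`|s - t|)%:E by move=> /I ? /I ?; exact: iso.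
have z0 : 0 <= (0 : R) <= e by rewrite lexx ltW.
have ee : 0 <= e <= e by rewrite lexx ltW.
have dE : dist (g 0) (g e) = e%:E by rewrite D// sub0r normrN gtr0_norm.
have [|||h [b [b0 h0 hb hi hu]]] := H (g 0) (g e).
- by rewrite distxx lte_fin.
- by rewrite dE lte_fin.
- by move=> E; move: dE; rewrite -E distxx => -[E']; move: e0; rewrite -E' ltxx.
have bE : b = e.
  have : dist (h 0) (h b) = (`|0 - b|)%:E by clear -b0 hi; apply: hi; rewrite /=; split_lra.
  by rewrite h0 hb dE sub0r normrN gtr0_norm// => -[].
exists h, (e / 2); split => //.
- by rewrite divr_gt0.
- by clear -hi bE; apply: isometric_on_sub hi => s /= /andP[s0 s1]; rewrite bE; split_lra.
- move=> s /andP[s0 se] _; have sI : 0 <= s <= e by split_lra.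
  apply/esym/(hu (g s) s); rewrite ?bE//.
    by rewrite D// sub0r normrN ger0_norm.
  by rewrite D// ler0_norm; [congr (_%:E); ring|lra].
Qed.

Lemma isometric_on_reverse (A : set R) g (c : R) : isometric_on A g ->
  isometric_on [set s | A (c - s)] (fun s => g (c - s)).
Proof. by move=> H s t As At; rewrite H// distrC; congr (`| _ |%:E); ring. Qed.

Lemma isometric_unit_segment g (a : R) : 0 < a -> isometric_on `[0, a] g ->
  exists2 h, unit_segment h a & forall s : R, s \in `[0, a] -> h s = g s.
Proof.
move=> a0 iso; have [h1 [d1 [d10 h10 i1 e1]]] := extend_left a0 iso.
have iso' : isometric_on `[0, a] (fun s => g (a - s)).
  apply: isometric_on_sub (isometric_on_reverse iso) => s /=.
  by rewrite !in_itv/= => /andP[? ?]; split_lra.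
have [h2 [d2 [d20 h20 i2 e2]]] := extend_left a0 iso'.
pose h s := if s < 0 then h1 s else if s <= a then g s else h2 (a - s).
have hE s : 0 <= s -> s <= a -> h s = g s by move=> s0 sa; rewrite /h ltNge s0 sa.
exists h; last by move=> s; rewrite in_itv/= => /andP[]; exact: hE.
split => //.
  by move=> s t /=; rewrite !in_itv/= => /andP[? ?] /andP[? ?]; rewrite !hE//; apply: iso; rewrite /= in_itv/=; apply/andP; split.
move=> t; rewrite in_itv/= => /andP[t0 ta].
have [t0'|nt0] := eqVneq t 0.
  pose d := Num.min d1 a; have d0 : 0 < d by rewrite lt_min d10.
  have dd1 : d <= d1 by rewrite ge_min lexx.
  have da : d <= a by rewrite ge_min lexx orbT.
  have E s : `|s - t| < d -> h s = h1 s /\ - d1 < s < d1.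
    rewrite t0' subr0 ltr_norml => /andP[s1 s2]; split; last by split_lra.
    rewrite /h; case: ltP => // s0; have -> : s <= a by lra.
    by clear -e1 dd1 da s2 s0; rewrite e1//; [split_lra|lra].
  by exists d => // s s' /E[-> ?] /E[-> ?]; exact: i1.
have [ta'|nta] := eqVneq t a.
  pose d := Num.min d2 a; have d0 : 0 < d by rewrite lt_min d20.
  have dd1 : d <= d2 by rewrite ge_min lexx.
  have da : d <= a by rewrite ge_min lexx orbT.
  have E s : `|s - t| < d -> h s = h2 (a - s) /\ - d2 < a - s < d2.
    rewrite ta' ltr_norml => /andP[s1 s2]; split; last by split_lra.
    rewrite /h; have -> : s < 0 = false by apply/negbTE; rewrite -leNgt; lra.
    by clear -e2 dd1 da s1; case: leP => // sa; rewrite e2; [rewrite opprB addrC subrK|split_lra|lra].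
  have := isometric_on_reverse (c := a) i2 => i2'.
  by exists d => // s s' /E[-> ?] /E[-> ?]; exact: i2'.
have t0' : 0 < t by rewrite lt_def nt0.
have ta' : t < a by rewrite lt_neqAle nta.
exists (Num.min t (a - t)); first by rewrite lt_min t0' subr_gt0.
have E s : `|s - t| < Num.min t (a - t) -> h s = g s /\ `[0, a]%classic s.
  rewrite lt_min !ltr_norml => /andP[/andP[s1 _] /andP[_ s2]].
  have s0 : 0 <= s by lra.
  have sa : s <= a by lra.
  by split; [exact: hE|rewrite /= in_itv/= s0].
by move=> s s' /E[-> ?] /E[-> ?]; exact: iso.
Qed.

Lemma pwC1_crossing x g (a b l c : R) : pwC1 g a b l -> (dist x (g a) <= c%:E)%E ->
  (c%:E <= dist x (g b))%E -> exists2 t : R, a <= t <= b & dist x (g t) = c%:E.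
Proof.
move=> H; elim: H => {a b l} [a b h P l ab Ch gh dP lE|a b e l1 l2 H1 IH1 H2 IH2] ga gb; last first.
  have ab := pwC1_lt H1; have be := pwC1_lt H2.
  have [cb|bc] := leP c%:E (dist x (g b)).
    by have [t /andP[? ?] E] := IH1 ga cb; exists t => //; split_lra.
  by have [t /andP[? ?] E] := IH2 (ltW bc) gb; exists t => //; split_lra.
have E t : a <= t <= b -> g t = h t by move=> ?; apply: gh; rewrite in_itv.
have aI : a <= a <= b by rewrite lexx ltW.
have bI : a <= b <= b by rewrite lexx ltW.
rewrite !E// in ga gb.
have fin t : a <= t <= b -> dist x (h t) \is a fin_num.
  move=> /andP[at_ tb]; rewrite ge0_fin_numE ?dist_ge0//.
  have [->|nat_] := eqVneq t a; first by rewrite (le_lt_trans ga) ?ltry.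
  have [l' Hl'] : exists l', pwC1 h a t l'.
    have ta : a < t by rewrite lt_neqAle eq_sym nat_.
    have hh : {in `[a, t], h =1 h} by [].
    exact: (pwC1_piece ta Ch hh).
  by rewrite (le_lt_trans (dist_le_add ga (dist_le_length Hl')))// ltry.
pose f t := fine (dist x (h t)).
have fE t : a <= t <= b -> dist x (h t) = (f t)%:E by move=> /fin tI; rewrite fineK.
have cf : {within `[a, b], continuous f}.
  apply/subspace_continuousP => t tI; rewrite /= in_itv/= in tI.
  apply/cvgrPdist_lt => e e0.
  have := C1_continuous Ch (nbhs_dist_lt (h t) e0) => N.
  have N' : \forall s \near t, (dist (h t) (h s) < e%:E)%E by exact: N.
  rewrite near_withinE; apply: filterS N' => s /= hs; rewrite in_itv/= => sI.
  have [w wI wE] := dist_le_fin (ltW hs); rewrite wE lte_fin in hs.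
  have ft : (dist x (h t) <= (f t)%:E)%E by rewrite fE.
  have fs : (dist x (h s) <= (f s)%:E)%E by rewrite fE.
  have w1 : (dist (h t) (h s) <= w%:E)%E by rewrite wE.
  have w2 : (dist (h s) (h t) <= w%:E)%E by rewrite dist_sym wE.
  have A1 := dist_le_add ft w1; have A2 := dist_le_add fs w2.
  rewrite fE// lee_fin in A1; rewrite fE// lee_fin in A2.
  change (`|f t - f s| < e).
  by clear -hs A1 A2; rewrite ltr_norml; split_lra.
have [|t tI ft] := IVT (ltW ab) cf (v := c).
  rewrite ge_min le_max -!lee_fin -!fE// ga gb ?orbT//.
by exists t; [move: tI; rewrite in_itv|rewrite E ?fE ?ft//; move: tI; rewrite in_itv].
Qed.

Lemma sphere_point m : exists2 rho : R, 0 < rho & forall x q (d c : R), (dist m x < rho%:E)%E ->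
  0 <= c <= rho -> c <= d -> dist x q = d%:E ->
  exists z, dist x z = c%:E /\ dist z q = (d - c)%:E.
Proof.
pose i := chart_at m; have im : chart_dom i m := mem_chart_at m.
have [r [K nc]] := ex_normal_chart im; have [_ mb sub] := nc.
have [r0 K1 R10 r4 /andP[h0 h1]] := normal_chart_radius nc.
have K0 : 0 < K by lra.
pose rho := geodesic_radius r K / (8 * K).
have rho0 : 0 < rho by rewrite divr_gt0// mulr_gt0.
have m1 : nball i m (dist_radius r K) m by split => //; rewrite /cball/= subrr normr0 ltW.
exists rho => // x q d c mx /andP[c0 cr] cd xq.
have [->|cN0] := eqVneq c 0; first by exists x; rewrite distxx subr0.
have [->|cNd] := eqVneq c d; first by exists q; rewrite subrr distxx.
have /choice[u Hu] : forall k : nat, exists z, dist x z = c%:E /\ (dist z q <= (d - c + k.+1%:R^-1)%:E)%E.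
  move=> k; have k0 : 0 < k.+1%:R^-1 :> R by rewrite invr_gt0.
  have [|g [l [H g0 g1 lt]]] := @dist_lt_ex _ _ M x q (d + k.+1%:R^-1)%:E.
    by rewrite xq lte_fin ltrDl.
  have [||t /andP[t0 t1] tc] := pwC1_crossing (x := x) (c := c) H.
  - by rewrite g0 distxx lee_fin.
  - by rewrite g1 xq lee_fin.
  exists (g t); split => //.
  have tN0 : t != 0 by apply/eqP => E; move: tc; rewrite E g0 distxx => -[/esym]; exact/eqP.
  have tN1 : t != 1 by apply/eqP => E; move: tc; rewrite E g1 xq => -[/esym]; exact/eqP.
  have [|l1 [l2 [H1 H2 lE]]] := pwC1_split (t := t) H; first by rewrite !lt_def tN0 t0 eq_sym tN1.
  have L1 := dist_le_length H1; have L2 := dist_le_length H2.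
  rewrite g0 tc lee_fin in L1; rewrite g1 in L2; apply: (le_trans L2).
  move: lt; rewrite lte_fin lE => lt; rewrite lee_fin; move: lt L1.
  by clear; move: (k.+1%:R^-1) => w *; lra.
have near k : nball i m (geodesic_radius r K / 2) (u k).
  have [xu _] := Hu k.
  have mu : (dist m (u k) < (geodesic_radius r K / (4 * K))%:E)%E.
    apply: (le_lt_trans (dist_triangle m x (u k))); rewrite xu.
    rewrite (_ : geodesic_radius r K / (4 * K) = rho + rho); last by rewrite /rho; field; rewrite gt_eqF.
    by rewrite EFinD lte_leD ?fin_numE// lee_fin.
  by have [] := dist_lt_nball nc m1 mu (lexx _).
have rr : geodesic_radius r K / 2 <= r by lra.
have [z _ Hz] := compact_cluster_seq (compact_nball nc rr) near.
exists z.
have dz (e : R) : 0 < e -> (dist x z <= (c + e)%:E)%E /\ (dist z q <= (d - c + e)%:E)%E.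
  move=> e0; have e20 : 0 < e / 2 by rewrite divr_gt0.
  have [N HN] : exists N : nat, N.+1%:R^-1 < e / 2.
    have := near_infty_natSinv_lt (PosNum e20) => -[N _ H]; exists N.
    exact: H (leqnn N).
  have [k Nk zk] := Hz (e / 2) N e20; have [xu uq] := Hu k.
  have ku : k.+1%:R^-1 <= N.+1%:R^-1 :> R by rewrite lef_pV2 ?posrE// ler_nat.
  have kE := le_lt_trans ku HN; move: kE uq; move: (k.+1%:R^-1) => w kE uq.
  split.
    have h : (dist (u k) z <= (e / 2)%:E)%E by rewrite dist_sym ltW.
    have h' : (dist x (u k) <= c%:E)%E by rewrite xu.
    by clear -e0 h h'; apply: (le_trans (dist_le_add h' h)); rewrite lee_fin; lra.
  by apply: (le_trans (dist_le_add (ltW zk) uq)); rewrite lee_fin; lra.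
have xz : (dist x z <= c%:E)%E by apply/lee_addgt0Pr => e /dz[]; rewrite EFinD.
have zq : (dist z q <= (d - c)%:E)%E by apply/lee_addgt0Pr => e /dz[_]; rewrite EFinD.
have h3 : ((c + (d - c))%:E <= dist x q)%E by rewrite xq lee_fin; lra.
exact: (dist_additive xz zq h3).
Qed.

End local_segments.

Section hopf_rinow.
Context {R : realType} {n : nat} {M : riemannianManifold R n}.
Implicit Types (p q x y z m : M) (g h : R -> M).

Definition joined x z (c : R) := exists g, [/\ g 0 = x, g c = z & isometric_on `[0, c] g].

Lemma joined_refl x : joined x x 0.
Proof.
exists (fun=> x); split => // s t /=; rewrite !in_itv/= => s0 t0.
have -> : s = 0 by apply/eqP; rewrite eq_le andbC.
have -> : t = 0 by apply/eqP; rewrite eq_le andbC.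
by rewrite distxx subrr normr0.
Qed.

Lemma joined_dist x z (c : R) : 0 <= c -> joined x z c -> dist x z = c%:E.
Proof.
move=> c0 [g [<- <- H]]; rewrite H/=; first by rewrite sub0r normrN ger0_norm.
  by rewrite in_itv/= lexx.
by rewrite in_itv/= lexx c0.
Qed.

Lemma joined_step m : exists2 rho : R, 0 < rho & forall x q (d c : R), (dist m x < rho%:E)%E ->
  0 <= c <= rho -> c <= d -> dist x q = d%:E ->
  exists z, joined x z c /\ dist z q = (d - c)%:E.
Proof.
have [r1 r10 H1] := sphere_point m; have [r2 r20 H2] := ex_local_segment m.
exists (Num.min r1 (r2 / 4)); first by rewrite lt_min r10 divr_gt0.
move=> x q d c mx; rewrite le_min => /andP[c0 /andP[c1 c2]] cd xq.
have mx1 : (dist m x < r1%:E)%E by apply: (lt_le_trans mx); rewrite lee_fin ge_min lexx.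
have mx2 : (dist m x < (r2 / 4)%:E)%E by apply: (lt_le_trans mx); rewrite lee_fin ge_min lexx orbT.
have [|z [xz zq]] := H1 x q d c mx1 _ cd xq; first by rewrite c0.
exists z; split => //.
have [cE|cN0] := eqVneq c 0.
  by have -> : z = x by [apply/esym/dist_eq0; rewrite xz cE]; rewrite cE; exact: joined_refl.
have [||E|g [a [a0 g0 ga gi _]]] := H2 x z.
- by apply: (lt_trans mx2); rewrite lte_fin; lra.
- apply: (le_lt_trans (dist_triangle m x z)); rewrite xz.
  rewrite (_ : r2 = r2 / 2 + r2 / 2); last by field.
  rewrite EFinD lte_leD ?fin_numE//; first by apply: (lt_trans mx2); rewrite lte_fin; lra.
  by rewrite lee_fin; lra.
- by move: xz; rewrite E distxx => -[/esym]; exact/eqP.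
have ac : a = c.
  have : dist (g 0) (g a) = (`|0 - a|)%:E by clear -a0 gi; apply: gi; rewrite /=; split_lra.
  by rewrite g0 ga xz sub0r normrN gtr0_norm// => -[].
exists g; split => //; first by rewrite -ac.
clear -gi ac; apply: isometric_on_sub gi => s /=; rewrite in_itv/= -ac => /andP[? ?]; split_lra.
Qed.

Lemma ex_good_step q x (d : R) : dist x q = d%:E -> exists w : M * R,
  [/\ 0 <= w.2 <= d, joined x w.1 w.2, dist w.1 q = (d - w.2)%:E &
   forall z (c : R), 0 <= c <= d -> joined x z c -> dist z q = (d - c)%:E -> c <= 2 * w.2].
Proof.
move=> xq; have d0 : 0 <= d by rewrite -lee_fin -xq dist_ge0.
pose S := [set c : R | 0 <= c <= d /\ exists2 z, joined x z c & dist z q = (d - c)%:E].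
have S0 : S 0 by split; [rewrite lexx|exists x; [exact: joined_refl|rewrite subr0]].
have Sd : ubound S d by move=> c [/andP[]].
have hS : has_sup S by split; [exists 0|exists d].
have le_sup c : S c -> c <= sup S by move=> Sc; apply: ub_le_sup => //; exists d.
have [sE|sN0] := eqVneq (sup S) 0.
  exists (x, 0); split; rewrite /= ?lexx ?subr0//; first exact: joined_refl.
  move=> z c cI xz zq; rewrite mulr0 -sE; apply: le_sup; split => //; by exists z.
have s0 : 0 < sup S by rewrite lt_def sN0; exact: le_sup.
have s20 : 0 < sup S / 2 by rewrite divr_gt0.
have [c [cI [z xz zq]] lt_c] := sup_adherent s20 hS.
exists (z, c); split => // z' c' cI' xz' zq'.
have : c' <= sup S by apply: le_sup; split => //; exists z'.
by rewrite /=; lra.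
Qed.

Hypothesis complete : complete_manifold M.

Section chain.
Variables (p q : M) (a : R).
Hypotheses (a0 : 0 < a) (pq : dist p q = a%:E).
Variables (x : nat -> M) (t : nat -> R).
Hypotheses (x0 : x 0%N = p) (t0 : t 0%N = 0).
Hypothesis xq : forall k, dist (x k) q = (a - t k)%:E.
Hypothesis tS : forall k, 0 <= t k.+1 - t k.
Hypothesis xS : forall k, joined (x k) (x k.+1) (t k.+1 - t k).
Hypothesis best : forall k z (c : R), 0 <= c <= a - t k -> joined (x k) z c ->
  dist z q = (a - t k - c)%:E -> c <= 2 * (t k.+1 - t k).

Let t_mono j k : (j <= k)%N -> t j <= t k.
Proof.
move=> /subnKC <-; elim: (k - j)%N => [|i IH]; first by rewrite addn0.
by rewrite addnS; have := tS (j + i); lra.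
Qed.

Let t_le k : t k <= a.
Proof. by rewrite -subr_ge0 -lee_fin -xq dist_ge0. Qed.

Let chain_dist j k : (j <= k)%N -> dist (x j) (x k) = (t k - t j)%:E.
Proof.
move=> jk; apply/eqP; rewrite eq_le; apply/andP; split.
  move: jk => /subnKC <-; elim: (k - j)%N => [|i IH]; first by rewrite addn0 distxx subrr.
  have h : (dist (x (j + i)%N) (x (j + i).+1) <= (t (j + i).+1 - t (j + i)%N)%:E)%E by rewrite (joined_dist (tS _) (xS _)).
  by rewrite addnS (le_trans (dist_le_add IH h))// lee_fin; lra.
have h1 : ((a - t j)%:E <= dist (x j) q)%E by rewrite xq.
have h2 : (dist (x k) q <= (a - t k)%:E)%E by rewrite xq.
by have := dist_ge_sub h1 h2; rewrite (_ : a - t j - (a - t k) = t k - t j)//; ring.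
Qed.

Let T := sup (range t).
Let ubt : has_sup (range t).
Proof. by split; [exists (t 0%N), 0%N|exists a => _ [k _ <-]; exact: t_le]. Qed.
Let tT k : t k <= T.
Proof. by apply: ub_le_sup; [case: ubt|exists k]. Qed.
Let Ta : T <= a.
Proof. by apply: ge_sup; [case: ubt|move=> _ [k _ <-]; exact: t_le]. Qed.
Let ex_t (e : R) : 0 < e -> exists N, forall k, (N <= k)%N -> T - e < t k.
Proof.
move=> e0; have [_ [N _ <-] lt] := sup_adherent e0 ubt.
by exists N => k Nk; apply: (lt_le_trans lt); exact: t_mono.
Qed.

Lemma chain_limit : T = a.
Proof.
have [|y Hy] := complete (u := x).
  move=> e e0; have [N HN] := ex_t e0; exists N.
  have W j k : (N <= j)%N -> (j <= k)%N -> (dist (x j) (x k) < e%:E)%E.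
    by move=> Nj jk; rewrite chain_dist// lte_fin; have := HN j Nj; have := tT k; lra.
  move=> j k Nj Nk; case: (leqP j k) => jk; first exact: W.
  by rewrite dist_sym W// ltnW.
apply/eqP; rewrite eq_le Ta/= leNgt; apply/negP => ltTa.
have [rho rho0 H] := joined_step y.
have [N1 HN1] := Hy rho rho0.
pose c := Num.min rho (a - T); have c0 : 0 < c by rewrite lt_min rho0 subr_gt0.
have c20 : 0 < c / 2 by rewrite divr_gt0.
have [N2 HN2] := ex_t c20.
pose k := maxn N1 N2.
have yk : (dist y (x k) < rho%:E)%E by rewrite dist_sym; apply: HN1; rewrite leq_maxl.
have tk : T - c / 2 < t k by apply: HN2; rewrite leq_maxr.
have cr : c <= rho by rewrite ge_min lexx.
have ca : c <= a - T by rewrite ge_min lexx orbT.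
have cak : c <= a - t k by have := tT k; lra.
have [|z [xz zq]] := H (x k) q (a - t k) c yk _ cak (xq k); first by rewrite (ltW c0).
have := best (k := k) (z := z) (c := c); rewrite (ltW c0) cak => /(_ isT xz zq).
have := tT k.+1; have := tS k; lra.
Qed.

Lemma chain_joined : joined p q a.
Proof.
have find s : 0 <= s < a -> exists k, t k <= s < t k.+1.
  move=> /andP[s0 sa]; have as0 : 0 < a - s by rewrite subr_gt0.
  have [N HN] := ex_t as0; have {}HN := HN N (leqnn N); rewrite chain_limit opprB addrC subrK in HN.
  elim: N HN => [|N IH] HN; first by move: HN; rewrite t0; lra.
  by have [tN|/IH//] := leP (t N) s; exists N; rewrite tN.
have /choice[kk Hkk] : forall s, exists k, 0 <= s < a -> t k <= s < t k.+1.
  move=> s; have [/find[k kP]|ns] := pselect (0 <= s < a); first by exists k.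
  by exists 0%N => /ns.
have /choice[gam Hgam] := xS.
have iso k : isometric_on `[0, t k.+1 - t k] (gam k) by have [] := Hgam k.
pose G s := if s < a then gam (kk s) (s - t (kk s)) else q.
have Gk s : 0 <= s < a -> [/\ dist (x (kk s)) (G s) = (s - t (kk s))%:E,
    dist (G s) (x (kk s).+1) = (t (kk s).+1 - s)%:E & t (kk s) <= s < t (kk s).+1].
  move=> sI; have /andP[k1 k2] := Hkk s sI; have /andP[s0 sa] := sI.
  have [g0 g1 _] := Hgam (kk s).
  have I0 : `[0, t (kk s).+1 - t (kk s)]%classic 0 by rewrite /= in_itv/= lexx; have := tS (kk s).
  have I1 : `[0, t (kk s).+1 - t (kk s)]%classic (t (kk s).+1 - t (kk s)) by rewrite /= in_itv/= lexx andbT; have := tS (kk s).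
  have Is : `[0, t (kk s).+1 - t (kk s)]%classic (s - t (kk s)) by rewrite /= in_itv/=; split_lra.
  rewrite /G sa; split; last by rewrite k1.
    by rewrite -g0 iso// sub0r normrN ger0_norm// subr_ge0.
  rewrite -g1 iso// ler0_norm; last lra.
  by congr (_%:E); ring.
have up s s' : 0 <= s -> s <= s' -> s' < a -> (dist (G s) (G s') <= (s' - s)%:E)%E.
  move=> s0 ss sa; have [|d1 d2 /andP[k1 k2]] := Gk s; first by split_lra.
  have [|d1' d2' /andP[k1' k2']] := Gk s'; first by split_lra.
  have [kk_|kk_|E] := ltngtP (kk s) (kk s').
  - have h1 : (dist (G s) (x (kk s).+1) <= (t (kk s).+1 - s)%:E)%E by rewrite d2.
    have h2 : (dist (x (kk s).+1) (x (kk s')) <= (t (kk s') - t (kk s).+1)%:E)%E by rewrite chain_dist.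
    have h3 : (dist (x (kk s')) (G s') <= (s' - t (kk s'))%:E)%E by rewrite d1'.
    by apply: (le_trans (dist_le_add (dist_le_add h1 h2) h3)); rewrite lee_fin; lra.
  - by exfalso; have := t_mono kk_; lra.
  - rewrite /G sa (_ : s < a); last lra.
    rewrite -E in k1' k2' *.
    have I1 : `[0, t (kk s).+1 - t (kk s)]%classic (s - t (kk s)) by rewrite /= in_itv/=; split_lra.
    have I2 : `[0, t (kk s).+1 - t (kk s)]%classic (s' - t (kk s)) by rewrite /= in_itv/=; split_lra.
    by rewrite iso// lee_fin ler0_norm; lra.
have Gq s : 0 <= s <= a -> dist (G s) q = (a - s)%:E.
  move=> /andP[s0 sa]; have [E|nsa] := eqVneq s a.
    by rewrite /G E ltxx distxx subrr.
  have sa' : s < a by rewrite lt_neqAle nsa.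
  have [|d1 d2 /andP[k1 k2]] := Gk s; first by split_lra.
  apply/eqP; rewrite eq_le; apply/andP; split.
    have h1 : (dist (G s) (x (kk s).+1) <= (t (kk s).+1 - s)%:E)%E by rewrite d2.
    have h2 : (dist (x (kk s).+1) q <= (a - t (kk s).+1)%:E)%E by rewrite xq.
    by apply: (le_trans (dist_le_add h1 h2)); rewrite lee_fin; lra.
  have h1 : (dist (x 0%N) (x (kk s)) <= (t (kk s) - t 0%N)%:E)%E by rewrite chain_dist.
  have h2 : (dist (x (kk s)) (G s) <= (s - t (kk s))%:E)%E by rewrite d1.
  have h3 := dist_le_add h1 h2.
  have h4 : (a%:E <= dist q p)%E by rewrite dist_sym pq.
  have h5 : (dist (G s) p <= s%:E)%E by rewrite dist_sym -x0 (le_trans h3)// lee_fin t0; lra.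
  by rewrite dist_sym; exact: (dist_ge_sub h4 h5).
exists G; split.
- have [|d1 _ /andP[k1 k2]] := Gk 0; first by rewrite lexx.
  have tk : t (kk 0) = 0 by have := t_mono (leq0n (kk 0)); rewrite t0; lra.
  have h : dist (x 0%N) (x (kk 0)) = 0%E by rewrite chain_dist// tk t0 subrr.
  rewrite -x0 (dist_eq0 h); apply/esym/dist_eq0; by rewrite d1 tk subrr.
- by rewrite /G ltxx.
- have W s s' : 0 <= s -> s <= s' -> s' <= a -> dist (G s) (G s') = (s' - s)%:E.
    move=> s0 ss sa; have sI : 0 <= s <= a by split_lra.
    have [E|nsa] := eqVneq s' a.
      by rewrite E {2}/G ltxx; exact: Gq.
    have sa' : s' < a by rewrite lt_neqAle nsa.
    have sI' : 0 <= s' <= a by split_lra.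
    apply/eqP; rewrite eq_le up//=.
    have h1 : ((a - s)%:E <= dist (G s) q)%E by rewrite Gq.
    have h2 : (dist (G s') q <= (a - s')%:E)%E by rewrite Gq.
    by have := dist_ge_sub h1 h2; rewrite (_ : a - s - (a - s') = s' - s)//; ring.
  move=> s s' /=; rewrite !in_itv/= => /andP[s0 sa] /andP[s0' sa'].
  have [ss|ss] := leP s s'.
    by rewrite W// ler0_norm; [congr (_%:E); ring|lra].
  by rewrite dist_sym W//; [rewrite ger0_norm//; lra|lra].
Qed.

End chain.

Lemma ex_joined p q (a : R) : 0 < a -> dist p q = a%:E -> joined p q a.
Proof.
move=> a0 pq.
have /choice[step Hstep] : forall y, exists w : M * R, forall d : R, dist y q = d%:E ->
   [/\ 0 <= w.2 <= d, joined y w.1 w.2, dist w.1 q = (d - w.2)%:E &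
   forall z (c : R), 0 <= c <= d -> joined y z c -> dist z q = (d - c)%:E -> c <= 2 * w.2].
  move=> y; have [[d yd]|nd] := pselect (exists d : R, dist y q = d%:E).
    have [w Hw] := ex_good_step yd; exists w => d'; rewrite yd => -[<-]; exact: Hw.
  by exists (y, 0) => d yd; case: nd; exists d.
pose st k := iter k (fun w : M * R => ((step w.1).1, w.2 + (step w.1).2)) (p, 0).
pose x k := (st k).1; pose t k := (st k).2.
have xq k : dist (x k) q = (a - t k)%:E.
  elim: k => [|k IH]; first by rewrite /x /t /= subr0.
  by have [_ _ H _] := Hstep _ _ IH; rewrite /x /t /= H; congr (_%:E); rewrite /t; ring.
have tE k : t k.+1 - t k = (step (x k)).2 by rewrite /t /x /=; ring.
apply: (@chain_joined p q a a0 pq x t) => // k; have [h1 h2 h3 h4] := Hstep _ _ (xq k).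
- by rewrite tE; case/andP: h1.
- by rewrite tE.
- by move=> z c; rewrite tE; exact: h4.
Qed.

Lemma ex_unit_segment p q (a : R) : 0 < a -> dist p q = a%:E ->
  exists g, [/\ unit_segment g a, g 0 = p & g a = q].
Proof.
move=> a0 /(ex_joined a0)[g [g0 ga iso]].
have [h uh hE] := isometric_unit_segment a0 iso.
by exists h; split => //; rewrite hE ?g0 ?ga// in_itv/= lexx ?ltW.
Qed.

End hopf_rinow.

Section chart_variation.
Context {R : realType} {n : nat}.
Variables (gm : 'rV[R]_n -> 'M[R]_n) (m : 'rV[R]_n) (r K : R).
Hypothesis mb : metric_ball gm m r K.
Implicit Types (p q z : 'rV[R]_n) (x u y v : R -> 'rV[R]_n).
Local Notation G := (gform gm).
Local Notation phi := (local_dist gm m r K).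
Local Notation R1 := (geodesic_radius r K).

Lemma local_dist_variation p z w x u (e : R) : cball m R1 p -> cball m R1 z ->
  geodesic_segment gm m r K p z x u -> 0 < phi p z -> 0 < e ->
  exists2 k : R, 0 < k & forall p' z' p2 (h : R), cball m R1 p' -> cball m R1 z' -> cball m R1 p2 ->
    `|p' - p| <= k -> `|z' - z| <= k -> `|h| <= k -> `|p2 - p' - h *: w| <= k * `|h| ->
    phi p2 z' <= phi p' z' + (e * `|h| - h * (G p (u 0) w / phi p z)).
Proof.
move=> pm zm S d0 e0; have K1 := mb_K mb; have K0 : 0 < K by lra.
have R10 := geodesic_radius_gt0 mb.
set d := phi p z in d0 *; pose I := G p (u 0) w / d.
pose C2 := 2 * K * (2 * `|u 0| + 10) * (`|w| + 1) + K * (17 + 16 * R1) * (`|w| + 1) ^+ 2.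
have C20 : 0 <= C2 by clear -K1 R10; rewrite addr_ge0// !mulr_ge0 ?exprn_ge0//; lra.
pose E := (8 * K * `|I| + C2) / d + 1.
have E0 : 0 < E by rewrite ltr_wpDl// divr_ge0 ?(ltW d0)// addr_ge0// !mulr_ge0//; lra.
pose k := Num.min (8^-1) (Num.min (d / (8 * K)) (e / E)).
have k0 : 0 < k by rewrite !lt_min invr_gt0 ltr0n /=; apply/andP; split; apply: divr_gt0 => //; exact: mulr_gt0.
have k1 : k <= 8^-1 by rewrite ge_min lexx.
have kd : k * (8 * K) <= d by rewrite -ler_pdivlMr ?mulr_gt0// !ge_min lexx !orbT.
have ke : k * E <= e by rewrite -ler_pdivlMr// !ge_min lexx !orbT.
clearbody k; exists k => // p' z' p2 h pm' zm' pm2 Hp Hz Hh Hw.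
have [x' [u' S']] := ex_geodesic_segment mb pm' zm'.
have FV := local_dist_first_variation mb pm' zm' pm2 S'.
have L := geodesic_segment_lip mb pm zm pm' zm' S S' 0.
have mr q : cball m R1 q -> cball m r q.
  move=> qm; have [qr _ _] := geodesic_radiusP mb qm qm.
  by clear -mb qr; rewrite /cball/= in qr *; have := mb_r mb; lra.
have L1 : `|u' 0 - u 0| <= 8 * k by clear -Hp Hz L; rewrite distrC (distrC p) (distrC z) in L *; lra.
have U1 : `|u' 0| <= `|u 0| + 1 by clear -k1 L1; rewrite -[u' 0](subrK (u 0)) (le_trans (ler_normD _ _))//; lra.
have W1 : `|p2 - p'| <= `|h| * (`|w| + 1).
  rewrite -[p2 - p'](subrK (h *: w)) (le_trans (ler_normD _ _))// normrZ.
  have : k * `|h| <= `|h| by clear -k1 kd; rewrite ler_piMl//; lra.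
  by clear -Hw; move: Hw; lra.
have T1 : `|G p' (u' 0) (p2 - p') - G p (u' 0) (p2 - p')| <= K * k * (`|u 0| + 1) * (`|h| * (`|w| + 1)).
  apply: (le_trans (mb_lip mb _ _ (mr _ pm') (mr _ pm))).
  by rewrite ler_pM ?mulr_ge0 ?(ltW K0)// ler_pM ?mulr_ge0 ?(ltW K0)// ler_wpM2l// ltW.
have T2 : `|G p (u' 0 - u 0) (p2 - p')| <= K * (8 * k) * (`|h| * (`|w| + 1)).
  apply: (le_trans (mb_bound mb _ _ (mr _ pm))).
  by rewrite ler_pM ?mulr_ge0 ?(ltW K0)// ler_wpM2l// ltW.
have T3 : `|G p (u 0) (p2 - p' - h *: w)| <= K * `|u 0| * (k * `|h|).
  apply: (le_trans (mb_bound mb _ _ (mr _ pm))).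
  by rewrite ler_wpM2l// mulr_ge0// ltW.
have E1 : G p (u' 0 - u 0) (p2 - p') = G p (u' 0) (p2 - p') - G p (u 0) (p2 - p') by rewrite -scaleN1r gformDl gformZl mulN1r.
have E2 : G p (u 0) (p2 - p' - h *: w) = G p (u 0) (p2 - p') - h * (I * d) by rewrite -scaleNr gformDr gformZr mulNr /I divfK// gt_eqF.
have Q : `|p2 - p'| ^+ 2 <= k * `|h| * (`|w| + 1) ^+ 2.
  apply: (@le_trans _ _ ((`|h| * (`|w| + 1)) ^+ 2)).
    by rewrite ler_pXn2r ?nnegrE.
  by rewrite exprMn ler_wpM2r ?sqr_ge0// expr2 ler_wpM2r.
have FV2 : phi p2 z' ^+ 2 <= phi p' z' ^+ 2 - 2 * h * (I * d) + k * `|h| * C2.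
  apply: (le_trans FV).
  have Q' : K * (17 + 16 * R1) * `|p2 - p'| ^+ 2 <= K * (17 + 16 * R1) * (k * `|h| * (`|w| + 1) ^+ 2).
    by clear -K1 R10 Q; rewrite ler_wpM2l// mulr_ge0//; lra.
  have K0' := ltW K0; have k0' := ltW k0.
  have A0 : 0 <= K * k * `|h| * `|w| by rewrite !mulr_ge0.
  have A1 : 0 <= K * k * `|h| by rewrite !mulr_ge0.
  have A3 : 0 <= K * k * `|h| * `|u 0| * `|w| by rewrite !mulr_ge0.
  rewrite E1 in T2; rewrite E2 in T3.
  move: T1 T2 T3; rewrite !ler_norml => /andP[T1 _] /andP[T2 _] /andP[T3 _].
  rewrite /C2; move: T1 T2 T3 Q' A0 A1 A3.
  move: (G p' (u' 0) (p2 - p')) (G p (u' 0) (p2 - p')) (G p (u 0) (p2 - p')) => f1 f2 f3.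
  move: (`|p2 - p'| ^+ 2) (I * d) (`|u 0|) (`|w|) (`|h|) => a1 a2 a3 a4 a5 *.
  move: (phi p' z' ^+ 2) => ph2; rewrite mulrDr; lra.
have pd : `|phi p' z' - d| <= 4 * K * k.
  have t1 := local_dist_triangle mb pm pm' zm.
  have t2 := local_dist_triangle mb pm' zm' zm.
  have t3 := local_dist_triangle mb pm' pm zm'.
  have t4 := local_dist_triangle mb pm zm zm'.
  have n1 := norm_local_dist mb pm pm'; have n2 := norm_local_dist mb zm zm'.
  rewrite (local_dist_sym mb zm' zm) in t2; rewrite (local_dist_sym mb pm' pm) in t3.
  have m1 : 2 * K * `|p' - p| <= 2 * K * k by rewrite ler_wpM2l// mulr_ge0// ltW.
  have m2 : 2 * K * `|z' - z| <= 2 * K * k by rewrite ler_wpM2l// mulr_ge0// ltW.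
  clear -t1 t4 n1 n2 t2 t3 m1 m2; rewrite ler_norml; apply/andP; split; rewrite /d; lra.
have fd : d / 2 <= phi p' z' by clear -kd pd; move: pd; rewrite ler_norml => /andP[? _]; lra.
have f0 : 0 < phi p' z' by apply: lt_le_trans fd; rewrite divr_gt0.
have main : phi p2 z' * (2 * phi p' z') <= 2 * phi p' z' ^+ 2 - 2 * h * (I * d) + k * `|h| * C2.
  have : 0 <= (phi p2 z' - phi p' z') ^+ 2 by rewrite sqr_ge0.
  by clear -FV2; rewrite sqrrB; move: FV2; lra.
rewrite -(@ler_pM2r _ (2 * phi p' z')) ?mulr_gt0//; apply: (le_trans main).
rewrite -/I.
have B1 : h * (phi p' z' - d) * I <= `|h| * (4 * K * k) * `|I|.
  apply: (le_trans (ler_norm _)); rewrite !normrM.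
  by rewrite ler_wpM2r// ler_wpM2l.
have B2 : `|h| * (k * (8 * K * `|I| + C2)) <= `|h| * (e * (2 * phi p' z')).
  rewrite ler_wpM2l//; apply: (@le_trans _ _ (e * d)); last by clear -e0 fd; rewrite ler_wpM2l ?(ltW e0)//; lra.
  have : k * E * d <= e * d by rewrite ler_wpM2r// ltW.
  have -> : k * E * d = k * (8 * K * `|I| + C2) + k * d by clear -d0; rewrite /E; field; rewrite gt_eqF.
  have : 0 <= k * d by rewrite mulr_ge0// ltW.
  clear; lra.
move: B1 B2; rewrite -/d -/I; move: (phi p' z') (`|I|) (`|h|) => f i hh.
clear; rewrite expr2; lra.
Qed.

End chart_variation.

Section velocities.
Context {R : realType} {n : nat} {M : riemannianManifold R n}.
Implicit Types (p q z m : M) (i : chart_index M) (g h c : R -> M).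
Local Notation X := (@chart R n M).

Lemma right_derive_unique (f1 f2 : R -> 'rV[R]_n) (v1 v2 : 'rV[R]_n) (t d : R) : 0 < d ->
  is_derive t (1 : R) f1 v1 -> is_derive t (1 : R) f2 v2 ->
  (forall s : R, t <= s <= t + d -> f1 s = f2 s) -> v1 = v2.
Proof.
move=> d0 D1 D2 E; apply/eqP; rewrite -subr_eq0 -normr_le0; apply/ler_addgt0Pr => e e0.
have e20 : 0 < e / 2 by rewrite divr_gt0.
have := filterI (is_derive_eps e20 D1) (is_derive_eps e20 D2); rewrite nbhs_ballP => -[b b0 H].
pose s := t + Num.min d (b / 2).
have s0 : 0 < Num.min d (b / 2) by rewrite lt_min d0 divr_gt0.
have sd : Num.min d (b / 2) <= d by rewrite ge_min lexx.
have sb : Num.min d (b / 2) < b by rewrite gt_min; apply/orP; right; move: b0 => /= b0; lra.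
have sE : s - t = Num.min d (b / 2) by rewrite /s; ring.
have [|h1 h2] := H s.
  by rewrite /ball/= distrC sE gtr0_norm.
have tI : t <= t <= t + d by clear -d0; split_lra.
have sI : t <= s <= t + d by clear -s0 sd; rewrite /s; split_lra.
rewrite (E _ sI) (E _ tI) in h1.
have st0 : 0 < `|s - t| by rewrite sE gtr0_norm.
rewrite add0r -(ler_pM2l st0) -normrZ scalerBr.
rewrite (_ : _ - _ = (f2 s - f2 t - (s - t) *: v2) - (f2 s - f2 t - (s - t) *: v1)); last first.
  by apply/rowP => j; rewrite !mxE; ring.
by clear -h2 h1; apply: (le_trans (ler_normB _ _)); rewrite mulrC; lra.
Qed.

Lemma initial_velocity g (a d : R) i r K x u : unit_segment g a -> 0 < d <= a ->
  normal_chart i (g 0) r K ->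
  (forall s : R, 0 <= s <= d -> nball i (g 0) (dist_radius r K) (g s)) ->
  geodesic_segment (@metric R n M i) (X i (g 0)) r K (X i (g 0)) (X i (g d)) x u ->
  [/\ local_dist (@metric R n M i) (X i (g 0)) r K (X i (g 0)) (X i (g d)) = d,
      {for 0, continuous g} & is_derive (0 : R) (1 : R) (X i \o g) (d^-1 *: u 0)].
Proof.
move=> [a0 iso loc] /andP[d0 da] nc near S; have [im mb _] := nc.
have i0 : (0 : R) \in `[0, a] by rewrite in_itv/= lexx ltW.
have [c [v [cg c0 D _]]] := locally_isometric_derive (loc 0 i0) im.
have [D0 _] := nbhs_singleton D.
have I s : 0 <= s <= d -> `[0, a]%classic s by clear -da; move=> /andP[? ?]; rewrite /= in_itv/=; split_lra.
have Id : 0 <= d <= d by rewrite lexx ltW.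
have I0 : 0 <= (0 : R) <= d by rewrite lexx ltW.
have L s s' : 0 <= s <= d -> 0 <= s' <= d ->
    local_dist (@metric R n M i) (X i (g 0)) r K (X i (g s)) (X i (g s')) = `|s - s'|.
  move=> sI sI'; have := dist_local nc (near _ sI) (near _ sI').
  by rewrite (iso _ _ (I _ sI) (I _ sI')) => -[].
have L0 := L _ _ I0 Id; rewrite sub0r normrN gtr0_norm// in L0.
split => //; suff <- : c *: v 0 = d^-1 *: u 0 by [].
have [[[x0 x1] [_ _ Ux] _ _] _ _ _] := S.
have ball0 s : 0 <= s <= d -> cball (X i (g 0)) (geodesic_radius r K) (X i (g s)) by move=> /near[_ sm]; exact: (dist_radius_cball mb sm).
have Dx : is_derive (0 : R) (1 : R) (fun s => x (d^-1 * s + 0)) (d^-1 *: u 0).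
  have z1 : d^-1 * 0 + 0 \in `](-1), 2[ by clear; rewrite mulr0 addr0 in_itv/=; split_lra.
  by have := is_derive_affine (Ux _ z1); rewrite mulr0 addr0.
apply: (right_derive_unique d0 D0 Dx) => s; rewrite add0r addr0 => sI.
have /andP[s0 sd] := sI.
apply: (local_dist_equality mb (ball0 _ I0) (ball0 _ sI) (ball0 _ Id) S).
- rewrite mulr_ge0 ?invr_ge0 ?(ltW d0)//=.
  by rewrite mulrC ler_pdivrMr// mul1r.
- by rewrite L0 L// sub0r normrN ger0_norm// mulrAC mulVf ?mul1r// gt_eqF.
- by clear -d0 Id L L0 sI; rewrite L0 L// ler0_norm; [field; rewrite gt_eqF|lra].
Qed.

Lemma near_strict_derivative (f df : R -> 'rV[R]_n) (w : 'rV[R]_n) (t b k : R) : 0 < b -> 0 <= k ->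
  (forall s : R, `|s - t| < b -> is_derive s (1 : R) f (df s) /\ `|df s - w| <= k) ->
  forall s h : R, `|s - t| <= b / 3 -> `|h| <= b / 3 -> `|f (s + h) - f s - h *: w| <= k * `|h|.
Proof.
move=> b0 k0 H s h st hb.
pose F s' := f s' - s' *: w.
have DF s' : `|s' - t| < b -> is_derive s' (1 : R) F (df s' - w).
  move=> /H[D1 _]; have D2 : is_derive s' (1 : R) (fun s : R => s *: w) w.
    apply/is_derive_rV => j; have D3 := is_deriveZ (w 0 j) (is_derive_id s' (1 : R)).
    rewrite [_ *: 1]mulr1 in D3; rewrite (_ : (fun s => _) = w 0 j \*: ssrfun.id)//.
    by apply/funext => y; rewrite mxE mulrC.
  exact: (is_deriveB D1 D2).
have MV (s1 s2 : R) : s1 <= s2 -> (forall s', s1 <= s' <= s2 -> `|s' - t| < b) -> `|F s2 - F s1| <= k * (s2 - s1).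
  move=> ss Hs; have Hs' s' : s' \in `[s1, s2] -> `|s' - t| < b by rewrite in_itv/=; exact: Hs.
  apply: (mean_value_norm (df := fun s' => df s' - w) ss k0).
  - by move=> s' /subset_itv_oo_cc/Hs'; exact: DF.
  - by move=> s' /subset_itv_oo_cc/Hs'/H[].
  - by apply: derivable_within_continuous => s' /Hs'/DF; case.
have -> : f (s + h) - f s - h *: w = F (s + h) - F s.
  by apply/rowP => j; rewrite /F !mxE; ring.
have near s' : s <= s' <= s + h \/ s + h <= s' <= s -> `|s' - t| < b.
  move: st hb; rewrite !ler_norml ltr_norml => /andP[? ?] /andP[? ?].
  by case=> /andP[? ?]; split_lra.
have [hp|hn] := leP 0 h.
  have sh : s <= s + h by rewrite lerDl.
  have := MV s (s + h) sh (fun s' sI => near s' (or_introl sI)).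
  by rewrite (ger0_norm hp) (_ : s + h - s = h)//; ring.
have sh : s + h <= s by rewrite gerDl ltW.
have := MV (s + h) s sh (fun s' sI => near s' (or_intror sI)).
by rewrite distrC (ltr0_norm hn) (_ : s - (s + h) = - h)//; ring.
Qed.

Lemma near_norm_lt (T : topologicalType) (V : normedModType R) (f : T -> V) (t : T) (e : R) :
  {for t, continuous f} -> 0 < e -> \forall s \near t, `|f s - f t| < e.
Proof.
move=> cf e0; have /cvgrPdist_lt/(_ _ e0) := cf.
by apply: filterS => s; rewrite distrC.
Qed.

Lemma endpoint_variation p : exists2 d0 : R, 0 < d0 & forall g (a d t : R) c, C1_curve c ->
  c t = p -> unit_segment g a -> g 0 = p -> 0 < d <= d0 -> d <= a -> forall e : R, 0 < e ->
  exists2 k : R, 0 < k & forall (s h : R) m', `|s - t| <= k -> (dist (g d) m' < k%:E)%E -> `|h| <= k ->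
    (dist (c (s + h)%R) m' <= dist (c s) m' + (e * `|h| - h * inner p (velocity c t) (velocity g 0))%:E)%E.
Proof.
pose i := chart_at p; have ip : chart_dom i p := mem_chart_at p.
have [r [K nc]] := ex_normal_chart ip; have [_ mb sub] := nc.
have [r0 K1 R10 r4 /andP[h0 h1]] := normal_chart_radius nc.
have K0 : 0 < K by lra.
pose d0 := Num.min (geodesic_radius r K / (8 * K)) (dist_radius r K / (4 * K)).
have d00 : 0 < d0 by rewrite lt_min; apply/andP; split; apply: divr_gt0 => //; exact: mulr_gt0.
have d01 : 2 * d0 <= geodesic_radius r K / (4 * K).
  rewrite (_ : geodesic_radius r K / (4 * K) = 2 * (geodesic_radius r K / (8 * K))); last by field; rewrite gt_eqF.
  by rewrite ler_pM2l// ge_min lexx.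
have d02 : K * (2 * d0) <= dist_radius r K / 2.
  rewrite (_ : dist_radius r K / 2 = K * (2 * (dist_radius r K / (4 * K)))); last by field; rewrite gt_eqF.
  by rewrite !ler_pM2l// ge_min lexx orbT.
clearbody d0; exists d0 => // g a d t c Cc ct us g0 /andP[d_gt0 dd0] da e e0.
have p1 : nball i p (dist_radius r K) p by split => //; rewrite /cball/= subrr normr0 ltW.
have [a0 iso _] := us.
have near s : 0 <= s <= d -> nball i p (dist_radius r K / 2) (g s).
  move=> /andP[s0 sd]; have ps : (dist p (g s) < (2 * d0)%:E)%E.
    rewrite -g0 iso/= ?in_itv/= ?lexx ?(ltW a0)//; last by clear -da s0 sd; split_lra.
    by clear -d_gt0 dd0 s0 sd; rewrite sub0r normrN ger0_norm// lte_fin; lra.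
  have [[is_ _] sm] := dist_lt_nball nc p1 ps d01.
  by split => //; rewrite /cball/= (le_trans sm).
have half : dist_radius r K / 2 <= dist_radius r K by lra.
have near' s sI := nball_le half (near s sI).
have Id : 0 <= d <= d by rewrite lexx ltW.
have [id dm] := near' _ Id; have [_ pm] := p1.
have dm1 := dist_radius_cball mb dm; have pm1 := dist_radius_cball mb pm.
have [x [u S]] := ex_geodesic_segment mb pm1 dm1.
have dI : 0 < d <= a by rewrite d_gt0.
have [|||LD cg Dg] := initial_velocity (i := i) (r := r) (K := K) (x := x) (u := u) us dI; rewrite ?g0//.
rewrite g0 in LD; have ld0 : 0 < local_dist (@metric R n M i) (X i p) r K (X i p) (X i (g d)) by rewrite LD.
pose w := derive1 (X i \o c) t.
have it : chart_dom i (c t) by rewrite ct.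
have Dc := C1_is_derive Cc it.
have [k k0 Hk] := local_dist_variation mb w pm1 dm1 S ld0 e0.
have IE : inner p (velocity c t) (velocity g 0) = gform (@metric R n M i) (X i p) (u 0) w / d.
  have cc : {for t, continuous c} := C1_continuous Cc (x := t).
  rewrite (inner_chart ct g0 ip cc cg Dc Dg) gformZr gformC; first by rewrite mulrC.
  exact: Defs.metric_sym.
have cX : {for t, continuous (X i \o c)} := is_derive_continuous Dc.
have N1 : \forall s \near t, chart_dom i (c s) := near_chart_dom (C1_continuous Cc (x := t)) it.
have N2 : \forall s \near t, `|X i (c s) - X i p| < Num.min k (dist_radius r K).
  have kk : 0 < Num.min k (dist_radius r K) by rewrite lt_min k0.
  have /cvgrPdist_lt/(_ _ kk) := cX; apply: filterS => s /=; rewrite ct distrC => ->//.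
have N3 : \forall s \near t, `|derive1 (X i \o c) s - w| < k.
  exact: (near_norm_lt (C1_derive1_continuous Cc it) k0).
have := filterI N1 (filterI N2 N3); rewrite nbhs_ballP => -[b b0 Hb].
have N4 : \forall m' \near g d, chart_dom i m' /\ `|X i m' - X i (g d)| < Num.min k (dist_radius r K / 2).
  have kk : 0 < Num.min k (dist_radius r K / 2) by rewrite lt_min k0 divr_gt0.
  have cd : {for g d, continuous (X i)} by exact: chart_continuous.
  have /cvgrPdist_lt/(_ _ kk) A := cd.
  have B : nbhs (g d) (chart_dom i) by apply: open_nbhs_nbhs; split; [exact: chart_dom_open|].
  by apply: filterS2 A B => z /= Az Bz; rewrite distrC.
have [b' b'0 Hb'] := nbhs_ex_dist N4.
pose k' := Num.min k (Num.min (b / 3) b').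
have b0' : 0 < b by [].
have k'0 : 0 < k' by rewrite !lt_min k0 b'0 divr_gt0.
have k'k : k' <= k by rewrite ge_min lexx.
have k'b : k' <= b / 3 by rewrite !ge_min lexx !orbT.
have k'b' : k' <= b' by rewrite !ge_min lexx !orbT.
clearbody k'; exists k' => // s h m' st gm' hk.
have inb s' : `|s' - t| < b -> [/\ chart_dom i (c s'), `|X i (c s') - X i p| < Num.min k (dist_radius r K) &
    `|derive1 (X i \o c) s' - w| < k].
  by move=> s't; have [|? []] := Hb s' => //; rewrite /ball/= distrC.
have [im' m'd] : chart_dom i m' /\ `|X i m' - X i (g d)| < Num.min k (dist_radius r K / 2).
  by apply: Hb'; apply: (lt_le_trans gm'); rewrite lee_fin.
have s1 : `|s - t| < b by clear -b0' k'b st; apply: (le_lt_trans st); lra.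
have s2 : `|s + h - t| < b by clear -b0' k'b st hk; rewrite (_ : s + h - t = (s - t) + h) ?(le_lt_trans (ler_normD _ _))//; [lra|ring].
have [is1 ns1 _] := inb _ s1; have [is2 ns2 _] := inb _ s2.
move: ns1 ns2 m'd; rewrite !lt_min => /andP[n1 n1'] /andP[n2 n2'] /andP[m1 m1'].
have b1 : nball i p (dist_radius r K) (c s) by split => //; exact: ltW.
have b2 : nball i p (dist_radius r K) (c (s + h)) by split => //; exact: ltW.
have b3 : nball i p (dist_radius r K) m'.
  split => //; have [_ dm'] := near _ Id; rewrite /cball/= in dm' *.
  rewrite (_ : X i m' - X i p = (X i m' - X i (g d)) + (X i (g d) - X i p)); last by rewrite addrA subrK.
  by clear -m1' dm'; rewrite (le_trans (ler_normD _ _))//; lra.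
rewrite (dist_local nc b1 b3) (dist_local nc b2 b3) -EFinD lee_fin IE -LD.
have [_ c1] := b1; have [_ c2] := b2; have [_ c3] := b3.
apply: Hk; try exact: (dist_radius_cball mb); try exact: ltW; first by apply: (le_trans hk).
have stb : `|s - t| <= b / 3 by exact: le_trans k'b.
have hb : `|h| <= b / 3 by exact: le_trans k'b.
by apply: (near_strict_derivative (f := X i \o c) (df := derive1 (X i \o c)) b0 (ltW k0) _ stb hb) => s' /inb[is' _ /ltW ws']; split => //; exact: C1_is_derive.
Qed.

Lemma unit_segment_reverse g (a : R) : unit_segment g a -> unit_segment (fun s => g (a - s)) a.
Proof.
move=> [a0 iso loc]; split => //.
  apply: isometric_on_sub (isometric_on_reverse iso) => s /=.
  by rewrite !in_itv/= => /andP[? ?]; split_lra.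
move=> t; rewrite in_itv/= => /andP[t0 ta].
have [|b b0 H] := loc (a - t); first by rewrite in_itv/=; split_lra.
exists b => //; have := isometric_on_reverse (c := a) H; apply: isometric_on_sub => s /=.
by rewrite (_ : a - s - (a - t) = - (s - t)) ?normrN//; ring.
Qed.

Lemma unit_segment_velocity g (a t : R) i : unit_segment g a -> t \in `[0, a] -> chart_dom i (g t) ->
  {for t, continuous g} /\ is_derive t (1 : R) (X i \o g) (derive1 (X i \o g) t).
Proof.
move=> [a0 iso loc] ta it; have [c [v [cg c0 D _]]] := locally_isometric_derive (loc t ta) it.
by have [D0 _] := nbhs_singleton D; rewrite (is_derive1_derive1 D0).
Qed.

Lemma velocity_reverse g (a : R) : unit_segment g a ->
  velocity (fun s => g (a - s)) 0 = - velocity g a.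
Proof.
move=> us; have [a0 _ _] := us; rewrite /velocity subr0.
have aI : a \in `[0, a] by rewrite in_itv/= lexx ltW.
have [_ D] := unit_segment_velocity us aI (mem_chart_at _).
have E0 : -1 * 0 + a = a by rewrite mulr0 add0r.
have D' : is_derive (0 : R) (1 : R) (fun s => (chart (chart_at (g a)) \o g) (-1 * s + a))
    (-1 *: derive1 (chart (chart_at (g a)) \o g) a).
  by apply: is_derive_affine; rewrite E0.
rewrite scaleN1r in D'; apply: is_derive1_derive1.
rewrite (_ : _ \o _ = fun s => (chart (chart_at (g a)) \o g) (-1 * s + a))//.
by apply/funext => s /=; rewrite mulN1r addrC.
Qed.

End velocities.

Section limits_of_segments.
Context {R : realType} {n : nat} {M : riemannianManifold R n}.
Implicit Types (p q z m : M) (g h : R -> M).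

Lemma isometric_concat g1 g2 (a1 a2 : R) : 0 <= a1 -> 0 <= a2 -> isometric_on `[0, a1] g1 ->
  isometric_on `[0, a2] g2 -> g1 a1 = g2 0 -> dist (g1 0) (g2 a2) = (a1 + a2)%:E ->
  exists g, [/\ isometric_on `[0, a1 + a2] g, forall s : R, 0 <= s <= a1 -> g s = g1 s &
    forall s : R, a1 <= s <= a1 + a2 -> g s = g2 (s - a1)].
Proof.
move=> a10 a20 i1 i2 g12 d12.
pose g s := if s <= a1 then g1 s else g2 (s - a1).
have gl s : 0 <= s <= a1 -> g s = g1 s by move=> /andP[_ sa]; rewrite /g sa.
have gr s : a1 <= s <= a1 + a2 -> g s = g2 (s - a1).
  move=> /andP[sa _]; rewrite /g; case: leP => // sa'.
  by have -> : s = a1 by [lra]; rewrite subrr.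
have I1 s : 0 <= s <= a1 -> `[0, a1]%classic s by rewrite /= in_itv.
have I2 s : a1 <= s <= a1 + a2 -> `[0, a2]%classic (s - a1) by move=> /andP[? ?]; rewrite /= in_itv/=; split_lra.
exists g; split => //.
have W s t : 0 <= s -> s <= t -> t <= a1 + a2 -> dist (g s) (g t) = (t - s)%:E.
  move=> s0 st ta; have [ta1|ta1] := leP t a1.
    have Is : 0 <= s <= a1 by split_lra.
    have It : 0 <= t <= a1 by split_lra.
    rewrite (gl s)// (gl t)// (i1 _ _ (I1 s Is) (I1 t It)) ler0_norm; last lra.
    by congr (_%:E); ring.
  have [sa1|sa1] := leP a1 s.
    have Is : a1 <= s <= a1 + a2 by split_lra.
    have It : a1 <= t <= a1 + a2 by split_lra.
    rewrite (gr s)// (gr t)// (i2 _ _ (I2 s Is) (I2 t It)) ler0_norm; last lra.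
    by congr (_%:E); ring.
  have Is : 0 <= s <= a1 by split_lra.
  have It : a1 <= t <= a1 + a2 by clear -ta ta1; split_lra.
  have I00 : 0 <= (0 : R) <= a1 by rewrite lexx.
  have I11 : 0 <= a1 <= a1 by rewrite lexx a10.
  have J0 : `[0, a2]%classic (0 : R) by rewrite /= in_itv/= lexx.
  have J1 : `[0, a2]%classic a2 by rewrite /= in_itv/= lexx a20.
  rewrite (gl s)// (gr t)//; apply/eqP; rewrite eq_le; apply/andP; split.
    have h1 : (dist (g1 s) (g1 a1) <= (a1 - s)%:E)%E by clear -i1 I1 Is I11; rewrite i1 ?ler0_norm ?lee_fin; [lra|lra|exact: I1|exact: I1].
    have h2 : (dist (g1 a1) (g2 (t - a1)%R) <= (t - a1)%:E)%E.
      clear -i2 g12 I2 It J0; by rewrite g12 i2 ?ler0_norm ?lee_fin; [lra|lra|exact: J0|exact: I2].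
    by apply: (le_trans (dist_le_add h1 h2)); rewrite lee_fin; lra.
  have h1 : ((a1 + a2)%:E <= dist (g1 0%R) (g2 a2))%E by rewrite d12.
  have h2 : (dist (g2 (t - a1)%R) (g2 a2) <= (a1 + a2 - t)%:E)%E.
    by clear -i2 I2 It J1; rewrite i2 ?ler0_norm ?lee_fin; [lra|lra|exact: I2|exact: J1].
  have h3 := dist_ge_sub h1 h2; rewrite dist_sym in h3.
  have h4 : (dist (g1 s) (g1 0%R) <= s%:E)%E by rewrite (i1 _ _ (I1 s Is) (I1 0 I00)) subr0 ger0_norm.
  rewrite dist_sym; have := dist_ge_sub h3 h4.
  by rewrite (_ : a1 + a2 - (a1 + a2 - t) - s = t - s)//; ring.
move=> s t /=; rewrite !in_itv/= => /andP[s0 sa] /andP[t0 ta].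
have [st|st] := leP s t.
  by rewrite W// ler0_norm; [congr (_%:E); ring|lra].
by rewrite dist_sym W//; [rewrite ger0_norm//; lra|lra].
Qed.

Lemma compact_dist_ball p : exists2 rho : R, 0 < rho & exists2 K : set M, compact K &
  forall z, (dist p z < rho%:E)%E -> K z.
Proof.
pose i := chart_at p; have ip : chart_dom i p := mem_chart_at p.
have [r [K nc]] := ex_normal_chart ip.
have [r0 K1 R10 r4 /andP[h0 h1]] := normal_chart_radius nc.
exists (geodesic_radius r K / (4 * K)); first by rewrite divr_gt0// mulr_gt0//; lra.
have rr : geodesic_radius r K / 2 <= r by lra.
exists (nball i p (geodesic_radius r K / 2)); first exact: (compact_nball nc rr).
move=> z pz; have p1 : nball i p (dist_radius r K) p by split => //; rewrite /cball/= subrr normr0 ltW.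
by have [] := dist_lt_nball nc p1 pz (lexx _).
Qed.

Lemma cluster_pair (K1 K2 : set M) (u1 u2 : nat -> M) : compact K1 -> compact K2 ->
  (forall k, K1 (u1 k)) -> (forall k, K2 (u2 k)) ->
  exists z1 z2, forall (e : R) N, 0 < e -> exists k, [/\ (N <= k)%N,
    (dist z1 (u1 k) < e%:E)%E & (dist z2 (u2 k) < e%:E)%E].
Proof.
move=> c1 c2 H1 H2; have [z1 _ Hz1] := compact_cluster_seq c1 H1.
have /choice[f Hf] : forall j : nat, exists k, (j <= k)%N /\ (dist z1 (u1 k) < (j.+1%:R^-1)%:E)%E.
  move=> j; have j0 : 0 < j.+1%:R^-1 :> R by rewrite invr_gt0.
  by have [k jk dk] := Hz1 _ j j0; exists k.
have [z2 _ Hz2] := compact_cluster_seq c2 (fun j => H2 (f j)).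
exists z1, z2 => e N e0.
have [N' HN'] : exists N' : nat, N'.+1%:R^-1 < e.
  have := near_infty_natSinv_lt (PosNum e0) => -[N' _ H]; exists N'.
  exact: H (leqnn N').
have [j Nj dj] := Hz2 e (maxn N N') e0; have [jf df] := Hf j.
exists (f j); split => //.
  by apply: leq_trans jf; apply: leq_trans Nj; rewrite leq_maxl.
apply: (lt_trans df); rewrite lte_fin; apply: le_lt_trans HN'.
by rewrite lef_pV2 ?posrE// ler_nat ltnS; apply: leq_trans Nj; rewrite leq_maxr.
Qed.


Lemma ex_invSn_lt (e : R) : 0 < e -> exists N : nat, forall k, (N <= k)%N -> k.+1%:R^-1 < e.
Proof.
move=> e0; have := near_infty_natSinv_lt (PosNum e0) => -[N _ H].
by exists N => k Nk; exact: H.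
Qed.

Hypothesis hM : complete_manifold M.

Lemma ex_segment_through p z1 z2 q (d a : R) : 0 < d -> 2 * d < a ->
  (dist p z1 <= d%:E)%E -> (dist z1 z2 <= (a - 2 * d)%:E)%E -> (dist z2 q <= d%:E)%E ->
  dist p q = a%:E ->
  exists h, [/\ unit_segment h a, h 0 = p, h d = z1, h (a - d) = z2 & h a = q].
Proof.
move=> d0 da p1 p2 p3 pq.
have q0 : ((d + (a - 2 * d) + d)%:E <= dist p q)%E by rewrite pq lee_fin; lra.
have [q1 q3] := dist_additive (dist_le_add p1 p2) p3 q0.
have q1' : ((d + (a - 2 * d))%:E <= dist p z2)%E by rewrite q1.
have [q2 q4] := dist_additive p1 p2 q1'.
have ad0 : 0 < a - 2 * d by lra.
have a0 : 0 < a by lra.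
have [f1 [f10 f11 i1]] := ex_joined hM d0 q2.
have [f2 [f20 f21 i2]] := ex_joined hM ad0 q4.
have [f3 [f30 f31 i3]] := ex_joined hM d0 q3.
have [|f12 [i12 L12 R12]] := isometric_concat (ltW d0) (ltW ad0) i1 i2 (etrans f11 (esym f20)).
  by rewrite f10 f21 q1.
have da2 : 0 <= d + (a - 2 * d) by lra.
have I1 : 0 <= (0 : R) <= d by rewrite lexx ltW.
have I2 : 0 <= d <= d by rewrite lexx ltW.
have I3 : d <= d + (a - 2 * d) <= d + (a - 2 * d) by clear -da; split_lra.
have I4 : 0 <= (0 : R) <= d + (a - 2 * d) by rewrite lexx.
have I5 : 0 <= d <= d + (a - 2 * d) by clear -d0 da; split_lra.
have I6 : 0 <= a - d <= d + (a - 2 * d) by clear -d0 da; split_lra.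
have aE : d + (a - 2 * d) + d = a by ring.
have I7 : d + (a - 2 * d) <= a <= a by clear -d0; split_lra.
have e12 : f12 (d + (a - 2 * d)) = f3 0 by rewrite (R12 _ I3) f30 -f21; congr (f2 _); ring.
have f120 : f12 0 = p by rewrite (L12 _ I1).
have [|f [iF LF RF]] := isometric_concat da2 (ltW d0) i12 i3 e12.
  by rewrite f120 f31 pq aE.
rewrite aE in iF RF.
have [h uh hE] := isometric_unit_segment a0 iF.
have hE' s : 0 <= s <= a -> h s = f s by move=> sI; apply: hE; rewrite in_itv.
have J1 : 0 <= (0 : R) <= a by rewrite lexx ltW.
have J2 : 0 <= d <= a by clear -d0 da; split_lra.
have J3 : 0 <= a - d <= a by clear -d0 da; split_lra.
have J4 : 0 <= a <= a by rewrite lexx ltW.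
exists h; split => //.
- by rewrite (hE' _ J1) (LF _ I4).
- by rewrite (hE' _ J2) (LF _ I5) (L12 _ I2).
- by rewrite (hE' _ J3) (LF _ I6) (_ : a - d = d + (a - 2 * d)) ?e12//; ring.
- by rewrite (hE' _ J4) (RF _ I7) -f31; congr (f3 _); ring.
Qed.

Lemma limit_segment p q (a : R) : 0 < a -> dist p q = a%:E -> exists2 d0 : R, 0 < d0 &
  forall (d : R) (P Q : nat -> M) (A : nat -> R), 0 < d <= d0 ->
    (forall k, (dist p (P k) < d%:E)%E) -> (forall k, (dist q (Q k) < d%:E)%E) ->
    (forall e : R, 0 < e -> exists N, forall k, (N <= k)%N ->
       (dist p (P k) < e%:E)%E /\ (dist q (Q k) < e%:E)%E) ->
    (forall k, dist (P k) (Q k) = (A k)%:E) ->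
    exists h u1 u2, [/\ unit_segment h a, h 0 = p & h a = q] /\
    [/\ forall k, dist (P k) (u1 k) = d%:E,
      forall k, dist (u1 k) (u2 k) = (A k - 2 * d)%:E, forall k, dist (u2 k) (Q k) = d%:E &
      forall (e : R) N, 0 < e -> exists k, [/\ (N <= k)%N,
        (dist (h d) (u1 k) < e%:E)%E & (dist (h (a - d)%R) (u2 k) < e%:E)%E]].
Proof.
move=> a0 pq; have [r1 r10 [K1 cK1 HK1]] := compact_dist_ball p.
have [r2 r20 [K2 cK2 HK2]] := compact_dist_ball q.
pose d0 := Num.min (Num.min r1 r2 / 2) (a / 8).
have d00 : 0 < d0 by rewrite lt_min !divr_gt0// lt_min r10.
exists d0 => // d P Q A /andP[d_0]; rewrite le_min => /andP[dr da] pP qQ lim0 PQ.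
have dr1 : 2 * d <= r1 by have : Num.min r1 r2 <= r1 by [rewrite ge_min lexx]; lra.
have dr2 : 2 * d <= r2 by have : Num.min r1 r2 <= r2 by [rewrite ge_min lexx orbT]; lra.
clear d0 d00 dr.
have A4 k : 4 * d <= A k.
  have h1 : (a%:E <= dist p q)%E by rewrite pq.
  have h2 : ((a - d)%:E <= dist p (Q k))%E by apply: (dist_ge_sub h1); rewrite dist_sym ltW.
  rewrite dist_sym in h2; have h3 : ((a - d - d)%:E <= dist (Q k) (P k))%E by apply: (dist_ge_sub h2); rewrite dist_sym ltW.
  by move: h3; rewrite dist_sym PQ lee_fin; lra.
have /choice[g Hg] : forall k, exists g, [/\ unit_segment g (A k), g 0 = P k & g (A k) = Q k].
  by move=> k; apply: ex_unit_segment => //; have := A4 k; lra.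
pose u1 k := g k d; pose u2 k := g k (A k - d).
have mid k : [/\ dist (P k) (u1 k) = d%:E, dist (u1 k) (u2 k) = (A k - 2 * d)%:E & dist (u2 k) (Q k) = d%:E].
  have [[_ iso _] g0 ga] := Hg k; have h3 := A4 k.
  have I s : 0 <= s <= A k -> `[0, A k]%classic s by rewrite /= in_itv.
  have I1 : `[0, A k]%classic 0 by apply: I; rewrite lexx; lra.
  have I2 : `[0, A k]%classic d by apply: I; split_lra.
  have I3 : `[0, A k]%classic (A k - d) by apply: I; split_lra.
  have I4 : `[0, A k]%classic (A k) by clear -d_0 h3 I; apply: I; rewrite lexx andbT; lra.
  rewrite -g0 -ga /u1 /u2 !iso//; split; congr (_%:E).
  - by rewrite sub0r normrN gtr0_norm.
  - by clear -d_0 h3; rewrite ler0_norm; [ring|lra].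
  - by rewrite ler0_norm; [ring|lra].
have K1u k : K1 (u1 k).
  apply: HK1; have [m1 _ _] := mid k; have e2 : (dist (P k) (u1 k) <= d%:E)%E by rewrite m1.
  apply: (le_lt_trans (dist_triangle p (P k) (u1 k))); rewrite m1.
  apply: (@lt_le_trans _ _ (d + d)%:E); first by rewrite EFinD lte_leD// fin_numE.
  by rewrite lee_fin; lra.
have K2u k : K2 (u2 k).
  apply: HK2; have [_ _ m1] := mid k.
  apply: (le_lt_trans (dist_triangle q (Q k) (u2 k))); rewrite (dist_sym (Q k)) m1.
  apply: (@lt_le_trans _ _ (d + d)%:E); first by rewrite EFinD lte_leD// fin_numE.
  by rewrite lee_fin; lra.
have [z1 [z2 Hz]] := cluster_pair cK1 cK2 K1u K2u.
have lim (e : R) : 0 < e -> [/\ (dist p z1 <= (d + e)%:E)%E, (dist z1 z2 <= (a - 2 * d + e)%:E)%E &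
    (dist z2 q <= (d + e)%:E)%E].
  move=> e0; have e40 : 0 < e / 4 by rewrite divr_gt0.
  have [N HN] := lim0 _ e40.
  have [k [Nk k1 k2]] := Hz _ N e40; have [D1 D2] := HN k Nk; have [m1 m2 m3] := mid k.
  have e1 : (dist p (P k) <= (e / 4)%:E)%E by exact: ltW.
  have e2 : (dist (Q k) q <= (e / 4)%:E)%E by rewrite dist_sym ltW.
  have e3 : (dist (u1 k) z1 <= (e / 4)%:E)%E by rewrite dist_sym ltW.
  have e4 : (dist (u2 k) z2 <= (e / 4)%:E)%E by rewrite dist_sym ltW.
  have e5 : (dist (P k) (u1 k) <= d%:E)%E by rewrite m1.
  have e6 : (dist (u2 k) (Q k) <= d%:E)%E by rewrite m3.
  have e7 : (dist (u1 k) (u2 k) <= (A k - 2 * d)%:E)%E by rewrite m2.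
  have Ak : A k <= a + e / 2.
    have e1' : (dist (P k) p <= (e / 4)%:E)%E by rewrite dist_sym.
    have e2' : (dist q (Q k) <= (e / 4)%:E)%E by exact: ltW.
    have pq' : (dist p q <= a%:E)%E by rewrite pq.
    by clear -PQ e1' e2' pq'; have := dist_le_add (dist_le_add e1' pq') e2'; rewrite PQ lee_fin; lra.
  split.
  - by clear -e0 e1 e3 e5; apply: (le_trans (dist_le_add (dist_le_add e1 e5) e3)); rewrite lee_fin; lra.
  - by clear -k1 e4 e7 Ak; apply: (le_trans (dist_le_add (dist_le_add (ltW k1) e7) e4)); rewrite lee_fin; lra.
  - by clear -e0 k2 e2 e6; apply: (le_trans (dist_le_add (dist_le_add (ltW k2) e6) e2)); rewrite lee_fin; lra.
have p1 : (dist p z1 <= d%:E)%E by apply/lee_addgt0Pr => e /lim[]; rewrite EFinD.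
have p2 : (dist z1 z2 <= (a - 2 * d)%:E)%E by apply/lee_addgt0Pr => e /lim[_]; rewrite EFinD.
have p3 : (dist z2 q <= d%:E)%E by apply/lee_addgt0Pr => e /lim[_ _]; rewrite EFinD.
have d2a : 2 * d < a by lra.
have [h [uh h0 hd had ha]] := ex_segment_through d_0 d2a p1 p2 p3 pq.
exists h, u1, u2; split => //; split; try by move=> k; have [] := mid k.
by move=> e N e0; have [k [Nk zk1 zk2]] := Hz e N e0; exists k; rewrite hd had.
Qed.

End limits_of_segments.

Section circle_distance.
Context {R : realType} {n : nat} {M : riemannianManifold R n}.
Variable c : R -> M.
Hypothesis hc : smooth_circle c.
Implicit Types (x y z s t : R) (g h : R -> M).

Lemma circle_C1 : C1_curve c.
Proof. by have [sm _ _ _] := hc; exact: (sm 1%N). Qed.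

Lemma circle_periodic t (k : int) : c (t + k%:~R) = c t.
Proof.
have [_ per _ _] := hc.
have P (j : nat) s : c (s + j%:R) = c s.
  elim: j s => [|j IH] s; first by rewrite addr0.
  by rewrite -addn1 natrD addrA per IH.
case: k => j; first exact: P.
by rewrite NegzE -(P j.+1) mulrNz -addrA addNr addr0.
Qed.

Lemma circle_eqP s t : c s = c t <-> exists k : int, s = t + k%:~R.
Proof.
split; first by have [_ _ + _] := hc; apply.
by move=> [k ->]; rewrite circle_periodic.
Qed.

Lemma velocity_periodic t (k : int) : velocity c (t + k%:~R) = velocity c t.
Proof.
rewrite /velocity circle_periodic; set i := chart_at (c t).
have it : chart_dom i (c (t + k%:~R)) by rewrite circle_periodic; exact: mem_chart_at.
have D := C1_is_derive circle_C1 it.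
have E : 1 * t + k%:~R = t + k%:~R by rewrite mul1r.
have D' : is_derive t (1 : R) (fun s => (chart i \o c) (1 * s + k%:~R)) (1 *: derive1 (chart i \o c) (t + k%:~R)).
  by apply: is_derive_affine; rewrite E.
rewrite scale1r in D'; rewrite (_ : (fun s => _) = chart i \o c) in D'.
  by rewrite (is_derive1_derive1 D').
by apply/funext => s /=; rewrite mul1r circle_periodic.
Qed.

Lemma tangentE x v : tangent c (c x) v <-> exists l : R, v = l *: velocity c x.
Proof.
split=> [[t [l [/circle_eqP[k ->] ->]]]|[l ->]]; last by exists x, l.
by exists l; rewrite velocity_periodic.
Qed.

Definition cdist x y : R := fine (dist (c x) (c y)).
Local Notation D := cdist.

Lemma cdistE x y : dist (c x) (c y) = (D x y)%:E.
Proof.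
suff f : dist (c x) (c y) \is a fin_num by rewrite fineK.
rewrite ge0_fin_numE ?dist_ge0//.
wlog : x y / x < y => [H|xy].
  have [/H//|/H|->] := ltgtP x y; first by rewrite dist_sym.
  by rewrite distxx ltry.
have gh : {in `[x, y], c =1 c} by [].
have [l H] := pwC1_piece xy circle_C1 gh.
by rewrite (le_lt_trans (dist_le_length H))// ltry.
Qed.

Lemma cdist_sym x y : D x y = D y x.
Proof. by rewrite /D dist_sym. Qed.

Lemma cdistxx x : D x x = 0.
Proof. by rewrite /D distxx. Qed.

Lemma cdist_ge0 x y : 0 <= D x y.
Proof. by rewrite -lee_fin -cdistE dist_ge0. Qed.

Lemma cdist_triangle x y z : D x z <= D x y + D y z.
Proof. by rewrite -lee_fin EFinD -!cdistE dist_triangle. Qed.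

Lemma cdist_eq0 x y : D x y = 0 <-> c x = c y.
Proof.
split=> [E|E]; last by rewrite /D E distxx.
by apply: dist_eq0; rewrite cdistE E.
Qed.

Lemma cdist_gt0 x y : c x <> c y -> 0 < D x y.
Proof. by move=> xy; rewrite lt_def cdist_ge0 andbT; apply/eqP => /cdist_eq0. Qed.

Lemma cdist_shiftl x y (k : int) : D (x + k%:~R) y = D x y.
Proof. by rewrite /D circle_periodic. Qed.

Lemma cdist_shiftr x y (k : int) : D x (y + k%:~R) = D x y.
Proof. by rewrite /D circle_periodic. Qed.

Lemma cdist_small x (e : R) : 0 < e -> exists2 d : R, 0 < d & forall y, `|y - x| < d -> D x y < e.
Proof.
move=> e0; have N : \forall y \near x, (dist (c x) (c y) < e%:E)%E.
  exact: (C1_continuous circle_C1 (nbhs_dist_lt (c x) e0)).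
move: N => /nbhs_ballP[d d0 H]; exists d => // y xy.
by rewrite -lte_fin -cdistE; apply: H; rewrite /ball/= distrC.
Qed.

Lemma cdist_close x y (e : R) : 0 < e -> exists2 d : R, 0 < d & forall x' y', `|x' - x| < d -> `|y' - y| < d ->
  `|D x' y' - D x y| < e.
Proof.
move=> e0; have e20 : 0 < e / 2 by rewrite divr_gt0.
have [d1 d10 H1] := cdist_small x e20; have [d2 d20 H2] := cdist_small y e20.
exists (Num.min d1 d2); first by rewrite lt_min d10.
move=> x' y'; rewrite !lt_min => /andP[/H1 a1 _] /andP[_ /H2 a2].
have t1 := cdist_triangle x' x y'; have t2 := cdist_triangle x y y'.
have t3 := cdist_triangle x x' y; have t4 := cdist_triangle x' y' y.
rewrite (cdist_sym x' x) in t1; rewrite (cdist_sym y' y) in t4.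
by rewrite ltr_norml; split_lra.
Qed.

Definition angle_at x g : R := inner (c x) (velocity c x) (velocity g 0).

Lemma cdist_variation x y g : unit_segment g (D x y) -> g 0 = c x -> g (D x y) = c y ->
  forall e : R, 0 < e -> exists2 k : R, 0 < k & forall h : R, `|h| <= k ->
    D (x + h) y <= D x y + (e * `|h| - h * angle_at x g).
Proof.
move=> us g0 ga e e0; have [a0 iso _] := us.
have [d0 d00 H] := endpoint_variation (c x).
pose d := Num.min d0 (D x y).
have d_0 : 0 < d by rewrite lt_min d00.
have dd0 : 0 < d <= d0 by rewrite d_0 ge_min lexx.
have da : d <= D x y by rewrite ge_min lexx orbT.
have [k k0 Hk] := H g _ d x c circle_C1 erefl us g0 dd0 da e e0.
exists k => // h hk; have := Hk x h (g d).
rewrite subrr normr0 (ltW k0) distxx lte_fin k0 => /(_ isT isT hk) h1.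
have Id : `[0, D x y]%classic d by rewrite /= in_itv/= (ltW d_0).
have I0 : `[0, D x y]%classic 0 by rewrite /= in_itv/= lexx ltW.
have I1 : `[0, D x y]%classic (D x y) by rewrite /= in_itv/= lexx ltW.
have E1 : dist (c x) (g d) = d%:E by rewrite -g0 iso// sub0r normrN gtr0_norm.
have E2 : (dist (g d) (c y) <= (D x y - d)%:E)%E by clear -ga iso da Id I1; rewrite -ga iso// ler0_norm ?lee_fin; lra.
rewrite E1 -EFinD in h1; have := dist_le_add h1 E2.
by clear -hc; rewrite cdistE lee_fin /angle_at; lra.
Qed.

Hypothesis hM : complete_manifold M.

Lemma descent_contradiction (A DD S iS d l1 l2 I1 I2 e eta n1 n2 : R) : 0 <= S -> 0 <= eta ->
  DD <= d + (e * (S * n1) - S * l1 * I1) + (A - 2 * d) + (d + (e * (S * n2) - S * l2 * - I2)) ->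
  A - iS * S < DD -> e * (n1 + n2) <= eta -> iS < eta -> l1 * I1 - l2 * I2 = 4 * eta -> False.
Proof.
move=> S0 eta0 F lt B1 B2 E4.
have C1 : S * (e * (n1 + n2)) <= S * eta by rewrite ler_wpM2l.
have C2 : S * iS <= S * eta by rewrite ler_wpM2l// ltW.
have C3 : S * (l1 * I1 - l2 * I2) = S * (4 * eta) by rewrite E4.
have C4 : 0 <= S * eta by rewrite mulr_ge0.
by move: F lt C1 C2 C3 C4; clear; move=> *; nra.
Qed.

Lemma inner_scalel p (l : R) (v v' : 'rV[R]_n) : @inner R n M p (l *: v) v' = l * inner p v v'.
Proof. by rewrite /inner -!scalemxAl mxE. Qed.

Lemma inner_oppr p (v v' : 'rV[R]_n) : @inner R n M p v (- v') = - inner p v v'.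
Proof. by rewrite /inner linearN mulmxN mxE. Qed.

Lemma descent_direction x y (l1 l2 : R) : c x <> c y ->
  (forall g, unit_segment g (D x y) -> g 0 = c x -> g (D x y) = c y ->
     l2 * inner (c y) (velocity c y) (velocity g (D x y)) < l1 * angle_at x g) ->
  exists eta k : R, [/\ 0 < eta, 0 < k & forall x' y' s, `|x' - x| <= k -> `|y' - y| <= k ->
    0 <= s <= k -> D (x' + s * l1) (y' + s * l2) <= D x' y' - eta * s].
Proof.
move=> xy reg.
apply: contrapT => NE.
have a0 := cdist_gt0 xy; have axy := cdistE x y.
have [d1 d10 V1] := endpoint_variation (c x).
have [d2 d20 V2] := endpoint_variation (c y).
have [d3 d30 LS] := limit_segment hM a0 axy.
pose d := Num.min (Num.min d1 d2) (Num.min d3 (D x y)).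
have d0 : 0 < d by rewrite !lt_min d10 d20 d30.
have dd1 : d <= d1 by rewrite !ge_min lexx.
have dd2 : d <= d2 by rewrite !ge_min lexx !orbT.
have : d <= Num.min d3 (D x y) by rewrite /d ge_min lexx orbT.
rewrite le_min => /andP[dd3 dda]; clearbody d.
have [b1 b10 C1] := cdist_small x d0; have [b2 b20 C2] := cdist_small y d0.
have /choice[w Hw] : forall k : nat, exists w : R * R * R, let: (x', y', s) := w in
    [/\ D x x' < d, D y y' < d, `|x' - x| <= k.+1%:R^-1, `|y' - y| <= k.+1%:R^-1 &
     0 <= s <= k.+1%:R^-1 /\ D x' y' - k.+1%:R^-1 * s < D (x' + s * l1) (y' + s * l2)].
  move=> k; apply: contrapT => Nk; apply: NE.
  have k0 : 0 < k.+1%:R^-1 :> R by rewrite invr_gt0.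
  have b0 : 0 < Num.min b1 b2 / 2 by rewrite divr_gt0// lt_min b10.
  exists k.+1%:R^-1, (Num.min k.+1%:R^-1 (Num.min b1 b2 / 2)); split => //.
    by rewrite lt_min k0.
  move=> x' y' s; rewrite !le_min => /andP[x1 x2] /andP[y1 y2] /andP[s0 /andP[s1 s2]].
  have mb1 : Num.min b1 b2 <= b1 by rewrite ge_min lexx.
  have mb2 : Num.min b1 b2 <= b2 by rewrite ge_min lexx orbT.
  rewrite leNgt; apply/negP => lt; apply: Nk; exists (x', y', s); split => //.
  - by clear -b10 C1 x2 mb1; apply: C1; lra.
  - by clear -b20 C2 y2 mb2; apply: C2; lra.
  - by rewrite s0 s1.
pose X k := (w k).1.1; pose Y k := (w k).1.2; pose S k := (w k).2.
have {}Hw k : [/\ D x (X k) < d, D y (Y k) < d, `|X k - x| <= k.+1%:R^-1, `|Y k - y| <= k.+1%:R^-1 &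
     0 <= S k <= k.+1%:R^-1 /\ D (X k) (Y k) - k.+1%:R^-1 * S k < D (X k + S k * l1) (Y k + S k * l2)].
  by move: (Hw k); rewrite /X /Y /S; case: (w k) => -[].
clearbody X Y S.
have near1 k : (dist (c x) (c (X k)) < d%:E)%E by rewrite cdistE lte_fin; have [] := Hw k.
have near2 k : (dist (c y) (c (Y k)) < d%:E)%E by rewrite cdistE lte_fin; have [] := Hw k.
have lim (e : R) : 0 < e -> exists N, forall k, (N <= k)%N ->
    (dist (c x) (c (X k)) < e%:E)%E /\ (dist (c y) (c (Y k)) < e%:E)%E.
  move=> e0; have [b1' b10' C1'] := cdist_small x e0; have [b2' b20' C2'] := cdist_small y e0.
  have bb0 : 0 < Num.min b1' b2' by rewrite lt_min b10'.
  have [N HN] := ex_invSn_lt bb0; exists N => k Nk; have := HN k Nk; rewrite lt_min => /andP[kb1 kb2].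
  have [_ _ h1 h2 _] := Hw k; rewrite !cdistE !lte_fin.
  by split; [apply: C1'; exact: le_lt_trans kb1|apply: C2'; exact: le_lt_trans kb2].
have d03 : 0 < d <= d3 by rewrite d0.
have [h [u1 [u2 [[uh h0 ha] [m1 m2 m3 Hz]]]]] :=
  LS d (c \o X) (c \o Y) (fun k => D (X k) (Y k)) d03 near1 near2 lim (fun k => cdistE _ _).
have := reg h uh h0 ha; rewrite /angle_at.
set I1 := inner (c x) (velocity c x) (velocity h 0).
set I2 := inner (c y) (velocity c y) (velocity h (D x y)) => neg.
pose eta := (l1 * I1 - l2 * I2) / 4; have eta0 : 0 < eta by clear -NE a0 d10 V1 d20 V2 d30 LS d0 dd1 dd2 dd3 dda b10 C1 b20 Hw d03 neg; rewrite divr_gt0//; lra.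
have E4 : l1 * I1 - l2 * I2 = 4 * eta by rewrite /eta; field.
clearbody eta; clear reg NE neg C1 C2.
pose L := `|l1| + `|l2| + 1.
have L0 : 0 < L by rewrite ltr_wpDl// addr_ge0.
pose e := eta / L.
have e0 : 0 < e by rewrite divr_gt0.
have eE : e * (`|l1| + `|l2|) <= eta.
  have E' : e * L = eta by rewrite divfK// gt_eqF.
  by move: E'; rewrite /L mulrDr mulr1 => <-; rewrite lerDl ltW.
have dl1 : 0 < d <= d1 by rewrite d0.
have dl2 : 0 < d <= d2 by rewrite d0.
have [k1 k10 W1] := V1 h _ d x c circle_C1 erefl uh h0 dl1 dda e e0.
have uh' := unit_segment_reverse uh.
have h0' : (fun s => h (D x y - s)) 0 = c y by rewrite /= subr0.
have [k2 k20 W2] := V2 _ _ d y c circle_C1 erefl uh' h0' dl2 dda e e0.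
rewrite (velocity_reverse uh) inner_oppr -/I2 /= in W2; rewrite -/I1 in W1.
clearbody e; have kmin0 : 0 < Num.min k1 k2 by rewrite lt_min k10.
have kk0 : 0 < Num.min (Num.min k1 k2) (Num.min eta (Num.min k1 k2 / L)) by rewrite !lt_min k10 k20 eta0 divr_gt0.
have [N HN] := ex_invSn_lt kk0.
have [k [Nk zk1 zk2]] := Hz _ N kmin0.
have := HN k Nk; rewrite !lt_min => /andP[/andP[kk1 kk2] /andP[keta kl]].
have [_ _ hx hy [/andP[s0 s1] lt]] := Hw k.
have zk1' : (dist (h d) (u1 k) < k1%:E)%E by apply: (lt_le_trans zk1); rewrite lee_fin ge_min lexx.
have zk2' : (dist (h (D x y - d)%R) (u2 k) < k2%:E)%E by apply: (lt_le_trans zk2); rewrite lee_fin ge_min lexx orbT.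
have sL : S k * L <= Num.min k1 k2 by rewrite -ler_pdivlMr//; apply: (le_trans s1); exact: ltW.
have sl (l : R) : `|l| <= L -> `|S k * l| <= Num.min k1 k2 by move=> ll; rewrite normrM (ger0_norm s0) (le_trans _ sL)// ler_wpM2l.
have sl1 : `|S k * l1| <= k1.
  apply: (le_trans (sl _ _)); last by rewrite ge_min lexx.
  by rewrite /L -addrA lerDl addr_ge0.
have sl2 : `|S k * l2| <= k2.
  apply: (le_trans (sl _ _)); last by rewrite ge_min lexx orbT.
  by rewrite /L addrAC lerDr addr_ge0.
have F1 := W1 (X k) (S k * l1) (u1 k) (le_trans hx (ltW kk1)) zk1' sl1.
have F2 := W2 (Y k) (S k * l2) (u2 k) (le_trans hy (ltW kk2)) zk2' sl2.
have m1' := m1 k; have m3' := m3 k; rewrite /= in m1' m3'.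
rewrite m1' -EFinD in F1; rewrite [dist (c (Y k)) _]dist_sym m3' -EFinD in F2.
have F3 : (dist (u1 k) (u2 k) <= (D (X k) (Y k) - 2 * d)%:E)%E by rewrite m2.
rewrite (dist_sym (c (Y k + S k * l2))) in F2.
have := dist_le_add (dist_le_add F1 F3) F2; rewrite cdistE lee_fin => F.
rewrite !normrM (ger0_norm s0) in F.
exact: (descent_contradiction s0 (ltW eta0) F lt eE keta E4).
Qed.

Lemma regular_descent x y : c x <> c y -> regular_pair c (c x) (c y) ->
  exists l1 l2 eta k : R, [/\ 0 < eta, 0 < k & forall x' y' s, `|x' - x| <= k -> `|y' - y| <= k ->
    0 <= s <= k -> D (x' + s * l1) (y' + s * l2) <= D x' y' - eta * s].
Proof.
move=> xy [v1 [v2 [/tangentE[l1 v1E] /tangentE[l2 v2E] reg]]].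
exists l1, l2; apply: descent_direction => // g ug g0 ga.
have := reg g (D x y) (unit_segment_minimising ug) g0 ga.
by rewrite v1E v2E !inner_scalel subr_lt0.
Qed.

End circle_distance.

Section real_topology.
Context {R : realType}.
Implicit Types (x y z s t : R).

Lemma compact_seq_cluster (T : topologicalType) (A : set T) (u : nat -> T) :
  compact A -> (forall k, A (u k)) ->
  exists2 z, A z & forall U N, nbhs z U -> exists2 k, (N <= k)%N & U (u k).
Proof.
move=> cA Au; have FA : (u @ \oo) A by exists 0%N => // k _; exact: Au.
have [z [Az cz]] := cA _ _ FA; exists z => // U N zU.
have [|_ [[k Nk <-] zk]] := cz (u @` [set k | (N <= k)%N]) U _ zU.
  by exists N => // k Nk; exists k.
by exists k.
Qed.

Lemma square_seq_cluster (u v : nat -> R) : (forall k, 0 <= u k <= 1) -> (forall k, 0 <= v k <= 1) ->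
  exists x y, [/\ 0 <= x <= 1, 0 <= y <= 1 & forall (e : R) N, 0 < e -> exists k,
    [/\ (N <= k)%N, `|u k - x| < e & `|v k - y| < e]].
Proof.
move=> hu hv; have cK := compact_setX (segment_compact (a := 0 : R) (b := 1)) (segment_compact (a := 0 : R) (b := 1)).
have [|[x y] [/= xI yI] H] := @compact_seq_cluster _ _ (fun k => (u k, v k)) cK.
  by move=> k; split; rewrite /= in_itv/=.
exists x, y; rewrite !in_itv/= in xI yI; split => // e N e0.
have [|k Nk [/= h1 h2]] := H (ball x e `*` ball y e) N.
  by exists (ball x e, ball y e) => //; split; apply: nbhsx_ballx.
by exists k; split => //; rewrite distrC.
Qed.

Lemma continuous_clip (f : R -> R) a b : a <= b ->
  (forall t e, a <= t <= b -> 0 < e -> exists2 d, 0 < d & forall s, a <= s <= b -> `|s - t| < d -> `|f s - f t| < e) ->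
  continuous (f \o clip a b).
Proof.
move=> ab H t; apply/cvgrPdist_lt => e e0.
have [d d0 Hd] := H _ e (clip_itv t ab) e0.
have /cvgrPdist_lt/(_ d d0) := @continuous_clip_id _ a b t; apply: filterS => s st.
by rewrite distrC; apply: Hd; [exact: clip_itv|rewrite distrC].
Qed.

Lemma continuous_eps (f : R -> R) t e : continuous f -> 0 < e ->
  exists2 d, 0 < d & forall s, `|s - t| < d -> `|f s - f t| < e.
Proof.
move=> cf e0; have /nbhs_ballP[d d0 H] := near_norm_lt (cf t) e0.
by exists d => // s st; apply: H; rewrite /ball/= distrC.
Qed.

Lemma ex_frac x : exists k : int, 0 <= x + k%:~R < 1.
Proof.
exists (- Num.floor x); have /andP[h1 h2] := floor_itv x.
rewrite intrD in h2; rewrite mulrNz; split_lra.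
Qed.

Lemma int_eq0 (k : int) : `|k%:~R : R| < 1 -> k = 0.
Proof.
by rewrite -intr_norm (_ : 1 = 1%:~R)// ltr_int -[1]add0r ltzD1 normr_le0 => /eqP.
Qed.

End real_topology.

Section circle_lifts.
Context {R : realType} {n : nat} {M : riemannianManifold R n}.
Variable c : R -> M.
Hypothesis hc : smooth_circle c.
Implicit Types (x y z s t : R).
Local Notation D := (cdist c).

Lemma continuous_cdist : continuous (fun z : R * R => D z.1 z.2).
Proof.
move=> [x y]; apply/cvgrPdist_lt => e e0.
have [d d0 H] := cdist_close hc x y e0.
exists (ball x d, ball y d); first by split; exact: nbhsx_ballx.
move=> [x' y'] [/= h1 h2]; rewrite distrC; apply: H; rewrite distrC//.
Qed.

Lemma ex_cdist_max : exists x0 y0, forall x y, D x y <= D x0 y0.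
Proof.
have cK := compact_setX (segment_compact (a := 0 : R) (b := 1)) (segment_compact (a := 0 : R) (b := 1)).
have ne : (`[(0 : R), 1]%classic `*` `[(0 : R), 1]%classic) !=set0 by exists (0, 0); split; rewrite /= in_itv/= lexx ler01.
have [|[x0 y0] _ H] := compact_EVT_max ne cK (f := fun z : R * R => D z.1 z.2).
  exact/continuous_subspaceT/continuous_cdist.
exists x0, y0 => x y; have [k /andP[k1 k2]] := ex_frac x; have [j /andP[j1 j2]] := ex_frac y.
rewrite -(cdist_shiftl hc x y k) -(cdist_shiftr hc _ y j); apply: (H (_, _)).
by apply/mem_set; split; rewrite /= in_itv/= ?k1 ?j1/= ltW.
Qed.

Lemma circle_inverse (e : R) : 0 < e -> exists2 d, 0 < d & forall x y, D x y < d ->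
  exists k : int, `|x - y - k%:~R| < e.
Proof.
move=> e0; apply: contrapT => NE.
have /choice[w Hw] : forall k : nat, exists w : R * R, [/\ 0 <= w.1 <= 1, 0 <= w.2 <= 1,
    D w.1 w.2 < k.+1%:R^-1 & forall j : int, e <= `|w.1 - w.2 - j%:~R|].
  move=> k; apply: contrapT => Nk; apply: NE; exists k.+1%:R^-1; first by rewrite invr_gt0.
  move=> x y xy; apply: contrapT => nj; apply: Nk.
  have [kx /andP[k1 k2]] := ex_frac x; have [ky /andP[j1 j2]] := ex_frac y.
  exists (x + kx%:~R, y + ky%:~R); split; rewrite /= ?k1 ?j1 ?(ltW k2) ?(ltW j2) ?cdist_shiftl ?cdist_shiftr//.
  move=> j; rewrite leNgt; apply/negP => h; apply: nj; exists (j + ky - kx).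
  by rewrite (_ : x - y - _ = x + kx%:~R - (y + ky%:~R) - j%:~R)// !intrD mulrNz; ring.
have [||x [y [_ _ H]]] := @square_seq_cluster R (fun k => (w k).1) (fun k => (w k).2).
- by move=> k; have [] := Hw k.
- by move=> k; have [] := Hw k.
have D0 : D x y = 0.
  apply/eqP; rewrite eq_le (cdist_ge0 hc) andbT; apply/ler_addgt0Pr => a a0; rewrite add0r.
  have a20 : 0 < a / 2 by rewrite divr_gt0.
  have [d d0 Hd] := cdist_close hc x y a20; have [N HN] := ex_invSn_lt a20.
  have [k [Nk h1 h2]] := H d N d0; have := Hd _ _ h1 h2; have [_ _ h3 _] := Hw k; have h4 := HN k Nk.
  by rewrite ltr_norml => /andP[h5 _]; move: h3 h4; move: (k.+1%:R^-1) => *; lra.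
have [j xyE] := (circle_eqP hc x y).1 ((cdist_eq0 hc x y).1 D0).
have e20 : 0 < e / 2 by rewrite divr_gt0.
have [k [_ h1 h2]] := H (e / 2) 0%N e20; have [_ _ _ /(_ j)] := Hw k.
rewrite leNgt => /negP; apply.
rewrite (_ : _ - _ - _ = ((w k).1 - x) - ((w k).2 - y)); last by rewrite xyE; ring.
by apply: (le_lt_trans (ler_normB _ _)); lra.
Qed.

Lemma circle_lift (p : R -> M) x0 : (forall t, 0 <= t <= 1 -> range c (p t)) ->
  {within `[0, 1], continuous p} -> c x0 = p 0 ->
  exists X : R -> R, [/\ continuous X, X 0 = x0 & forall t, 0 <= t <= 1 -> c (X t) = p t].
Proof.
move=> rp cp xp0.
have pc t e : 0 <= t <= 1 -> 0 < e -> exists2 d, 0 < d & forall s, 0 <= s <= 1 -> `|s - t| < d ->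
    (dist (p t) (p s) < e%:E)%E.
  move=> tI e0; have /subspace_continuousP/(_ t) := cp; rewrite /= in_itv/= => /(_ tI).
  move=> /(_ _ (nbhs_dist_lt (p t) e0)); rewrite /= nbhs_simpl/= /within/= => /nbhs_ballP[d d0 H].
  by exists d => // s sI st; apply: H; [rewrite /ball/= distrC|rewrite in_itv].
have /choice[xi Hxi] : forall t, exists x, 0 <= t <= 1 -> c x = p t.
  move=> t; have [tI|nt] := pselect (0 <= t <= 1); last by exists 0.
  by have [x _ xE] := rp t tI; exists x.
have e80 : 0 < 8^-1 :> R by rewrite invr_gt0.
have [dl dl0 Hdl] := circle_inverse e80.
pose Q s t := forall x, c x = p s -> exists X : R -> R, [/\ continuous X, X s = x &
  forall u, s <= u <= t -> c (X u) = p u].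
suff : Q 0 1 by move=> /(_ x0 xp0).
apply: (@interval_gluing _ Q) => // [s t u st tu Q1 Q2 x xs|t tI].
  have [X1 [c1 X1s X1E]] := Q1 x xs.
  have [|X2 [c2 X2t X2E]] := Q2 (X1 t); first by apply: X1E; rewrite st lexx.
  exists (fun w => X1 (Num.min w t) + X2 (Num.max w t) - X1 t); split.
  - move=> w; apply: cvgB; last exact: cvg_cst.
    apply: cvgD.
      apply: (@continuous_comp _ _ _ (fun w => Num.min w t) X1); last exact: c1.
      by apply: continuous_min; [exact: cvg_id|exact: cvg_cst].
    apply: (@continuous_comp _ _ _ (fun w => Num.max w t) X2); last exact: c2.
    by apply: continuous_max; [exact: cvg_id|exact: cvg_cst].
  - by rewrite min_l// max_r// X2t addrK.
  - move=> w /andP[sw wu]; have [wt|tw] := leP w t.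
      by rewrite X2t addrK X1E// sw.
    by rewrite addrAC subrr add0r X2E// (ltW tw).
have dl20 : 0 < dl / 2 by rewrite divr_gt0.
have [d d0 Hd] := pc t _ tI dl20.
exists d => // s s' s0 s'1 ds st ts' s'd x xs.
have ss' : s <= s' by lra.
have close u : s <= u <= s' -> exists y, c y = p u /\ `|y - x| < 8^-1.
  move=> /andP[su us']; have uI : 0 <= u <= 1 by clear -su us' s0 s'1; split_lra.
  have sI : 0 <= s <= 1 by clear -su us' s0 s'1; split_lra.
  have h1 : (dist (p t) (p u) < (dl / 2)%:E)%E by apply: Hd => //; clear -st ts' ds s'd su us'; rewrite ltr_norml; split_lra.
  have h2 : (dist (p t) (p s) < (dl / 2)%:E)%E by apply: Hd => //; clear -ds st; rewrite ltr_norml; split_lra.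
  have : D (xi u) x < dl.
    rewrite -lte_fin -(cdistE hc) Hxi// xs; apply: (le_lt_trans (dist_triangle _ (p t) _)).
    rewrite (_ : dl = dl / 2 + dl / 2); last by field.
    by rewrite EFinD dist_sym lteD.
  move=> /Hdl[k hk]; exists (xi u - k%:~R); split.
    by rewrite -mulrNz (circle_periodic hc) Hxi.
  by rewrite (_ : xi u - _ - x = xi u - x - k%:~R)//; ring.
have /choice[X HX] : forall u, exists y, s <= u <= s' -> c y = p u /\ `|y - x| < 8^-1.
  move=> u; have [/close[y Hy]|nu] := pselect (s <= u <= s'); first by exists y.
  by exists 0.
have uniq y y' (e : R) : `|y - x| < 8^-1 -> `|y' - x| < 8^-1 -> e <= 8^-1 ->
    (exists k : int, `|y - y' - k%:~R| < e) -> `|y - y'| < e.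
  move=> hy hy' he [k hk]; suff k0 : k = 0 by rewrite k0 subr0 in hk.
  apply: (@int_eq0 R); rewrite (_ : k%:~R = (y - x) - (y' - x) - (y - y' - k%:~R)); last by ring.
  rewrite (le_lt_trans (ler_normB _ _))//.
  have := ler_normB (y - x) (y' - x); lra.
have sIs : s <= s <= s' by rewrite lexx ss'.
exists (X \o clip s s'); split.
- apply: continuous_clip => // u e uI e0.
  pose e' := Num.min e 8^-1; have e'0 : 0 < e' by rewrite lt_min e0 e80.
  have e'e : e' <= e by rewrite ge_min lexx.
  have e'8 : e' <= 8^-1 by rewrite ge_min lexx orbT.
  have [d1 d10 H1] := circle_inverse e'0.
  have uI' : 0 <= u <= 1 by clear -uI s0 s'1; case/andP: uI => *; split_lra.
  have [d2 d20 H2] := pc u _ uI' d10.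
  exists d2 => // v vI vu; have vI' : 0 <= v <= 1 by clear -vI s0 s'1; case/andP: vI => *; split_lra.
  have [cu nu] := HX u uI; have [cv nv] := HX v vI.
  apply: (lt_le_trans _ e'e); apply: uniq => //; apply: H1.
  by rewrite -lte_fin -(cdistE hc) cu cv dist_sym H2.
- rewrite /= clip_id//; have [cs ns] := HX s sIs.
  have /(circle_eqP hc)[k XE] : c (X s) = c x by rewrite cs xs.
  have k0 : k = 0.
    apply: (@int_eq0 R); move: ns; rewrite XE addrAC subrr add0r => ns.
    by apply: (lt_trans ns); rewrite invf_lt1// ltr1n.
  by rewrite XE k0 addr0.
- by move=> u uI; rewrite /= clip_id//; have [] := HX u uI.
Qed.

Definition lifted_loop (X Y : R -> R) :=
  [/\ continuous X, continuous Y, X 0 = Y 0 & Y 1 = X 1 + 1].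

Lemma ex_lifted_loop (X Y : R -> R) t1 : continuous X -> continuous Y -> X 0 = Y 0 ->
  0 <= t1 <= 1 -> `|Y t1 - X t1| = 1 -> exists X' Y', [/\ lifted_loop X' Y',
    forall t, X' t <= Y' t <= X' t + 1 &
    forall t, 0 <= t <= 1 -> exists2 t', 0 <= t' <= 1 & D (X' t) (Y' t) <= D (X t') (Y t')].
Proof.
move=> cX cY XY0 t1I; wlog : X Y cX cY XY0 / Y t1 - X t1 = 1 => [H|E _].
  have [p0|n0] := leP 0 (Y t1 - X t1).
    by rewrite ger0_norm// => E; apply: H => //; rewrite ger0_norm.
  rewrite ltr0_norm// opprB => E.
  have [|X' [Y' [h1 h2 h3]]] := H Y X cY cX (esym XY0) E; first by rewrite E normr1.
  exists X', Y'; split => // t tI; have [t' t'I le] := h3 t tI; exists t' => //.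
  by rewrite (cdist_sym c (X t')).
pose X' t := X (t1 * t); pose Y' t := X' t + clip 0 1 (Y (t1 * t) - X (t1 * t)).
have cX' : continuous X'.
  move=> t; apply: (@continuous_comp _ _ _ (fun t => t1 * t) X); last exact: cX.
  by apply: cvgM; [exact: cvg_cst|exact: cvg_id].
have cY' : continuous (fun t => Y (t1 * t)).
  move=> t; apply: (@continuous_comp _ _ _ (fun t => t1 * t) Y); last exact: cY.
  by apply: cvgM; [exact: cvg_cst|exact: cvg_id].
have ccl := @continuous_clip_id R 0 1.
have cYX : continuous (fun t => Y (t1 * t) - X' t) by move=> t; apply: cvgB; [exact: cY'|exact: cX'].
exists X', Y'; split.
- split => //.
  + move=> t; apply: cvgD; first exact: cX'.
    by apply: (@continuous_comp _ _ _ (fun t => Y (t1 * t) - X' t) (clip 0 1)); [exact: cYX|exact: ccl].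
  + by rewrite /Y' /X' mulr0 XY0 subrr clip_id ?addr0// lexx ler01.
  + by rewrite /Y' /X' mulr1 E clip_id// lexx ler01.
- by move=> t; have /andP[? ?] := clip_itv (Y (t1 * t) - X (t1 * t)) ler01; rewrite /Y'; split_lra.
- move=> t /andP[t0 t1']; have t1tI : 0 <= t1 * t <= 1 by case/andP: t1I => h1 h2; rewrite mulr_ge0//= mulr_ile1.
  exists (t1 * t) => //; rewrite /Y' /X'; set z := Y _ - X _.
  have [z0|z0] := ltP z 0.
    by rewrite /clip min_r ?max_l ?addr0 ?cdistxx ?(cdist_ge0 hc)//; lra.
  have [z1|z1] := ltP 1 z.
    rewrite /clip min_l ?max_r ?ler01//; last exact: ltW.
    rewrite (_ : 1 = (1 : int)%:~R)// (cdist_shiftr hc) cdistxx; exact: cdist_ge0.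
  by rewrite clip_id ?z0// /z addrC subrK.
Qed.

End circle_lifts.

Section arcs.
Context {R : realType} {n : nat} {M : riemannianManifold R n}.
Variable c : R -> M.
Hypothesis hc : smooth_circle c.
Implicit Types (x y z s t u v : R) (A B C : set M).
Local Notation D := (cdist c).
Local Notation mu := (@lebesgue_measure R).

Definition arc x y : set M := c @` `[x, y].

Lemma speed_circle_measurable (S : set R) : measurable S -> measurable_fun S (EFin \o speed c).
Proof.
move=> mS; apply/measurable_EFinP; apply: (measurable_funS measurableT) => //.
exact: (continuous_measurable_fun (speed_continuous (circle_C1 hc))).
Qed.

Lemma le_length_over (S S' : set R) : measurable S -> measurable S' -> S `<=` S' ->
  (length_over c S <= length_over c S')%E.
Proof.
move=> mS mS' SS; apply: ge0_subset_integral => //; first exact: speed_circle_measurable.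
by move=> t _; rewrite lee_fin speed_ge0.
Qed.

Lemma length_overU (S S' : set R) : measurable S -> measurable S' ->
  (length_over c (S `|` S') <= length_over c S + length_over c S')%E.
Proof.
move=> mS mS'; have mD : measurable (S' `\` S) by exact: measurableD.
have -> : S `|` S' = S `|` (S' `\` S).
  apply/seteqP; split => t /=; last by case=> [?|[? _]]; [left|right].
  by case=> [?|?]; [left|have [?|?] := pselect (S t); [left|right]].
rewrite /length_over ge0_integral_setU//.
- by rewrite leeD2l//; apply: le_length_over => // t [].
- by apply: speed_circle_measurable; exact: measurableU.
- by move=> t _; rewrite lee_fin speed_ge0.
- by apply/disj_setPS => t [St [_ nSt]].
Qed.

Lemma measurable_preimage_closed A : closed A -> measurable (c @^-1` A).
Proof.
move=> cA; apply: closed_measurable; apply: closed_comp => // t _.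
exact: C1_continuous (circle_C1 hc) t.
Qed.

Lemma closed_arc_closed x y : closed (arc x y).
Proof.
apply: compact_closed; first exact: carrier_hausdorff.
apply: continuous_compact; last exact: segment_compact.
exact: continuous_subspaceT (C1_continuous (circle_C1 hc)).
Qed.

Definition arc_set A := `[0, 1[%classic `&` c @^-1` A.

Lemma measurable_arc_set A : measurable (c @^-1` A) -> measurable (arc_set A).
Proof. by move=> mA; apply: measurableI. Qed.

Lemma measurable_preimage_setY A B : measurable (c @^-1` A) -> measurable (c @^-1` B) ->
  measurable (c @^-1` (A `+` B)).
Proof.
move=> mA mB; rewrite (_ : _ @^-1` _ = (c @^-1` A `\` c @^-1` B) `|` (c @^-1` B `\` c @^-1` A))//.
by apply: measurableU; exact: measurableD.
Qed.

Lemma arc_dist_triangle A B C : measurable (c @^-1` A) -> measurable (c @^-1` B) -> measurable (c @^-1` C) ->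
  (arc_dist c A C <= arc_dist c A B + arc_dist c B C)%E.
Proof.
move=> mA mB mC.
have mAC := measurable_arc_set (measurable_preimage_setY mA mC).
have mAB := measurable_arc_set (measurable_preimage_setY mA mB).
have mBC := measurable_arc_set (measurable_preimage_setY mB mC).
apply: (@le_trans _ _ (length_over c (arc_set (A `+` B) `|` arc_set (B `+` C)))); last exact: length_overU.
apply: le_length_over => //; first exact: measurableU.
move=> t [t01 /= h]; have [Bt|nBt] := pselect (B (c t)).
  by case: h => -[h1 h2]; [right; split => //; left|left; split => //; right].
by case: h => -[h1 h2]; [left; split => //; left|right; split => //; right].
Qed.

Lemma arc_dist_sym A B : arc_dist c A B = arc_dist c B A.
Proof. by rewrite /arc_dist setYC. Qed.

Lemma arc_distxx A : arc_dist c A A = 0%E.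
Proof. by rewrite /arc_dist /length_over setYK preimage_set0 setI0 integral_set0. Qed.

Lemma speed_periodic t (k : int) : speed c (t + k%:~R) = speed c t.
Proof. by rewrite /speed (velocity_periodic hc) (circle_periodic hc). Qed.

Lemma ex_speed_bound : exists2 S : R, 0 < S & forall t, speed c t <= S.
Proof.
have cs : {within `[(0 : R), 1], continuous (speed c)}.
  exact: continuous_subspaceT (speed_continuous (circle_C1 hc)).
have [t0 _ H] := EVT_max ler01 cs.
exists (speed c t0 + 1); first by rewrite ltr_wpDl// speed_ge0.
move=> t; have [k /andP[k1 k2]] := ex_frac t; rewrite -(speed_periodic t k).
have : speed c (t + k%:~R) <= speed c t0 by apply: H; rewrite in_itv/= k1 ltW.
by move=> /le_trans; apply; rewrite lerDl.
Qed.

Lemma ex_speed_lower_bound : exists2 S : R, 0 < S & forall t, S <= speed c t.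
Proof.
have cs : {within `[(0 : R), 1], continuous (speed c)}.
  exact: continuous_subspaceT (speed_continuous (circle_C1 hc)).
have [t0 _ H] := EVT_min ler01 cs.
exists (speed c t0); last first.
  move=> t; have [k /andP[k1 k2]] := ex_frac t; rewrite -(speed_periodic t k).
  by apply: H; rewrite in_itv/= k1 ltW.
have [_ _ _ /(_ t0) v0] := hc; rewrite sqrtr_gt0.
exact: (metric_posdef (mem_chart_at (c t0)) v0).
Qed.

Lemma length_over_itv (S a b : R) : (forall t, speed c t <= S) -> 0 <= S -> a <= b ->
  (length_over c `[a, b] <= (S * (b - a))%:E)%E.
Proof.
move=> HS S0 ab; apply: (@le_trans _ _ (\int[mu]_(t in `[a, b]) (cst S%:E) t)%E).
  apply: ge0_le_integral => //.
  - by move=> t _; rewrite lee_fin speed_ge0.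
  - exact: speed_circle_measurable.
  - by move=> t _; rewrite lee_fin.
rewrite integral_cst//= lebesgue_measure_itv/= lte_fin.
case: ltP => ab'; first by rewrite -EFinD -EFinM.
by rewrite mule0 lee_fin mulr_ge0// subr_ge0.
Qed.

Lemma arc_set_sub_itv x y : x <= y -> y < x + 1 -> exists k : R,
  arc_set (arc x y) `<=` `[x - k, y - k] `|` `[x - k - 1, y - k - 1].
Proof.
move=> xy yx; exists (Num.floor x)%:~R => t [/=]; rewrite in_itv/= => /andP[t0 t1] [s].
rewrite /= in_itv/= => /andP[xs sy] /(circle_eqP hc)[k sE].
have /andP[f1 f2] := floor_itv x; rewrite intrD in f2.
have k1 : ((Num.floor x - 1)%:~R : R) < k%:~R by rewrite intrD mulrNz; lra.
have k2 : (k%:~R : R) < (Num.floor x + 2)%:~R by rewrite intrD; lra.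
move: k1 k2; rewrite !ltr_int => k1 k2.
have [kE|kE] : k = Num.floor x \/ k = Num.floor x + 1 by lia.
  by left; rewrite /= in_itv/= -kE; split_lra.
right; rewrite /= in_itv/=; have : (k%:~R : R) = (Num.floor x)%:~R + 1 by rewrite kE intrD.
by move=> *; split_lra.
Qed.

Lemma arc_set_length (S : R) x y : (forall t, speed c t <= S) -> 0 <= S -> x <= y -> y < x + 1 ->
  (length_over c (arc_set (arc x y)) <= (2 * S * (y - x))%:E)%E.
Proof.
move=> HS S0 xy yx; have [k sub] := arc_set_sub_itv xy yx.
have m1 := measurable_arc_set (measurable_preimage_closed (closed_arc_closed (x := x) (y := y))).
apply: (@le_trans _ _ (length_over c (`[x - k, y - k] `|` `[x - k - 1, y - k - 1]))).
  by apply: le_length_over => //; exact: measurableU.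
apply: (le_trans (length_overU _ _)) => //.
have l1 : (length_over c `[(x - k)%R, (y - k)%R] <= (S * (y - x))%:E)%E.
  have -> : y - x = (y - k) - (x - k) by ring.
  by apply: length_over_itv => //; lra.
have l2 : (length_over c `[(x - k - 1)%R, (y - k - 1)%R] <= (S * (y - x))%:E)%E.
  have -> : y - x = (y - k - 1) - (x - k - 1) by ring.
  by apply: length_over_itv => //; lra.
by apply: (le_trans (leeD l1 l2)); rewrite -EFinD lee_fin; lra.
Qed.

Lemma arc_dist_small (S : R) x y x' y' : (forall t, speed c t <= S) -> 0 <= S ->
  x <= y -> x' <= y' -> `|x - x'| < 1 -> `|y - y'| < 1 ->
  (arc_dist c (arc x y) (arc x' y') <= (2 * S * (`|x - x'| + `|y - y'|))%:E)%E.
Proof.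
move=> HS S0 xy xy' dx dy.
pose lx := Num.min x x'; pose hx := Num.max x x'; pose ly := Num.min y y'; pose hy := Num.max y y'.
have ex : hx - lx = `|x - x'|.
  rewrite /hx /lx; case: (leP x x') => h; first by rewrite ler0_norm; lra.
  by rewrite gtr0_norm; lra.
have ey : hy - ly = `|y - y'|.
  rewrite /hy /ly; case: (leP y y') => h; first by rewrite ler0_norm; lra.
  by rewrite gtr0_norm; lra.
have mA u v := measurable_preimage_closed (closed_arc_closed (x := u) (y := v)).
have mS u v := measurable_arc_set (mA u v).
apply: (@le_trans _ _ (length_over c (arc_set (arc lx hx) `|` arc_set (arc ly hy)))).
  apply: le_length_over.
  - exact: (measurable_arc_set (measurable_preimage_setY (mA x y) (mA x' y'))).
  - exact: measurableU.
  - have lem a b a' b' t : a <= b -> a' <= b' -> `[0, 1[%classic t -> arc a b (c t) -> ~ arc a' b' (c t) ->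
        (arc_set (arc (Num.min a a') (Num.max a a')) `|` arc_set (arc (Num.min b b') (Num.max b b'))) t.
      move=> ab ab' t01 [s]; rewrite /= in_itv/= => /andP[as_ sb] cs nA.
      have [sa'|a's] := ltP s a'.
        by left; split => //; exists s => //; rewrite /= in_itv/= ge_min le_max as_ (ltW sa') orbT.
      have [b's|sb'] := ltP b' s.
        by right; split => //; exists s => //; rewrite /= in_itv/= ge_min le_max sb (ltW b's) orbT.
      by exfalso; apply: nA; exists s => //; rewrite /= in_itv/= a's.
    move=> t [t01 [[h1 h2]|[h1 h2]]]; first exact: lem h1 h2.
    by have := lem _ _ _ _ _ xy' xy t01 h1 h2; rewrite /lx /hx /ly /hy minC maxC (minC y') (maxC y').
apply: (le_trans (length_overU (mS _ _) (mS _ _))).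
have l1 : (length_over c (arc_set (arc lx hx)) <= (2 * S * `|x - x'|)%:E)%E.
  by rewrite -ex; apply: arc_set_length => //; [have := normr_ge0 (x - x')|]; lra.
have l2 : (length_over c (arc_set (arc ly hy)) <= (2 * S * `|y - y'|)%:E)%E.
  by rewrite -ey; apply: arc_set_length => //; [have := normr_ge0 (y - y')|]; lra.
by apply: (le_trans (leeD l1 l2)); rewrite -EFinD lee_fin; lra.
Qed.

Definition total_length : \bar R := length_over c `[0, 1[.

Lemma total_length_gt0 : exists2 l : R, 0 < l & (l%:E <= total_length)%E.
Proof.
have [S S0 HS] := ex_speed_lower_bound; exists S => //.
apply: (@le_trans _ _ (\int[mu]_(t in `[0%R, 1%R[) (cst S%:E) t)%E).
  by rewrite integral_cst//= lebesgue_measure_itv/= lte_fin ltr01 sube0 mule1.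
apply: ge0_le_integral => //.
- by move=> t _; rewrite lee_fin ltW.
- exact: speed_circle_measurable.
- by move=> t _; rewrite lee_fin.
Qed.

Lemma cofinite_length (S : set R) u v : measurable S -> S `<=` `[0, 1[ ->
  (forall t, 0 <= t < 1 -> c t <> c u -> c t <> c v -> S t) ->
  (total_length <= length_over c S)%E.
Proof.
move=> mS S01 H; have [ku ku01] := ex_frac u; have [kv kv01] := ex_frac v.
have m1 : measurable (`[0, 1[ `\ (u + ku%:~R)) by exact: measurableD.
have m2 : measurable (`[0, 1[ `\ (u + ku%:~R) `\ (v + kv%:~R)) by exact: measurableD.
rewrite /total_length /length_over -(integral_setD1 m1); last exact: speed_circle_measurable.
rewrite -(integral_setD1 m2); last exact: speed_circle_measurable.
apply: le_length_over => // t [[]] /=; rewrite in_itv/= => t01 tu tv.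
have uniq w (k : int) : 0 <= w + k%:~R < 1 -> t <> w + k%:~R -> c t <> c w.
  move=> /andP[w0 w1] tw /(circle_eqP hc)[j tE]; apply: tw.
  suff : j - k = 0 by move/eqP; rewrite subr_eq0 => /eqP <-.
  apply: (@int_eq0 R); rewrite intrD mulrNz; move: t01; rewrite tE => /andP[? ?].
  by rewrite ltr_norml; split_lra.
by apply: (H t t01); [exact: (uniq u ku)|exact: (uniq v kv)].
Qed.

End arcs.

Section sweepouts.
Context {R : realType} {n : nat} {M : riemannianManifold R n}.
Variable c : R -> M.
Hypothesis hc : smooth_circle c.
Implicit Types (x y z s t u v : R) (A B C : set M).
Local Notation D := (cdist c).
Local Notation arc := (arc c).

Lemma circle_shift1 x : c (x + 1) = c x.
Proof. by rewrite (_ : 1 = (1 : int)%:~R)// (circle_periodic hc). Qed.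

Lemma arc_point x : arc x x = [set c x].
Proof.
apply/seteqP; split=> [_ [t tI <-]|_ ->]; last by exists x; rewrite //= in_itv/= lexx.
by move: tI; rewrite /= in_itv/= => /andP[? ?]; congr c; apply/eqP; rewrite eq_le; apply/andP; split.
Qed.

Lemma arc_full x : arc x (x + 1) = range c.
Proof.
apply/seteqP; split=> [_ [t _ <-]|_ [t _ <-]]; first by exists t.
have [k /andP[k1 k2]] := ex_frac (t - x).
exists (t + k%:~R); last by rewrite (circle_periodic hc).
by rewrite /= in_itv/=; split_lra.
Qed.

Lemma arc_shift x y (k : int) : arc (x + k%:~R) (y + k%:~R) = arc x y.
Proof.
apply/seteqP; split=> [_ [t tI <-]|_ [t tI <-]]; move: tI; rewrite /= in_itv/= => /andP[? ?].
  exists (t + (- k)%:~R); last by rewrite (circle_periodic hc).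
  by rewrite /= in_itv/= mulrNz; split_lra.
exists (t + k%:~R); last by rewrite (circle_periodic hc).
by rewrite /= in_itv/=; split_lra.
Qed.

Lemma mem_arc x t v : 0 <= v < 1 -> c t = c (x + v) -> forall w : R, 0 <= w < 1 ->
  (arc x (x + w) (c t) <-> v <= w).
Proof.
move=> /andP[v0 v1] ct w /andP[w0 w1]; split; last first.
  by move=> vw; exists (x + v) => //; rewrite /= in_itv/=; split_lra.
move=> [s /=]; rewrite in_itv/= ct => /andP[s1 s2] /(circle_eqP hc)[k sE].
have k0 : k = 0 by apply: (@int_eq0 R); rewrite ltr_norml; split_lra.
by rewrite k0 in sE; lra.
Qed.

Let mA x y := measurable_preimage_closed hc (closed_arc_closed hc (x := x) (y := y)).

Lemma arc_dist_point_full x : (total_length c <= arc_dist c (arc x x) (range c))%E.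
Proof.
apply: (cofinite_length hc (u := x) (v := x)).
- apply: measurable_arc_set => //; rewrite -(arc_full x).
  exact: (measurable_preimage_setY (mA x x) (mA x (x + 1))).
- by move=> t [].
- move=> t t01 tx _; split; first by rewrite /= in_itv.
  by right; split; [exists t|rewrite arc_point].
Qed.

Lemma arc_dist_complement u v : u <= v -> v < u + 1 ->
  (total_length c <= arc_dist c (arc u v) (arc v (u + 1)))%E.
Proof.
move=> uv vu; have [uvE|uvN] := eqVneq u v.
  by rewrite -uvE arc_full; exact: arc_dist_point_full.
apply: (cofinite_length hc (u := u) (v := v)).
- apply: measurable_arc_set => //; exact: (measurable_preimage_setY (mA u v) (mA v (u + 1))).
- by move=> t [].
- move=> t t01 tu tv; split; first by rewrite /= in_itv.
  have [k kI] := ex_frac (t - u); have [j jI] := ex_frac (t - v).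
  have c1 : c t = c (u + (t - u + k%:~R)) by rewrite -(circle_periodic hc t k); congr c; ring.
  have c2 : c t = c (v + (t - v + j%:~R)) by rewrite -(circle_periodic hc t j); congr c; ring.
  have vI : 0 <= v - u < 1 by split_lra.
  have uI : 0 <= u + 1 - v < 1.
    have : u < v by rewrite lt_neqAle uvN.
    by move=> ?; split_lra.
  have E1 := mem_arc kI c1 vI; have E2 := mem_arc jI c2 uI.
  rewrite (_ : u + (v - u) = v) in E1; last by ring.
  rewrite (_ : v + (u + 1 - v) = u + 1) in E2; last by ring.
  set a := t - u + k%:~R in kI c1 E1; set b := t - v + j%:~R in jI c2 E2.
  have a0 : a <> 0 by move=> a0; apply: tu; rewrite c1 a0 addr0.
  have b0 : b <> 0 by move=> b0; apply: tv; rewrite c2 b0 addr0.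
  have ab : a - b = v - u + (k - j)%:~R by rewrite /a /b intrD mulrNz; ring.
  have kj : k - j = 0 \/ k - j = - 1.
    have h1 : ((k - j)%:~R : R) < 1%:~R by move: kI jI => /andP[? ?] /andP[? ?]; lra.
    have h2 : (- 2)%:~R < ((k - j)%:~R : R) by rewrite (_ : (-2)%:~R = -2 :> R)//; move: kI jI => /andP[? ?] /andP[? ?]; lra.
    by move: h1 h2; rewrite !ltr_int; move: (k - j) => i; clear; lia.
  have /eqP a0' := a0; have /eqP b0' := b0.
  have a1 : 0 < a by rewrite lt_def a0'; case/andP: kI.
  have b1 : 0 < b by rewrite lt_def b0'; case/andP: jI.
  case: kj => kj; rewrite kj in ab.
    right; split; first by apply/E2; case/andP: kI => *; lra.
    by move=> /E1; lra.
  rewrite (_ : (-1)%:~R = -1 :> R)// in ab; left; split; first by apply/E1; case/andP: jI => *; lra.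
  by move=> /E2; lra.
Qed.

Lemma arc_alternative u v s s' : u <= v -> v < u + 1 -> s <= s' <= s + 1 ->
  (c s = c u /\ c s' = c v) \/ (c s = c v /\ c s' = c u) ->
  arc_dist c (arc u v) (arc s s') = 0%E \/ (total_length c <= arc_dist c (arc u v) (arc s s'))%E.
Proof.
move=> uv vu /andP[ss ss1] [] [/(circle_eqP hc)[k sE] /(circle_eqP hc)[j s'E]].
  have s'E' : s' = v + (j - k)%:~R + k%:~R by rewrite s'E intrD mulrNz; ring.
  rewrite sE s'E' arc_shift; set i := j - k in s'E' *.
  have i0 : - 1 < (i%:~R : R) by lra.
  have i2 : (i%:~R : R) < 2 by lra.
  rewrite (_ : -1 = (-1)%:~R :> R)// ltr_int in i0; rewrite (_ : 2 = 2%:~R :> R)// ltr_int in i2.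
  have [-> | iE] : i = 0 \/ i = 1 by lia.
    by left; rewrite addr0 arc_distxx.
  rewrite iE in s'E' *; have uvE : u = v by apply/eqP; rewrite eq_le uv /=; lra.
  by right; rewrite -uvE arc_full; exact: arc_dist_point_full.
have s'E' : s' = u + (j - k)%:~R + k%:~R by rewrite s'E intrD mulrNz; ring.
rewrite sE s'E' arc_shift; set i := j - k in s'E' *.
have i0 : - 1 < (i%:~R : R) by lra.
have i2 : (i%:~R : R) < 2 by lra.
rewrite (_ : -1 = (-1)%:~R :> R)// ltr_int in i0; rewrite (_ : 2 = 2%:~R :> R)// ltr_int in i2.
have [iE | ->] : i = 0 \/ i = 1 by lia.
  rewrite iE in s'E' *; have uvE : u = v by apply/eqP; rewrite eq_le uv /=; rewrite addr0 in s'E'; lra.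
  by left; rewrite -uvE addr0 arc_distxx.
by right; exact: arc_dist_complement.
Qed.

Lemma lifted_loop_sweepout (X Y : R -> R) : lifted_loop X Y -> (forall t, X t <= Y t <= X t + 1) ->
  sweepout c (c \o X) (c \o Y).
Proof.
move=> [cX cY XY0 XY1] XYI; have cc := C1_continuous (circle_C1 hc).
split.
- by rewrite /= XY0 XY1 circle_shift1.
- by split; apply: continuous_subspaceT => t; [apply: (@continuous_comp _ _ _ X c)|apply: (@continuous_comp _ _ _ Y c)];
    [exact: cX|exact: cc|exact: cY|exact: cc].
- exists (fun t => arc (X t) (Y t)); split.
  + by move=> t _; exists (X t), (Y t); split => //; left.
  + move=> t _ e e0; have [S S0 HS] := ex_speed_bound hc.
    have e'0 : 0 < Num.min 1 (e / (8 * S)) by rewrite lt_min ltr01 divr_gt0// mulr_gt0.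
    have [d1 d10 H1] := continuous_eps t cX e'0; have [d2 d20 H2] := continuous_eps t cY e'0.
    exists (Num.min d1 d2); first by rewrite lt_min d10.
    move=> s _; rewrite lt_min => /andP[/H1 h1 /H2 h2].
    rewrite distrC lt_min in h1; rewrite distrC lt_min in h2.
    have /andP[h11 h12] := h1; have /andP[h21 h22] := h2.
    have /andP[t1 _] := XYI t; have /andP[s1 _] := XYI s.
    apply: (le_lt_trans (arc_dist_small hc HS (ltW S0) t1 s1 h11 h21)); rewrite lte_fin.
    apply: (@lt_le_trans _ _ (2 * S * (e / (8 * S) + e / (8 * S)))).
      by rewrite ltr_pM2l ?mulr_gt0// ltrD.
    by clear -e0 S0 HS; rewrite (_ : _ * (_ + _) = e / 2) ?ler_pdivrMr//; [lra|field; rewrite gt_eqF].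
  + by rewrite -XY0 arc_point.
  + by rewrite XY1 arc_full.
Qed.

Lemma sweepout_lifted_loop (p q : R -> M) : sweepout c p q ->
  exists X Y, [/\ lifted_loop X Y, forall t, X t <= Y t <= X t + 1 &
    forall t, 0 <= t <= 1 -> exists2 t', 0 <= t' <= 1 & ((D (X t) (Y t))%:E <= dist (p t') (q t'))%E].
Proof.
move=> [[pq0 pq1] [cp cq] [C [arcC contC C0 C1]]].
have Itv t : 0 <= t <= 1 -> t \in `[0, 1] by rewrite in_itv.
have rp t : 0 <= t <= 1 -> range c (p t) by move=> /Itv/arcC[s [s' [_ _ [[<- _]|[_ <-]]]]]; [exists s|exists s'].
have rq t : 0 <= t <= 1 -> range c (q t) by move=> /Itv/arcC[s [s' [_ _ [[_ <-]|[<- _]]]]]; [exists s'|exists s].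
have I0 : 0 <= (0 : R) <= 1 by rewrite lexx ler01.
have I1 : 0 <= (1 : R) <= 1 by rewrite lexx ler01.
have [x0 _ x0E] := rp 0 I0.
have [X [cX X0 XE]] := circle_lift hc rp cp x0E.
have [Y [cY Y0 YE]] := circle_lift hc rq cq (etrans x0E pq0).
have cZ : continuous (fun t => `|Y t - X t|) by move=> t; apply: cvg_norm; apply: cvgB; [exact: cY|exact: cX].
suff [t1 t1I Z1] : exists2 t1, 0 <= t1 <= 1 & 1 <= `|Y t1 - X t1|.
  have t10 : 0 <= t1 by case/andP: t1I.
  have Z0 : `|Y 0 - X 0| = 0 by rewrite X0 Y0 subrr normr0.
  have [|t2 t2I Z2] := IVT t10 (continuous_subspaceT cZ) (v := 1).
    by rewrite Z0 ge_min ler01 le_max Z1 orbT.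
  have t2I' : 0 <= t2 <= 1 by clear -t1I t2I; move: t2I t1I; rewrite in_itv/= => /andP[? ?] /andP[? ?]; split_lra.
  have [X' [Y' [h1 h2 h3]]] := ex_lifted_loop hc cX cY (etrans X0 (esym Y0)) t2I' Z2.
  exists X', Y'; split => // t tI; have [t' t'I le] := h3 t tI; exists t' => //.
  by rewrite -XE// -YE// (cdistE hc) lee_fin.
apply: contrapT => NE.
have Zlt t : 0 <= t <= 1 -> `|Y t - X t| < 1 by move=> tI; rewrite ltNge; apply/negP => h; apply: NE; exists t.
pose U t := Num.min (X t) (Y t); pose V t := Num.max (X t) (Y t).
have UV t : U t <= V t by rewrite /U /V ge_min !le_max lexx.
have VU t : 0 <= t <= 1 -> V t < U t + 1.
  move=> /Zlt; rewrite ltr_norml /U /V => /andP[h1 h2].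
  by clear -h1 h2; case: (leP (X t) (Y t)) => ?; lra.
have cU : continuous U by move=> t; apply: continuous_min; [exact: cX|exact: cY].
have cV : continuous V by move=> t; apply: continuous_max; [exact: cX|exact: cY].
pose F t := arc_dist c (arc (U t) (V t)) (C t).
have mC t : 0 <= t <= 1 -> measurable (c @^-1` (C t)) by move=> /Itv/arcC[s [s' [_ -> _]]]; exact: mA.
have [l l0 Hl] := total_length_gt0 hc.
have gap t : 0 <= t <= 1 -> F t = 0%E \/ (l%:E <= F t)%E.
  move=> tI; have [s [s' [ss CE ends]]] := arcC t (Itv t tI).
  have [|E|E] := arc_alternative (UV t) (VU t tI) ss.
  - rewrite /U /V -XE// -YE// in ends *.
    by case: (leP (X t) (Y t)) => _; case: ends => -[h1 h2]; [left|right|right|left]; split.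
  - by left; rewrite /F CE.
  - by right; rewrite /F CE; exact: le_trans Hl E.
have F0 : F 0 = 0%E by rewrite /F /U /V X0 Y0 minxx maxxx arc_point C0 -x0E arc_distxx.
have F1 : F 1 <> 0%E.
  move=> F1; have XY1 : X 1 = Y 1.
    have /(circle_eqP hc)[k kE] : c (Y 1) = c (X 1) by rewrite XE// YE// pq1.
    have := Zlt 1 I1; rewrite kE (_ : X 1 + k%:~R - X 1 = k%:~R); last by ring.
    by move=> /(@int_eq0 R) ->; rewrite addr0.
  move: F1; rewrite /F /U /V XY1 minxx maxxx C1 => F1.
  have := le_trans Hl (arc_dist_point_full (Y 1)); rewrite F1 lee_fin.
  lra.
apply: F1; pose Q s t := 0 <= s -> t <= 1 -> F s = 0%E -> F t = 0%E.
suff : Q 0 1 by apply.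
apply: (@interval_gluing _ Q) => // [s t u st tu Q1 Q2 s0 u1 Fs|t tI].
  by clear -st tu Q1 Q2 s0 u1 Fs; apply: Q2 => //; [lra|apply: Q1 => //; lra].
have l80 : 0 < l / 8 by rewrite divr_gt0.
have [d1 d10 H1] := contC t (Itv t tI) _ l80.
have [S S0 HS] := ex_speed_bound hc.
have e'0 : 0 < Num.min 1 (l / (32 * S)) by rewrite lt_min ltr01 divr_gt0// mulr_gt0.
have [d2 d20 H2] := continuous_eps t cU e'0; have [d3 d30 H3] := continuous_eps t cV e'0.
have closeA s : `|s - t| < Num.min d2 d3 -> (arc_dist c (arc (U t) (V t)) (arc (U s) (V s)) <= (l / 8)%:E)%E.
  rewrite lt_min => /andP[/H2 h1 /H3 h2].
  rewrite distrC lt_min in h1; rewrite distrC lt_min in h2.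
  have /andP[h11 h12] := h1; have /andP[h21 h22] := h2.
  apply: (le_trans (arc_dist_small hc HS (ltW S0) (UV t) (UV s) h11 h21)); rewrite lee_fin.
  apply: (@le_trans _ _ (2 * S * (l / (32 * S) + l / (32 * S)))).
    by rewrite ler_pM2l ?mulr_gt0// lerD// ltW.
  by rewrite (_ : _ * (_ + _) = l / 8)//; field; rewrite gt_eqF.
exists (Num.min d1 (Num.min d2 d3)); first by rewrite !lt_min d10 d20.
move=> s s' s0 s'1 ds st ts' s'd _ _ Fs.
have sI : 0 <= s <= 1 by clear -tI s0 st; case/andP: tI => *; split_lra.
have s'I : 0 <= s' <= 1 by clear -tI s'1 ts'; case/andP: tI => *; split_lra.
have near w : t - Num.min d1 (Num.min d2 d3) < w < t + Num.min d1 (Num.min d2 d3) ->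
    `|w - t| < d1 /\ `|w - t| < Num.min d2 d3.
  move=> /andP[w1 w2]; have : `|w - t| < Num.min d1 (Num.min d2 d3).
    by clear -w1 w2; rewrite ltr_norml; split_lra.
  by rewrite lt_min => /andP.
have [n1 n2] : `|s - t| < d1 /\ `|s - t| < Num.min d2 d3 by clear -ds st near; apply: near; split_lra.
have [n1' n2'] : `|s' - t| < d1 /\ `|s' - t| < Num.min d2 d3 by clear -ts' s'd near; apply: near; split_lra.
have [//|Fs'] := gap s' s'I; exfalso.
have B1 := closeA _ n2; have B2 := closeA _ n2'.
have B3 := ltW (H1 s (Itv s sI) n1); have B4 := ltW (H1 s' (Itv s' s'I) n1').
rewrite arc_dist_sym in B2; rewrite arc_dist_sym in B3.
have T : (F s' <= (l / 8)%:E + (l / 8)%:E + (0 + ((l / 8)%:E + (l / 8)%:E)))%E.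
  apply: (le_trans (arc_dist_triangle hc (mA _ _) (mA (U s) (V s)) (mC _ s'I))).
  apply: leeD.
    apply: (le_trans (arc_dist_triangle hc (mA _ _) (mA (U t) (V t)) (mA _ _))).
    exact: leeD.
  apply: (le_trans (arc_dist_triangle hc (mA _ _) (mC s sI) (mC _ s'I))).
  rewrite -/(F s) Fs leeD2l//.
  apply: (le_trans (arc_dist_triangle hc (mC s sI) (mC t tI) (mC _ s'I))).
  exact: leeD.
by clear -l80 Fs' T; have := le_trans Fs' T; rewrite add0e -!EFinD lee_fin; lra.
Qed.

End sweepouts.

Lemma continuous_pair (T U V : topologicalType) (X : T -> U) (Y : T -> V) : continuous X -> continuous Y ->
  continuous (fun t => (X t, Y t)).
Proof.
move=> cX cY t; rewrite /continuous_at.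
exact: (cvg_pair (cX t : X @ nbhs t --> nbhs (X t)) (cY t : Y @ nbhs t --> nbhs (Y t))).
Qed.

Section critical_pairs.
Context {R : realType} {n : nat} {M : riemannianManifold R n}.
Hypothesis hM : complete_manifold M.
Variable c : R -> M.
Hypothesis hc : smooth_circle c.
Implicit Types (x y t u v : R).
Local Notation D := (cdist c).

Definition circle_point x : set_type (range c) := SigSub (mem_set (imageT c x)).

Lemma circle_pointP (p : set_type (range c)) : exists x, p = circle_point x.
Proof. by have [x _ xE] := set_valP p; exists x; apply: val_inj; rewrite /= xE. Qed.

Lemma circle_point_eq x y : circle_point x = circle_point y <-> c x = c y.
Proof. by split=> [/(congr1 val)//|E]; exact: val_inj. Qed.

Lemma nontrivial_criticalP (s : collapsed_pairs (set_type (range c))) : nontrivial_critical c s <->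
  exists x y, [/\ s = collapsed_pair (circle_point x) (circle_point y), c x <> c y &
    ~ regular_pair c (c x) (c y)].
Proof.
split=> [[p [q]]|[x [y [-> xy nr]]]]; last first.
  by exists (circle_point x), (circle_point y); split => // /circle_point_eq.
have [x ->] := circle_pointP p; have [y ->] := circle_pointP q.
by move=> [-> /circle_point_eq xy nr]; exists x, y.
Qed.

Lemma pair_point_eq x y x' y' : c x <> c y ->
  collapsed_pair (circle_point x) (circle_point y) = collapsed_pair (circle_point x') (circle_point y') <->
  (c x = c x' /\ c y = c y') \/ (c x = c y' /\ c y = c x').
Proof.
move=> xy; split=> [/eqP|E].
  rewrite collapsed_pair_eq => /orP[|/andP[/eqP/circle_point_eq//]].
  rewrite /swap_rel/= !xpair_eqE => /orP[]/andP[/eqP/circle_point_eq -> /eqP/circle_point_eq ->].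
    by left.
  by right.
apply/eqP; rewrite collapsed_pair_eq /swap_rel/= !xpair_eqE.
by case: E => -[/circle_point_eq -> /circle_point_eq ->]; rewrite !eqxx ?orbT.
Qed.

Lemma pair_point_dist x y x' y' : c x <> c y ->
  collapsed_pair (circle_point x) (circle_point y) = collapsed_pair (circle_point x') (circle_point y') ->
  D x y = D x' y'.
Proof. by move=> xy /(pair_point_eq _ _ xy)[][h1 h2]; rewrite /cdist h1 h2// dist_sym. Qed.

Lemma diam_circle : exists x0 y0, (forall x y, D x y <= D x0 y0) /\ diam (range c) = (D x0 y0)%:E.
Proof.
have [x0 [y0 H]] := ex_cdist_max hc; exists x0, y0; split => //.
apply/eqP; rewrite eq_le; apply/andP; split.
  apply: ub_ereal_sup => _ [[_ _] [[x _ <-] [y _ <-]] <-].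
  by rewrite (cdistE hc) lee_fin.
by apply: ereal_sup_ubound; exists (c x0, c y0); rewrite ?(cdistE hc).
Qed.

Lemma max_critical x y : c x <> c y -> (forall x' y', D x' y' <= D x y) -> ~ regular_pair c (c x) (c y).
Proof.
move=> xy H /(regular_descent hc hM xy)[l1 [l2 [eta [k [eta0 k0 H']]]]].
pose s := Num.min k (k / (`|l1| + `|l2| + 1)).
have s0 : 0 < s by rewrite lt_min k0 divr_gt0.
have sk : s <= k by rewrite ge_min lexx.
have sL : s * (`|l1| + `|l2| + 1) <= k by rewrite -ler_pdivlMr// ge_min lexx orbT.
have n1 := normr_ge0 l1; have n2 := normr_ge0 l2.
have small (l : R) z : `|l| <= `|l1| + `|l2| + 1 -> `|z - s * l - z| <= k.
  move=> hl; rewrite addrAC subrr add0r normrN normrM (gtr0_norm s0).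
  by apply: le_trans sL; rewrite ler_pM2l.
have := H' (x - s * l1) (y - s * l2) s (small l1 x _) (small l2 y _).
rewrite (ltW s0) sk !subrK => /(_ _ _ isT) F.
have le1 : `|l1| <= `|l1| + `|l2| + 1 by clear -n1 n2; lra.
have le2 : `|l2| <= `|l1| + `|l2| + 1 by clear -sL n1; lra.
have := F le1 le2; have := H (x - s * l1) (y - s * l2).
by clear -eta0 s0; have : 0 < eta * s by [rewrite mulr_gt0]; lra.
Qed.

Lemma width_le_lift (X Y : R -> R) B : lifted_loop X Y -> (forall t, X t <= Y t <= X t + 1) ->
  (forall t, 0 <= t <= 1 -> D (X t) (Y t) <= B) -> (width c <= B%:E)%E.
Proof.
move=> L XY HB; have S := lifted_loop_sweepout hc L XY.
apply: (@le_trans _ _ (ereal_sup [set dist (c (X t)) (c (Y t)) | t in `[0%R, 1%R]])).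
  by apply: ereal_inf_lbound; exists (c \o X), (c \o Y).
apply: ub_ereal_sup => _ [t tI <-]; rewrite /= in_itv/= in tI.
by rewrite (cdistE hc) lee_fin HB.
Qed.

Lemma width_ge_lift B : (forall X Y, lifted_loop X Y -> (forall t, X t <= Y t <= X t + 1) ->
  exists2 t, 0 <= t <= 1 & B <= D (X t) (Y t)) -> (B%:E <= width c)%E.
Proof.
move=> H; apply: le_ereal_inf_tmp => _ [p [q [S ->]]].
have [X [Y [L XY le]]] := sweepout_lifted_loop hc S.
have [t tI tB] := H X Y L XY; have [t' t'I le'] := le t tI.
apply: (@le_trans _ _ (D (X t) (Y t))%:E); first by rewrite lee_fin.
by apply: (le_trans le'); apply: ereal_sup_ubound; exists t' => //; rewrite /= in_itv.
Qed.

Lemma rotating_lift x : lifted_loop (fun=> x) (fun t => x + clip 0 1 t) /\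
  forall t, x <= x + clip 0 1 t <= x + 1.
Proof.
split; last by move=> t; have /andP[? ?] := clip_itv t (@ler01 R); split_lra.
have ccl := @continuous_clip_id R 0 1.
split.
- by move=> t; exact: cvg_cst.
- by move=> t; apply: cvgD; [exact: cvg_cst|exact: ccl].
- by rewrite clip_id ?addr0// lexx ler01.
- by rewrite clip_id// lexx ler01.
Qed.

Lemma half_neq x : c x <> c (x + 2^-1).
Proof.
move=> /esym/(circle_eqP hc)[k]; move=> /addrI kE.
have : 0 < (k%:~R : R) < 1%:~R by rewrite -kE; split_lra.
by rewrite (_ : 0 = 0%:~R)// !ltr_int => /andP[? ?]; lia.
Qed.

Lemma continuous_cdist_comp (X Y : R -> R) : continuous X -> continuous Y ->
  continuous (fun t => D (X t) (Y t)).
Proof.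
move=> cX cY t; apply: (@continuous_comp _ _ _ (fun t => (X t, Y t)) (fun z : R * R => D z.1 z.2)).
  exact: continuous_pair cX cY t.
exact: continuous_cdist.
Qed.

Lemma widthE : exists2 W : R, 0 < W & width c = W%:E.
Proof.
have cD : {within `[(0 : R), 1], continuous (fun x => D x (x + 2^-1))}.
  apply: continuous_subspaceT; apply: continuous_cdist_comp.
    by move=> x; exact: cvg_id.
  by move=> x; apply: cvgD; [exact: cvg_id|exact: cvg_cst].
have [x0 _ Hx0] := EVT_min ler01 cD; set m := D x0 (x0 + 2^-1) in Hx0.
have m0 : 0 < m by apply: (cdist_gt0 hc); exact: half_neq.
have mW : (m%:E <= width c)%E.
  apply: width_ge_lift => X Y [cX cY XY0 XY1] _.
  have cZ : continuous (fun t => Y t - X t) by move=> t; apply: cvgB; [exact: cY|exact: cX].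
  have [|t tI tE] := IVT ler01 (continuous_subspaceT cZ) (v := 2^-1).
    by rewrite XY0 XY1 subrr addrAC subrr add0r min_l// max_r//; split_lra.
  rewrite in_itv/= in tI; exists t => //.
  have YE : Y t = X t + 2^-1 by rewrite -tE; ring.
  have [k /andP[k1 k2]] := ex_frac (X t).
  have := Hx0 (X t + k%:~R); rewrite in_itv/= k1 (ltW k2) => /(_ isT).
  by rewrite addrAC -YE (cdist_shiftl hc) (cdist_shiftr hc).
have [x1 [y1 [H _]]] := diam_circle.
have Wle : (width c <= (D x1 y1)%:E)%E.
  have [L XY] := rotating_lift 0; apply: (width_le_lift L XY) => t _; exact: H.
have Wfin : width c \is a fin_num by rewrite fin_real// (lt_le_trans _ mW) ?ltNyr//= (le_lt_trans Wle) ?ltry.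
by exists (fine (width c)); rewrite ?fineK// -lte_fin fineK// (lt_le_trans _ mW)// lte_fin.
Qed.

Definition descent (Phi : R * R -> R * R) (V : set (R * R)) :=
  [/\ continuous Phi, forall (z : R * R) (i j : int),
      Phi (z.1 + i%:~R, z.2 + j%:~R) = ((Phi z).1 + i%:~R, (Phi z).2 + j%:~R),
      forall z : R * R, Phi z = z \/ D (Phi z).1 (Phi z).2 < D z.1 z.2 &
      forall z : R * R, V z -> D (Phi z).1 (Phi z).2 < D z.1 z.2].

Lemma descent_id : descent id set0.
Proof. by split => // [z|z]; [exact: cvg_id|left]. Qed.

Lemma descent_comp Phi V Psi V' : descent Phi V -> descent Psi V' -> descent (Phi \o Psi) (V `|` V').
Proof.
move=> [c1 p1 d1 s1] [c2 p2 d2 s2]; split.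
- by move=> z; apply: (@continuous_comp _ _ _ Psi Phi); [exact: c2|exact: c1].
- by move=> z i j; rewrite /= p2 p1.
- move=> z /=; case: (d2 z) => [->//|lt]; right.
  by case: (d1 (Psi z)) => [->//|lt2]; exact: lt_trans lt2 lt.
- move=> z VV /=; case: (d2 z) => [E|lt]; last first.
    by case: (d1 (Psi z)) => [->//|lt2]; exact: lt_trans lt2 lt.
  by rewrite E; case: VV => [/s1//|/s2]; rewrite E ltxx.
Qed.

Lemma ex_descent x0 y0 : c x0 <> c y0 -> regular_pair c (c x0) (c y0) ->
  exists Phi V, [/\ descent Phi V, open V & V (x0, y0)].
Proof.
move=> xy0 /(regular_descent hc hM xy0)[l1 [l2 [eta [k [eta0 k0 H]]]]].
have [d d0 Hd] := circle_inverse hc k0.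
pose k' := Num.min d k; have k'0 : 0 < k' by rewrite lt_min d0.
have k'd : k' <= d by rewrite ge_min lexx.
have k'k : k' <= k by rewrite ge_min lexx orbT.
pose phi (z : R * R) : R := Num.max 0 (k' - D z.1 x0 - D z.2 y0).
have cphi : continuous phi.
  have c1 y : continuous (fun x => D x y) by apply: continuous_cdist_comp => x; [exact: cvg_id|exact: cvg_cst].
  move=> z; apply: (@continuous_max _ _ (cst 0) (fun z => k' - D z.1 x0 - D z.2 y0)); first exact: cvg_cst.
  apply: cvgB; first (apply: cvgB; first exact: cvg_cst).
    by apply: (@continuous_comp _ _ _ fst (fun x => D x x0)); [exact: cvg_fst|exact: c1].
  by apply: (@continuous_comp _ _ _ snd (fun x => D x y0)); [exact: cvg_snd|exact: c1].
have phik z : phi z <= k.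
  rewrite ge_max (ltW k0)/=; have := cdist_ge0 hc z.1 x0; have := cdist_ge0 hc z.2 y0; lra.
have dec z : 0 < phi z -> D (z.1 + phi z * l1) (z.2 + phi z * l2) <= D z.1 z.2 - eta * phi z.
  move=> p0; have lt : 0 < k' - D z.1 x0 - D z.2 y0 by move: p0; rewrite /phi lt_max ltxx.
  have g1 := cdist_ge0 hc z.1 x0; have g2 := cdist_ge0 hc z.2 y0.
  have [|i hi] := Hd z.1 x0; first lra.
  have [|j hj] := Hd z.2 y0; first lra.
  have := H (z.1 + (- i)%:~R) (z.2 + (- j)%:~R) (phi z).
  rewrite (ltW p0) phik (cdist_shiftl hc) (cdist_shiftr hc) => F.
  rewrite -(cdist_shiftl hc _ _ (- i)) -(cdist_shiftr hc _ _ (- j)) addrAC (addrAC z.2).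
  apply: F => //; rewrite mulrNz; apply: ltW.
    by rewrite addrAC.
  by rewrite addrAC.
exists (fun z => (z.1 + phi z * l1, z.2 + phi z * l2)), [set z | 0 < phi z]; split.
- split.
  + apply: continuous_pair => z.
      by apply: cvgD; [exact: cvg_fst|apply: cvgM; [exact: cphi|exact: cvg_cst]].
    by apply: cvgD; [exact: cvg_snd|apply: cvgM; [exact: cphi|exact: cvg_cst]].
  + move=> z i j; rewrite /= (_ : phi (_, _) = phi z); last by rewrite /phi/= !(cdist_shiftl hc).
    by congr (_, _); rewrite addrAC.
  + move=> z; have [p0|p0] := ltP 0 (phi z).
      by right; apply: (le_lt_trans (dec z p0)); rewrite ltrBlDr ltrDl mulr_gt0.
    have -> : phi z = 0 by apply/eqP; rewrite eq_le p0 le_max lexx.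
    by left; rewrite !mul0r !addr0; case: z {p0}.
  + by move=> z /= p0; apply: (le_lt_trans (dec z p0)); rewrite ltrBlDr ltrDl mulr_gt0.
- rewrite (_ : [set z | 0 < phi z] = phi @^-1` [set r | 0 < r])//.
  by apply: open_comp => [z _|]; [exact: cphi|exact: open_gt].
- by rewrite /= /phi/= !cdistxx !subr0 lt_max k'0 orbT.
Qed.

Lemma ex_level_descent W : (forall x y, D x y = W -> c x <> c y /\ regular_pair c (c x) (c y)) ->
  exists Phi V, descent Phi V /\ forall x y, D x y = W -> V (x, y).
Proof.
move=> reg; pose K := [set z : R * R | [/\ 0 <= z.1 <= 1, 0 <= z.2 <= 1 & D z.1 z.2 = W]].
have cK : compact K.
  apply: (@subclosed_compact _ _ (`[(0 : R), 1]%classic `*` `[(0 : R), 1]%classic)).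
  - rewrite (_ : K = (fst @^-1` `[0, 1]%classic `&` snd @^-1` `[0, 1]%classic) `&` (fun z => D z.1 z.2) @^-1` [set r | r = W]).
      apply: closedI; first by apply: closedI; apply: closed_comp => [z _|];
        [exact: cvg_fst|exact: interval_closed|exact: cvg_snd|exact: interval_closed].
      by apply: closed_comp => [z _|]; [exact: continuous_cdist|exact: closed_eq].
    by apply/seteqP; split=> z /=; rewrite !in_itv/=; [move=> []|move=> [[]]].
  - by apply: compact_setX; exact: segment_compact.
  - by move=> z [] /= h1 h2 _; rewrite /= !in_itv.
pose Dsc := [set p : (R * R -> R * R) * set (R * R) | descent p.1 p.2].
pose B (p : (R * R -> R * R) * set (R * R)) := Dsc `&` [set q | p.2 `<=` q.2].
have FF : Filter (filter_from Dsc B).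
  apply: filter_from_filter; first by exists (id, set0); exact: descent_id.
  move=> p q dp dq; exists (p.1 \o q.1, p.2 `|` q.2); first exact: descent_comp.
  by move=> r [dr sub]; split; split => // z Vz; apply: sub; [left|right].
have /(_ _ _ (fun p z => Dsc p /\ p.2 z) FF) := (compact_near_coveringP K).1 cK.
case=> [[x y] [_ _ /= xyW]|[Phi V] dPhi H].
  have [ne rg] := reg _ _ xyW; have [Phi [V [dPhi oV Vxy]]] := ex_descent ne rg.
  exists (V, B (Phi, V)); first by split; [exact: open_nbhs_nbhs|exists (Phi, V)].
  by move=> [z p] [/= Vz [dp sub]]; split => //; exact: sub.
have {}H z : K z -> V z by move=> /(H (Phi, V)); rewrite /B/= => F; apply F; split.
have [c1 per d1 s1] := dPhi.
exists Phi, [set z | D (Phi z).1 (Phi z).2 < D z.1 z.2]; split=> [|x y xyW]; first by split.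
have [i /andP[i1 i2]] := ex_frac x; have [j /andP[j1 j2]] := ex_frac y.
have /H/s1 : K (x + i%:~R, y + j%:~R) by split; rewrite /= ?i1 ?j1 ?(ltW i2) ?(ltW j2)// (cdist_shiftl hc) (cdist_shiftr hc).
by rewrite (per (x, y))/= !(cdist_shiftl hc) !(cdist_shiftr hc).
Qed.

Lemma ex_critical_level W : 0 < W -> width c = W%:E ->
  exists x y, [/\ D x y = W, c x <> c y & ~ regular_pair c (c x) (c y)].
Proof.
move=> W0 WE; apply: contrapT => NE.
have [x y xyW|Phi [V [[cPhi per dec s1] str]]] := @ex_level_descent W.
  have ne : c x <> c y by move=> /(cdist_eq0 hc) xy0; move: W0; rewrite -xyW xy0 ltxx.
  by split => //; apply: contrapT => nr; apply: NE; exists x, y.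
have DPhi z : D (Phi z).1 (Phi z).2 <= D z.1 z.2 by case: (dec z) => [->|/ltW].
have cDPhi : continuous (fun z => D (Phi z).1 (Phi z).2).
  by move=> z; apply: (@continuous_comp _ _ _ Phi (fun z : R * R => D z.1 z.2)); [exact: cPhi|exact: continuous_cdist].
have [e e0 He] : exists2 e, 0 < e & forall z, D z.1 z.2 <= W + e -> D (Phi z).1 (Phi z).2 <= W - e.
  apply: contrapT => Ne.
  have /choice[w Hw] : forall k : nat, exists w : R * R, [/\ 0 <= w.1 <= 1, 0 <= w.2 <= 1,
      D w.1 w.2 <= W + k.+1%:R^-1 & W - k.+1%:R^-1 < D (Phi w).1 (Phi w).2].
    move=> k; apply: contrapT => Nk; apply: Ne; exists k.+1%:R^-1; first by rewrite invr_gt0.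
    move=> [x y] xy; rewrite leNgt; apply/negP => lt; apply: Nk.
    have [i /andP[i1 i2]] := ex_frac x; have [j /andP[j1 j2]] := ex_frac y.
    exists (x + i%:~R, y + j%:~R).
    rewrite (per (x, y))/= !(cdist_shiftl hc) !(cdist_shiftr hc).
    by split; rewrite ?i1 ?j1 ?(ltW i2) ?(ltW j2).
  have [||x [y [_ _ H]]] := @square_seq_cluster R (fun k => (w k).1) (fun k => (w k).2).
  - by move=> k; have [] := Hw k.
  - by move=> k; have [] := Hw k.
  have near e : 0 < e -> exists w' : R * R, [/\ `|D w'.1 w'.2 - D x y| < e,
      `|D (Phi w').1 (Phi w').2 - D (Phi (x, y)).1 (Phi (x, y)).2| < e,
      D w'.1 w'.2 <= W + e & W - e < D (Phi w').1 (Phi w').2].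
    move=> e0; have [d1 d10 H1] := cdist_close hc x y e0.
    have /nbhs_ballP[d2 d20 H2] := near_norm_lt (cDPhi (x, y)) e0.
    have [N HN] := ex_invSn_lt e0.
    have d0 : 0 < Num.min d1 d2 by rewrite lt_min d10.
    have [k [Nk h1 h2]] := H _ N d0; have [_ _ h3 h4] := Hw k; have h5 := HN k Nk.
    move: h1 h2; rewrite !lt_min => /andP[h11 h12] /andP[h21 h22].
    exists (w k); split.
    - exact: H1.
    - by apply: H2; split; rewrite /ball/= distrC.
    - by apply: (le_trans h3); rewrite lerD2l ltW.
    - by apply: le_lt_trans h4; rewrite lerD2l lerN2 ltW.
  have le1 : D x y <= W.
    apply/ler_addgt0Pr => e e0; have e20 : 0 < e / 2 by rewrite divr_gt0.
    have [w' [h1 _ h2 _]] := near _ e20; move: h1; rewrite ltr_norml => /andP[h1 _]; lra.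
  have le2 : W <= D (Phi (x, y)).1 (Phi (x, y)).2.
    apply/ler_addgt0Pr => e e0; have e20 : 0 < e / 2 by rewrite divr_gt0.
    have [w' [_ h1 _ h2]] := near _ e20; move: h1; rewrite ltr_norml => /andP[_ h1]; lra.
  have := DPhi (x, y); rewrite /= => le3.
  have xyW : D x y = W by apply/eqP; rewrite eq_le le1 (le_trans le2 le3).
  have := s1 _ (str _ _ xyW); rewrite /= xyW ltNge le2.
  by [].
have [X [Y [[cX cY XY0 XY1] XY HXY]]] : exists X Y, [/\ lifted_loop X Y,
    forall t, X t <= Y t <= X t + 1 & forall t, 0 <= t <= 1 -> D (X t) (Y t) <= W + e].
  apply: contrapT => NXY.
  have : ((W + e)%:E <= width c)%E.
    apply: width_ge_lift => X Y L XY; apply: contrapT => Nt; apply: NXY; exists X, Y; split => // t tI.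
    by rewrite leNgt; apply/negP => /ltW lt; apply: Nt; exists t.
  by rewrite WE lee_fin; lra.
pose X1 t := (Phi (X t, Y t)).1; pose Y1 t := (Phi (X t, Y t)).2.
have cP : continuous (fun t => Phi (X t, Y t)).
  move=> t; apply: (@continuous_comp _ _ _ (fun t => (X t, Y t)) Phi); last exact: cPhi.
  exact: continuous_pair cX cY t.
have cX1 : continuous X1 by move=> t; apply: (@continuous_comp _ _ _ (fun t => Phi (X t, Y t)) fst); [exact: cP|exact: cvg_fst].
have cY1 : continuous Y1 by move=> t; apply: (@continuous_comp _ _ _ (fun t => Phi (X t, Y t)) snd); [exact: cP|exact: cvg_snd].
have fix_diag t : c (X t) = c (Y t) -> Phi (X t, Y t) = (X t, Y t).
  move=> E; case: (dec (X t, Y t)) => //=; rewrite [ltRHS](_ : _ = 0); last exact/(cdist_eq0 hc).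
  by rewrite ltNge (cdist_ge0 hc).
have [|||X2 [Y2 [L2 XY2 le2]]] := @ex_lifted_loop _ _ _ _ hc _ _ 1 cX1 cY1.
- by rewrite /X1 /Y1 fix_diag ?XY0.
- by rewrite ler01 lexx.
- by rewrite /X1 /Y1 fix_diag ?XY1 ?(circle_shift1 hc)//= addrAC subrr add0r normr1.
have : (width c <= (W - e)%:E)%E.
  apply: (width_le_lift L2 XY2) => t tI; have [t' t'I le] := le2 t tI; apply: (le_trans le).
  by apply: He; exact: HXY.
by rewrite WE lee_fin; lra.
Qed.

Lemma two_critical_points : (width c < diam (range c))%E ->
  exists x y : collapsed_pairs (set_type (range c)),
    [/\ x <> y, nontrivial_critical c x & nontrivial_critical c y].
Proof.
have [W W0 WE] := widthE; have [x0 [y0 [max ->]]] := diam_circle; rewrite WE lte_fin => lt.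
have [x1 [y1 [D1 ne1 cr1]]] := ex_critical_level W0 WE.
have ne0 : c x0 <> c y0 by move=> /(cdist_eq0 hc) E; move: lt; rewrite E; lra.
exists (collapsed_pair (circle_point x0) (circle_point y0)), (collapsed_pair (circle_point x1) (circle_point y1)).
split.
- by move=> /(pair_point_dist ne0) E; move: lt; rewrite E D1 ltxx.
- by apply/nontrivial_criticalP; exists x0, y0; split => //; exact: max_critical.
- by apply/nontrivial_criticalP; exists x1, y1.
Qed.

Lemma ex_partner W x : width c = W%:E -> (forall x y, D x y <= W) -> exists2 y, x <= y <= x + 1 & D x y = W.
Proof.
move=> WE max; have [L XY] := rotating_lift x; have [cX cY _ _] := L.
have [t tI Ht] := EVT_max (@ler01 R) (continuous_subspaceT (continuous_cdist_comp cX cY)).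
exists (x + clip 0 1 t); first exact: XY.
apply/eqP; rewrite eq_le max/= -lee_fin -WE; apply: (width_le_lift L XY) => s sI.
by apply: Ht; rewrite in_itv.
Qed.

Lemma infinite_critical_points : width c = diam (range c) -> infinite_set (nontrivial_critical c).
Proof.
have [W W0 WE] := widthE; have [x0 [y0 [max dE]]] := diam_circle; rewrite dE WE => -[E0].
have {}max x y : D x y <= W by rewrite E0.
move=> fin; pose T := set_type (range c).
pose fib (s : collapsed_pairs T) := [set p : T | exists q, s = collapsed_pair p q /\ p <> q].
have finfib s : finite_set (fib s).
  have [[p [q [sE pq]]]|N] := pselect (exists p, fib s p); last first.
    by rewrite (_ : fib s = set0)//; apply/seteqP; split=> // p sp; apply: N; exists p.
  apply: (@sub_finite_set _ _ [set p; q]) => // p' [q' [/esym/eqP]].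
  rewrite sE collapsed_pair_eq => /orP[|/andP[/eqP-> _]//].
  by rewrite /swap_rel/= !xpair_eqE => /orP[]/andP[/eqP E1 /eqP E2] _; [left|right].
have : finite_set (\bigcup_(s in nontrivial_critical c) fib s) by exact: bigcup_finite.
have sub x : (\bigcup_(s in nontrivial_critical c) fib s) (circle_point x).
  have [y _ xyW] := ex_partner x WE max.
  have ne : c x <> c y by move=> /(cdist_eq0 hc) E; move: W0; rewrite -xyW E ltxx.
  exists (collapsed_pair (circle_point x) (circle_point y)).
    apply/nontrivial_criticalP; exists x, y; split => //; apply: max_critical => // x' y'.
    by rewrite xyW.
  by exists (circle_point y); split => // /circle_point_eq.
move=> finU; apply: infinite_nat.
have inj : {in [set: nat] &, injective (fun k : nat => circle_point (k.+2%:R^-1))}.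
  move=> i j _ _ /circle_point_eq/(circle_eqP hc)[k kE].
  have bd (l : nat) : 0 < (l.+2%:R^-1 : R) < 1 by rewrite invr_gt0 ltr0n/= invf_lt1 ?ltr0n// ltr1n.
  have k0 : k = 0.
    apply: (@int_eq0 R); rewrite ltr_norml; have := bd i; have := bd j; rewrite kE.
    by move: (j.+2%:R^-1) (k%:~R) => a b /andP[? ?] /andP[? ?]; split_lra.
  move: kE; rewrite k0 addr0 => /invr_inj/eqP; rewrite eqr_nat => /eqP[].
  by [].
apply: (@sub_finite_set _ _ ((fun k : nat => circle_point (k.+2%:R^-1)) @^-1` (\bigcup_(s in nontrivial_critical c) fib s))).
  by move=> k _; exact: sub.
by apply: finite_preimage => // i j _ _; apply: inj; exact: in_setT.
Qed.

Lemma part1 :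
  ((0 < width c)%E /\ (width c < diam (range c))%E /\
    exists x y : collapsed_pairs (set_type (range c)),
      [/\ x <> y, nontrivial_critical c x & nontrivial_critical c y])
   \/
   (width c = diam (range c) /\ infinite_set (nontrivial_critical c)).
Proof.
have [W W0 WE] := widthE.
have : (width c <= diam (range c))%E.
  have [x0 [y0 [max ->]]] := diam_circle; have [L XY] := rotating_lift 0.
  by apply: (width_le_lift L XY) => t _; exact: max.
rewrite le_eqVlt => /orP[/eqP E|lt]; first by right; split => //; exact: infinite_critical_points.
by left; rewrite WE lte_fin; split => //; split; rewrite -?WE//; exact: two_critical_points.
Qed.

End critical_pairs.

Section geodesics.
Context {R : realType} {n : nat} {M : riemannianManifold R n}.
Implicit Types (g h : R -> M) (i : chart_index M).
Local Notation X := (@chart R n M).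

Lemma geodesic_chart g t i : geodesic_at g t -> chart_dom i (g t) ->
  [/\ {for t, continuous g}, is_derive t (1 : R) (X i \o g) (derive1 (X i \o g) t) &
      is_derive t (1 : R) (derive1 (X i \o g)) (gaccel (@metric R n M i) (X i (g t)) (derive1 (X i \o g) t))].
Proof.
move=> [cg H] it; have [D1 D2 E] := H i it; split; [exact: cg|exact: (is_derive1_intro D1)|].
suff <- : derive1 (derive1 (X i \o g)) t = gaccel (@metric R n M i) (X i (g t)) (derive1 (X i \o g) t).
  exact: (is_derive1_intro D2).
by apply/rowP => k; rewrite mxE; apply/eqP; rewrite -addr_eq0; apply/eqP; exact: E.
Qed.

Lemma geodesic_velocity_chart g h t i : geodesic_at g t -> geodesic_at h t -> g t = h t -> chart_dom i (g t) ->
  velocity g t = velocity h t <-> derive1 (X i \o g) t = derive1 (X i \o h) t.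
Proof.
move=> Gg Gh gh ig; have ih : chart_dom i (h t) by rewrite -gh.
have jg := mem_chart_at (g t); have jh : chart_dom (chart_at (g t)) (h t) by rewrite -gh.
have [cg D1 _] := geodesic_chart Gg ig; have [ch D2 _] := geodesic_chart Gh ih.
have [_ E1 _] := geodesic_chart Gg jg; have [_ E2 _] := geodesic_chart Gh jh.
rewrite /velocity -gh; split=> E.
  rewrite (is_derive1_derive1 (is_derive_transition cg jg ig E1)).
  by rewrite (is_derive1_derive1 (is_derive_transition ch jh ih E2)) E gh.
rewrite (is_derive1_derive1 (is_derive_transition cg ig jg D1)).
by rewrite (is_derive1_derive1 (is_derive_transition ch ih jh D2)) E gh.
Qed.

Lemma near_ball (P : R -> Prop) t : (\forall s \near t, P s) ->
  exists2 d : R, 0 < d & forall s, `|s - t| < d -> P s.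
Proof. by move=> /nbhs_ballP[d d0 H]; exists d => // s st; apply: H; rewrite /ball/= distrC. Qed.

Lemma near_nball g t i r K : normal_chart i (g t) r K -> {for t, continuous g} ->
  \forall s \near t, nball i (g t) (dist_radius r K) (g s).
Proof.
move=> nc cg; have [it mb _] := nc; have [_ _ _ _ /andP[rho0 _]] := normal_chart_radius nc.
by apply: cg; apply: nbhs_nball => //; rewrite subrr normr0.
Qed.

Lemma geodesic_locally_isometric g t : (\forall s \near t, geodesic_at g s) -> speed g t = 1 ->
  locally_isometric g t.
Proof.
move=> Gg sp; pose i := chart_at (g t); have it : chart_dom i (g t) := mem_chart_at _.
have [r [K nc]] := ex_normal_chart it; have [_ mb sub] := nc.
have [r0 K1 R10 R1r /andP[rho0 rhoR]] := normal_chart_radius nc.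
have [cg Dt _] := geodesic_chart (nbhs_singleton Gg) it.
have [b b0 Hb] := near_ball (filterI Gg (near_nball nc cg)).
pose x := X i \o g; pose u := derive1 x.
pose d := Num.min b (Num.min 4^-1 (small_energy K / 2)).
have se0 : 0 < small_energy K := small_energy_gt0 mb.
have d0 : 0 < d by rewrite !lt_min b0 invr_gt0 divr_gt0//= ltr0n.
have db : d <= b by rewrite ge_min lexx.
have d4 : d <= 4^-1 by rewrite !ge_min lexx orbT.
have dse : d <= small_energy K / 2 by rewrite !ge_min lexx !orbT.
clearbody d; have ode s : `|s - t| < d -> [/\ nball i (g t) (dist_radius r K) (g s), cball (X i (g t)) r (x s),
    is_derive s (1 : R) x (u s) & is_derive s (1 : R) u (gaccel (@metric R n M i) (x s) (u s))].
  move=> sd; have [Gs [is_ sm]] := Hb s (lt_le_trans sd db).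
  have [_ D1 D2] := geodesic_chart Gs is_; split => //.
  by rewrite /cball/= in sm *; apply: (le_trans sm); lra.
have geo s s' : `|s - t| < d -> `|s' - t| < d -> s < s' ->
    geodesic01 (@metric R n M i) (X i (g t)) r (fun w => x ((s' - s) * w + s)) (fun w => (s' - s) *: u ((s' - s) * w + s)).
  rewrite !ltr_norml => /andP[s1 s2] /andP[s1' s2'] ss'; apply: geodesic01_affine => w; rewrite in_itv/= => /andP[w0 w1].
  have h1 : 0 <= (s' - s) * w by rewrite mulr_ge0// subr_ge0 ltW.
  have h2 : (s' - s) * w <= s' - s by rewrite ler_piMr// subr_ge0 ltW.
  have [|_ ? ? ?] := ode ((s' - s) * w + s); last by split.
  by clear -s1 s2' h1 h2; rewrite ltr_norml; split_lra.
pose G s := gform (@metric R n M i) (x s) (u s) (u s).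
have energyE s s' : energy (@metric R n M i) (fun w => x ((s' - s) * w + s)) (fun w => (s' - s) *: u ((s' - s) * w + s))
    = (s' - s) ^+ 2 * G s.
  by rewrite /energy mulr0 add0r gformZl gformZr /G; ring.
have Gconst s s' : `|s - t| < d -> `|s' - t| < d -> s < s' -> G s' = G s.
  move=> sd sd' ss'; have I1 : (1 : R) \in `[0, 1] by rewrite in_itv/= lexx ler01.
  have := energy_const mb (geo s s' sd sd' ss') I1; rewrite energyE mulr1 subrK gformZl gformZr mulrA -expr2.
  by apply: mulfI; rewrite expf_neq0// subr_eq0 gt_eqF.
have Gt : G t = 1.
  have E := speed_chart it cg Dt; rewrite sp in E.
  have := esym E; rewrite -/x -/u -/(G t); have [G0|G0] := leP (G t) 0; last first.
    by move=> h; rewrite -(sqr_sqrtr (ltW G0)) h expr1n.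
  by rewrite ler0_sqrtr// => /esym/eqP; rewrite oner_eq0.
have G1 s : `|s - t| < d -> G s = 1.
  move=> sd; have td : `|t - t| < d by rewrite subrr normr0.
  by have [st|ts|->//] := ltgtP s t; [rewrite -(Gconst s t)|rewrite (Gconst t s)].
have iso s s' : `|s - t| < d -> `|s' - t| < d -> s < s' -> dist (g s) (g s') = (s' - s)%:E.
  move=> sd sd' ss'; have [n1 _ _ _] := ode s sd; have [n2 _ _ _] := ode s' sd'.
  have E := energyE s s'; rewrite (G1 s sd) mulr1 in E.
  rewrite (dist_local nc n1 n2); congr EFin.
  have := local_distE mb (geo s s' sd sd' ss'); rewrite mulr0 add0r mulr1 subrK E => ->.
    by rewrite sqrtr_sqr gtr0_norm// subr_gt0.
  move: sd sd'; rewrite !ltr_norml => /andP[s1 s2] /andP[s1' s2'].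
  have D1 : 0 < s' - s by rewrite subr_gt0.
  have D2 : s' - s <= 2^-1 by clear -d4 s1 s2'; lra.
  have D3 : s' - s <= small_energy K by clear -dse s1 s2'; lra.
  by clear -D1 D2 D3; rewrite expr2; apply: le_trans D3; rewrite ler_piMr ?(ltW D1)//; lra.
exists d => // s s' /= sd sd'; have [ss'|s's|->] := ltgtP s s'.
- by rewrite iso// ltr0_norm ?subr_lt0// opprB.
- by rewrite dist_sym iso// gtr0_norm ?subr_gt0.
- by rewrite distxx subrr normr0.
Qed.

Lemma minimising_unit_segment g (a : R) : minimising_geodesic g a -> g 0 <> g a -> unit_segment g a.
Proof.
move=> [a0 Gg sp len] ne; case: sp => [[{}a0 sp]|/(_ a)/esym//].
have loc t : t \in `[0, a] -> locally_isometric g t by move=> ta; apply: geodesic_locally_isometric; [exact: Gg|exact: sp].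
have da : dist (g 0) (g a) = a%:E.
  rewrite -len /length_over (eq_integral (fun=> 1%E)); last by move=> t /set_mem ta; rewrite sp.
  by rewrite integral_cst//= mul1e lebesgue_measure_itv/= lte_fin a0 -EFinB subr0.
have up s s' : 0 <= s -> s <= s' -> s' <= a -> (dist (g s) (g s') <= (s' - s)%:E)%E.
  move=> s0 ss' s'a; apply: (@interval_gluing _ (fun s s' => (dist (g s) (g s') <= (s' - s)%:E)%E)) => //.
    move=> u v w uv vw h1 h2; apply: (le_trans (dist_triangle _ (g v) _)); apply: (le_trans (leeD h1 h2)).
    by rewrite -EFinD lee_fin; lra.
  move=> t /andP[t1 t2]; have [|d d0 H] := loc t; first by rewrite in_itv/=; split_lra.
  exists d => // v w v1 w1 h1 h2 h3 h4.
  have e1 : `|v - t| < d by rewrite ltr_norml; split_lra.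
  have e2 : `|w - t| < d by clear -h3 h4; rewrite ltr_norml; split_lra.
  by clear -H h2 h3 e1 e2; rewrite (H v w e1 e2) lee_fin ler0_norm; lra.
split => // s s'; rewrite /= !in_itv/= => /andP[s0 sa] /andP[s0' sa'].
have iso u v : 0 <= u -> u <= v -> v <= a -> dist (g u) (g v) = (v - u)%:E.
  move=> u0 uv va; have ua : u <= a by lra.
  have v0 : 0 <= v by lra.
  have h1 := up 0 v (lexx 0) v0 va; have h2 := up v a v0 va (lexx a).
  have [|E1 _] := dist_additive h1 h2; first by rewrite da lee_fin; lra.
  have h3 := up 0 u (lexx 0) u0 ua; have h4 := up u v u0 uv va.
  by have [|_ E2] := dist_additive h3 h4; first by rewrite E1 lee_fin; lra.
have [ss'|/ltW s's] := leP s s'; first by rewrite iso// ler0_norm ?subr_le0// opprB.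
by rewrite dist_sym iso// ger0_norm// subr_ge0.
Qed.

Lemma is_derive_continuous_norm (f : R -> 'rV[R]_n) t w : is_derive t (1 : R) f w ->
  \forall s \near t, `|f s| <= `|f t| + 1.
Proof.
move=> D; have cf : {for t, continuous f} by apply: is_derive_continuous.
apply: filterS (near_norm_lt cf ltr01) => s.
move=> h; rewrite -[f s](subrK (f t)) (le_trans (ler_normD _ _))// addrC lerD2l; exact: ltW.
Qed.

Lemma ivp_step (K U b : R) : 0 < K -> 0 <= U -> 0 < b -> exists d, [/\ 0 < d, d <= b &
  forall s s' t, t - d < s -> s <= t -> t <= s' -> s' < t + d ->
    K * (s' - s) * (U ^+ 2 * (s' - s) + 2 * U) <= 2^-1].
Proof.
move=> K0 U0 b0; pose C := K * (U ^+ 2 + 2 * U) + 1.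
have C1 : 0 <= K * (U ^+ 2 + 2 * U) by rewrite mulr_ge0 ?(ltW K0)// addr_ge0 ?exprn_ge0// mulr_ge0.
have C0 : 0 < C by rewrite /C; lra.
exists (Num.min b (Num.min 4^-1 (4 * C)^-1)); split.
- by rewrite !lt_min b0 !invr_gt0 mulr_gt0//= ltr0n.
- by rewrite ge_min lexx.
set d := Num.min _ _.
have d4 : d <= 4^-1 by rewrite !ge_min lexx orbT.
have dC : 4 * C * d <= 1 by rewrite mulrC -ler_pdivlMr ?mulr_gt0// div1r !ge_min lexx !orbT.
clearbody d; move=> s s' t h1 h2 h3 h4.
have ds0 : 0 <= s' - s by lra.
have ds1 : s' - s <= 1 by lra.
have e1 : U ^+ 2 * (s' - s) + 2 * U <= U ^+ 2 + 2 * U by rewrite lerD2r ler_piMr// exprn_ge0.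
have e2 : K * (s' - s) * (U ^+ 2 * (s' - s) + 2 * U) <= (s' - s) * (C - 1).
  rewrite /C addrK (mulrC K) -mulrA ler_wpM2l// ler_wpM2l//; exact: ltW.
have e3 : (s' - s) * (C - 1) <= (2 * d) * C by apply: ler_pM => //; [rewrite /C addrK|lra|rewrite lerBlDr lerDl].
by apply: (le_trans e2); apply: (le_trans e3); move: dC; clear; lra.
Qed.

Lemma geodesics_agree_chart g h t i : (\forall s \near t, geodesic_at g s) -> (\forall s \near t, geodesic_at h s) ->
  g t = h t -> chart_dom i (g t) ->
  exists2 d : R, 0 < d & forall s s', t - d < s -> s <= t -> t <= s' -> s' < t + d ->
    g s = h s -> velocity g s = velocity h s -> g s' = h s' /\ velocity g s' = velocity h s'.
Proof.
move=> Ng Nh Et it.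
have [cg _] := nbhs_singleton Ng; have [ch _] := nbhs_singleton Nh.
have [r [K nc]] := ex_normal_chart it; have [_ mb sub] := nc.
have [K0 rr] : 0 < K /\ dist_radius r K <= r.
  have [r0 K1 _ R1r /andP[rho0 rhoR]] := normal_chart_radius nc; split; first exact: lt_le_trans K1.
  by apply: (le_trans rhoR); move: R1r r0; move: (geodesic_radius r K) => w; clear; lra.
have ith : chart_dom i (h t) by rewrite -Et.
have [_ _ D2g] := geodesic_chart (nbhs_singleton Ng) it.
have [_ _ D2h] := geodesic_chart (nbhs_singleton Nh) ith.
have nbg := near_nball nc cg.
have nbh : \forall s \near t, nball i (g t) (dist_radius r K) (h s).
  by have := near_nball (g := h) (t := t) (i := i) (r := r) (K := K); rewrite -Et => /(_ nc ch).
have [b b0 Hb] := near_ball (filterI (filterI Ng Nh) (filterI (filterI nbg nbh)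
  (filterI (is_derive_continuous_norm D2g) (is_derive_continuous_norm D2h)))).
have [U [U0 Ug Uh]] : exists U, [/\ 0 <= U, `|derive1 (X i \o g) t| + 1 <= U & `|derive1 (X i \o h) t| + 1 <= U].
  have := normr_ge0 (derive1 (X i \o g) t); have := normr_ge0 (derive1 (X i \o h) t).
  move: `|derive1 (X i \o g) t| `|derive1 (X i \o h) t| => A B; clear => B0 A0.
  by exists (A + B + 1); split; lra.
have [d [d0 db Hd]] := ivp_step K0 U0 b0.
exists d; first exact: d0.
move=> s s' h1 h2 h3 h4 Es Vs; have small := Hd _ _ _ h1 h2 h3 h4.
have ss' : s <= s' := le_trans h2 h3.
have P w : s <= w <= s' -> `|w - t| < b.
  move=> /andP[w1 w2]; rewrite ltr_norml; apply/andP; split.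
    by move: h1 db w1; clear; lra.
  by move: h4 db w2; clear; lra.
have sI : s <= s <= s' by rewrite lexx ss'.
have s'I : s <= s' <= s' by rewrite lexx ss'.
have [[Gs Hs] [[[isg _] [ish _]] _]] := Hb s (P s sI).
have [[Gs' Hs'] [[[isg' _] [ish' _]] _]] := Hb s' (P s' s'I).
have bd w : w \in `[s, s'] -> [/\ cball (X i (g t)) r (X i (g w)), cball (X i (g t)) r (X i (h w)),
    `|derive1 (X i \o g) w| <= U & `|derive1 (X i \o h) w| <= U].
  rewrite in_itv/= => /P/Hb[_ [[[_ b1] [_ b2]] [n1 n2]]].
  by split; [exact: le_trans b1 rr|exact: le_trans b2 rr|exact: le_trans n1 Ug|exact: le_trans n2 Uh].
have og w : w \in `[s, s'] -> is_derive w (1 : R) (X i \o g) (derive1 (X i \o g) w) /\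
    is_derive w (1 : R) (derive1 (X i \o g)) (gaccel (@metric R n M i) (X i (g w)) (derive1 (X i \o g) w)).
  rewrite in_itv/= => /P/Hb[[Gw _] [[[iw _] _] _]].
  by have [_ D1 D2] := geodesic_chart Gw iw; split; [exact: D1|exact: D2].
have oh w : w \in `[s, s'] -> is_derive w (1 : R) (X i \o h) (derive1 (X i \o h) w) /\
    is_derive w (1 : R) (derive1 (X i \o h)) (gaccel (@metric R n M i) (X i (h w)) (derive1 (X i \o h) w)).
  rewrite in_itv/= => /P/Hb[[_ Gw] [[_ [iw _]] _]].
  by have [_ D1 D2] := geodesic_chart Gw iw; split; [exact: D1|exact: D2].
have V : derive1 (X i \o g) s = derive1 (X i \o h) s by exact: (geodesic_velocity_chart Gs Hs Es isg).1.
have Xs : (X i \o g) s = (X i \o h) s by rewrite /= Es.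
have s'in : s' \in `[s, s'] by rewrite in_itv.
have [/= xE uE] := @geodesic_ivp_unique R n (gaccel (@metric R n M i)) (X i (g t)) r K K0 (mb_Fl mb)
  (X i \o g) (derive1 (X i \o g)) (X i \o h) (derive1 (X i \o h)) s s' U ss' U0 small bd og oh Xs V s' s'in.
have Es' : g s' = h s' by rewrite -(chartK isg') xE chartK.
exact: (conj Es' ((geodesic_velocity_chart Gs' Hs' Es' isg').2 uE)).
Qed.

Lemma near_neq g h t : {for t, continuous g} -> {for t, continuous h} -> g t <> h t ->
  exists2 d : R, 0 < d & forall s, `|s - t| < d -> g s <> h s.
Proof.
move=> cg ch /eqP Nt; have := @carrier_hausdorff R n M; rewrite open_hausdorff.
move=> /(_ _ _ Nt)[[A B] /= [/set_mem gA /set_mem hB] [oA oB /eqP AB]].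
have NA : \forall s \near t, A (g s) by apply: cg; apply: open_nbhs_nbhs.
have NB : \forall s \near t, B (h s) by apply: ch; apply: open_nbhs_nbhs.
have [d d0 H] := near_ball (filterI NA NB); exists d => // s /H[As Bs] E.
by have : (A `&` B) (g s) by [split => //; rewrite E]; rewrite AB.
Qed.

Lemma geodesics_agree g h (a : R) : 0 <= a ->
  (forall t, 0 <= t <= a -> \forall s \near t, geodesic_at g s) ->
  (forall t, 0 <= t <= a -> \forall s \near t, geodesic_at h s) ->
  g 0 = h 0 -> velocity g 0 = velocity h 0 -> forall t, 0 <= t <= a -> g t = h t.
Proof.
move=> a0 Gg Gh E0 V0 t1 /andP[t10 t1a].
pose Q s s' := g s = h s /\ velocity g s = velocity h s -> g s' = h s' /\ velocity g s' = velocity h s'.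
suff : Q 0 t1 by move=> /(_ (conj E0 V0))[].
apply: (interval_gluing (Q := Q) t10) => [s t u _ _ Q1 Q2 E|t /andP[t0 tt1]]; first exact: Q2 (Q1 E).
have ta : 0 <= t <= a by rewrite t0 (le_trans tt1).
have Ng := Gg t ta; have Nh := Gh t ta.
have [cg _] := nbhs_singleton Ng; have [ch _] := nbhs_singleton Nh.
have [Et|Nt] := pselect (g t = h t).
  have [d d0 H] := geodesics_agree_chart Ng Nh Et (mem_chart_at (g t)).
  exists d; first exact: d0.
  by move=> s s' _ _ h1 h2 h3 h4 [Es Vs]; exact: (H s s' h1 h2 h3 h4 Es Vs).
have [d d0 H] := near_neq cg ch Nt.
exists d; first exact: d0.
move=> s s' _ _ h1 h2 h3 h4 [Es _]; exfalso; apply: (H s); last exact: Es.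
by rewrite ltr_norml; apply/andP; split; [move: h1|move: h2 d0]; clear; lra.
Qed.

Lemma unit_segment_geodesic g (a : R) : unit_segment g a ->
  forall t, 0 <= t <= a -> \forall s \near t, geodesic_at g s.
Proof.
move=> [_ _ loc] t ta; have := near_locally_isometric (loc t ta).
by apply: filterS => s; exact: locally_isometric_geodesic_at.
Qed.

Lemma unit_segments_velocity g h (a b : R) : unit_segment g a -> unit_segment h b -> g 0 = h 0 ->
  velocity g 0 = velocity h 0 -> forall t, 0 <= t <= Num.min a b -> g t = h t.
Proof.
move=> ug uh E0 V0; have [a0 _ _] := ug; have [b0 _ _] := uh.
have m0 : 0 <= Num.min a b by rewrite le_min !ltW.
apply: geodesics_agree => // t; rewrite le_min => /and3P[t0 ta tb].
  by apply: (unit_segment_geodesic ug); rewrite t0.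
by apply: (unit_segment_geodesic uh); rewrite t0.
Qed.

Lemma unit_segments_agree g h (a b d : R) : unit_segment g a -> unit_segment h b -> 0 < d ->
  (forall t, 0 <= t <= d -> g t = h t) -> forall t, 0 <= t <= Num.min a b -> g t = h t.
Proof.
move=> ug uh d0 E; have E0 : g 0 = h 0 by apply: E; rewrite lexx ltW.
have [a0 _ _] := ug; have [b0 _ _] := uh.
apply: (unit_segments_velocity ug uh E0).
have [|_ D1] := unit_segment_velocity ug (t := 0) _ (mem_chart_at _); first by rewrite in_itv/= lexx ltW.
have [|_ D2] := unit_segment_velocity uh (t := 0) _ (mem_chart_at _); first by rewrite in_itv/= lexx ltW.
rewrite -E0 in D2; rewrite /velocity -E0.
by apply: (right_derive_unique d0 D1 D2) => s; rewrite add0r => /E/= ->.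
Qed.

End geodesics.

Section line_fields.
Context {R : realType}.

Lemma continuous_sum (T : topologicalType) (I : finType) (f : I -> T -> R) :
  (forall i, continuous (f i)) -> continuous (fun x => \sum_i f i x).
Proof.
move=> cf; rewrite (_ : (fun x => _) = \sum_i f i); last by apply/funext => x; rewrite fct_sumE.
by elim/big_ind: _ => // [x|g h cg ch x]; [exact: cvg_cst|apply: cvgD; [exact: cg|exact: ch]].
Qed.

Variables (n : nat) (P : R * R -> 'M[R]_n).
Hypothesis cP : forall i j, continuous (fun z => P z i j).
Hypothesis rk1 : forall z, exists w : 'rV[R]_n, w *m w^T = 1 /\ P z = w^T *m w.

Let dot (u v : 'rV[R]_n) := (u *m v^T) 0 0.

Let dotE u v : u *m v^T = (dot u v)%:M.
Proof. exact: mx11_scalar. Qed.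

Let dot_unit w : w *m w^T = 1 -> dot w w = 1.
Proof. by rewrite /dot => ->; rewrite mxE eqxx. Qed.

Let dotC u v : dot u v = dot v u.
Proof. by rewrite /dot -[u *m v^T]trmxK trmx_mul trmxK mxE. Qed.

Let trP u v : \tr (u^T *m u *m (v^T *m v)) = dot u v ^+ 2.
Proof.
rewrite -mulmxA (mulmxA u) dotE mxtrace_mulC mul_scalar_mx -scalemxAl dotE.
by rewrite mxtraceZ mxtrace_scalar mulr1n dotC expr2.
Qed.

Let trP1 (u : 'rV[R]_n) : \tr (u^T *m u) = dot u u.
Proof. by rewrite mxtrace_mulC dotE mxtrace_scalar mulr1n. Qed.

Lemma line_field_close : exists N : nat, forall s t t', 0 <= s <= 1 -> 0 <= t <= 1 -> `|t - t'| <= N.+1%:R^-1 ->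
  \tr (P (s, t) *m P (s, t')) != 0.
Proof.
apply: contrapT => NE.
have /choice[w Hw] : forall k : nat, exists w : R * R * R, [/\ 0 <= w.1.1 <= 1, 0 <= w.1.2 <= 1,
    `|w.1.2 - w.2| <= k.+1%:R^-1 & \tr (P (w.1.1, w.1.2) *m P (w.1.1, w.2)) = 0].
  move=> k; apply: contrapT => Nk; apply: NE; exists k => s t t' s1 t1 tt'.
  by apply/eqP => E; apply: Nk; exists (s, t, t').
have [||x [y [_ _ H]]] := @square_seq_cluster R (fun k => (w k).1.1) (fun k => (w k).1.2).
- by move=> k; have [] := Hw k.
- by move=> k; have [] := Hw k.
pose q (z : (R * R) * (R * R)) := \sum_i \sum_j P z.1 i j * P z.2 j i.
have qE z : q z = \tr (P z.1 *m P z.2) by rewrite /q /mxtrace; apply: eq_bigr => i _; rewrite mxE.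
have cq : continuous q.
  apply: continuous_sum => i; apply: continuous_sum => j z; apply: cvgM.
    by apply: (@continuous_comp _ _ _ fst (fun z => P z i j)); [exact: cvg_fst|exact: cP].
  by apply: (@continuous_comp _ _ _ snd (fun z => P z j i)); [exact: cvg_snd|exact: cP].
have q1 : q ((x, y), (x, y)) = 1 by have [u [u1 uE]] := rk1 (x, y); rewrite qE /= uE trP dot_unit// expr1n.
have /nbhs_ballP[d d0 Hd] := near_norm_lt (cq ((x, y), (x, y))) (ltr01).
have d20 : 0 < d / 2 by rewrite divr_gt0.
have [N HN] := ex_invSn_lt d20; have [k [Nk h1 h2]] := H (d / 2) N d20.
have [_ _ h3 h4] := Hw k; have h5 := HN k Nk.
have := Hd (((w k).1.1, (w k).1.2), ((w k).1.1, (w k).2)); rewrite q1 qE /= h4 sub0r normrN normr1 ltxx.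
suff [B1 [B2 B3]] : `|x - (w k).1.1| < d /\ `|y - (w k).1.2| < d /\ `|y - (w k).2| < d.
  by move=> /(_ (conj (conj B1 B2) (conj B1 B3))).
rewrite distrC in h1; rewrite distrC in h2; move: d0 => /= d0.
split; first by lra.
split; first by lra.
rewrite (_ : y - (w k).2 = (y - (w k).1.2) + ((w k).1.2 - (w k).2)); last by ring.
by apply: (le_lt_trans (ler_normD _ _)); move: h2 h3 h5; move: (k.+1%:R^-1) => *; lra.
Qed.

Lemma parallel_transport : exists A : R -> 'M[R]_n, [/\ forall i j, continuous (fun s => A s i j),
  forall s : R, 0 <= s <= 1 -> exists (w0 w1 : 'rV[R]_n) (k : R), [/\ P (s, 0) = w0^T *m w0, P (s, 1) = w1^T *m w1, k != 0 & A s = k *: (w0^T *m w1)] &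
  forall (s : R) (W : R -> 'rV[R]_n), 0 <= s <= 1 -> (forall j, continuous (fun t => W t 0 j)) ->
    (forall t : R, 0 <= t <= 1 -> P (s, t) = (W t)^T *m W t) ->
    exists2 k, 0 < k & A s = k *: ((W 0)^T *m W 1)].
Proof.
have [N HN] := line_field_close; pose tau k : R := k%:R / N.+1%:R.
pose fix A (k : nat) (s : R) {struct k} : 'M[R]_n := if k is k'.+1 then A k' s *m P (s, tau k) else P (s, tau 0%N).
have tau0 : tau 0%N = 0 by rewrite /tau mul0r.
have tau1 : tau N.+1 = 1 by rewrite /tau divff// gt_eqF.
have tauI k : (k <= N.+1)%N -> 0 <= tau k <= 1 by move=> kN; rewrite divr_ge0//= ler_pdivrMr// mul1r ler_nat.
have tauS k : tau k.+1 = tau k + N.+1%:R^-1 by rewrite /tau -natr1 mulrDl mul1r.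
have tau_lt k : tau k <= tau k.+1 by rewrite tauS lerDl invr_ge0 ltW.
have step s k : 0 <= s <= 1 -> (k < N.+1)%N -> \tr (P (s, tau k) *m P (s, tau k.+1)) != 0.
  move=> sI kN; apply: HN => //; first by apply: tauI; exact: ltnW.
  by rewrite tauS opprD addrA subrr sub0r normrN ger0_norm// invr_ge0 ltW.
have inner_step (u v w : 'rV[R]_n) (k : R) : (k *: (u^T *m v)) *m (w^T *m w) = (k * dot v w) *: (u^T *m w).
  by rewrite -scalemxAl -mulmxA (mulmxA v) dotE mul_scalar_mx -scalemxAr scalerA.
exists (A N.+1); split.
- move=> i j; elim: N.+1 i j => [|k IH] i j /=.
    by move=> s; apply: (@continuous_comp _ _ _ (fun s => (s, tau 0%N)) (fun z => P z i j)); [apply: continuous_pair => ?; [exact: cvg_id|exact: cvg_cst]|exact: cP].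
  rewrite (_ : (fun s => _) = (fun s => \sum_l A k s i l * P (s, tau k.+1) l j)); last by apply/funext => s; rewrite mxE.
  apply: continuous_sum => l s; apply: cvgM; first exact: IH.
  by apply: (@continuous_comp _ _ _ (fun s => (s, tau k.+1)) (fun z => P z l j)); [apply: continuous_pair => ?; [exact: cvg_id|exact: cvg_cst]|exact: cP].
- move=> s sI.
  suff H k : (k <= N.+1)%N -> exists (w0 w1 : 'rV[R]_n) (r : R), [/\ P (s, tau 0%N) = w0^T *m w0, P (s, tau k) = w1^T *m w1, r != 0 & A k s = r *: (w0^T *m w1)].
    by have := H N.+1 (leqnn _); rewrite tau1 tau0.
  elim: k => [_|k IH kN].
    by have [w [_ wE]] := rk1 (s, tau 0%N); exists w, w, 1; rewrite scale1r oner_eq0 wE.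
  have [w0 [w1 [r [E0 E1 r0 EA]]]] := IH (ltnW kN); have [w [_ wE]] := rk1 (s, tau k.+1).
  exists w0, w, (r * dot w1 w); split => //; last by rewrite /= EA wE inner_step.
  by have := step s k sI kN; rewrite E1 wE trP sqrf_eq0 mulf_eq0 negb_or r0.
- move=> s W sI cW WP.
  suff H k : (k <= N.+1)%N -> exists2 r, 0 < r & A k s = r *: ((W 0)^T *m W (tau k)).
    by have := H N.+1 (leqnn _); rewrite tau1.
  elim: k => [_|k IH kN].
    by exists 1 => //=; rewrite scale1r tau0 WP// lexx ler01.
  have [r r0 EA] := IH (ltnW kN); have kI := tauI k (ltnW kN); have k1I := tauI _ kN.
  exists (r * dot (W (tau k)) (W (tau k.+1))); last by rewrite /= EA (WP _ k1I) inner_step.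
  rewrite pmulr_rgt0// ltNge; apply/negP => le0.
  have cd : continuous (fun t => dot (W (tau k)) (W t)).
    rewrite (_ : (fun t => _) = (fun t => \sum_j W (tau k) 0 j * W t 0 j)).
      by apply: continuous_sum => j t; apply: cvgM; [exact: cvg_cst|exact: cW].
    by apply/funext => t; rewrite /dot mxE; apply: eq_bigr => j _; rewrite mxE.
  have unit t : 0 <= t <= 1 -> dot (W t) (W t) = 1 by move=> tI; have [w [w1 wE]] := rk1 (s, t); rewrite -trP1 -WP// wE trP1 dot_unit.
  have [|t tI t0] := IVT (tau_lt k) (continuous_subspaceT cd) (v := 0).
    by rewrite ge_min le0 orbT/= le_max unit// ler01.
  move: tI k1I kI; rewrite in_itv/= => /andP[t1 t2] /andP[_ k2] /andP[k1 k3].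
  have tI : 0 <= t <= 1 by rewrite (le_trans k1 t1) (le_trans t2 k2).
  have := HN s (tau k) t sI; rewrite k1 k3 => /(_ isT).
  rewrite distrC ger0_norm ?subr_ge0// lerBlDr addrC -tauS => /(_ t2).
  by rewrite !WP ?k1// trP t0 expr0n eqxx.
Qed.

Lemma no_contraction (W : R -> 'rV[R]_n) : (forall s, P (s, 1) = P (s, 0)) -> (forall t, P (1, t) = P (1, 0)) ->
  (forall j, continuous (fun t => W t 0 j)) -> (forall t : R, 0 <= t <= 1 -> P (0, t) = (W t)^T *m W t) ->
  W 1 = - W 0 -> False.
Proof.
move=> P01 P1 cW WP W1; have [A [cA A1 A2]] := parallel_transport.
have I0 : 0 <= (0 : R) <= 1 by rewrite lexx ler01.
have I1 : 0 <= (1 : R) <= 1 by rewrite lexx ler01.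
have cT : continuous (fun s => \tr (A s)) by apply: continuous_sum => i; exact: cA.
have trA (u v : 'rV[R]_n) (k : R) : \tr (k *: (u^T *m v)) = k * dot v u by rewrite mxtraceZ mxtrace_mulC dotE mxtrace_scalar mulr1n.
have T0 : \tr (A 0) < 0.
  have [k k0 ->] := A2 0 W I0 cW WP; rewrite trA W1 /dot mulNmx mxE mulrN oppr_lt0 pmulr_rgt0//.
  have [w [w1 wE]] := rk1 (0, 0).
  by rewrite -/(dot (W 0) (W 0)) -trP1 -WP// wE trP1 dot_unit.
have T1 : 0 < \tr (A 1).
  have [w [w1 wE]] := rk1 (1, 0).
  have [||k k0 ->] := A2 1 (fun=> w) I1; [by move=> j t; exact: cvg_cst|by move=> t _; rewrite P1|].
  by rewrite trA dot_unit// mulr1.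
have [|s] := IVT (@ler01 R) (continuous_subspaceT cT) (v := 0).
  by rewrite ge_min (ltW T0)/= le_max (ltW T1) orbT.
rewrite in_itv/= => sI; have [w0 [w1 [k [E0 E1 k0 ->]]]] := A1 s sI.
rewrite trA => /eqP; rewrite mulf_eq0 (negbTE k0)/= => /eqP d0.
have := trP w1 w0; rewrite -E0 -E1 P01 d0 expr0n/= E0 trP => /eqP; rewrite expf_eq0/= => /eqP d00.
have [w [w1' wE]] := rk1 (s, 0).
by have := trP1 w0; rewrite -E0 wE trP1 dot_unit// d00 => /eqP; rewrite oner_eq0.
Qed.

End line_fields.

Section poincare_miranda.
Context {R : realType}.

Lemma poincare_miranda (f g : R * R -> R) : continuous f -> continuous g ->
  (forall s, 0 <= s <= 1 -> 0 < f (s, 0) /\ f (s, 1) < 0) ->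
  (forall t, 0 <= t <= 1 -> 0 < g (0, t) /\ g (1, t) < 0) ->
  exists s t, [/\ 0 <= s <= 1, 0 <= t <= 1, f (s, t) = 0 & g (s, t) = 0].
Proof.
move=> cf0 cg0 fb gb; apply: contrapT => NE.
pose cl (z : R * R) := (clip 0 1 z.1, clip 0 1 z.2) : R * R.
have ccl : continuous cl.
  have cc := @continuous_clip_id R 0 1.
  by apply: continuous_pair => z; [apply: (@continuous_comp _ _ _ fst (clip 0 1))|apply: (@continuous_comp _ _ _ snd (clip 0 1))];
    [exact: cvg_fst|exact: cc|exact: cvg_snd|exact: cc].
pose f1 z := f (cl z); pose f2 z := g (cl z); pose r z := Num.sqrt (f1 z ^+ 2 + f2 z ^+ 2).
have c1 : continuous f1 by move=> z; apply: (@continuous_comp _ _ _ cl f); [exact: ccl|exact: cf0].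
have c2 : continuous f2 by move=> z; apply: (@continuous_comp _ _ _ cl g); [exact: ccl|exact: cg0].
have S0 z : 0 < f1 z ^+ 2 + f2 z ^+ 2.
  rewrite lt_def addr_ge0 ?sqr_ge0// andbT paddr_eq0 ?sqr_ge0// !sqrf_eq0.
  apply/negP => /andP[/eqP h1 /eqP h2]; apply: NE.
  exists (clip 0 1 z.1), (clip 0 1 z.2); split => //; exact: clip_itv.
have r0 z : 0 < r z by rewrite sqrtr_gt0.
have rE z : r z ^+ 2 = f1 z ^+ 2 + f2 z ^+ 2 by rewrite sqr_sqrtr// ltW.
have cr : continuous r.
  move=> z; apply: (@continuous_comp _ _ _ (fun z => f1 z ^+ 2 + f2 z ^+ 2) Num.sqrt); last exact: sqrt_continuous.
  by apply: cvgD; (apply: cvgM; [|]); [exact: c1|exact: c1|exact: c2|exact: c2].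
have rf z : - r z <= f1 z <= r z by rewrite -ler_norml -(@ler_sqr _ `|f1 z|) ?nnegrE ?(ltW (r0 z))// real_normK ?num_real// rE lerDl sqr_ge0.
pose a z := Num.sqrt ((r z + f1 z) / (2 * r z)); pose b z := Num.sqrt ((r z - f1 z) / (2 * r z)).
have a2 z : a z ^+ 2 = (r z + f1 z) / (2 * r z) by rewrite sqr_sqrtr// divr_ge0 ?mulr_ge0 ?(ltW (r0 z))//; have /andP[? ?] := rf z; lra.
have b2 z : b z ^+ 2 = (r z - f1 z) / (2 * r z) by rewrite sqr_sqrtr// divr_ge0 ?mulr_ge0 ?(ltW (r0 z))//; have /andP[? ?] := rf z; lra.
have ab z : a z * b z = `|f2 z| / (2 * r z).
  have r20 : 0 < 2 * r z by rewrite mulr_gt0.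
  apply/eqP; rewrite -(@eqrXn2 _ 2)// ?mulr_ge0 ?sqrtr_ge0// ?divr_ge0 ?invr_ge0 ?(ltW r20)//.
  rewrite exprMn a2 b2 expr_div_n real_normK ?num_real//; apply/eqP.
  rewrite (_ : f2 z ^+ 2 = r z ^+ 2 - f1 z ^+ 2); last by rewrite rE addrAC subrr add0r.
  by field; rewrite gt_eqF.
pose vec (x y : R) : 'rV[R]_2 := \row_j (if j == 0 then x else y).
have vec2 x y i j : ((vec x y)^T *m vec x y) i j = (if i == 0 then x else y) * (if j == 0 then x else y) by rewrite mxE big_ord1 !mxE.
pose W (e : R) z := vec (a z) (e * b z).
pose sg z : R := if 0 <= f2 z then 1 else -1.
pose P z := (W (sg z) z)^T *m W (sg z) z.
have sg2 z : sg z ^+ 2 = 1 by rewrite /sg; case: ifP => _; rewrite ?expr1n// sqrrN expr1n.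
have sgE z : sg z * `|f2 z| = f2 z.
  rewrite /sg; case: leP => h; first by rewrite mul1r ger0_norm.
  by rewrite mulN1r ltr0_norm// opprK.
have Wij e z i j : e ^+ 2 = 1 -> e * `|f2 z| = f2 z -> ((W e z)^T *m W e z) i j =
    if i == 0 then (if j == 0 then (r z + f1 z) / (2 * r z) else f2 z / (2 * r z))
    else (if j == 0 then f2 z / (2 * r z) else (r z - f1 z) / (2 * r z)).
  move=> e2 eE; rewrite /W vec2; case: eqP => _; case: eqP => _.
  - by rewrite -expr2 a2.
  - by rewrite mulrCA ab mulrA eE.
  - by rewrite -mulrA [b z * a z]mulrC ab mulrA eE.
  - by rewrite mulrACA -!expr2 e2 mul1r b2.
have WE e z : e ^+ 2 = 1 -> e * `|f2 z| = f2 z -> P z = (W e z)^T *m W e z by move=> e2 eE; apply/matrixP => i j; rewrite !Wij.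
have Pij z i j := Wij _ z i j (sg2 z) (sgE z).
have cden z : {for z, continuous (fun z => (2 * r z)^-1)}.
  by apply: cvgV; [rewrite gt_eqF// mulr_gt0|apply: cvgM; [exact: cvg_cst|exact: cr]].
have cP i j : continuous (fun z => P z i j).
  rewrite (_ : (fun z => P z i j) = (fun z => (if i == 0 then (if j == 0 then r z + f1 z else f2 z)
      else (if j == 0 then f2 z else r z - f1 z)) * (2 * r z)^-1)); last first.
    by apply/funext => z; rewrite /P Pij; case: (i == 0); case: (j == 0).
  case: (i == 0); case: (j == 0) => z; (apply: cvgM; last exact: cden).
  - by apply: cvgD; [exact: cr|exact: c1].
  - exact: c2.
  - exact: c2.
  - by apply: cvgB; [exact: cr|exact: c1].
have rk1 z : exists w : 'rV[R]_2, w *m w^T = 1 /\ P z = w^T *m w.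
  exists (W (sg z) z); split => //; apply/matrixP => i j; rewrite !ord1 !mxE eqxx big_ord_recl big_ord1 !mxE/=.
  rewrite mulrACA -!expr2 sg2 mul1r a2 b2; field; by rewrite gt_eqF.
have [A [cA A1 A2]] := parallel_transport cP rk1.
have I0 : 0 <= (0 : R) <= 1 by rewrite lexx ler01.
have I1 : 0 <= (1 : R) <= 1 by rewrite lexx ler01.
have clE s t : 0 <= s <= 1 -> 0 <= t <= 1 -> cl (s, t) = (s, t) by move=> sI tI; rewrite /cl/= !clip_id.
have bot s : 0 <= s <= 1 -> a (s, 0) != 0.
  move=> sI; rewrite -sqrf_eq0 a2 gt_eqF// divr_gt0 ?mulr_gt0// ltr_pwDl//.
  by have [/ltW h _] := fb s sI; rewrite /f1 (clE _ _ sI I0).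
have top s : 0 <= s <= 1 -> b (s, 1) != 0.
  move=> sI; rewrite -sqrf_eq0 b2 gt_eqF// divr_gt0 ?mulr_gt0// ltr_pwDl//.
  by have [_ /ltW h] := fb s sI; rewrite oppr_ge0 /f1 (clE _ _ sI I1).
have A01 (w w' : 'rV[R]_2) (k : R) : (k *: (w^T *m w')) 0 1 = k * (w 0 0 * w' 0 1) by rewrite !mxE big_ord1 !mxE.
have cS (h : R * R -> R) : continuous h -> continuous (fun z => Num.sqrt (h z / (2 * r z))).
  move=> ch z; apply: (@continuous_comp _ _ _ (fun z => h z / (2 * r z)) Num.sqrt); last exact: sqrt_continuous.
  by apply: cvgM; [exact: ch|exact: cden].
have ca : continuous a by apply: (cS (fun z => r z + f1 z)) => z; apply: cvgD; [exact: cr|exact: c1].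
have cb : continuous b by apply: (cS (fun z => r z - f1 z)) => z; apply: cvgB; [exact: cr|exact: c1].
have cW e s j : continuous (fun t => W e (s, t) 0 j).
  have cs : continuous (fun t : R => (s, t)) by apply: continuous_pair => t; [exact: cvg_cst|exact: cvg_id].
  rewrite (_ : (fun t => _) = (fun t => if j == 0 then a (s, t) else e * b (s, t))); last first.
    by apply/funext => t; rewrite mxE.
  case: (j == 0) => t; last (apply: cvgM; first exact: cvg_cst).
    by apply: (@continuous_comp _ _ _ (fun t => (s, t)) a); [exact: cs|exact: ca].
  by apply: (@continuous_comp _ _ _ (fun t => (s, t)) b); [exact: cs|exact: cb].
have edge e s : 0 <= s <= 1 -> e ^+ 2 = 1 -> (forall t, 0 <= t <= 1 -> e * `|f2 (s, t)| = f2 (s, t)) ->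
    exists2 k, 0 < k & A s 0 1 = k * e.
  move=> sI e2 eE; have [t tI|k k0 ->] := A2 s (fun t => W e (s, t)) sI (cW e s).
    by apply: WE => //; exact: eE.
  exists (k * (a (s, 0) * b (s, 1))); last by rewrite A01 !mxE/=; ring.
  by apply: mulr_gt0 => //; apply: mulr_gt0; rewrite lt0r sqrtr_ge0 andbT; [exact: bot|exact: top].
have [|t tI|k0 k00 E0] := edge 1 0 I0; [by rewrite expr1n|by have [h _] := gb t tI; rewrite mul1r /f2 (clE _ _ I0 tI) gtr0_norm|].
have [|t tI|k1 k10 E1] := edge (-1) 1 I1; [by rewrite sqrrN expr1n| |].
  by have [_ h] := gb t tI; rewrite mulN1r /f2 (clE _ _ I1 tI) ltr0_norm// opprK.
have [|s] := IVT (@ler01 R) (continuous_subspaceT (cA 0 1)) (v := 0).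
  by rewrite E0 E1 mulr1 mulrN1 ge_min le_max oppr_le0 (ltW k00) (ltW k10) orbT.
rewrite in_itv/= => sI; have [w0 [w1 [k [W0 W1 k0' ->]]]] := A1 s sI.
rewrite A01 => /eqP; rewrite !mulf_eq0 (negbTE k0')/= => /orP[/eqP w00|/eqP w11].
  have := bot s sI; rewrite -sqrf_eq0.
  have := congr1 (fun B : 'M[R]_2 => B 0 0) W0; rewrite /P Pij/= -a2 => ->.
  by rewrite mxE big_ord1 !mxE w00 mul0r eqxx.
have := top s sI; rewrite -sqrf_eq0.
have := congr1 (fun B : 'M[R]_2 => B 1 1) W1; rewrite /P Pij/= -b2 => ->.
by rewrite mxE big_ord1 !mxE w11 mul0r eqxx.
Qed.

End poincare_miranda.

Section chords.
Context {R : realType}.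
Implicit Types (x y z w p q : 'rV[R]_2).

Definition dot2 x y := x 0 0 * y 0 0 + x 0 1 * y 0 1.

Lemma row2P x y : x 0 0 = y 0 0 -> x 0 1 = y 0 1 -> x = y.
Proof.
move=> h0 h1; apply/rowP => j.
by case: j => -[|[|//]] i; [move: h0|move: h1]; congr (_ = _); congr (_ _ _); apply: val_inj.
Qed.

Lemma unit_discE x : unit_disc x = (dot2 x x <= 1 : Prop).
Proof. by rewrite /unit_disc /dot2/= !expr2. Qed.

Lemma unit_circleE x : unit_circle x = (dot2 x x = 1 : Prop).
Proof. by rewrite /unit_circle /dot2/= !expr2. Qed.

Lemma tangent_line_gt0 x y : dot2 x x = 1 -> dot2 y y <= 1 -> x <> y -> 0 < 1 - dot2 x y.
Proof.
rewrite /dot2 => hx hy xy.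
have : 0 < (x 0 0 - y 0 0) ^+ 2 + (x 0 1 - y 0 1) ^+ 2.
  rewrite lt_def addr_ge0 ?sqr_ge0// andbT paddr_eq0 ?sqr_ge0// !sqrf_eq0 !subr_eq0.
  by apply/negP => /andP[/eqP h0 /eqP h1]; apply: xy; exact: row2P.
lra.
Qed.

Lemma parallel_scale (u0 u1 w0 w1 : R) : u0 * w1 - u1 * w0 = 0 ->
  (u0 ^+ 2 + u1 ^+ 2) * w0 = (u0 * w0 + u1 * w1) * u0 /\ (u0 ^+ 2 + u1 ^+ 2) * w1 = (u0 * w0 + u1 * w1) * u1.
Proof.
move=> E; split; apply/eqP; rewrite -subr_eq0.
  by rewrite [X in X == 0](_ : _ = - u1 * (u0 * w1 - u1 * w0)); [rewrite E mulr0|ring].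
by rewrite [X in X == 0](_ : _ = u0 * (u0 * w1 - u1 * w0)); [rewrite E mulr0|ring].
Qed.

Lemma unit_polar (x0 x1 y0 y1 : R) : x0 * x0 + x1 * x1 = 1 -> y0 * y0 + y1 * y1 = 1 ->
  2 * (x0 * (y0 - x0) + x1 * (y1 - x1)) = - ((y0 - x0) ^+ 2 + (y1 - x1) ^+ 2).
Proof.
move=> hx hy; apply/eqP; rewrite -subr_eq0.
by rewrite [X in X == 0](_ : _ = (y0 * y0 + y1 * y1) - (x0 * x0 + x1 * x1)); [rewrite hx hy subrr|ring].
Qed.

Lemma opposite_weight (x y : R) : x * y < 0 -> y - x != 0 /\ 0 < y / (y - x) < 1.
Proof.
have lem (a b : R) : a < 0 -> 0 < b -> b - a != 0 /\ 0 < b / (b - a) < 1.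
  move=> a0 b0; have ba : 0 < b - a by lra.
  by rewrite gt_eqF// divr_gt0//= ltr_pdivrMr// mul1r; split => //; lra.
move=> xy; have [x0|x0] := ltP x 0; first by apply: lem => //; move: xy; rewrite nmulr_rlt0.
have x1 : 0 < x by rewrite lt_def x0 andbT; apply/eqP => E; move: xy; rewrite E mul0r ltxx.
have y0 : y < 0 by move: xy; rewrite pmulr_rlt0.
have [] := lem (- x) (- y); [by rewrite oppr_lt0|by rewrite oppr_gt0|].
by rewrite -opprD oppr_eq0 invrN mulrNN.
Qed.

Lemma cramer2 (a0 a1 b0 b1 w0 w1 : R) : a0 * w0 + a1 * w1 = 0 -> b0 * w0 + b1 * w1 = 0 ->
  a0 * b1 - a1 * b0 != 0 -> w0 = 0 /\ w1 = 0.
Proof.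
move=> ha hb d0; split; apply: (mulfI d0); rewrite mulr0.
  by rewrite [LHS](_ : _ = b1 * (a0 * w0 + a1 * w1) - a1 * (b0 * w0 + b1 * w1)); [rewrite ha hb !mulr0 subrr|ring].
by rewrite [LHS](_ : _ = a0 * (b0 * w0 + b1 * w1) - b0 * (a0 * w0 + a1 * w1)); [rewrite ha hb !mulr0 subrr|ring].
Qed.

Definition side x y z := (y 0 0 - x 0 0) * (z 0 1 - x 0 1) - (y 0 1 - x 0 1) * (z 0 0 - x 0 0).

Lemma side_circle x y z : dot2 x x = 1 -> dot2 y y = 1 -> dot2 z z = 1 -> x <> y -> side x y z = 0 ->
  z = x \/ z = y.
Proof.
rewrite /dot2 /side => hx hy hz xy.
pose u0 := y 0 0 - x 0 0; pose u1 := y 0 1 - x 0 1; pose w0 := z 0 0 - x 0 0; pose w1 := z 0 1 - x 0 1.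
rewrite -/u0 -/u1 -/w0 -/w1 => E; pose N := u0 ^+ 2 + u1 ^+ 2; pose S := u0 * w0 + u1 * w1.
have N0 : N != 0.
  rewrite /N paddr_eq0 ?sqr_ge0// !sqrf_eq0 !subr_eq0; apply/negP => /andP[/eqP h0 /eqP h1].
  by apply: xy; exact: row2P.
have [e0 e1] : N * w0 = S * u0 /\ N * w1 = S * u1 by exact: parallel_scale.
have xu : 2 * (x 0 0 * u0 + x 0 1 * u1) = - N by exact: unit_polar.
have xw : 2 * (x 0 0 * w0 + x 0 1 * w1) = - (w0 ^+ 2 + w1 ^+ 2) by exact: unit_polar.
have S1 : N * (w0 ^+ 2 + w1 ^+ 2) = S * N.
  apply/eqP; rewrite -(inj_eq oppr_inj) -mulrN -xw -mulrN -xu; apply/eqP.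
  by rewrite mulrCA mulrDr !(mulrCA N) e0 e1; ring.
have S2 : N * (N * (w0 ^+ 2 + w1 ^+ 2)) = N * S ^+ 2.
  rewrite mulrA mulrDr -!expr2 -!exprMn e0 e1; rewrite /N; ring.
have : S * (S - N) = 0.
  by move/(mulfI N0): S2; rewrite S1 => h; rewrite mulrBr -expr2 -h subrr.
move=> /eqP; rewrite mulf_eq0 subr_eq0 => /orP[]/eqP SE; rewrite SE in e0 e1.
  left; apply: row2P; apply/eqP; rewrite -subr_eq0.
    by rewrite -/w0 -(mulrI_eq0 _ (mulfI N0)) e0 mul0r.
  by rewrite -/w1 -(mulrI_eq0 _ (mulfI N0)) e1 mul0r.
by right; move/(mulfI N0): e0 => /addIr h0; move/(mulfI N0): e1 => /addIr h1; exact: row2P.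
Qed.

Variable b : R -> 'rV[R]_2.
Hypothesis cb : forall j, continuous (fun t => b t 0 j).
Hypothesis b1 : forall t, dot2 (b t) (b t) = 1.
Hypothesis b_inj : forall s t, b s = b t <-> exists k : int, s = t + k%:~R.
Hypothesis b_surj : forall x, dot2 x x = 1 -> exists t, b t = x.

Lemma circle_param_neq s t : s < t -> t < s + 1 -> b s <> b t.
Proof.
move=> st ts /b_inj[k sE]; have k0 : k = 0 by apply: (@int_eq0 R); rewrite ltr_norml; split_lra.
by move: st; rewrite sE k0 addr0 ltxx.
Qed.

Lemma continuous_side x y : continuous (fun t => side x y (b t)).
Proof.
move=> t; apply: cvgB; (apply: cvgM; first exact: cvg_cst); (apply: cvgB; last exact: cvg_cst); exact: cb.
Qed.

Lemma chord_sides a c d e : a < c -> c < d -> d < e -> e < a + 1 ->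
  side (b a) (b d) (b c) * side (b a) (b d) (b e) < 0.
Proof.
move=> ac cd de ea; pose f t := side (b a) (b d) (b t).
have ad : b a <> b d by apply: circle_param_neq; lra.
have cf : continuous f by exact: continuous_side.
have f0 t : a < t -> t < a + 1 -> t <> d -> f t <> 0.
  move=> at_ ta td /(side_circle (b1 a) (b1 d) (b1 t) ad)[] /esym E.
    exact: circle_param_neq at_ ta E.
  have [lt|gt|//] := ltgtP t d.
    by apply: (circle_param_neq lt _ (esym E)); lra.
  by apply: (circle_param_neq gt _ E); lra.
have pos s t : a < s -> s <= t -> t < a + 1 -> (t < d \/ d < s) -> 0 < f s * f t.
  move=> as_ st ta sd; rewrite lt_def; apply/andP; split.
    by clear -f0 as_ st ta sd; rewrite mulf_neq0//; apply/eqP; apply: f0; lra.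
  rewrite leNgt; apply/negP => neg.
  have [|w] := IVT st (continuous_subspaceT cf) (v := 0).
    rewrite ge_min le_max; have [fs|fs] := leP (f s) 0; have [ft|ft] := leP (f t) 0 => //=.
    - by move: neg; rewrite ltNge mulr_le0.
    - by rewrite (ltW ft) orbT.
    - by rewrite (ltW fs).
    - by move: neg; rewrite ltNge mulr_ge0// ltW.
  by rewrite in_itv/= => /andP[sw wt]; apply: f0; lra.
have ne : f c * f e != 0 by rewrite mulf_neq0//; apply/eqP; apply: f0; lra.
rewrite -/(f c) -/(f e) lt_def eq_sym ne/= leNgt; apply/negP => same.
pose u0 := b d 0 0 - b a 0 0; pose u1 := b d 0 1 - b a 0 1.
pose N := u0 ^+ 2 + u1 ^+ 2; pose v := u0 * b a 0 1 - u1 * b a 0 0.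
have N0 : 0 < N.
  rewrite lt_def addr_ge0 ?sqr_ge0// andbT paddr_eq0 ?sqr_ge0// !sqrf_eq0 !subr_eq0.
  by apply/negP => /andP[/eqP h0 /eqP h1]; apply: ad; exact/esym/row2P.
have v2 : v ^+ 2 = N - N ^+ 2 / 4.
  have := b1 a; have := b1 d; rewrite /dot2 /v /N /u0 /u1.
  move: (b a 0 0) (b a 0 1) (b d 0 0) (b d 0 1) => x0 x1 y0 y1 hy hx.
  have xu : x0 * (y0 - x0) + x1 * (y1 - x1) = - ((y0 - x0) ^+ 2 + (y1 - x1) ^+ 2) / 2 by have := unit_polar hx hy; lra.
  have L : ((y0 - x0) * x1 - (y1 - x1) * x0) ^+ 2 + (x0 * (y0 - x0) + x1 * (y1 - x1)) ^+ 2 =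
      ((y0 - x0) ^+ 2 + (y1 - x1) ^+ 2) * (x0 * x0 + x1 * x1) by ring.
  by rewrite hx xu mulr1 in L; move: L; lra.
have [r [r0 rN]] : exists r : R, 0 < r /\ r ^+ 2 = N by exists (Num.sqrt N); rewrite sqrtr_gt0 sqr_sqrtr// ltW.
have vr : `|v| < r.
  rewrite -(@ltr_sqr _ `|v|) ?nnegrE ?(ltW r0)// real_normK ?num_real// v2 rN.
  by rewrite ltrBlDr ltrDl divr_gt0// exprn_gt0.
have pt (sg : R) : sg ^+ 2 = 1 -> exists t, [/\ a <= t, t < a + 1 & f t = sg * r - v].
  move=> sg2; pose x : 'rV[R]_2 := \row_j (if j == 0 then - (sg * u1 / r) else sg * u0 / r).
  have [|t tE] := b_surj (x := x).
    have G (x0 x1 y : R) : y != 0 -> - (sg * x1 / y) * - (sg * x1 / y) + sg * x0 / y * (sg * x0 / y) =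
        sg ^+ 2 * (x0 ^+ 2 + x1 ^+ 2) / y ^+ 2 by move=> y0; field.
    by rewrite /dot2 !mxE/= G ?gt_eqF// sg2 rN mul1r divff// gt_eqF.
  have [k /andP[k0 k1]] := ex_frac (t - a); exists (t + k%:~R); split; [lra|lra|].
  have -> : f (t + k%:~R) = f t by rewrite /f (_ : b (t + _) = b t)//; apply/b_inj; exists k.
  rewrite /f tE /side !mxE/= -/u0 -/u1 /v.
  have G (x0 x1 y a0 a1 : R) : y != 0 -> x0 * (sg * x0 / y - a1) - x1 * (- (sg * x1 / y) - a0) =
      sg * (x0 ^+ 2 + x1 ^+ 2) / y - (x0 * a1 - x1 * a0) by move=> y0; field.
  by rewrite G ?gt_eqF// -/N -rN expr2 mulrA mulfK// gt_eqF.
move: vr; rewrite ltr_norml => /andP[v1' v2'].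
have fne t : a <= t -> t < a + 1 -> f t != 0 -> 0 < f t * f c.
  move=> at_ ta ft; have at' : a < t.
    by rewrite lt_neqAle at_ andbT; apply/eqP => aE; move: ft; rewrite -aE /f /side !subrr !mulr0 subrr eqxx.
  have [td|dt|tE] := ltgtP t d; last first.
  - by move: ft; rewrite tE /f /side mulrC subrr eqxx.
  - have : 0 < f t * f e.
      have [te|/ltW et] := leP t e; first by apply: pos => //; lra.
      by clear -ac cd de pos ta et; rewrite mulrC; apply: pos => //; lra.
    by clear -same; move: same; move: (f t) (f e) (f c) => A B C *; nra.
  - have [tc|/ltW ct] := leP t c; first by apply: pos => //; lra.
    by rewrite mulrC; apply: pos => //; lra.
have [|t1 [a1 a1' E1]] := pt 1; first by rewrite expr1n.
have [|t2 [a2 a2' E2]] := pt (-1); first by rewrite sqrrN expr1n.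
have p1 : 0 < f t1 * f c by clear -v2' fne a1 a1' E1; apply: fne => //; rewrite E1 gt_eqF//; lra.
have p2 : 0 < f t2 * f c by apply: fne => //; rewrite E2 lt_eqF//; lra.
have q1 : 0 < f t1 by clear -v2' E1; rewrite E1; lra.
have q2 : f t2 < 0 by rewrite E2; lra.
by clear -p1 p2 q1 q2; move: p1 p2 q1 q2; move: (f t1) (f t2) (f c) => *; nra.
Qed.

Lemma chords_cross a c d e (p q : R -> 'rV[R]_2) : a < c -> c < d -> d < e -> e < a + 1 ->
  (forall j, continuous (fun t => p t 0 j)) -> (forall j, continuous (fun t => q t 0 j)) ->
  (forall t, dot2 (p t) (p t) <= 1) -> (forall t, dot2 (q t) (q t) <= 1) ->
  p 0 = b a -> p 1 = b d -> q 0 = b c -> q 1 = b e ->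
  exists s t, [/\ 0 <= s <= 1, 0 <= t <= 1 & p s = q t].
Proof.
move=> ac cd de ea cp cq dp dq p0 p1 q0 q1; apply: contrapT => NE.
have ne s t : 0 <= s <= 1 -> 0 <= t <= 1 -> p s <> q t by move=> sI tI E; apply: NE; exists s, t.
pose T x z := 1 - dot2 x z.
have I0 : 0 <= (0 : R) <= 1 by rewrite lexx ler01.
have I1 : 0 <= (1 : R) <= 1 by rewrite lexx ler01.
have T0 x : dot2 x x = 1 -> T x x = 0 by rewrite /T => ->; rewrite subrr.
have Tpos t x : dot2 x x <= 1 -> b t <> x -> 0 < T (b t) x by move=> hx /tangent_line_gt0; apply.
have le1 t : dot2 (b t) (b t) <= 1 by rewrite b1.
have bpos u v : u < v -> v < u + 1 -> 0 < T (b u) (b v) /\ 0 < T (b v) (b u).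
  by move=> uv vu; have uv' := circle_param_neq uv vu; split; apply: Tpos => //; exact/nesym.
have cT (h : R * R -> R) (g : R -> 'rV[R]_2) x : continuous h -> (forall j, continuous (fun t => g t 0 j)) ->
    continuous (fun u : R * R => T x (g (h u))).
  move=> ch cg u; apply: cvgB; first exact: cvg_cst.
  apply: cvgD; (apply: cvgM; first exact: cvg_cst).
    by apply: (@continuous_comp _ _ _ h (fun t => g t 0 0)); [exact: ch|exact: cg].
  by apply: (@continuous_comp _ _ _ h (fun t => g t 0 1)); [exact: ch|exact: cg].
have c1 : continuous (fun z : R * R => z.1) by move=> z; exact: cvg_fst.
have c2 : continuous (fun z : R * R => z.2) by move=> z; exact: cvg_snd.
have [||||s [t [sI tI E1 E2]]] := @poincare_miranda R
  (fun z : R * R => T (b c) (p z.1) * T (b e) (q z.2) - T (b c) (q z.2) * T (b e) (p z.1))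
  (fun z : R * R => T (b a) (q z.2) * T (b d) (p z.1) - T (b a) (p z.1) * T (b d) (q z.2)).
- by move=> z; apply: cvgB; apply: cvgM; apply: cT.
- by move=> z; apply: cvgB; apply: cvgM; apply: cT.
- move=> s sI /=; rewrite q0 q1 !T0 ?b1// mul0r subr0 mulr0 sub0r oppr_lt0.
  have h1 : 0 < T (b c) (p s) by apply: Tpos => //; rewrite -q0; apply/nesym/ne.
  have h2 : 0 < T (b e) (p s) by apply: Tpos => //; rewrite -q1; apply/nesym/ne.
  have [||h4 h3] := bpos c e; [lra|lra|].
  by split; exact: mulr_gt0.
- move=> t tI /=; rewrite p0 p1 !T0 ?b1// mul0r subr0 mulr0 sub0r oppr_lt0.
  have h1 : 0 < T (b a) (q t) by apply: Tpos => //; rewrite -p0; apply: ne.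
  have h2 : 0 < T (b d) (q t) by apply: Tpos => //; rewrite -p1; apply: ne.
  have [||h4 h3] := bpos a d; [lra|lra|].
  by split; exact: mulr_gt0.
have := chord_sides ac cd de ea; set lc := side _ _ (b c); set le := side _ _ (b e) => opp.
rewrite /= in E1 E2; set P := p s in E1 E2 *; set Q := q t in E1 E2 *.
have [lne] := opposite_weight opp; set k := le / (le - lc) => k01.
pose S z := k * T (b c) z + (1 - k) * T (b e) z.
have ce : b c <> b e by clear -b_inj ac cd de ea; apply: circle_param_neq; lra.
have Tge x y : dot2 x x = 1 -> dot2 y y <= 1 -> 0 <= T x y.
  move=> hx hy; have [->|xy] := pselect (x = y); last exact/ltW/tangent_line_gt0.
  by rewrite /T subr_ge0.
have Spos z : dot2 z z <= 1 -> 0 < S z.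
  move=> hz; have /andP[k0 k1] := k01; have [E|E] := pselect (b c = z).
    apply: ltr_wpDl; first by rewrite mulr_ge0 ?(ltW k0)// Tge.
    apply: mulr_gt0; first by rewrite subr_gt0.
    by apply: Tpos => // E'; apply: ce; rewrite E E'.
  by apply: ltr_pwDl; [rewrite mulr_gt0//; exact: Tpos|apply: mulr_ge0; [rewrite subr_ge0; exact: ltW|exact: Tge]].
have [m SE] : exists m, forall z, S z = (1 - m) * T (b a) z + m * T (b d) z.
  pose u0 := b d 0 0 - b a 0 0; pose u1 := b d 0 1 - b a 0 1; pose N := u0 ^+ 2 + u1 ^+ 2.
  pose w0 := k * b c 0 0 + (1 - k) * b e 0 0 - b a 0 0; pose w1 := k * b c 0 1 + (1 - k) * b e 0 1 - b a 0 1.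
  have N0 : N != 0.
    rewrite /N paddr_eq0 ?sqr_ge0// !sqrf_eq0 !subr_eq0; apply/negP => /andP[/eqP h0 /eqP h1].
    have : b a <> b d by clear -b_inj ac cd de ea; apply: circle_param_neq; lra.
    by apply; apply/esym/row2P.
  have [|e0 e1] := @parallel_scale u0 u1 w0 w1.
    have <- : k * lc + (1 - k) * le = 0.
      have G (x y : R) : y - x != 0 -> y / (y - x) * x + (1 - y / (y - x)) * y = 0 by move=> xy; field.
      exact: G.
    by rewrite /lc /le /side /w0 /w1 /u0 /u1; ring.
  exists ((u0 * w0 + u1 * w1) / N) => z.
  have E0 : w0 = (u0 * w0 + u1 * w1) / N * u0 by rewrite mulrAC -e0 mulrC mulKf.
  have E1' : w1 = (u0 * w0 + u1 * w1) / N * u1 by rewrite mulrAC -e1 mulrC mulKf.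
  move: E0 E1'; move: ((u0 * w0 + u1 * w1) / N) => m E0 E1'.
  have -> : S z = 1 - ((w0 + b a 0 0) * z 0 0 + (w1 + b a 0 1) * z 0 1).
    by rewrite /S /T /dot2 /w0 /w1; ring.
  by rewrite E0 E1' /T /dot2 /u0 /u1; ring.
have SP := Spos P (dp s); have SQ := Spos Q (dq t).
have hc : T (b c) P * S Q = T (b c) Q * S P.
  apply/eqP; rewrite -subr_eq0 [X in X == 0](_ : _ = (1 - k) * (T (b c) P * T (b e) Q - T (b c) Q * T (b e) P)); first by rewrite E1 mulr0.
  by rewrite /S; ring.
have ha : T (b a) P * S Q = T (b a) Q * S P.
  apply/eqP; rewrite -subr_eq0 !SE [X in X == 0](_ : _ = - m * (T (b a) Q * T (b d) P - T (b a) P * T (b d) Q)); first by rewrite E2 mulr0.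
  by ring.
have hd : T (b d) P * S Q = T (b d) Q * S P.
  apply/eqP; rewrite -subr_eq0 !SE [X in X == 0](_ : _ = (1 - m) * (T (b a) Q * T (b d) P - T (b a) P * T (b d) Q)); first by rewrite E2 mulr0.
  by ring.
pose w0 := S Q * P 0 0 - S P * Q 0 0; pose w1 := S Q * P 0 1 - S P * Q 0 1.
have D1 : (b d 0 0 - b a 0 0) * w0 + (b d 0 1 - b a 0 1) * w1 = 0.
  have : T (b a) P * S Q - T (b a) Q * S P - (T (b d) P * S Q - T (b d) Q * S P) = 0 by rewrite ha hd !subrr.
  by move=> <-; rewrite /w0 /w1 /T /dot2; ring.
have D2 : (b c 0 0 - b a 0 0) * w0 + (b c 0 1 - b a 0 1) * w1 = 0.
  have : T (b a) P * S Q - T (b a) Q * S P - (T (b c) P * S Q - T (b c) Q * S P) = 0 by rewrite ha hc !subrr.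
  by move=> <-; rewrite /w0 /w1 /T /dot2; ring.
have lc0 : lc != 0 by apply/eqP => E; move: opp; rewrite E mul0r ltxx.
have [W0 W1] : w0 = 0 /\ w1 = 0 by exact: cramer2 D1 D2 lc0.
have SPQ : S Q = S P.
  apply/eqP; rewrite -subr_eq0; apply/eqP.
  have : T (b a) P * S Q - T (b a) Q * S P = 0 by rewrite ha subrr.
  rewrite (_ : _ - _ = S Q - S P - (b a 0 0 * w0 + b a 0 1 * w1)); last by rewrite /w0 /w1 /T /dot2; ring.
  by rewrite W0 W1 !mulr0 addr0 subr0.
apply: (ne s t sI tI); apply: row2P; apply: (mulfI (lt0r_neq0 SQ)); apply/eqP; rewrite -subr_eq0 {2}SPQ.
  by rewrite -/P -/Q -/w0 W0.
by rewrite -/P -/Q -/w1 W1.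
Qed.

End chords.

Section regular_pairs.
Context {R : realType} {n : nat} {M : riemannianManifold R n}.
Hypothesis hM : complete_manifold M.
Variable c : R -> M.
Hypothesis hc : smooth_circle c.
Implicit Types (x y s t a : R) (g h : R -> M).
Local Notation D := (cdist c).
Local Notation X := (@chart R n M).

Lemma regular_of_segments x y (l1 l2 : R) : c x <> c y ->
  (forall g, unit_segment g (D x y) -> g 0 = c x -> g (D x y) = c y ->
     l2 * inner (c y) (velocity c y) (velocity g (D x y)) < l1 * angle_at c x g) ->
  regular_pair c (c x) (c y).
Proof.
move=> xy H; exists (l1 *: velocity c x), (l2 *: velocity c y); split.
- by apply/(tangentE hc); exists l1.
- by apply/(tangentE hc); exists l2.
move=> g a mg g0 ga; have ug : unit_segment g a by apply: minimising_unit_segment; rewrite ?g0 ?ga.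
have aE : a = D x y.
  have [a0 iso _] := ug; have := iso 0 a; rewrite /= !in_itv/= !lexx (ltW a0) => /(_ isT isT).
  by rewrite g0 ga (cdistE hc) sub0r normrN gtr0_norm// => -[].
rewrite aE in ug ga *; rewrite !inner_scalel subr_lt0; exact: H.
Qed.

Lemma velocity_reverse_end g a : unit_segment g a -> velocity (fun s => g (a - s)) a = - velocity g 0.
Proof.
move=> ug; have := velocity_reverse (unit_segment_reverse ug).
rewrite (_ : (fun s => g (a - (a - s))) = g) => [->|]; first by rewrite opprK.
by apply/funext => s; congr g; ring.
Qed.

Lemma regular_pair_sym x y : c x <> c y -> regular_pair c (c x) (c y) -> regular_pair c (c y) (c x).
Proof.
move=> xy [v1 [v2 [t1 t2 H]]]; exists v2, v1; split => // g a mg g0 ga.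
have ug : unit_segment g a by apply: minimising_unit_segment => //; rewrite g0 ga => /esym.
have := H _ _ (unit_segment_minimising (unit_segment_reverse ug)).
rewrite subr0 subrr (velocity_reverse ug) (velocity_reverse_end ug) !inner_oppr => /(_ ga g0).
by rewrite opprK addrC.
Qed.

Lemma cdist_variation_end x y g : unit_segment g (D x y) -> g 0 = c x -> g (D x y) = c y ->
  forall e : R, 0 < e -> exists2 k : R, 0 < k & forall h : R, `|h| <= k ->
    D x (y + h) <= D x y + (e * `|h| + h * inner (c y) (velocity c y) (velocity g (D x y))).
Proof.
move=> ug g0 ga e e0; have ur := unit_segment_reverse ug; rewrite -{2}(cdist_sym c y x) in ur.
have [||k k0 H] := cdist_variation hc ur _ _ e0.
- by rewrite subr0.
- by rewrite (cdist_sym c y x) subrr.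
exists k => // h hk; rewrite (cdist_sym c x (y + h)) (cdist_sym c x y); apply: (le_trans (H h hk)).
rewrite /angle_at (cdist_sym c y x) (velocity_reverse ug) inner_oppr mulrN opprK.
by rewrite (cdist_sym c x y).
Qed.

Lemma cdist_lower y : exists k0 k : R, [/\ 0 < k0, 0 < k & forall h : R, `|h| <= k -> k0 * `|h| <= D y (y + h)].
Proof.
pose i := chart_at (c y); have iy : chart_dom i (c y) := mem_chart_at _.
have [r [K nc]] := ex_normal_chart iy; have [_ mb _] := nc.
have [_ K1 _ _ /andP[rho0 _]] := normal_chart_radius nc; have K0 : 0 < K := lt_le_trans ltr01 K1.
have Dc : is_derive y (1 : R) (X i \o c) (velocity c y) := C1_is_derive (circle_C1 hc) iy.
pose m := `|velocity c y|; have m0 : 0 < m by have [_ _ _ /(_ y)] := hc; rewrite normr_gt0.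
have e0 : 0 < m / 2 by rewrite divr_gt0.
have cc : {for y, continuous c} by exact: (C1_continuous (circle_C1 hc)).
have [d d0 H] := near_ball (filterI (is_derive_eps e0 Dc) (near_nball nc cc)).
exists (m / (2 * K)), (d / 2); split; [by rewrite divr_gt0// mulr_gt0|by rewrite divr_gt0|].
move=> h hd; have [|E nb] := H (y + h).
  by rewrite addrAC subrr add0r; apply: (le_lt_trans hd); lra.
have ny : nball i (c y) (dist_radius r K) (c y) by split => //; rewrite /cball/= subrr normr0 ltW.
have := dist_local nc ny nb; rewrite (cdistE hc) => -[->].
have [_ bm] := nb; have [_ ym] := ny.
have := local_dist_norm mb (dist_radius_cball mb ym) (dist_radius_cball mb bm).
have yh : y + h - y = h by rewrite addrAC subrr add0r.
rewrite yh /= in E; set p := X i (c (y + h)) in E *; set q := X i (c y) in E *.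
move: (local_dist _ _ _ _ _ _) => phi L.
have B : `|h| * m <= `|p - q| + m / 2 * `|h|.
  rewrite -normrZ (_ : h *: velocity c y = (p - q) - (p - q - h *: velocity c y)).
    by rewrite (le_trans (ler_normB _ _))// lerD2l.
  by rewrite opprB addrCA subrr addr0.
rewrite mulrAC ler_pdivrMr ?mulr_gt0//.
by move: L B; move: `|p - q| `|h| => a b; lra.
Qed.

End regular_pairs.

Section disc.
Context {R : realType} {n : nat} {M : riemannianManifold R n}.
Hypothesis hM : complete_manifold M.
Variable c : R -> M.
Hypothesis hc : smooth_circle c.
Variable F : 'rV[R]_2 -> M.
Hypothesis sF : smooth_disc F.
Hypothesis tF : totally_convex (F @` unit_disc).
Hypothesis bF : F @` unit_circle = range c.
Implicit Types (x y s t a : R) (g h : R -> M).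
Local Notation D := (cdist c).
Local Notation X := (@chart R n M).
Local Notation disc := (F @` unit_disc).

Lemma F_inj z z' : unit_disc z -> unit_disc z' -> F z = F z' -> z = z'.
Proof. by have [_ inj _] := sF => hz hz'; apply: inj; apply/mem_set. Qed.

Lemma F_continuous z : unit_disc z -> {for z, continuous F}.
Proof. by have [[U [oU DU sm]] _ _] := sF => /DU Uz; have [cF _] := sm 0%N; exact: cF. Qed.

Lemma closed_unit_disc : closed (@unit_disc R).
Proof.
have -> : @unit_disc R = (fun z : 'rV[R]_2 => dot2 z z) @^-1` [set r | r <= 1].
  by apply/seteqP; split=> z; rewrite /= unit_discE.
apply: closed_comp => [z _|]; last exact: closed_le.
have ct j : {for z, continuous (fun z : 'rV[R]_2 => z 0 j)} by exact: coord_continuous.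
exact: (continuousD (continuousM (ct 0) (ct 0)) (continuousM (ct 1) (ct 1))).
Qed.

Lemma unit_disc_norm (z : 'rV[R]_2) : unit_disc z -> `|z| <= 1.
Proof.
rewrite unit_discE /dot2 => h; apply: norm_mx_le => // i j; rewrite ord1.
rewrite -(@ler_sqr _ `|_|) ?nnegrE// expr1n real_normK ?num_real// expr2.
have h0 : 0 <= z 0 0 * z 0 0 by rewrite -expr2 sqr_ge0.
have h1 : 0 <= z 0 1 * z 0 1 by rewrite -expr2 sqr_ge0.
have [->|->] : j = 0 \/ j = 1 by case: j => -[|[|//]] i'; [left|right]; apply: val_inj.
  lra.
lra.
Qed.

Lemma inverse_continuous z0 (e : R) : unit_disc z0 -> 0 < e ->
  exists2 U : set M, nbhs (F z0) U & forall z, unit_disc z -> U (F z) -> `|z - z0| < e.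
Proof.
move=> hz0 e0; pose K := @unit_disc R `&` [set z | e <= `|z - z0|].
have cK : compact K.
  apply: (@subclosed_compact _ _ (cball 0 1)); last by move=> z [/unit_disc_norm h _]; rewrite /cball/= subr0.
    apply: closedI; first exact: closed_unit_disc.
    rewrite (_ : [set z | _] = (fun z : 'rV[R]_2 => `|z - z0|) @^-1` [set r | e <= r])//.
    apply: closed_comp => [z _|]; last exact: closed_ge.
    apply: (@continuous_comp _ _ _ (fun z : 'rV[R]_2 => z - z0) (@Num.Def.normr _ _)); last exact: norm_continuous.
    by apply: (@continuousB _ _ _ id (cst z0)) => //; exact: cst_continuous.
  exact: compact_cball.
have cFK : closed (F @` K).
  apply: compact_closed; first exact: carrier_hausdorff.
  by apply: continuous_compact cK; apply: continuous_in_subspaceT => z /set_mem[hz _]; exact: F_continuous.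
exists (~` (F @` K)).
  apply: open_nbhs_nbhs; split; first exact: closed_openC.
  by move=> [z [hz]] /= ez /(F_inj hz hz0) zE; move: ez; rewrite zE subrr normr0 leNgt e0.
by move=> z hz nK; rewrite ltNge; apply/negP => ez; apply: nK; exists z.
Qed.

Lemma disc_lift h : continuous h -> (forall t, disc (h t)) -> exists p : R -> 'rV[R]_2,
  [/\ forall t, unit_disc (p t), forall t, F (p t) = h t & forall j, continuous (fun t => p t 0 j)].
Proof.
move=> ch dh; have /choice[p Hp] : forall t, exists z, unit_disc z /\ F z = h t by move=> t; have [z ? ?] := dh t; exists z.
exists p; split=> [t|t|j t]; [by have [] := Hp t|by have [] := Hp t|].
apply: (@continuous_comp _ _ _ p (fun z : 'rV[R]_2 => z 0 j)); last exact: coord_continuous.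
apply/cvgrPdist_lt => e e0; have [dt ht] := Hp t.
have [U NU HU] := inverse_continuous dt e0.
rewrite ht in NU; have N : \forall s \near t, U (h s) := ch t _ NU.
apply: (@filterS _ (nbhs t) _ _ _ _ N) => s Us.
by rewrite distrC; have [ds hs] := Hp s; apply: HU => //; rewrite hs.
Qed.

Lemma boundary_disc t : disc (c t).
Proof.
have : range c (c t) by exists t.
by rewrite -bF => -[z hz <-]; exists z => //; move: hz; rewrite unit_circleE unit_discE => ->.
Qed.

Lemma ex_boundary_param : exists b : R -> 'rV[R]_2,
  [/\ forall t, F (b t) = c t, forall j, continuous (fun t => b t 0 j), forall t, dot2 (b t) (b t) = 1,
      forall s t, b s = b t <-> exists k : int, s = t + k%:~R & forall z, dot2 z z = 1 -> exists t, b t = z].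
Proof.
have [b [bd bE bc]] := disc_lift (C1_continuous (circle_C1 hc)) boundary_disc.
have cd (z : 'rV[R]_2) : unit_circle z -> unit_disc z by rewrite unit_circleE unit_discE => ->.
exists b; split => //.
- move=> t; have : range c (c t) by exists t.
  by rewrite -bF => -[z hz]; rewrite -bE => /(F_inj (cd _ hz) (bd t)) <-; rewrite -unit_circleE.
- move=> s t; split=> [E|/(circle_eqP hc)]; first by apply/(circle_eqP hc); rewrite -!bE E.
  by rewrite -!bE => /F_inj; apply.
- move=> z; rewrite -unit_circleE => hz; have : (F @` unit_circle) (F z) by exists z.
  by rewrite bF => -[t _]; rewrite -bE => /(F_inj (bd t) (cd _ hz)) E; exists t.
Qed.

Lemma unit_segment_disc g a : unit_segment g a -> disc (g 0) -> disc (g a) ->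
  forall t, 0 <= t <= a -> disc (g t).
Proof.
move=> ug d0 da t ta; have [a0 _ _] := ug; apply: (@tF g 0 a) => //.
- exact: ltW.
- by move=> s; rewrite /= in_itv/= => /(unit_segment_geodesic ug).
Qed.

Lemma segments_cross x1 x2 x3 x4 g h a a' : x1 < x2 -> x2 < x3 -> x3 < x4 -> x4 < x1 + 1 ->
  unit_segment g a -> g 0 = c x1 -> g a = c x3 -> unit_segment h a' -> h 0 = c x2 -> h a' = c x4 ->
  exists s t, [/\ 0 <= s <= a, 0 <= t <= a' & g s = h t].
Proof.
move=> x12 x23 x34 x41 ug g0 ga uh h0 ha; have [a0 _ _] := ug; have [a'0 _ _] := uh.
have lift f l : unit_segment f l -> disc (f 0) -> disc (f l) -> exists p : R -> 'rV[R]_2,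
    [/\ forall t, unit_disc (p t), forall t, 0 <= t <= 1 -> F (p t) = f (l * t) & forall j, continuous (fun t => p t 0 j)].
  move=> uf d0 dl; have [l0 _ _] := uf.
  have lI t : 0 <= l * clip 0 1 t <= l.
    have /andP[? ?] := clip_itv t (@ler01 R); rewrite mulr_ge0 ?(ltW l0)//=.
    by rewrite ler_piMr// ltW.
  have [||p [p1 p2 p3]] := @disc_lift (fun t => f (l * clip 0 1 t)).
  - move=> t; apply: (@continuous_comp _ _ _ (fun t => l * clip 0 1 t) f).
      by apply: cvgM; [exact: cvg_cst|exact: continuous_clip_id].
    have [|cf _] := unit_segment_velocity uf (t := l * clip 0 1 t) _ (mem_chart_at _); last exact: cf.
    by rewrite in_itv/=; exact: lI.
  - by move=> t; apply: unit_segment_disc uf _ _ _ _.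
  by exists p; split => // t tI; rewrite p2 clip_id.
have [b [bE bc b1 binj bsurj]] := ex_boundary_param.
have bd t : unit_disc (b t) by rewrite unit_discE b1.
have [||p [p1 p2 p3]] := lift g a ug; [by rewrite g0; exact: boundary_disc|by rewrite ga; exact: boundary_disc|].
have [||q [q1 q2 q3]] := lift h a' uh; [by rewrite h0; exact: boundary_disc|by rewrite ha; exact: boundary_disc|].
have I0 : 0 <= (0 : R) <= 1 by rewrite lexx ler01.
have I1 : 0 <= (1 : R) <= 1 by rewrite lexx ler01.
have [||||||s [t [sI tI E]]] := chords_cross bc b1 binj bsurj x12 x23 x34 x41 p3 q3.
- by move=> t; rewrite -unit_discE.
- by move=> t; rewrite -unit_discE.
- by apply: F_inj => //; rewrite p2// mulr0 g0 bE.
- by apply: F_inj => //; rewrite p2// mulr1 ga bE.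
- by apply: F_inj => //; rewrite q2// mulr0 h0 bE.
- by apply: F_inj => //; rewrite q2// mulr1 ha bE.
have itv l r : 0 < l -> 0 <= r <= 1 -> 0 <= l * r <= l by move=> l0 /andP[r0 r1]; rewrite mulr_ge0 ?(ltW l0)//= ler_piMr// ltW.
by exists (a * s), (a' * t); split; [exact: itv|exact: itv|rewrite -p2// E q2].
Qed.

Lemma circle_neq x y : x < y -> y < x + 1 -> c x <> c y.
Proof.
move=> xy yx /(circle_eqP hc)[k xE]; have k0 : k = 0 by apply: (@int_eq0 R); rewrite ltr_norml; split_lra.
by move: xy; rewrite xE k0 addr0 ltxx.
Qed.

Lemma ex_circle_segment x y : c x <> c y ->
  exists g, [/\ unit_segment g (D x y), g 0 = c x & g (D x y) = c y].
Proof. by move=> xy; apply: ex_unit_segment; [exact: hM|exact: cdist_gt0|exact: cdistE]. Qed.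

Lemma segment_dist g a s t : unit_segment g a -> 0 <= s -> s <= t -> t <= a -> dist (g s) (g t) = (t - s)%:E.
Proof.
move=> [_ iso _] s0 st ta; rewrite iso/= ?in_itv/= ?s0 ?ta ?(le_trans st)//; last by rewrite (le_trans s0).
by rewrite distrC ger0_norm// subr_ge0.
Qed.

Lemma crossing_dists x1 x2 x3 x4 g h s t : unit_segment g (D x1 x3) -> g 0 = c x1 -> g (D x1 x3) = c x3 ->
  unit_segment h (D x2 x4) -> h 0 = c x2 -> h (D x2 x4) = c x4 ->
  0 <= s <= D x1 x3 -> 0 <= t <= D x2 x4 -> g s = h t ->
  [/\ D x1 x2 <= s + t, D x3 x4 <= (D x1 x3 - s) + (D x2 x4 - t),
      D x1 x4 <= s + (D x2 x4 - t) & D x2 x3 <= t + (D x1 x3 - s)].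
Proof.
move=> ug g0 ga uh h0 ha /andP[s0 sa] /andP[t0 ta] E.
have g1 : dist (c x1) (g s) = s%:E by rewrite -g0 (segment_dist ug)// subr0.
have g2 : dist (g s) (c x3) = (D x1 x3 - s)%:E by rewrite -ga (segment_dist ug).
have h1 : dist (c x2) (g s) = t%:E by rewrite -h0 E (segment_dist uh)// subr0.
have h2 : dist (g s) (c x4) = (D x2 x4 - t)%:E by rewrite -ha E (segment_dist uh).
split; rewrite -lee_fin -(cdistE hc) EFinD; [rewrite -g1 -h1 (dist_sym (c x2))|
  rewrite -g2 -h2 (dist_sym (g s) (c x3))|rewrite -g1 -h2|rewrite -h1 -g2]; exact: dist_triangle.
Qed.

Lemma monge x1 x2 x3 x4 : x1 < x2 -> x2 < x3 -> x3 < x4 -> x4 < x1 + 1 ->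
  D x1 x4 + D x2 x3 <= D x1 x3 + D x2 x4.
Proof.
move=> x12 x23 x34 x41.
have [|g [ug g0 ga]] := @ex_circle_segment x1 x3; first by apply: circle_neq; lra.
have [|h [uh h0 ha]] := @ex_circle_segment x2 x4; first by apply: circle_neq; lra.
have [s [t [sI tI E]]] := segments_cross x12 x23 x34 x41 ug g0 ga uh h0 ha.
by have [_ _ h1 h2] := crossing_dists ug g0 ga uh h0 ha sI tI E; lra.
Qed.

Lemma max_pairs_not_nested W x1 x2 x3 x4 : (forall x y, D x y <= W) ->
  x1 < x2 -> x2 < x3 -> x3 < x4 -> x4 < x1 + 1 -> D x1 x2 = W -> D x3 x4 = W -> False.
Proof.
move=> max x12 x23 x34 x41 W12 W34.
have [|g [ug g0 ga]] := @ex_circle_segment x1 x3; first by apply: circle_neq; lra.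
have [|h [uh h0 ha]] := @ex_circle_segment x2 x4; first by apply: circle_neq; lra.
have [s [t [sI tI E]]] := segments_cross x12 x23 x34 x41 ug g0 ga uh h0 ha.
have [h1 h2 _ _] := crossing_dists ug g0 ga uh h0 ha sI tI E.
have m1 := max x1 x3; have m2 := max x2 x4.
have A : D x1 x3 = W by lra.
have B : D x2 x4 = W by lra.
have st : s + t = W by lra.
rewrite A in ug ga sI; rewrite B in uh ha tI.
have [W0 _ _] := ug.
have [s0|sn] := eqVneq s 0.
  have tW : t = W by rewrite -st s0 add0r.
  have := @circle_neq x1 x4; apply; [lra|lra|].
  by rewrite -g0 -ha -tW -E s0.
have [t0|tn] := eqVneq t 0.
  have sW : s = W by rewrite -st t0 addr0.
  by apply: (@circle_neq x2 x3) => //; [lra|rewrite -h0 -ga -sW -t0 -E].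
have /andP[s0 sW] := sI; have /andP[t0 tW] := tI.
have sp : 0 < s by rewrite lt_def sn.
have i1 : isometric_on `[0, s] g.
  have [_ iso _] := ug; apply: isometric_on_sub iso => u; rewrite /= !in_itv/= => /andP[-> us].
  exact: le_trans us sW.
have i2 : isometric_on `[0, t] (fun u => h (t - u)).
  have [_ iso _] := uh; apply: isometric_on_sub (isometric_on_reverse (c := t) iso) => u.
  by clear -ha tI; rewrite /= !in_itv/= => /andP[u0 ut]; split_lra.
have [||k [ik k1 k2]] := isometric_concat s0 t0 i1 i2.
- by rewrite subr0.
- by rewrite g0 subrr h0 (cdistE hc) W12 st.
rewrite st in ik k2; have [k' uk' k'E] := isometric_unit_segment W0 ik.
have := unit_segments_agree ug uk' sp _ (t := W).
have agree u : 0 <= u <= s -> g u = k' u by move=> /andP[u0 us]; rewrite k'E ?k1 ?u0// in_itv/= u0 (le_trans us).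
move=> /(_ agree); rewrite minxx lexx (ltW W0) => /(_ isT).
rewrite ga k'E ?in_itv/= ?lexx ?(ltW W0)// k2 ?sW ?lexx// (_ : t - (W - s) = 0); last by rewrite -st; ring.
by clear -hc x12 x23 x34 x41 h0; rewrite h0 => /esym; apply: circle_neq; lra.
Qed.

Let f x := X (chart_at (c x)) \o F.
Let L x (z : 'rV[R]_2) : 'rV[R]_2 -> 'rV[R]_n := 'd (f x) z.

Lemma F_differentiable x z : unit_disc z -> F z = c x -> differentiable (f x) z.
Proof.
have [[U [oU DU sm]] _ _] := sF => /DU Uz Fz.
have [_ H] := sm 1%N; have [d _] := H (chart_at (c x)); apply: d; split => //.
by rewrite /= Fz; exact: mem_chart_at.
Qed.

Lemma left_inverse_estimate (CB v e q r : R) : 0 <= CB -> 0 <= v -> 0 < e -> 0 <= q ->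
  e * (2 * (CB + 1)) <= 1 -> q <= CB * (e * (r + 1)) -> r <= v + q ->
  q <= e * (2 * (CB + 1) * (v + 1)) /\ e * (r + 1) <= e * (2 * (CB + 1) * (v + 1)).
Proof.
move=> CB0 v0 e0 q0 e2 h3 h4; have t0 : 0 <= CB * e by rewrite mulr_ge0// ltW.
have t1 : CB * e <= 2^-1 by lra.
have t2 : CB * e * (r + 1) <= CB * e * (v + q + 1) by rewrite ler_wpM2l//; lra.
have t3 : CB * e * q <= 2^-1 * q by rewrite ler_wpM2r.
have k2 : q <= 2 * (CB * e) * (v + 1) by lra.
have k3 : 0 <= e * (v + 1) by rewrite mulr_ge0 ?(ltW e0)//; lra.
have k4 : e * (r + 1) <= e * (v + q + 1) by rewrite ler_pM2l//; lra.
have k5 : e * q <= e * (2 * (CB * e) * (v + 1)) by rewrite ler_pM2l.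
have k6 : 2 * (CB * e) * (e * (v + 1)) <= 1 * (e * (v + 1)) by rewrite ler_wpM2r//; lra.
have k7 : 0 <= CB * e * (v + 1) by rewrite mulr_ge0//; lra.
by split; lra.
Qed.

Lemma inward_tangent x z (h : R -> M) w (d : R) : dot2 z z = 1 -> F z = c x -> h 0 = c x -> 0 < d ->
  (forall s, 0 <= s <= d -> disc (h s)) -> {for 0, continuous h} ->
  is_derive (0 : R) (1 : R) (X (chart_at (c x)) \o h) w ->
  exists2 v : 'rV[R]_2, L x z v = w & dot2 z v <= 0.
Proof.
move=> z1 Fz h0 d0 hd ch Dh; have dz : unit_disc z by rewrite unit_discE z1.
have df := F_differentiable dz Fz.
have Linj v : L x z v = 0 -> v = 0 by have [_ _ inj] := sF; move=> E; apply: (inj z dz); rewrite Fz.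
pose A := lin1_mx (L x z : {linear 'rV[R]_2 -> 'rV[R]_n}).
have LE v : L x z v = v *m A by rewrite mul_rV_lin1.
have Afree : row_free A by rewrite -kermx_eq0; apply/eqP/row_matrixP => i; rewrite row0; apply: Linj; rewrite LE -row_mul mulmx_ker row0.
have /row_freeP[B AB] := Afree.
pose v := w *m B; pose CA := 2 * `|A|; pose CB := n%:R * `|B|.
have CA0 : 0 <= CA by rewrite mulr_ge0.
have CB0 : 0 <= CB by rewrite mulr_ge0.
have bA (u : 'rV[R]_2) : `|u *m A| <= CA * `|u| by apply: (le_trans (norm_mulmx_le _ _)); rewrite mulrAC.
have bB (u : 'rV[R]_n) : `|u *m B| <= CB * `|u| by apply: (le_trans (norm_mulmx_le _ _)); rewrite mulrAC.
have step (e : R) : 0 < e -> exists2 v' : 'rV[R]_2, `|v' *m A - w| <= e * (`|v'| + 1) & dot2 z v' <= 0.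
  move=> e0; have [d1 d10 H1] : exists2 d1 : R, 0 < d1 & forall y : 'rV[R]_2, `|y - z| < d1 ->
      `|f x y - f x z - L x z (y - z)| <= e * `|y - z|.
    have := differentiable_eps df e0; move=> /nbhs_ballP[d1 d10 H1]; exists d1 => // y yz.
    by apply: H1; rewrite -ball_normE /ball_/= distrC.
  have [U NU HU] := inverse_continuous dz d10.
  have N : \forall s \near (0 : R), U (h s) by apply: ch; rewrite h0 -Fz.
  have [d2 d20 H2] := near_ball (filterI N (is_derive_eps e0 Dh)).
  pose s := Num.min d (d2 / 2); have s0 : 0 < s by rewrite lt_min d0 divr_gt0.
  have sd : s <= d by rewrite ge_min lexx.
  have sd2 : s < d2 by rewrite gt_min; apply/orP; right; lra.
  clearbody s; have [|Us] := H2 s; first by rewrite subr0 gtr0_norm.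
  rewrite subr0 (gtr0_norm s0) => W.
  have [|y hy yE] := hd s; first by rewrite (ltW s0).
  have yz : `|y - z| < d1 by apply: HU => //; rewrite yE.
  have V := H1 y yz; rewrite /f /= yE Fz in V; rewrite /= h0 in W.
  exists (s^-1 *: (y - z)).
    have nE : s * `|s^-1 *: (y - z)| = `|y - z| by rewrite normrZ gtr0_norm ?invr_gt0// mulrA divff ?mul1r// gt_eqF.
    have sE : s *: (s^-1 *: (y - z) *m A - w) = L x z (y - z) - s *: w by rewrite LE scalerBr -scalemxAl scalerA divff ?scale1r// gt_eqF.
    rewrite -(ler_pM2l s0) -{1}(gtr0_norm s0) -normrZ sE mulrCA mulrDr mulr1 nE.
    set p := X _ _ in V W; set q := X _ _ in V W.
    rewrite (_ : _ - _ = (p - q - s *: w) - (p - q - L x z (y - z))); last by apply/rowP => j; rewrite !mxE; ring.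
    by apply: (le_trans (ler_normB _ _)); rewrite mulrDr addrC lerD.
  rewrite (_ : dot2 z _ = s^-1 * (dot2 z y - 1)); last by rewrite -z1 /dot2 !mxE; ring.
  rewrite pmulr_rle0 ?invr_gt0// subr_le0.
  have [->|/eqP zy] := eqVneq z y; first by move: hy; rewrite unit_discE.
  by rewrite -subr_ge0 ltW// tangent_line_gt0//; move: hy; rewrite unit_discE.
have close (eta : R) : 0 < eta -> exists v' : 'rV[R]_2, [/\ `|v' - v| <= eta, `|v' *m A - w| <= eta & dot2 z v' <= 0].
  move=> eta0; pose C := 2 * (CB + 1) * (`|v| + 1).
  have v0 : 0 <= `|v| by [].
  have C0 : 0 < C by rewrite /C !mulr_gt0//; lra.
  pose e := Num.min (eta / C) (2 * (CB + 1))^-1.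
  have e0 : 0 < e by rewrite lt_min divr_gt0//= invr_gt0 mulr_gt0//; lra.
  have eC : e * C <= eta by rewrite -ler_pdivlMr// ge_min lexx.
  have e2 : e * (2 * (CB + 1)) <= 1 by rewrite -ler_pdivlMr ?div1r ?ge_min ?lexx ?orbT// mulr_gt0//; lra.
  clearbody e; have [v' h1 h2] := step e e0.
  have E : v' - v = (v' *m A - w) *m B by rewrite mulmxBl -mulmxA AB mulmx1.
  have h3 : `|v' - v| <= CB * (e * (`|v'| + 1)) by rewrite E (le_trans (bB _))// ler_wpM2l.
  have h4 : `|v'| <= `|v| + `|v' - v| by rewrite -{1}[v'](subrK v) addrC ler_normD.
  have [k1 k2] := left_inverse_estimate CB0 v0 e0 (normr_ge0 (v' - v)) e2 h3 h4.
  exists v'; split => //; first by clear -eC k1; apply: le_trans eC; apply: (le_trans k1); rewrite /C; lra.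
  by apply: le_trans eC; apply: (le_trans h1); apply: (le_trans k2); rewrite /C; lra.
exists v.
  rewrite LE; apply/eqP; rewrite -subr_eq0 -normr_le0; apply/ler_addgt0Pr => e e0; rewrite add0r.
  have [|v' [h1 h2 _]] := close (e / (CA + 1)); first by rewrite divr_gt0//; lra.
  rewrite (_ : _ - _ = (v' *m A - w) - (v' - v) *m A); last by rewrite mulmxBl; apply/rowP => j; rewrite !mxE; ring.
  apply: (le_trans (ler_normB _ _)); apply: (le_trans (lerD h2 (le_trans (bA _) (ler_wpM2l CA0 h1)))).
  have G (a b : R) : 0 <= a -> b / (a + 1) + a * (b / (a + 1)) = b by move=> a0; field; lra.
  by rewrite G.
apply/ler_addgt0Pr => e e0; rewrite add0r.
have [|v' [h1 _ h2]] := close (e / 2); first by rewrite divr_gt0.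
have z0 j : `|z 0 j| <= 1 by apply: (le_trans (le_coord_norm _ _ _)); exact: unit_disc_norm.
have cj j : `|z 0 j * (v 0 j - v' 0 j)| <= e / 2.
  rewrite normrM -[leRHS]mul1r ler_pM//; apply: le_trans h1.
  by rewrite distrC; have := le_coord_norm (v' - v) 0 j; rewrite !mxE.
have E : dot2 z v = dot2 z v' + (z 0 0 * (v 0 0 - v' 0 0) + z 0 1 * (v 0 1 - v' 0 1)) by rewrite /dot2; ring.
by rewrite E; have := ler_norm (z 0 0 * (v 0 0 - v' 0 0)); have := ler_norm (z 0 1 * (v 0 1 - v' 0 1)); have := cj 0; have := cj 1; lra.
Qed.

Lemma inward_normal x : exists (e : 'rV[R]_n) (Q : R), forall g a, unit_segment g a -> g 0 = c x -> disc (g a) ->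
  angle_at c x g = 0 -> exists mu : R, [/\ mu <= 0, velocity g 0 = mu *: e & mu ^+ 2 * Q = 1].
Proof.
have [b [bE _ b1 _ _]] := ex_boundary_param; pose z := b x.
have z1 : dot2 z z = 1 := b1 x; have Fz : F z = c x := bE x.
have dz : unit_disc z by rewrite unit_discE z1.
have Linj v : L x z v = 0 -> v = 0 by have [_ _ inj] := sF; move=> E; apply: (inj z dz); rewrite Fz.
pose i := chart_at (c x); have ix : chart_dom i (c x) := mem_chart_at _.
pose I u v := gform (@metric R n M i) (X i (c x)) u v.
have Dc : is_derive x (1 : R) (X i \o c) (velocity c x) := C1_is_derive (circle_C1 hc) ix.
have tang (k : R) : exists2 v, L x z v = k *: velocity c x & dot2 z v <= 0.
  apply: (@inward_tangent x z (fun s => c (k * s + x)) _ 1) => //.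
  - by rewrite mulr0 add0r.
  - by move=> s _; exact: boundary_disc.
  - apply: (@continuous_comp _ _ _ (fun s => k * s + x) c); last exact: C1_continuous (circle_C1 hc) _.
    by apply: cvgD; [apply: cvgM; [exact: cvg_cst|exact: cvg_id]|exact: cvg_cst].
  - have D0 : is_derive (k * 0 + x) (1 : R) (X i \o c) (velocity c x) by rewrite mulr0 add0r.
    exact: (is_derive_affine D0).
have [v0 Lv0 zv0] := tang 1; rewrite scale1r in Lv0.
have {}zv0 : dot2 z v0 = 0.
  have [v1 Lv1 zv1] := tang (-1); have E : v1 = - v0.
    apply/eqP; rewrite -subr_eq0 opprK; apply/eqP/Linj.
    by rewrite /L linearD/= -/(L x z _) -/(L x z _) Lv0 Lv1 scaleN1r addNr.
  have E' : dot2 z v1 = - dot2 z v0 by rewrite E /dot2 !mxE; ring.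
  by apply/eqP; rewrite eq_le zv0/= -oppr_le0 -E'.
have v00 : v0 <> 0 by move=> E; have [_ _ _ /(_ x)/eqP] := hc; apply; rewrite -Lv0 E /L linear0.
have basis v : exists k, v = k *: v0 + dot2 z v *: z.
  pose ka := z 0 0 * v0 0 1 - z 0 1 * v0 0 0.
  have e0 : v0 0 0 = - ka * z 0 1.
    rewrite -[LHS]mulr1 -[X in _ * X]z1 -[LHS]addr0 -[X in _ + X](mulr0 (- z 0 0)) -{1}zv0 /dot2 /ka; ring.
  have e1 : v0 0 1 = ka * z 0 0.
    rewrite -[LHS]mulr1 -[X in _ * X]z1 -[LHS]addr0 -[X in _ + X](mulr0 (- z 0 1)) -{1}zv0 /dot2 /ka; ring.
  have ka0 : ka != 0 by apply/eqP => ka0; apply: v00; apply: row2P; rewrite ?e0 ?e1 ka0 mxE ?oppr0 mul0r.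
  exists ((z 0 0 * v 0 1 - z 0 1 * v 0 0) / ka); apply: row2P; rewrite !mxE ?e0 ?e1.
    rewrite -[LHS]mulr1 -[X in _ * X]z1 /dot2; move: ka ka0 {e0 e1} (z 0 0) (z 0 1) (v 0 0) (v 0 1) => k k0 x0 x1 y0 y1.
    by field.
  rewrite -[LHS]mulr1 -[X in _ * X]z1 /dot2; move: ka ka0 {e0 e1} (z 0 0) (z 0 1) (v 0 0) (v 0 1) => k k0 x0 x1 y0 y1.
  by field.
have h00 : 0 < I (velocity c x) (velocity c x) by have [_ _ _ /(_ x) vx] := hc; exact: (metric_posdef ix vx).
pose E := L x z z; pose r := I (velocity c x) E / I (velocity c x) (velocity c x).
exists (E - r *: velocity c x), (I (E - r *: velocity c x) (E - r *: velocity c x)).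
move=> g a ug g0 ga orth; have [a0 _ loc] := ug.
have aI : (0 : R) \in `[0, a] by rewrite in_itv/= lexx ltW.
have ig : chart_dom i (g 0) by rewrite g0.
have [cg Dg] := unit_segment_velocity ug aI ig.
have Vg : velocity g 0 = derive1 (X i \o g) 0 by rewrite /velocity g0.
have [|v Lv zv] := @inward_tangent x z g (derive1 (X i \o g) 0) a z1 Fz g0 a0 _ cg Dg.
  by apply: (unit_segment_disc ug) => //; rewrite g0; exact: boundary_disc.
have [k vE] := basis v; rewrite -Vg in Lv.
have VE : velocity g 0 = k *: velocity c x + dot2 z v *: E by rewrite -Lv {1}vE /L linearD/= !linearZ/= -/(L x z _) -/(L x z _) Lv0.
have kE : k = - (dot2 z v * r).
  have O : I (velocity c x) (velocity g 0) = 0 := orth.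
  rewrite VE /I gformDr !gformZr -/(I _ _) -/(I _ _) in O.
  apply: (mulIf (lt0r_neq0 h00)); rewrite /r mulNr mulrA divfK ?gt_eqF//.
  by apply/eqP; rewrite -addr_eq0; apply/eqP.
have VE' : velocity g 0 = dot2 z v *: (E - r *: velocity c x) by rewrite VE kE scalerBr scalerA scaleNr addrC.
exists (dot2 z v); split => //.
have := locally_isometric_speed (loc 0 aI); rewrite /speed g0 -/(I _ _) => sp.
have G1 : I (velocity g 0) (velocity g 0) = 1.
  have [G0|G0] := leP (I (velocity g 0) (velocity g 0)) 0.
    by move: sp; rewrite ler0_sqrtr// => /esym/eqP; rewrite oner_eq0.
  by rewrite -(sqr_sqrtr (ltW G0)) sp expr1n.
by rewrite -G1 VE' /I gformZl gformZr expr2 mulrA.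
Qed.

Lemma normal_velocity_unique x g1 g2 (a1 a2 : R) : unit_segment g1 a1 -> unit_segment g2 a2 ->
  g1 0 = c x -> g2 0 = c x -> disc (g1 a1) -> disc (g2 a2) -> angle_at c x g1 = 0 -> angle_at c x g2 = 0 ->
  velocity g1 0 = velocity g2 0.
Proof.
move=> u1 u2 g10 g20 d1 d2 o1 o2; have [e [Q H]] := inward_normal x.
have [m1 [m1n -> m1Q]] := H _ _ u1 g10 d1 o1; have [m2 [m2n -> m2Q]] := H _ _ u2 g20 d2 o2.
have Q0 : Q != 0 by apply/eqP => Q0; move: m1Q; rewrite Q0 mulr0 => /esym/eqP; rewrite oner_eq0.
have : m1 ^+ 2 == m2 ^+ 2 by apply/eqP/(mulIf Q0); rewrite m1Q m2Q.
rewrite eqf_sqr => /orP[/eqP ->//|/eqP E].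
have m10 : m1 = 0 by apply/eqP; rewrite eq_le m1n/= E oppr_ge0.
by move: m1Q; rewrite m10 expr0n mul0r => /esym/eqP; rewrite oner_eq0.
Qed.

Variable W : R.
Hypothesis W0 : 0 < W.
Hypothesis WE : width c = W%:E.
Hypothesis Wmax : forall x y : R, cdist c x y <= W.

Definition max_pair x y := [/\ x < y, y < x + 1 & D x y = W].

Lemma ex_max_pair t : exists tau : R, max_pair ((t - tau) / 2) ((t + tau) / 2).
Proof.
pose Xt tau := (t - clip 0 1 tau) / 2; pose Yt tau := (t + clip 0 1 tau) / 2.
have ccl := @continuous_clip_id R 0 1.
have LH : lifted_loop Xt Yt.
  split.
  - by move=> s; apply: cvgM; [apply: cvgB; [exact: cvg_cst|exact: ccl]|exact: cvg_cst].
  - by move=> s; apply: cvgM; [apply: cvgD; [exact: cvg_cst|exact: ccl]|exact: cvg_cst].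
  - by rewrite /Xt /Yt clip_id ?subr0 ?addr0// lexx ler01.
  - by rewrite /Xt /Yt clip_id ?lexx ?ler01//; field.
have XY s : Xt s <= Yt s <= Xt s + 1 by have /andP[? ?] := clip_itv s (@ler01 R); rewrite /Xt /Yt; split_lra.
have [cX cY _ _] := LH.
have [s sI Hs] := EVT_max (@ler01 R) (continuous_subspaceT (continuous_cdist_comp hc cX cY)).
have DW : D (Xt s) (Yt s) = W.
  apply/eqP; rewrite eq_le Wmax/= -lee_fin -WE; apply: (width_le_lift hc LH XY) => s' sI'.
  by apply: Hs; rewrite in_itv.
rewrite in_itv/= in sI; exists s; rewrite /Xt /Yt clip_id// in DW.
have [sn0 sn1] : s <> 0 /\ s <> 1.
  split=> E; move: DW; rewrite E ?subr0 ?addr0; first by rewrite cdistxx => W0'; move: W0; rewrite -W0' ltxx.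
  rewrite (_ : (t + 1) / 2 = (t - 1) / 2 + (1 : int)%:~R); last by rewrite (_ : (1 : int)%:~R = 1 :> R)//; field.
  by rewrite (cdist_shiftr hc) cdistxx => W0'; move: W0; rewrite -W0' ltxx.
have /andP[s0 s1] := sI; have {}s0 : 0 < s by rewrite lt_def s0 andbT; apply/eqP.
have {}s1 : s < 1 by rewrite lt_neqAle s1 andbT; apply/eqP.
by split => //; lra.
Qed.

Lemma max_pair_rotate x y : max_pair x y -> max_pair y (x + 1).
Proof.
move=> [xy yx DW]; split => //; first by lra.
by rewrite (_ : 1 = (1 : int)%:~R)// (cdist_shiftr hc) cdist_sym.
Qed.

Lemma max_pair_mono x y x' y' : max_pair x y -> max_pair x' y' -> x + y <= x' + y' -> x <= x' /\ y <= y'.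
Proof.
move=> m m'; have [xy yx DW] := m; have [xy' yx' DW'] := m'; move=> le.
have [_ _ DR] := max_pair_rotate m; have [_ _ DR'] := max_pair_rotate m'.
split; rewrite leNgt; apply/negP => lt.
  by apply: (max_pairs_not_nested Wmax xy _ _ _ DW DR'); lra.
by apply: (max_pairs_not_nested Wmax xy' _ _ _ DW' DR); lra.
Qed.

Lemma max_pair_unique x y x' y' : max_pair x y -> max_pair x' y' -> x + y = x' + y' -> x = x' /\ y = y'.
Proof.
move=> m m' E; have [|h1 h2] := max_pair_mono m m'; first by rewrite E.
have [|h3 h4] := max_pair_mono m' m; first by rewrite E.
by split; apply/eqP; rewrite eq_le ?h1 ?h2.
Qed.

Lemma max_pair_family : exists xx yy : R -> R, [/\ forall t, max_pair (xx t) (yy t),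
  forall t, xx t + yy t = t, continuous xx & continuous yy].
Proof.
have /choice[tau Ht] := ex_max_pair; pose xx t := (t - tau t) / 2; pose yy t := (t + tau t) / 2.
have mp t : max_pair (xx t) (yy t) := Ht t.
have sum t : xx t + yy t = t by rewrite /xx /yy; field.
have lip s t : s <= t -> xx s <= xx t /\ yy s <= yy t by move=> st; apply: max_pair_mono (mp s) (mp t) _; rewrite !sum.
have lip' (z w : R -> R) : (forall t, z t + w t = t) -> (forall s t, s <= t -> z s <= z t /\ w s <= w t) -> continuous z.
  move=> zw mono t; apply/cvgrPdist_lt => e e0; have := nbhsx_ballx t _ e0; apply: filterS => s.
  rewrite /ball/=; apply: le_lt_trans; have := zw s; have := zw t.
  have [st|/ltW ts] := leP s t.
    by have [? ?] := mono s t st; rewrite !ger0_norm ?subr_ge0//; lra.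
  by have [? ?] := mono t s ts; rewrite !ler0_norm ?subr_le0//; lra.
exists xx, yy; split => //; first exact: lip' sum lip.
by apply: (lip' yy xx) => [t|s t /lip[]]; [rewrite addrC|].
Qed.

Section family.
Variables xx yy : R -> R.
Hypothesis mp : forall t, max_pair (xx t) (yy t).
Hypothesis sum : forall t, xx t + yy t = t.
Hypothesis cxx : continuous xx.
Hypothesis cyy : continuous yy.

Lemma family_mono s t : s <= t -> xx s <= xx t /\ yy s <= yy t.
Proof. by move=> st; apply: max_pair_mono (mp s) (mp t) _; rewrite !sum. Qed.

Lemma family_rotate t : xx (t + 1) = yy t /\ yy (t + 1) = xx t + 1.
Proof.
have [|-> ->] := max_pair_unique (mp (t + 1)) (max_pair_rotate (mp t)); last by [].
by rewrite sum -[in LHS](sum t); ring.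
Qed.

Lemma family_rotate2 t : xx (t + 2) = xx t + 1 /\ yy (t + 2) = yy t + 1.
Proof.
have [x1 y1] := family_rotate t; have [x2 y2] := family_rotate (t + 1).
by rewrite (_ : t + 2 = t + 1 + 1) ?x2 ?y2 ?x1 ?y1//; ring.
Qed.

Section nonmaximal.
Variables (t0 x0 y0 : R).
Hypothesis xx0 : xx t0 < x0.
Hypothesis xy0 : x0 < y0.
Hypothesis yy0 : y0 < yy t0.

Let IVTx u : xx t0 <= u <= yy t0 -> exists2 s, t0 <= s & xx s = u.
Proof.
move=> /andP[u1 u2]; have [_ yx _] := mp t0; have [x2 _] := family_rotate2 t0.
have t2 : t0 <= t0 + 2 by lra.
have [|s] := IVT t2 (continuous_subspaceT cxx) (v := u).
  by rewrite x2 ge_min le_max u1/=; apply/orP; right; lra.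
by rewrite in_itv/= => /andP[ts _] <-; exists s.
Qed.

Let IVTy u : xx t0 <= u <= yy t0 -> exists2 s, s <= t0 & yy s = u.
Proof.
move=> /andP[u1 u2]; have [_ yx _] := mp t0; have [_ y2] := family_rotate2 (t0 - 2); rewrite subrK in y2.
have t2 : t0 - 2 <= t0 by lra.
have [|s] := IVT t2 (continuous_subspaceT cyy) (v := u).
  by rewrite ge_min le_max u2 orbT andbT; apply/orP; left; lra.
by rewrite in_itv/= => /andP[_ ts] <-; exists s.
Qed.

Lemma cdist_mono_left u' u z : xx t0 <= u' -> u' <= u -> u < z -> z <= yy t0 -> D u z <= D u' z.
Proof.
move=> u'1 u'u uz zy; have [xy yx _] := mp t0.
have [s ts sE] : exists2 s, t0 <= s & xx s = u' by apply: IVTx; split_lra.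
have [_ ys] := family_mono ts; have [_ yxs DW] := mp s; rewrite sE in yxs DW.
have [uE|un] := eqVneq u' u; first by rewrite uE.
have [zE|zn] := eqVneq z (yy s); first by rewrite zE DW.
have zs : z < yy s by rewrite lt_neqAle zn (le_trans zy).
have lt : u' < u by rewrite lt_neqAle un.
have := monge lt uz zs yxs; have := Wmax u (yy s); lra.
Qed.

Lemma cdist_mono_right u z z' : xx t0 <= u -> u < z -> z <= z' -> z' <= yy t0 -> D u z <= D u z'.
Proof.
move=> u1 uz zz' zy; have [xy yx _] := mp t0.
have [s st sE] : exists2 s, s <= t0 & yy s = z' by apply: IVTy; split_lra.
have [xs _] := family_mono st; have [_ yxs DW] := mp s; rewrite sE in yxs DW.
have [zE|zn] := eqVneq z z'; first by rewrite zE.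
have [uE|un] := eqVneq (xx s) u; first by rewrite -uE DW.
have us : xx s < u by rewrite lt_neqAle un (le_trans xs).
have lt : z < z' by rewrite lt_neqAle zn.
have := monge us uz lt yxs; have := Wmax (xx s) z; lra.
Qed.

Let ne u z : xx t0 <= u -> u < z -> z <= yy t0 -> c u <> c z.
Proof. by move=> u1 uz zy; have [_ yx _] := mp t0; apply: circle_neq => //; lra. Qed.

Lemma angle_start_ge0 z g : x0 < z -> z <= yy t0 -> unit_segment g (D x0 z) -> g 0 = c x0 -> g (D x0 z) = c z ->
  0 <= angle_at c x0 g.
Proof.
move: (xx0) (xy0) (yy0) => X1 X2 X3.
move=> xz zy ug g0 ga; apply/ler_addgt0Pr => e e0; have [k k0 H] := cdist_variation hc ug g0 ga e0.
pose h := Num.min k (x0 - xx t0); have h0 : 0 < h by rewrite lt_min k0 subr_gt0.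
have hk : h <= k by rewrite ge_min lexx.
have hx : h <= x0 - xx t0 by rewrite ge_min lexx orbT.
have := H (- h); rewrite normrN (gtr0_norm h0) => /(_ hk).
have : D x0 z <= D (x0 - h) z by apply: cdist_mono_left => //; lra.
move=> h1 h2; have : 0 <= h * (e + angle_at c x0 g) by lra.
by rewrite pmulr_rge0// addrC.
Qed.

Lemma angle_end_ge0 g : unit_segment g (D x0 y0) -> g 0 = c x0 -> g (D x0 y0) = c y0 ->
  0 <= inner (c y0) (velocity c y0) (velocity g (D x0 y0)).
Proof.
move: (xx0) (xy0) (yy0) => X1 X2 X3.
move=> ug g0 ga; apply/ler_addgt0Pr => e e0; have [k k0 H] := cdist_variation_end hc ug g0 ga e0.
pose h := Num.min k (yy t0 - y0); have h0 : 0 < h by rewrite lt_min k0 subr_gt0.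
have hk : h <= k by rewrite ge_min lexx.
have hx : h <= yy t0 - y0 by rewrite ge_min lexx orbT.
have := H h; rewrite (gtr0_norm h0) => /(_ hk).
have : D x0 y0 <= D x0 (y0 + h) by apply: cdist_mono_right => //; lra.
set b := inner _ _ _ => h1 h2; have : 0 <= h * (e + b) by lra.
by rewrite pmulr_rge0// addrC.
Qed.

Lemma normal_segment g z : unit_segment g (D x0 y0) -> g 0 = c x0 -> g (D x0 y0) = c y0 ->
  angle_at c x0 g = 0 -> y0 < z -> z < yy t0 ->
  exists g', [/\ unit_segment g' (D x0 z), g' 0 = c x0, g' (D x0 z) = c z & angle_at c x0 g' = 0].
Proof.
move: (xx0) (xy0) (yy0) => X1 X2 X3.
move=> ug g0 ga orth yz zy; apply: contrapT => NE; have [_ yx _] := mp t0.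
have xz : x0 < z := lt_trans xy0 yz.
have [|g' ug' g0' ga'|eta [k [eta0 k0 H]]] := descent_direction (l1 := 1) (l2 := 0) hc hM (x := x0) (y := z).
- by apply: ne => //; exact: ltW.
- rewrite mul0r mul1r lt_def (angle_start_ge0 xz (ltW zy) ug' g0' ga') andbT.
  by apply/eqP => E; apply: NE; exists g'.
have eta20 : 0 < eta / 2 by rewrite divr_gt0.
have [k' k'0 V] := cdist_variation hc ug g0 ga eta20.
pose s := Num.min (Num.min k k') ((x0 - xx t0) / 2).
have s0 : 0 < s by rewrite !lt_min k0 k'0 divr_gt0// subr_gt0.
have sk : s <= k by rewrite !ge_min lexx.
have sk' : s <= k' by rewrite !ge_min lexx orbT.
have sx : s <= (x0 - xx t0) / 2 by rewrite ge_min lexx orbT.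
clearbody s; have := H (x0 - s) z s; rewrite mulr1 mulr0 addr0 subrK subrr normr0 (ltW k0) (ltW s0) sk.
rewrite addrAC subrr add0r normrN (gtr0_norm s0) sk => /(_ isT isT isT) h1.
have := V (- s); rewrite normrN (gtr0_norm s0) orth mulr0 subr0 => /(_ sk') h2.
have a1 : x0 - s < x0 by lra.
have a2 : z < x0 - s + 1 by lra.
have h3 := monge a1 xy0 yz a2.
have : 0 < eta * s by rewrite mulr_gt0.
clear -f L zy NE yx xz eta0 k0 H eta20 k'0 h1 h2 a1 a2 h3; lra.
Qed.

Lemma normal_pair_absurd g : unit_segment g (D x0 y0) -> g 0 = c x0 -> g (D x0 y0) = c y0 ->
  angle_at c x0 g = 0 -> inner (c y0) (velocity c y0) (velocity g (D x0 y0)) = 0 -> False.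
Proof.
move: (xx0) (xy0) (yy0) => X1 X2 X3.
move=> ug g0 ga orth orth'.
have bd := boundary_disc.
pose z1 := (y0 + yy t0) / 2; have yz1 : y0 < z1 by rewrite /z1; lra.
have z1y : z1 < yy t0 by rewrite /z1; lra.
have [G [uG G0 Ga oG]] := normal_segment ug g0 ga orth yz1 z1y.
have on_ray z g' : x0 < z -> z <= z1 -> unit_segment g' (D x0 z) -> g' 0 = c x0 -> g' (D x0 z) = c z ->
    angle_at c x0 g' = 0 -> c z = G (D x0 z).
  move=> xz zz1 ug' g0' ga' o'.
  have V : velocity g' 0 = velocity G 0 by apply: (normal_velocity_unique ug' uG g0' G0 _ _ o' oG); rewrite ?ga' ?Ga.
  have le : D x0 z <= D x0 z1 by apply: cdist_mono_right => //; exact: ltW.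
  rewrite -ga'; apply: (unit_segments_velocity ug' uG _ V); first by rewrite g0' G0.
  by rewrite le_min lexx le (cdist_ge0 hc).
have ey : c y0 = G (D x0 y0) by apply: (on_ray _ g) => //; exact: ltW.
have [k0 [k [k00 kk0 LH]]] := cdist_lower hc y0.
have e0 : 0 < k0 / 2 by rewrite divr_gt0.
have [k' k'0 V] := cdist_variation_end hc ug g0 ga e0.
pose h := Num.min (Num.min k k') (z1 - y0).
have h0 : 0 < h by rewrite !lt_min kk0 k'0 subr_gt0.
have hk : h <= k by rewrite !ge_min lexx.
have hk' : h <= k' by rewrite !ge_min lexx orbT.
have hz : h <= z1 - y0 by rewrite ge_min lexx orbT.
clearbody h; have h1 := LH h; rewrite (gtr0_norm h0) in h1; have {}h1 := h1 hk.
have h2 := V h; rewrite (gtr0_norm h0) orth' mulr0 addr0 in h2; have {}h2 := h2 hk'.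
have yz : y0 < y0 + h by rewrite ltrDl.
have zz : y0 + h <= z1 by rewrite addrC -lerBrDr.
have zy : y0 + h < yy t0 := le_lt_trans zz z1y.
have xz : x0 < y0 + h := lt_trans X2 yz.
have [g' [ug' g0' ga' o']] := normal_segment ug g0 ga orth yz zy.
have ez : c (y0 + h) = G (D x0 (y0 + h)) := on_ray _ g' xz zz ug' g0' ga' o'.
have le1 : D x0 y0 <= D x0 (y0 + h) := cdist_mono_right (ltW X1) X2 (ltW yz) (ltW zy).
have le2 : D x0 (y0 + h) <= D x0 z1 := cdist_mono_right (ltW X1) xz zz (ltW z1y).
have := segment_dist uG (cdist_ge0 hc x0 y0) le1 le2; rewrite -ey -ez (cdistE hc) => -[E].
have : k0 * h <= k0 / 2 * h by rewrite (le_trans h1)// E lerBlDl.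
by rewrite leNgt ltr_pM2r// ltr_pdivrMr// ltr_pMr// ltr1n.
Qed.

Lemma nested_regular : regular_pair c (c x0) (c y0).
Proof.
move: (xx0) (xy0) (yy0) => X1 X2 X3.
have cxy : c x0 <> c y0 by apply: ne => //; exact: ltW.
apply: (regular_of_segments hc (l1 := 1) (l2 := -1)) => // g ug g0 ga.
have a0 := angle_start_ge0 xy0 (ltW yy0) ug g0 ga; have b0 := angle_end_ge0 ug g0 ga.
rewrite mul1r mulN1r ltNge; apply/negP => le.
have a00 : angle_at c x0 g = 0 by lra.
apply: (normal_pair_absurd ug g0 ga a00); lra.
Qed.

End nonmaximal.

Lemma critical_max_pair x y : x < y -> y < x + 1 -> ~ regular_pair c (c x) (c y) ->
  x = xx (x + y) /\ y = yy (x + y).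
Proof.
move=> xy yx nr; pose t := x + y; have sE := sum t; rewrite /t in sE *.
have cxy : c x <> c y by apply: circle_neq.
have [lt|gt|E] := ltgtP (xx (x + y)) x.
- by exfalso; apply: nr; apply: (nested_regular (t0 := x + y)) => //; lra.
- exfalso; apply: nr.
  have [x1 y1] := family_rotate (x + y).
  have := nested_regular (t0 := x + y + 1) (x0 := y) (y0 := x + 1).
  rewrite x1 y1 (circle_shift1 hc) => H; apply: regular_pair_sym.
    by move=> /esym.
  by apply: H; lra.
- by split => //; lra.
Qed.

End family.

End disc.

Section pair_line.
Context {R : realType}.
Implicit Types (x y t : R).

(* A unit vector, well defined up to sign on unordered pairs of points of R/Z,
   whose line identifies the collapsed pairs with the projective plane. *)
Definition pair_dir x y : 'rV[R]_3 := \row_j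
  [:: `|sin (pi * (y - x))| * cos (pi * (x + y)); `|sin (pi * (y - x))| * sin (pi * (x + y)); cos (pi * (y - x))]`_j.

Lemma pair_dir_unit x y : pair_dir x y *m (pair_dir x y)^T = 1.
Proof.
apply/matrixP => i j; rewrite !ord1 !mxE !big_ord_recr big_ord0/= !mxE/= add0r.
have := cos2Dsin2 (pi * (x + y)); have := cos2Dsin2 (pi * (y - x)).
rewrite -(real_normK (num_real (sin (pi * (y - x))))).
set s := `| _ |; set u := cos _; set v := cos _; set w := sin _ => E1 E2.
by rewrite -E1 -[s ^+ 2]mulr1 -E2; ring.
Qed.

Lemma pair_dir_swap x y : pair_dir y x = pair_dir x y.
Proof.
apply/rowP => j; rewrite !mxE (addrC y x) (_ : pi * (x - y) = - (pi * (y - x))); last by ring.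
by rewrite sinN cosN normrN.
Qed.

Lemma pair_dir_shift x y : pair_dir x (y + 1) = - pair_dir x y.
Proof.
have E1 : pi * (y + 1 - x) = pi * (y - x) + pi by ring.
have E2 : pi * (x + (y + 1)) = pi * (x + y) + pi by ring.
apply/rowP => j; rewrite !mxE E1 E2 !sinDpi !cosDpi normrN.
by case: j => -[|[|[|//]]] jl /=; rewrite ?mulrN.
Qed.

Lemma pair_dir_diag x : pair_dir x x = \row_j [:: 0; 0; 1]`_j.
Proof.
apply/rowP => j; rewrite !mxE subrr mulr0 sin0 cos0 normr0.
by case: j => -[|[|[|//]]] jl /=; rewrite ?mul0r.
Qed.

Lemma continuous_pair_dir j : continuous (fun z : R * R => pair_dir z.1 z.2 0 j).
Proof.
have c1 : continuous (fun z : R * R => pi * (z.2 - z.1)).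
  move=> z; apply: cvgM; first exact: cvg_cst.
  by apply: cvgB; [exact: cvg_snd|exact: cvg_fst].
have c2 : continuous (fun z : R * R => pi * (z.1 + z.2)).
  move=> z; apply: cvgM; first exact: cvg_cst.
  by apply: cvgD; [exact: cvg_fst|exact: cvg_snd].
have cs : continuous (fun z : R * R => `|sin (pi * (z.2 - z.1))|).
  move=> z; apply: (continuous_comp (f := fun z : R * R => sin (pi * (z.2 - z.1))) (g := Num.norm)).
    by apply: continuous_comp; [exact: c1|exact: continuous_sin].
  exact: norm_continuous.
case: j => -[|[|[|//]]] jl z; rewrite /continuous_at.
- under eq_fun do rewrite mxE/=; rewrite mxE/=; apply: cvgM; first exact: cs.
  by apply: continuous_comp; [exact: c2|exact: continuous_cos].
- under eq_fun do rewrite mxE/=; rewrite mxE/=; apply: cvgM; first exact: cs.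
  by apply: continuous_comp; [exact: c2|exact: continuous_sin].
- under eq_fun do rewrite mxE/=; rewrite mxE/=.
  by apply: continuous_comp; [exact: c1|exact: continuous_cos].
Qed.

Definition pair_line x y : 'M[R]_3 := (pair_dir x y)^T *m pair_dir x y.

Lemma pair_lineE x y i j : pair_line x y i j = pair_dir x y 0 i * pair_dir x y 0 j.
Proof. by rewrite mxE big_ord1 mxE. Qed.

Lemma pair_line_swap x y : pair_line y x = pair_line x y.
Proof. by rewrite /pair_line pair_dir_swap. Qed.

Lemma pair_line_shift x y (k l : int) : pair_line (x + k%:~R) (y + l%:~R) = pair_line x y.
Proof.
have S1 u v : pair_line u (v + 1) = pair_line u v by rewrite /pair_line pair_dir_shift mulmxN [(- _)^T]linearN mulNmx opprK.
have Sn u v (m : nat) : pair_line u (v + m%:R) = pair_line u v by elim: m => [|m IH]; rewrite ?addr0// -natr1 addrA S1.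
have Sz u v (m : int) : pair_line u (v + m%:~R) = pair_line u v.
  case: m => m; first exact: Sn.
  by rewrite NegzE mulrNz -[RHS](Sn _ _ m.+1) -[in RHS](Sn _ _ m.+1) -(Sn _ (v - _) m.+1) subrK Sn Sn.
by rewrite Sz pair_line_swap Sz pair_line_swap.
Qed.

End pair_line.

From mathcomp Require Import generic_quotient.
Local Open Scope quotient_scope.

Section pairs_topology.
Context {R : realType} {n : nat} {M : riemannianManifold R n}.
Variable c : R -> M.
Hypothesis hc : smooth_circle c.
Implicit Types (x y t : R).
Local Notation D := (cdist c).
Local Notation T := (set_type (range c)).

Lemma ex_circle_lift : exists l : T -> R, forall p, p = circle_point c (l p).
Proof. by have /choice[l lE] := @circle_pointP _ _ _ c; exists l. Qed.

Lemma continuous_circle_point : continuous (circle_point c).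
Proof.
apply: (@continuous_comp_initial _ _ _ (@set_val _ (range c)) (circle_point c)).
exact: (C1_continuous (circle_C1 hc)).
Qed.

Lemma near_circle_point x (e : R) : 0 < e -> \forall p \near circle_point c x,
  exists2 y, p = circle_point c y & `|y - x| < e.
Proof.
move=> e0; have [d d0 Hd] := circle_inverse hc e0.
have N : \forall p \near circle_point c x, (dist (c x) (val p) < d%:E)%E.
  exact: (@initial_continuous _ _ (@set_val _ (range c)) (circle_point c x) _ (nbhs_dist_lt (c x) d0)).
apply: filterS N => p; have [y ->] := circle_pointP p; rewrite /= (cdistE hc) lte_fin (cdist_sym c) => /Hd[k yk].
exists (y + (- k)%:~R); first by apply/circle_point_eq; rewrite (circle_periodic hc).
by rewrite mulrNz addrAC.
Qed.

Lemma ex_pairs_line : exists Q : collapsed_pairs T -> 'M[R]_3,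
  [/\ forall i j, continuous (fun s => Q s i j),
      forall s, exists w : 'rV[R]_3, w *m w^T = 1 /\ Q s = w^T *m w &
      forall x y, Q (collapsed_pair (circle_point c x) (circle_point c y)) = pair_line x y].
Proof.
have [l lE] := ex_circle_lift.
pose Q0 (z : T * T) := pair_line (l z.1) (l z.2).
pose Q1 (s : unordered_pairs T) := Q0 (repr s).
have Q0E x y : Q0 (circle_point c x, circle_point c y) = pair_line x y.
  have H z : exists k : int, z = l (circle_point c z) + k%:~R by apply/(circle_eqP hc)/circle_point_eq; rewrite -lE.
  by rewrite /Q0/=; have [k {2}->] := H x; have [j {2}->] := H y; rewrite pair_line_shift.
have cQ0 i j : continuous (fun z => Q0 z i j).
  case=> p q; have [x ->] := circle_pointP p; have [y ->] := circle_pointP q.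
  apply/cvgrPdist_lt => e e0; rewrite Q0E.
  have cl : continuous (fun z : R * R => pair_line z.1 z.2 i j).
    move=> z; rewrite /continuous_at pair_lineE; under eq_fun do rewrite pair_lineE.
    by apply: cvgM; exact: continuous_pair_dir.
  have /cvgrPdist_lt/(_ e e0)/nbhs_ballP[d d0 Hd] := cl (x, y).
  have N : \forall z \near (circle_point c x, circle_point c y),
      (exists2 x', z.1 = circle_point c x' & `|x' - x| < d) /\ (exists2 y', z.2 = circle_point c y' & `|y' - y| < d).
    exists ([set p | exists2 x', p = circle_point c x' & `|x' - x| < d], [set p | exists2 x', p = circle_point c x' & `|x' - y| < d]); last by [].
    by split; exact: near_circle_point.
  apply: filterS N => -[p' q'] [[x' /= -> xx'] [y' -> yy']]; rewrite Q0E.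
  by apply: (Hd (x', y')); split; rewrite /= /ball/= distrC.
have Q01 z z' : swap_rel z z' -> Q0 z = Q0 z' by move=> /orP[/eqP->//|/eqP->]; rewrite /Q0/= pair_line_swap.
have Q1E z : Q1 (\pi_(unordered_pairs T) z)%qT = Q0 z.
  rewrite /Q1; apply: Q01; rewrite swap_rel_sym.
  by have := reprK (\pi_(unordered_pairs T) z)%qT => /esym/(@eqquotP _ (swap_equiv T) {eq_quot (swap_equiv T)}).
have Q1s s : singleton s -> Q1 s = pair_line 0 0.
  rewrite /singleton /Q1; case: (repr s) => p q /= /eqP ->; have [x ->] := circle_pointP q.
  by rewrite Q0E /pair_line !pair_dir_diag.
have Q12 s s' : collapse_rel s s' -> Q1 s = Q1 s' by move=> /orP[/eqP->//|/andP[/Q1s-> /Q1s->]].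
have cQ1 i j : continuous (fun s => Q1 s i j).
  apply/quotient_continuous; rewrite (_ : _ \o _ = fun z => Q0 z i j) //.
  by apply/funext => z; rewrite /= Q1E.
pose Q2 (s : collapsed_pairs T) := Q1 (repr s).
have Q2E s : Q2 (\pi_(collapsed_pairs T) s)%qT = Q1 s.
  rewrite /Q2; apply: Q12; rewrite collapse_rel_sym.
  by have := reprK (\pi_(collapsed_pairs T) s)%qT => /esym/(@eqquotP _ (collapse_equiv T) {eq_quot (collapse_equiv T)}).
exists Q2; split.
- move=> i j; apply/quotient_continuous; rewrite (_ : _ \o _ = fun z => Q1 z i j) //.
  by apply/funext => z; rewrite /= Q2E.
- by move=> s; exists (pair_dir (l (repr (repr s)).1) (l (repr (repr s)).2)); split => //; exact: pair_dir_unit.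
- by move=> x y; rewrite Q2E Q1E Q0E.
Qed.

Lemma continuous_collapsed_pair (X Y : R -> R) : continuous X -> continuous Y ->
  continuous (fun t => collapsed_pair (circle_point c (X t)) (circle_point c (Y t))).
Proof.
move=> cX cY; have cC (Z : R -> R) : continuous Z -> continuous (fun t => circle_point c (Z t)).
  by move=> cZ t; apply: continuous_comp; [exact: cZ|exact: continuous_circle_point].
have c0 := continuous_pair (cC X cX) (cC Y cY).
move=> t; apply: (continuous_comp (f := fun t => unordered_pair (circle_point c (X t)) (circle_point c (Y t)))
  (g := \pi_(collapsed_pairs T)%qT)); last exact: pi_continuous.
by apply: (continuous_comp (g := \pi_(unordered_pairs T)%qT) (c0 t)); exact: pi_continuous.
Qed.

Lemma half_turn_not_null (X Y : R -> R) : continuous X -> continuous Y -> X 1 = Y 0 -> Y 1 = X 0 + 1 ->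
  ~ null_homotopic (fun t => collapsed_pair (circle_point c (X t)) (circle_point c (Y t))).
Proof.
move=> cX cY X1 Y1 [H [s0 [cH per H0 H1]]].
have [Q [cQ rk QE]] := ex_pairs_line.
pose P (z : R * R) := Q (H (clip 0 1 z.1, z.2)).
have cl1 z : 0 <= clip 0 1 z <= 1 := clip_itv z (@ler01 R).
have I0 : clip 0 1 0 = 0 :> R by rewrite clip_id// lexx ler01.
have I1 : clip 0 1 1 = 1 :> R by rewrite clip_id// lexx ler01.
have cHc : continuous (fun z : R * R => H (clip 0 1 z.1, z.2)).
  move=> z; have A (w : R * R) : (`[0, 1] `*` [set: R]) (clip 0 1 w.1, w.2) by split; rewrite //= in_itv/=; exact: cl1.
  have /subspace_continuousP/(_ _ (A z)) cHz := cH.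
  have cg : continuous (fun z : R * R => (clip 0 1 z.1, z.2)).
    apply: continuous_pair; last by move=> w; exact: cvg_snd.
    by move=> w; apply: (continuous_comp (f := fst)); [exact: cvg_fst|exact: continuous_clip_id].
  apply: cvg_comp cHz => B; rewrite /within/= => /cg; rewrite nbhs_simpl/=.
  by apply: filterS => w; apply; exact: A.
apply: (@no_contraction _ 3 P _ _ (fun t => pair_dir (X t) (Y t))).
- by move=> i j z; apply: (continuous_comp (g := fun s => Q s i j) (cHc z)); exact: cQ.
- by move=> z; exact: rk.
- by move=> s; have := per (clip 0 1 s) 0; rewrite /P/= add0r => -> //; rewrite in_itv/=; exact: cl1.
- by move=> t; rewrite /P/= I1 !H1.
- move=> j t; apply: (continuous_comp (f := fun t => (X t, Y t)) (g := fun z : R * R => pair_dir z.1 z.2 0 j)).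
    exact: continuous_pair cX cY t.
  exact: continuous_pair_dir.
- by move=> t _; rewrite /P/= I0 H0 QE.
- by rewrite X1 Y1 pair_dir_shift pair_dir_swap.
Qed.

End pairs_topology.

Section critical_circle.
Context {R : realType} {n : nat} {M : riemannianManifold R n}.
Hypothesis hM : complete_manifold M.
Variable c : R -> M.
Hypothesis hc : smooth_circle c.
Implicit Types (x y s t : R).
Local Notation D := (cdist c).

Section family.
Variable W : R.
Variables xx yy : R -> R.
Hypothesis mp : forall t, max_pair c W (xx t) (yy t).
Hypothesis sum : forall t, xx t + yy t = t.
Local Notation f t := (collapsed_pair (circle_point c (xx t)) (circle_point c (yy t))).

Lemma family_neq t : c (xx t) <> c (yy t).
Proof. by have [xy yx _] := mp t; apply: (circle_neq hc). Qed.

Lemma family_injective s t : f s = f t -> exists k : int, s = t + k%:~R.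
Proof.
have [xs ys _] := mp s; have [xt yt _] := mp t.
have int0 (k : int) : - 1 < (k%:~R : R) -> (k%:~R : R) < 1 -> (k%:~R : R) = 0.
  by move=> k1 k2; rewrite (_ : k = 0)//; apply: (@int_eq0 R); rewrite ltr_norml k1.
move=> /(pair_point_eq _ _ (@family_neq s))[][/(circle_eqP hc)[k xk] /(circle_eqP hc)[j yj]].
  have := int0 (j - k); rewrite intrB => /(_ _ _)/wrap[||jk]; [lra|lra|].
  exists (k + k); rewrite intrD -(sum s) -(sum t); lra.
have := int0 (j - k - 1); rewrite !intrB => /(_ _ _)/wrap[||jk]; [lra|lra|].
exists (k + j); rewrite intrD -(sum s) -(sum t); lra.
Qed.

End family.

Lemma part2 : bounds_totally_convex_disc (range c) -> width c = diam (range c) ->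
   exists f : R -> collapsed_pairs (set_type (range c)),
     [/\ embedded_loop f, ~ null_homotopic f &
         range f = nontrivial_critical c].
Proof.
move=> [F [sF tF bF]] WD; have [W W0 WE] := widthE hc.
have [x0 [y0 [Hmax dE]]] := diam_circle hc.
have Wmax x y : D x y <= W by apply: (le_trans (Hmax x y)); rewrite -lee_fin -dE -WD WE.
have [xx [yy [mp sum cxx cyy]]] := max_pair_family hM hc sF tF bF W0 WE Wmax.
have rot := family_rotate hM hc sF tF bF Wmax mp sum.
have ne := family_neq mp.
exists (fun t => collapsed_pair (circle_point c (xx t)) (circle_point c (yy t))); split.
- split; last exact: family_injective.
  split; first exact: (continuous_collapsed_pair hc).
  move=> t; apply/(pair_point_eq _ _ (ne _)); right.
  by have [-> ->] := rot t; rewrite (circle_shift1 hc).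
- by apply: (half_turn_not_null hc) => //; rewrite -[1 in LHS]add0r; have [] := rot 0.
apply/seteqP; split=> [_ [t _ <-]|s /nontrivial_criticalP[x [y [-> xy nr]]]].
  apply/nontrivial_criticalP; exists (xx t), (yy t); split => //; apply: (max_critical hM hc) => // x' y'.
  by have [_ _ ->] := mp t.
have [k /andP[k0 k1]] := ex_frac (y - x).
have E : c (y + k%:~R) = c y by rewrite (circle_periodic hc).
have yx : x <> y + k%:~R by move=> xE; apply: xy; rewrite -E -xE.
have [xE yE] : x = xx (x + (y + k%:~R)) /\ y + k%:~R = yy (x + (y + k%:~R)).
  apply: (critical_max_pair hM hc sF tF bF Wmax mp sum) => //; last by rewrite E.
    by rewrite lt_neqAle; apply/andP; split; [exact/eqP|lra].
  lra.
exists (x + (y + k%:~R)) => //; rewrite -xE -yE.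
by apply/(pair_point_eq _ _ _); [rewrite E|rewrite E; left].
Qed.

End critical_circle.

Theorem theoremE (R : realType) (n : nat) (M : riemannianManifold R n)
    (hM : complete_manifold M) (c : R -> M) (hc : smooth_circle c) :
  (((0 < width c)%E /\ (width c < diam (range c))%E /\
    exists x y : collapsed_pairs (set_type (range c)),
      [/\ x <> y, nontrivial_critical c x & nontrivial_critical c y])
   \/
   (width c = diam (range c) /\ infinite_set (nontrivial_critical c)))
  /\
  (bounds_totally_convex_disc (range c) -> width c = diam (range c) ->
   exists f : R -> collapsed_pairs (set_type (range c)),
     [/\ embedded_loop f, ~ null_homotopic f &
         range f = nontrivial_critical c]).
Proof. by split; [exact: part1 | exact: part2]. Qed.
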